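(* Let $(N,r)\in\{(2,4),(3,3),(4,2)\}$. Then: (1) Define, as functions of $q=e^{2\pi i\tau}$, $\tau\in\mathfrak{H}$, $$\mathscr{E}_4(q)=\tfrac13\bigl[4E_2(q^2)-E_2(q)\bigr],\qquad \mathscr{E}_3(q)=\tfrac18\bigl[9E_2(q^3)-E_2(q)\bigr],\qquad \mathscr{E}_2(q)=\tfrac13\bigl[4E_2(q^4)-E_2(q^2)\bigr].$$ Then $\mathscr{E}_r$ is a quasi-modular form of weight $2$ and depth $\le 1$ on $\Gamma_0(N)$, equal to $1$ at the infinite cusp, with $$\mathscr{E}_4(q)=1+8\sum_{n\ge1}\sigma_1(n;-1,1)q^n=1+8\sum_{n\ge1}\sigma^{\mathrm c}_1(n;-3,1)q^n,$$ $$\mathscr{E}_3(q)=1+3\sum_{n\ge1}\sigma_1(n;-2,1,1)q^n=1+3\sum_{n\ge1}\sigma^{\mathrm c}_1(n;-8,1,1)q^n,$$ $$\mathscr{E}_2(q)=1+4\sum_{n\ge1}\sigma_1(n;-1,0,1,0)q^n=1+8\sum_{n\ge1}\sigma^{\mathrm c}_1(n;-3,0,1,0)q^n,$$ so that $\mathscr{E}_2(q)=\mathscr{E}_4(q^2)$; and $u=(2\pi i/r)\mathscr{E}_r$ satisfies the generalized Chazy equation $p_r(u_4,u_6,u_8)=0$, where $$p_4=u_4u_8-u_6^2+8u_4^3,\qquad p_3=u_4u_8^2-u_6^2u_8+24u_4^3u_8-15u_4^2u_6^2+144u_4^5,\qquad p_2=u_4u_8-u_6^2+8u_4^3.$$ (2)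 There is a triple of weight-$1$ modular forms $\mathscr{A}_r,\mathscr{B}_r,\mathscr{C}_r$ on $\Gamma_0(N)$ (allowed to have multiplier systems not of Dirichlet-character type, and allowed to be multivalued on $\mathfrak H$, i.e. roots of single-valued modular forms) such that: (a) $\mathscr{A}_r^{\,r}=\mathscr{B}_r^{\,r}+\mathscr{C}_r^{\,r}$, each term being a single-valued modular form of weight $r$; (b) $\mathscr{A}_r$, $\mathscr{B}_r$, $\mathscr{C}_r$ vanish respectively at (the $\Gamma_0(N)$-equivalence class of) the third fixed point $P_N$, at the cusp $\tau=0$, and at the cusp $\tau=i\infty$, and they vanish nowhere else on $\mathfrak H^*$; in each case the order of vanishing, computed with respect to a local parameter for $\Gamma_0(N)$, is $1/r$; (c) together with $\mathscr{E}_r$ from part (1) they satisfy $$(\mathscr{A}_r^{\,r})'=\mathscr{E}_r\mathscr{A}_r^{\,r}-\mathscr{A}_r^{\,2}\mathscr{B}_r^{\,r},\quad (\mathscr{B}_r^{\,r})'=\mathscr{E}_r\mathscr{B}_r^{\,r}-\mathscr{A}_r^{\,2}\mathscr{B}_r^{\,r},\quad (\mathscr{C}_r^{\,r})'=\mathscr{E}_r\mathscr{C}_r^{\,r},\quad r\,\mathscr{E}_r'=\mathscr{E}_r^{\,2}-\mathscr{A}_r^{\,4-r}\mathscr{B}_r^{\,r}.$$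
   Context: $\mathfrak H=\{\tau\in\mathbb C:\Im\tau>0\}$, $\mathfrak H^*=\mathfrak H\cup\mathbb Q\cup\{i\infty\}$, $q=e^{2\pi i\tau}$. The prime $'$ denotes $q\,\frac{d}{dq}=(2\pi i)^{-1}\frac{d}{d\tau}$, and a dot denotes $\frac{d}{d\tau}$. $E_2(q)=1-24\sum_{n\ge1}\sigma_1(n)q^n$ is the weight-2 Eisenstein series. For $\chi:\mathbb Z/N'\mathbb Z\to\mathbb C$ written as the list $\chi(0),\dots,\chi(N'-1)$, $\sigma_k(n;\chi)=\sum_{d\mid n}\chi(d\bmod N')d^k$ and $\sigma^{\mathrm c}_k(n;\chi)=\sum_{d\mid n}\chi((n/d)\bmod N')d^k$ (sums over positive divisors). A holomorphic $f$ on $\mathfrak H^*$ is quasi-modular of weight 2 and depth $\le1$ on $\Gamma<{\it PSL}(2,\mathbb Z)$ (trivial multiplier) if for some $s\in\mathbb C$, $f(\frac{a\tau+b}{c\tau+d})=(c\tau+d)^2f(\tau)+(s/2\pi i)c(c\tau+d)$ for all $\pm\begin{pmatrix}a&b\\c&d\end{pmatrix}\in\Gamma$. For a holomorphic function $u$ on $\mathfrak H$ set $u_4=\dot u-u^2$ and $u_{k+2}=\dot u_k-k\,u\,u_k$; so $u_6=\ddot u-6u\dot u+4u^3$, $u_8=\dddot u-12u\ddot u-6\dot u^2+48u^2\dot u-24u^4$. The three inequivalent fixed points of $\Gamma_0(N)$ on $\mathfrak H^*$ are the cusps $i\infty$, $0$, and a third point $P_N$: for $N=2$ the (unique up to equivalence)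 elliptic fixed point of order 2 of $\Gamma_0(2)$ in $\mathfrak H$, for $N=3$ the (unique up to equivalence) elliptic fixed point of order 3 of $\Gamma_0(3)$ in $\mathfrak H$, for $N=4$ the cusp $1/2$. Order of vanishing with respect to a local parameter for $\Gamma_0(N)$: at a cusp $s$ it is the width of $s$ for $\Gamma_0(N)$ times the leading exponent (in powers of $q$) of the expansion of the form at $s$; at an elliptic point of order $e$ it is the ordinary analytic order divided by $e$. *)

(* Defs.v *)
From HB Require Import structures.
From mathcomp Require Import all_boot all_order all_algebra.
From mathcomp Require Import finmap complex.
From mathcomp Require Import all_classical all_reals all_analysis.
Set Implicit Arguments.
Unset Strict Implicit.
Unset Printing Implicit Defensive.
Import Order.TTheory GRing.Theory Num.Theory numFieldNormedType.Exports.
Local Open Scope classical_set_scope.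
Local Open Scope ring_scope.
Local Open Scope complex_scope.

(* R[i] as a [numFieldType], through which topology and derivatives over the
   complex field are inferred. *)
Definition cplx (R : realType) : numFieldType := R[i].

Section Groups.

Definition SL2Z : set 'M[int]_2 := [set g | \det g = 1].

(* Subgroups of PSL(2,Z) are represented by their full preimages in SL(2,Z),
   which contain -1. *)
Definition Gamma0 (N : nat) : set 'M[int]_2 :=
  [set g | SL2Z g /\ (N%:Z %| g 1%R 0%R)%Z].

Definition translation (h : nat) : 'M[int]_2 :=
  \matrix_(i, j) (if i == j then 1 else if i == 0 then h%:Z else 0).

(* The class in P^1(Q) of (p : s), with [None] standing for i*oo. *)
Definition cusp_of (p s : rat) : option rat :=
  if s == 0 then None else Some (p / s).

Definition cusp_act (g : 'M[int]_2) (s : option rat) : option rat :=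
  if s is Some x then
    cusp_of ((g 0 0)%:~R * x + (g 0 1)%:~R) ((g 1 0)%:~R * x + (g 1 1)%:~R)
  else cusp_of (g 0 0)%:~R (g 1 0)%:~R.

(* The width of the cusp [g oo], for [g] in SL(2,Z) and [G] containing -1. *)
Definition is_width (G : set 'M[int]_2) (g : 'M[int]_2) (h : nat) : Prop :=
  [/\ (0 < h)%N, G (g *m translation h *m invmx g) &
      forall h', (0 < h')%N -> G (g *m translation h' *m invmx g) -> (h <= h')%N].

End Groups.

Section ModularForms.
Variable R : realType.
Local Notation C := (cplx R).
Implicit Types (f F : C -> C) (G : set 'M[int]_2) (g : 'M[int]_2) (t : C).

Definition cexp (z : C) : C :=
  (expR (complex.Re z))%:C *
  (cos (complex.Im z) +i* sin (complex.Im z)).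

Definition twopii : C := 0 +i* (2 * pi).

Definition upper_half : set C := [set t | 0 < complex.Im t].

Definition nome t : C := cexp (twopii * t).

Definition holomorphic_on (U : set C) f : Prop :=
  forall t, U t -> derivable f t 1.

Definition qD f t : C := twopii^-1 * derive1 f t.

Definition jfactor g t : C := (g 1 0)%:~R * t + (g 1 1)%:~R.

Definition mobius g t : C := ((g 0 0)%:~R * t + (g 0 1)%:~R) / jfactor g t.

Definition slash (k : nat) f g t : C := jfactor g t ^- k * f (mobius g t).

(* [f = \sum_n a_n q^(alpha + n/h)] on the upper half-plane; real exponents
   accommodate non-trivial multipliers. *)
Definition q_expansion f (alpha : R) (h : nat) (a : nat -> C) : Prop :=
  forall t, upper_half t ->
    series (fun n => a n * cexp (twopii * (alpha + n%:R / h%:R)%:C * t))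
      @ \oo --> f t.

Definition holomorphic_at_infty f : Prop :=
  exists (alpha : R) (h : nat) (a : nat -> C),
    [/\ 0 <= alpha, (0 < h)%N & q_expansion f alpha h a].

Definition leading_exponent f (alpha : R) : Prop :=
  exists (h : nat) (a : nat -> C),
    [/\ (0 < h)%N, a 0%N != 0 & q_expansion f alpha h a].

Definition value_at_infty f (l : C) : Prop :=
  forall e : R, 0 < e -> exists Y : R,
    forall t, upper_half t -> Y < complex.Im t -> `|f t - l| < e%:C.

(* Multiplier systems of integral weight: unitary characters; the sign at -1
   is forced by the transformation law of a nonzero form. *)
Definition multiplier_system G (v : 'M[int]_2 -> C) : Prop :=
  (forall g, G g -> `|v g| = 1) /\
  (forall g g', G g -> G g' -> v (g *m g') = v g * v g').

Definition modular_form G (k : nat) f : Prop :=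
  [/\ holomorphic_on upper_half f,
      exists v, multiplier_system G v /\
        forall g t, G g -> upper_half t ->
          f (mobius g t) = v g * jfactor g t ^+ k * f t &
      forall g, SL2Z g -> holomorphic_at_infty (slash k f g)].

(* Weight 2, depth <= 1, trivial multiplier.  At the cusp [g oo] the anomalous
   term of the slashed form, which is not a q-series, is removed before
   expanding. *)
Definition quasi_modular_form G f : Prop :=
  exists s : C,
  [/\ holomorphic_on upper_half f,
      forall g t, G g -> upper_half t ->
        f (mobius g t) = jfactor g t ^+ 2 * f t
                         + s / twopii * (g 1 0)%:~R * jfactor g t &
      forall g, SL2Z g -> holomorphic_at_infty
        (fun t => slash 2 f g t - s / twopii * (g 1 0)%:~R / jfactor g t)].

(* The extended upper half-plane; [Pt t] is a genuine point when
   [upper_half t]. *)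
Inductive hstar : Type := Pt of C | Cusp of option rat.

Definition in_hstar (z : hstar) : Prop := if z is Pt t then upper_half t else True.

Definition hact g (z : hstar) : hstar :=
  match z with
  | Pt t => Pt (mobius g t)
  | Cusp s => Cusp (cusp_act g s)
  end.

Definition equivalent G (z z' : hstar) : Prop := exists2 g, G g & hact g z = z'.

(* Order of the stabilizer in PSL(2,Z), whence the halving. *)
Definition elliptic_order G t : nat :=
  (#|` fset_set [set g | G g /\ mobius g t = t]|%fset %/ 2)%N.

Definition vanishing_order f t (n : nat) : Prop :=
  (forall j, (j < n)%N -> derive1n j f t = 0) /\ derive1n n f t != 0.

(* [nu] is the order of the weight-[k] form [f] at [z] in a local parameter
   for [G]. *)
Definition order_at G (k : nat) f (z : hstar) (nu : R) : Prop :=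
  match z with
  | Pt t => exists2 n, vanishing_order f t n & nu = n%:R / (elliptic_order G t)%:R
  | Cusp s => exists g h alpha,
      [/\ SL2Z g, cusp_act g None = s, is_width G g h,
          leading_exponent (slash k f g) alpha & nu = h%:R * alpha]
  end.

(* A possibly multivalued function sends each point to its set of values. *)
Definition mvfun := C -> set C.
Implicit Types (A : mvfun).

(* [A^m] is single-valued and equal to [F]. *)
Definition mv_power A (m : nat) F : Prop :=
  forall t, upper_half t -> [set w ^+ m | w in A t] = [set F t].

(* Away from its zeros, [A] is locally the union of the graphs of holomorphic
   branches over one common neighbourhood. *)
Definition mv_holomorphic A : Prop :=
  forall t0, upper_half t0 -> ~ A t0 0 ->
  exists U : set C,
  [/\ nbhs t0 U, U `<=` upper_half &
      forall t1 w1, U t1 -> A t1 w1 ->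
      exists b : C -> C,
      [/\ b t1 = w1, holomorphic_on U b & forall t, U t -> A t (b t)]].

(* Multivalued modular forms are roots of single-valued ones. *)
Definition mv_modular_form G (k : nat) A : Prop :=
  mv_holomorphic A /\
  exists m F, [/\ (0 < m)%N, mv_power A m F & modular_form G (m * k)%N F].

Definition mv_order_at G (k : nat) A (z : hstar) (nu : R) : Prop :=
  exists m F,
    [/\ (0 < m)%N, mv_power A m F & order_at G (m * k)%N F z (m%:R * nu)].

(* [A] vanishes exactly on the class of [P], to order [nu]. *)
Definition mv_vanishes_only_at G (k : nat) A (P : hstar) (nu : R) : Prop :=
  forall z, in_hstar z ->
    (equivalent G P z -> mv_order_at G k A z nu) /\
    (~ equivalent G P z -> mv_order_at G k A z 0).

Definition third_fixed_point (N : nat) (P : hstar) : Prop :=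
  match N with
  | 2 => exists t, [/\ P = Pt t, upper_half t & elliptic_order (Gamma0 2) t = 2]
  | 3 => exists t, [/\ P = Pt t, upper_half t & elliptic_order (Gamma0 3) t = 3]
  | 4 => P = Cusp (Some (1 / 2))
  | _ => False
  end.

(* A function on Z/N'Z is the list of its values, N' being the length. *)
Definition sigma (k : nat) (chi : seq int) (n : nat) : C :=
  \sum_(d <- divisors n) (chi`_(d %% size chi)%N)%:~R * d%:R ^+ k.

Definition sigmac (k : nat) (chi : seq int) (n : nat) : C :=
  \sum_(d <- divisors n) (chi`_((n %/ d) %% size chi)%N)%:~R * d%:R ^+ k.

Definition E2 (q : C) : C :=
  1 - 24 * limn (fun n => \sum_(1 <= j < n) (\sum_(d <- divisors j) d)%N%:R * q ^+ j).

Definition calE (r : nat) (q : C) : C :=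
  match r with
  | 4 => (4 * E2 (q ^+ 2) - E2 q) / 3
  | 3 => (9 * E2 (q ^+ 3) - E2 q) / 8
  | 2 => (4 * E2 (q ^+ 4) - E2 (q ^+ 2)) / 3
  | _ => 0
  end.

Definition calEt (r : nat) t : C := calE r (nome t).

(* [f = 1 + c * \sum_(n >= 1) a_n q^n] for |q| < 1, q <> 0. *)
Definition has_qseries (f : C -> C) (c : C) (a : nat -> C) : Prop :=
  forall t, upper_half t ->
    (fun n => 1 + c * \sum_(1 <= j < n) a j * nome t ^+ j) @ \oo --> f (nome t).

(* [chazy_u u j] is u_{2j+4}. *)
Fixpoint chazy_u (u : C -> C) (j : nat) : C -> C :=
  match j with
  | 0 => fun t => derive1 u t - u t ^+ 2
  | j'.+1 => fun t =>
      derive1 (chazy_u u j') t - (2 * j' + 4)%N%:R * u t * chazy_u u j' t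
  end.

Definition chazy_p (r : nat) (u4 u6 u8 : C) : C :=
  match r with
  | 4 | 2 => u4 * u8 - u6 ^+ 2 + 8 * u4 ^+ 3
  | 3 => u4 * u8 ^+ 2 - u6 ^+ 2 * u8 + 24 * u4 ^+ 3 * u8
         - 15 * u4 ^+ 2 * u6 ^+ 2 + 144 * u4 ^+ 5
  | _ => 0
  end.

Definition gen_chazy (r : nat) (u : C -> C) : Prop :=
  forall t, upper_half t ->
    chazy_p r (chazy_u u 0 t) (chazy_u u 1 t) (chazy_u u 2 t) = 0.

End ModularForms.

(* Main.v *)
(**
   Write P for E_2, D for q d/dq and w for the Fricke involution t |-> -1/(N t).
   The transformation law of E_2 is obtained by comparing its Lambert series
   with the Lipschitz sums over the lattice Z t + Z: the two orders of summation
   are compared with a telescoping double series, and the discrepancy is the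
   anomaly.

   For N = 2, 3 let E be the form calE_r, E^ its companion under w, and
   W = E - E^, a modular form of weight 2.  The forms FB and FC are
   defined as q-series solutions of D FB = E^ FB and D FC = E FC, so that they
   never vanish and w exchanges them up to a constant, by comparison of
   logarithmic derivatives.  Algebraic identities between E, W, FB, FC (the
   Riccati equation for E and FA = FB + FC being a power of a root of W) follow
   from a vanishing lemma: a form of weight k whose first coefficients vanish
   gives, after division by a power of FB FC, a bounded w-invariant q-series
   without constant term, and such a series is 0 by descent towards large
   imaginary part.  The same descent, with the injectivity of explicit q-series
   on small discs, shows that W only vanishes on the orbit of the elliptic point.

   Level 4 is deduced from level 2: E(t) is the level 2 form at 2t, and FA, FB,
   FC are the combinations alpha, beta, gamma of P(t), P(2t), P(4t), with
   alpha beta (t) the level 2 form FB at 2t.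
*)
Require Import Defs.
From HB Require Import structures.
From mathcomp Require Import all_boot all_order all_algebra.
From mathcomp Require Import finmap complex.
From mathcomp Require Import all_classical all_reals all_analysis.
From mathcomp Require Import ring lra zify.
Import Order.TTheory GRing.Theory Num.Theory numFieldNormedType.Exports.
Local Open Scope classical_set_scope.
Local Open Scope ring_scope.
Local Open Scope complex_scope.

Set Implicit Arguments.
Unset Strict Implicit.
Unset Printing Implicit Defensive.

(** * Series and derivatives over the complex field *)

(** No contour integral enters: every function comes with a q-series, Cauchy's estimate becomes an
    average over roots of unity, and the vanishing lemma takes the place of the valence formula. For
    N = 2, 3, 4 the group Gamma_0(N) is generated by -1, the powers of T and their conjugates under
    w, so automorphy of f and its expansion at the cusp 0 both follow once f and its transform under
    w are q-series. Solving the equations for FB and FC up to the exponent 1/r yields the roots B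
    and C on the whole upper half-plane. Classically FB and FC are eta(t)^16/eta(2t)^8 and 64
    eta(2t)^16/eta(t)^8 at level 2, eta(t)^9/eta(3t)^3 and 27 eta(3t)^9/eta(t)^3 at level 3; the
    factors 64 and 27 are forced by the coefficient of q in FA = FB + FC. The descent needs a height
    y with N (1/4 + y^2) < 1 and y not too small. This leaves little room for N = 3 and none for N =
    4, hence the detour through level 2; the forms alpha, beta, gamma found there are the fourth
    powers of Jacobi's theta constants. *)

Section Modulus.
Variable R : realType.
Local Notation C := (cplx R).
Implicit Types (z w : C).

(** The norm of [C] takes its values in [C]; estimates need a real number, to which real
    inequalities and linear arithmetic apply. *)
Definition nm (z : C) : R := Normc.normc z.

Lemma normE z : `|z| = (nm z)%:C. Proof. by case: z. Qed.
Lemma nmE z : nm z = Num.sqrt (complex.Re z ^+ 2 + complex.Im z ^+ 2).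
Proof. by case: z. Qed.
Lemma nm0 : nm 0 = 0. Proof. exact: Normc.normc0. Qed.
Lemma nm1 : nm 1 = 1. Proof. exact: Normc.normc1. Qed.
Lemma nm_ge0 z : 0 <= nm z. Proof. by rewrite nmE sqrtr_ge0. Qed.
Lemma nm_eq0 z : (nm z == 0) = (z == 0).
Proof. by apply/eqP/eqP => [/Normc.eq0_normc|-> ] //; rewrite nm0. Qed.
Lemma nm_gt0 z : (0 < nm z) = (z != 0).
Proof. by rewrite lt0r nm_ge0 nm_eq0 andbT. Qed.
Lemma nmM z w : nm (z * w) = nm z * nm w. Proof. exact: Normc.normcM. Qed.
Lemma nmV z : nm z^-1 = (nm z)^-1. Proof. exact: Normc.normcV. Qed.
Lemma nmN z : nm (- z) = nm z.
Proof. by case: z => a b /=; rewrite /nm /= !sqrrN. Qed.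
Lemma nmD z w : nm (z + w) <= nm z + nm w. Proof. exact: le_normcD. Qed.
Lemma nmB z w : nm (z - w) <= nm z + nm w.
Proof. by apply: le_trans (nmD _ _) _; rewrite nmN. Qed.
Lemma nmBC z w : nm (z - w) = nm (w - z).
Proof. by rewrite -nmN opprB. Qed.
Lemma nmX z n : nm (z ^+ n) = nm z ^+ n.
Proof. by elim: n => [|n IH]; rewrite ?expr0 ?nm1 // !exprS nmM IH. Qed.
Lemma nm_real (x : R) : nm x%:C = `|x|.
Proof. by rewrite nmE /= expr0n /= addr0 sqrtr_sqr. Qed.
Lemma nm_nat n : nm n%:R = n%:R.
Proof.
have -> : (n%:R : C) = (n%:R : R)%:C by rewrite rmorph_nat.
by rewrite nm_real ger0_norm.
Qed.
Lemma nm_triB z w : nm z - nm w <= nm (z - w).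
Proof. by rewrite lerBlDr; apply: le_trans (nmD _ _); rewrite subrK. Qed.
Lemma nm_sum (I : Type) (r : seq I) (Pr : pred I) (F : I -> C) :
  nm (\sum_(i <- r | Pr i) F i) <= \sum_(i <- r | Pr i) nm (F i).
Proof.
elim/big_ind2 : _ => //; first by rewrite nm0.
by move=> x a y b h1 h2; apply: le_trans (nmD _ _) (lerD h1 h2).
Qed.
Lemma Re_le_nm z : `|complex.Re z| <= nm z.
Proof.
by rewrite nmE -sqrtr_sqr ler_sqrt ?addr_ge0 ?sqr_ge0// lerDl sqr_ge0.
Qed.
Lemma Im_le_nm z : `|complex.Im z| <= nm z.
Proof.
by rewrite nmE -sqrtr_sqr ler_sqrt ?addr_ge0 ?sqr_ge0// lerDr sqr_ge0.
Qed.
Lemma nm_le_ReIm z : nm z <= `|complex.Re z| + `|complex.Im z|.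
Proof.
have -> : z = (complex.Re z)%:C + (0 +i* 1) * (complex.Im z)%:C.
  by rewrite -complexE.
apply: le_trans (nmD _ _) _; rewrite nmM !nm_real /nm /=.
by rewrite expr0n/= expr1n add0r sqrtr1 mul1r !(mul0r,mul1r,add0r,addr0,mulr0,subr0) /=.
Qed.
Lemma sqr_nm z : nm z ^+ 2 = complex.Re z ^+ 2 + complex.Im z ^+ 2.
Proof. by rewrite nmE sqr_sqrtr // addr_ge0 ?sqr_ge0. Qed.

Lemma ReD z w : complex.Re (z + w) = complex.Re z + complex.Re w.
Proof. by case: z w => [? ?] [? ?]. Qed.
Lemma ImD z w : complex.Im (z + w) = complex.Im z + complex.Im w.
Proof. by case: z w => [? ?] [? ?]. Qed.
Lemma ReB z w : complex.Re (z - w) = complex.Re z - complex.Re w.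
Proof. by case: z w => [? ?] [? ?]. Qed.
Lemma ImB z w : complex.Im (z - w) = complex.Im z - complex.Im w.
Proof. by case: z w => [? ?] [? ?]. Qed.
Lemma Re_sum (I : Type) (r : seq I) (Pr : pred I) (F : I -> C) :
  complex.Re (\sum_(i <- r | Pr i) F i) = \sum_(i <- r | Pr i) complex.Re (F i).
Proof. by elim/big_ind2 : _ => // x a y b h1 h2; rewrite ReD h1 h2. Qed.
Lemma Im_sum (I : Type) (r : seq I) (Pr : pred I) (F : I -> C) :
  complex.Im (\sum_(i <- r | Pr i) F i) = \sum_(i <- r | Pr i) complex.Im (F i).
Proof. by elim/big_ind2 : _ => // x a y b h1 h2; rewrite ImD h1 h2. Qed.

Lemma cplx_gt0 (e : C) : 0 < e -> exists2 r : R, 0 < r & e = r%:C.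
Proof.
case: e => a b; rewrite ltcE /= => /andP[/eqP b0 a0].
by exists a => //; rewrite b0.
Qed.

Lemma cvg_nmP (T : Type) (F : set_system T) (FF : Filter F) (f : T -> C) (l : C) :
  f @ F --> l <-> forall e : R, 0 < e -> \forall x \near F, nm (l - f x) < e.
Proof.
split=> [/cvgrPdist_lt H e e0|H].
  have : 0 < e%:C :> C by rewrite ltcR.
  move=> /H; apply: filterS => x; rewrite normE ltcR; exact.
apply/cvgrPdist_lt => e /cplx_gt0[r r0 ->].
by have := H r r0; apply: filterS => x; rewrite normE ltcR.
Qed.

Lemma cvg_nm_le (T : Type) (F : set_system T) (FF : Filter F) (f : T -> C) (l : C)
  (u : T -> R) : (\forall x \near F, nm (l - f x) <= u x) -> u @ F --> (0 : R) ->
  f @ F --> l.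
Proof.
move=> H /cvgrPdist_lt u0; apply/cvg_nmP => e e0.
near=> x; have h : nm (l - f x) <= u x by near: x.
apply: le_lt_trans h _; apply: le_lt_trans (ler_norm _) _.
rewrite -[u x]subr0 distrC; near: x; exact: u0.
Unshelve. all: by end_near. Qed.

Lemma cvg_nm_lim (T : Type) (F : set_system T) (FF : Filter F) (f : T -> C) (l : C) :
  f @ F --> l -> nm (f x) @[x --> F] --> nm l.
Proof.
move=> /cvg_nmP H; apply/cvgrPdist_lt => e e0.
near=> x; have h : nm (l - f x) < e by near: x; exact: H.
apply: le_lt_trans h; rewrite ler_norml; have h1 := nm_triB l (f x).
have h2 := nm_triB (f x) l; rewrite nmBC in h2; lra.
Unshelve. all: by end_near. Qed.

Lemma slim_eq (u v : nat -> C) (l : C) : u =1 v -> u @ \oo --> l -> v @ \oo --> l.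
Proof. by move=> /funext ->. Qed.
Lemma slimD (u v : nat -> C) (a b : C) : u @ \oo --> a -> v @ \oo --> b ->
  (fun n => u n + v n) @ \oo --> a + b.
Proof. exact: cvgD. Qed.
Lemma slimB (u v : nat -> C) (a b : C) : u @ \oo --> a -> v @ \oo --> b ->
  (fun n => u n - v n) @ \oo --> a - b.
Proof. exact: cvgB. Qed.
Lemma slimM (u v : nat -> C) (a b : C) : u @ \oo --> a -> v @ \oo --> b ->
  (fun n => u n * v n) @ \oo --> a * b.
Proof. exact: cvgM. Qed.
Lemma slimV (u : nat -> C) (a : C) : u @ \oo --> a -> a != 0 ->
  (fun n => (u n)^-1) @ \oo --> a^-1.
Proof. by move=> h a0; exact: (cvgV a0 h). Qed.
Lemma slim_cst (a : C) : (fun=> a) @ \oo --> a.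
Proof. exact: cvg_cst. Qed.
Lemma slim_uniq (u : nat -> C) (a b : C) : u @ \oo --> a -> u @ \oo --> b -> a = b.
Proof. by move=> h1 h2; rewrite -(cvg_lim _ h1) // -(cvg_lim _ h2). Qed.

Lemma cplx_cvg (u : nat -> C) (lr li : R) :
  (fun n => complex.Re (u n)) @ \oo --> lr -> (fun n => complex.Im (u n)) @ \oo --> li ->
  u @ \oo --> (lr +i* li : C).
Proof.
move=> /cvgrPdist_lt Hr /cvgrPdist_lt Hi; apply/cvg_nmP => e e0.
near=> n.
have h1 : `|lr - complex.Re (u n)| < e / 2 by near: n; apply: Hr; lra.
have h2 : `|li - complex.Im (u n)| < e / 2 by near: n; apply: Hi; lra.
apply: le_lt_trans (nm_le_ReIm _) _; rewrite ReB ImB /=; lra.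
Unshelve. all: by end_near. Qed.

End Modulus.

Arguments nm {R} z : simpl never.

Lemma big_nat_shift (V : nmodType) (F : nat -> V) m n :
  \sum_(m <= i < m + n) F i = \sum_(0 <= i < n) F (m + i)%N.
Proof.
by rewrite -{1}[m]add0n big_addn addKn; apply: eq_bigr => i _; rewrite addnC.
Qed.

(** * Absolutely summable series of complex numbers *)

Section AbsSummable.
Variable R : realType.
Local Notation C := (cplx R).
Implicit Types (a b : nat -> C).

(** The bound [M] is kept explicit because it also bounds the sum and, for a shifted sequence, the
    error of a partial sum. *)
Definition abs_summable (a : nat -> C) (M : R) :=
  forall n, \sum_(0 <= k < n) nm (a k) <= M.

Lemma real_series_cvg (u : nat -> R) (M : R) :
  (forall n, \sum_(0 <= k < n) `|u k| <= M) -> cvgn (series u).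
Proof.
move=> H; apply: normed_cvg; apply: nondecreasing_is_cvgn.
  by apply: nondecreasing_series => n _ _; exact: normr_ge0.
by exists M => _ [n _ <-]; exact: H.
Qed.

Lemma abs_summable_cvg a M : abs_summable a M -> cvgn (series a).
Proof.
move=> H.
have /cvg_ex[lr hr] : cvgn (series (fun k => complex.Re (a k))).
  apply: (@real_series_cvg _ M) => n; apply: le_trans (H n).
  by apply: ler_sum => i _; exact: Re_le_nm.
have /cvg_ex[li hi] : cvgn (series (fun k => complex.Im (a k))).
  apply: (@real_series_cvg _ M) => n; apply: le_trans (H n).
  by apply: ler_sum => i _; exact: Im_le_nm.
apply/cvg_ex; exists (lr +i* li : C); apply: cplx_cvg.
  by under eq_fun do rewrite /series/= Re_sum; exact: hr.
by under eq_fun do rewrite /series/= Im_sum; exact: hi.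
Qed.

Definition csum a : C := limn (series a).

Lemma csum_cvg a M : abs_summable a M -> series a @ \oo --> csum a.
Proof. exact: abs_summable_cvg. Qed.

Lemma csumE a l : series a @ \oo --> l -> csum a = l.
Proof. by move=> h; apply: cvg_lim. Qed.

Lemma cvg_nm_bound (u : nat -> C) l (M : R) :
  u @ \oo --> l -> (\forall n \near \oo, nm (u n) <= M) -> nm l <= M.
Proof.
move=> /cvg_nm_lim h hM.
rewrite -(cvg_lim _ h) //; apply: limr_le => //; by apply: (cvgP _ h).
Qed.

Lemma csum_le a M : abs_summable a M -> nm (csum a) <= M.
Proof.
move=> H; apply: (cvg_nm_bound (csum_cvg H)).
by near=> n; apply: le_trans (H n); exact: nm_sum.
Unshelve. all: by end_near. Qed.

Lemma series_tail a l N : series a @ \oo --> l ->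
  series (fun k => a (N + k)%N) @ \oo --> l - series a N.
Proof.
move=> h.
have e n : series (fun k => a (N + k)%N) n = series a (n + N)%N - series a N.
  rewrite /series /= (@big_cat_nat _ _ _ N 0 (n + N)) /= ?leq_addl //.
  by rewrite [(n + N)%N]addnC (big_nat_shift _ N n) addrAC subrr add0r.
rewrite (_ : series _ = fun n => series a (n + N)%N - series a N); last exact/funext.
by apply: cvgB; [rewrite cvg_shiftn|exact: cvg_cst].
Qed.

Lemma csum_tail_le a M N : abs_summable (fun k => a (N + k)%N) M ->
  cvgn (series a) -> nm (csum a - series a N) <= M.
Proof.
move=> H h; have := csum_le H; congr (nm _ <= _).
by apply: csumE; apply: series_tail.
Qed.

End AbsSummable.

(** * Complex derivatives *)

Section Derivatives.
Variable R : realType.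
Local Notation C := (cplx R).
Implicit Types (f g : C -> C) (t d : C).

(** The scalars are complex, so the derivative in the direction [1] is the complex derivative. *)
Definition cder f t d := is_derive t (1 : C) f d.

Lemma cder_eq f t d d' : cder f t d -> d = d' -> cder f t d'.
Proof. by move=> h <-. Qed.
Lemma cder_derivable f t d : cder f t d -> derivable f t 1.
Proof. by case. Qed.
Lemma cderE f t d : cder f t d -> derive1 f t = d.
Proof. by move=> [_ <-]; rewrite derive1E. Qed.
Lemma cder_cst c t : cder (fun _ => c) t 0.
Proof. exact: is_derive_cst. Qed.
Lemma cder_id t : cder (fun t => t) t 1.
Proof. exact: is_derive_id. Qed.
Lemma cderD f g t d e : cder f t d -> cder g t e -> cder (fun t => f t + g t) t (d + e).
Proof. exact: is_deriveD. Qed.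
Lemma cderN f t d : cder f t d -> cder (fun t => - f t) t (- d).
Proof. exact: is_deriveN. Qed.
Lemma cderB f g t d e : cder f t d -> cder g t e -> cder (fun t => f t - g t) t (d - e).
Proof. exact: is_deriveB. Qed.
Lemma cderM f g t d e : cder f t d -> cder g t e ->
  cder (fun t => f t * g t) t (d * g t + f t * e).
Proof.
move=> h1 h2; have := is_deriveM h1 h2; rewrite addrC [_ *: d]mulrC; exact.
Qed.
Lemma cderZ c f t d : cder f t d -> cder (fun t => c * f t) t (c * d).
Proof. by move=> h; apply: cder_eq (cderM (cder_cst c t) h) _; rewrite mul0r add0r. Qed.
Lemma cderX f n t d : cder f t d -> cder (fun t => f t ^+ n) t (n%:R * f t ^+ n.-1 * d).
Proof.
elim: n => [|n IH] h; first by apply: cder_eq (cder_cst 1 t) _; rewrite !mul0r.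
have := cderM h (IH h); under eq_fun do rewrite -exprS.
move=> h'; apply: cder_eq h' _; rewrite -natr1.
case: n {IH} => [|n]; rewrite ?expr0 ?exprS /=; ring.
Qed.
Lemma cder_near f g t d : (\near t, f t = g t) -> cder f t d -> cder g t d.
Proof. exact: near_eq_is_derive. Qed.
Lemma near_nm (t : C) (P : C -> Prop) (e : R) : 0 < e ->
  (forall x, nm (x - t) < e -> P x) -> \forall x \near t, P x.
Proof.
move=> e0 H; have : (fun x : C => x) @ t --> t by exact: cvg_id.
move=> /cvg_nmP /(_ e e0); apply: filterS => x; rewrite nmBC; exact: H.
Qed.

Lemma nearP_nm (t : C) (P : C -> Prop) : (\forall x \near t, P x) ->
  exists2 e : R, 0 < e & forall x, nm (x - t) < e -> P x.
Proof.
move=> /nbhs_ballP[e /cplx_gt0[r r0 ->]] H; exists r => // x hx; apply: H.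
by rewrite /ball /= normE ltcR nmBC.
Qed.

Lemma cvg_nm_at (t l : C) f : f x @[x --> t] --> l <->
  forall e : R, 0 < e -> exists2 s : R, 0 < s & forall x, nm (x - t) < s -> nm (l - f x) < e.
Proof.
split=> [/(@cvg_nmP _ _ _ (nbhs_filter t)) H e /H/nearP_nm //|H].
apply/(@cvg_nmP _ _ _ (nbhs_filter t)) => e /H[s s0 h].
exact: near_nm s0 h.
Qed.

Lemma climD f g t (a b : C) : f x @[x --> t] --> a -> g x @[x --> t] --> b ->
  (f x + g x) @[x --> t] --> a + b.
Proof. exact: (@cvgD _ _ _ _ (nbhs_filter t)). Qed.
Lemma climM f g t (a b : C) : f x @[x --> t] --> a -> g x @[x --> t] --> b ->
  (f x * g x) @[x --> t] --> a * b.
Proof. exact: (@cvgM _ _ _ (nbhs_filter t)). Qed.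
Lemma climN f t (a : C) : f x @[x --> t] --> a -> (- f x) @[x --> t] --> - a.
Proof. exact: (@cvgN _ _ _ _ (nbhs_filter t)). Qed.
Lemma clim_cst t (a : C) : (fun=> a) x @[x --> t] --> a.
Proof. exact: (@cvg_cst _ _ _ _ (nbhs_filter t)). Qed.
Lemma climV f t (a : C) : f x @[x --> t] --> a -> a != 0 -> (f x)^-1 @[x --> t] --> a^-1.
Proof. move=> h h0; exact: (@cvgV _ _ _ (nbhs_filter t) _ _ h0 h). Qed.

(** Caratheodory's form of differentiability. The chain rule, the inverse and later the square root
    then become statements about the limit of a slope function. *)
Lemma cder_slope f t d (g : C -> C) : g x @[x --> t] --> d ->
  (\forall x \near t, f x = f t + (x - t) * g x) -> cder f t d.
Proof.
move=> gd fg.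
have H : (h^-1 *: ((f \o shift t) (h *: (1 : C)) - f t)) @[h --> (0 : C)^'] --> d.
  apply/cvg_nmP => e e0.
  have [e1 e10 h1] := nearP_nm fg.
  move/cvg_nm_at : gd => /(_ e e0)[e2 e20 h2].
  rewrite near_withinE; apply: (@near_nm _ _ (Num.min e1 e2)).
    by rewrite lt_min e10.
  move=> h; rewrite subr0 lt_min => /andP[a1 a2] h0 /=.
  have : h *: (1 : C) + t - t = h by rewrite addrK /GRing.scale /= mulr1.
  move: (h *: (1 : C) + t) => x ex.
  rewrite h1 ?ex // [_ + _ - f t]addrC addKr /GRing.scale /= mulKf //.
  by apply: h2; rewrite ex.
split; first by apply/cvg_ex; exists d.
exact: (cvg_lim _ H).
Qed.

Lemma cder_slope_cvg f t d : cder f t d ->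
  ((f x - f t) / (x - t)) @[x --> t^'] --> d.
Proof.
move=> [/cvg_ex[l H] dE]; have el : l = d by rewrite -dE; symmetry; apply: cvg_lim.
rewrite {}el in H.
apply/cvg_nmP => e e0; move/cvg_nmP : H => /(_ e e0).
rewrite near_withinE => /nearP_nm[e1 e10 h1].
rewrite near_withinE; apply: (near_nm e10) => x hx xt.
have x0 : x - t != 0 by rewrite subr_eq0.
have := h1 (x - t); rewrite subr0 => /(_ hx x0) /=.
by rewrite /GRing.scale /= mulr1 subrK mulrC.
Qed.

Lemma cder_slopeP f t d : cder f t d -> exists g : C -> C,
  [/\ g x @[x --> t] --> d, g t = d & forall x, f x = f t + (x - t) * g x].
Proof.
move=> /cder_slope_cvg /cvg_nmP h.
exists (fun x => if x == t then d else (f x - f t) / (x - t)); split.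
- apply/cvg_nm_at => e e0; have := h e e0; rewrite near_withinE => /nearP_nm[e1 e10 h1].
  exists e1 => // x hx; case: eqP => [_|/eqP xt]; first by rewrite subrr nm0.
  exact: h1.
- by rewrite eqxx.
- move=> x; case: eqP => [->|/eqP xt]; first by rewrite subrr mul0r addr0.
  by rewrite mulrC divfK ?subr_eq0 // addrC subrK.
Qed.

Lemma cder_continuous f t d : cder f t d -> f x @[x --> t] --> f t.
Proof.
move=> /cder_slopeP[g [gd _ fg]].
have h : f t + (x - t) * g x @[x --> t] --> f t + (t - t) * d.
  apply: climD; first exact: clim_cst.
  by apply: climM gd; apply: climD; [exact: cvg_id|exact: clim_cst].
rewrite subrr mul0r addr0 in h.
have e : (fun x => f t + (x - t) * g x) = f by apply/funext => x; rewrite -fg.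
by rewrite e in h.
Qed.

Lemma cder_comp f g t d e : cder f t d -> cder g (f t) e ->
  cder (fun t => g (f t)) t (e * d).
Proof.
move=> hf hg; have cf := cder_continuous hf.
move: hf hg => /cder_slopeP[u [ud _ fu]] /cder_slopeP[v [vd vE gv]].
apply: (@cder_slope _ _ _ (fun x => v (f x) * u x)).
  apply: climM ud; apply/cvg_nm_at => r r0.
  move/cvg_nm_at : vd => /(_ r r0)[s s0 hs].
  move/cvg_nm_at : cf => /(_ s s0)[s' s'0 h']; exists s' => // x /h'; rewrite nmBC; exact: hs.
near=> x; rewrite gv; congr (_ + _); rewrite {1}[f x]fu; ring.
Unshelve. all: by end_near. Qed.

(** A quadratic remainder is exactly what termwise differentiation of a power series produces. *)
Lemma cder_quad f t d (K e : R) : 0 < e ->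
  (forall x, nm (x - t) < e -> nm (f x - f t - (x - t) * d) <= K * nm (x - t) ^+ 2) ->
  cder f t d.
Proof.
move=> e0 H.
pose g x := if x == t then d else (f x - f t) / (x - t).
apply: (@cder_slope _ _ _ g); last first.
  apply: (near_nm e0) => x _; rewrite /g; case: eqP => [->|/eqP xt].
    by rewrite subrr mul0r addr0.
  by rewrite mulrC divfK ?subr_eq0 // addrC subrK.
apply/cvg_nm_at => e1 e10.
have K1 : 0 < `|K| + 1 by rewrite ltr_pwDr.
exists (Num.min e (e1 / (`|K| + 1))).
  by rewrite lt_min e0 divr_gt0.
move=> x; rewrite lt_min => /andP[/H h]; rewrite ltr_pdivlMr // => h1.
rewrite /g; case: eqP => [_|/eqP xt]; first by rewrite subrr nm0.
have n0 : 0 < nm (x - t) by rewrite nm_gt0 subr_eq0.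
rewrite nmBC -(ltr_pM2l n0) -nmM mulrBr [_ * (_ / _)]mulrC divfK ?subr_eq0 //.
apply: le_lt_trans h _; rewrite expr2 mulrCA ltr_pM2l // mulrC.
apply: le_lt_trans h1; rewrite ler_pM2l //; have := ler_norm K; lra.
Qed.

Lemma cderV f t d : cder f t d -> f t != 0 ->
  cder (fun t => (f t)^-1) t (- d / f t ^+ 2).
Proof.
move=> hf f0.
have hV : cder (fun z : C => z^-1) (f t) (- (f t) ^- 2).
  apply: (@cder_slope _ _ _ (fun x => - (x^-1 * (f t)^-1))).
    rewrite expr2 invfM; apply: climN.
    by apply: climM; [apply: climV f0; exact: cvg_id|exact: clim_cst].
  have n0 : 0 < nm (f t) by rewrite nm_gt0.
  apply: (near_nm n0) => x hx.
  have x0 : x != 0 by apply: contraTneq hx => ->; rewrite sub0r nmN ltxx.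
  by field; rewrite x0 f0.
by apply: cder_eq (cder_comp hf hV) _; rewrite mulrC mulrN mulNr.
Qed.

End Derivatives.

(** * Power series on the unit disc *)

Section PowerSeries.
Variable R : realType.
Local Notation C := (cplx R).
Implicit Types (a b c : nat -> C) (q x : C) (r rho : R).

(** Radius of convergence at least 1, expressed by boundedness at each smaller radius, a form that
    passes easily to derivatives, Cauchy products and dilations. *)
Definition tame a := forall rho : R, 0 <= rho -> rho < 1 ->
  exists M : R, forall n, nm (a n) * rho ^+ n <= M.

Definition ev a q : C := csum (fun n => a n * q ^+ n).

Lemma geom_le (t : R) n : 0 <= t -> t < 1 -> \sum_(0 <= k < n) t ^+ k <= (1 - t)^-1.
Proof.
move=> t0 t1; have u0 : 0 < 1 - t by rewrite subr_gt0.
rewrite -(ler_pM2l u0) mulfV ?gt_eqF // mulrC.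
have -> : (\sum_(0 <= k < n) t ^+ k) * (1 - t) = 1 - t ^+ n.
  elim: n => [|n IH]; first by rewrite big_geq // mul0r expr0 subrr.
  by rewrite big_nat_recr //= mulrDl IH exprS; ring.
by rewrite gerBl exprn_ge0.
Qed.

Lemma mulSn_geom_le (t : R) n : 0 <= t -> t < 1 -> n.+1%:R * t ^+ n <= (1 - t)^-1.
Proof.
move=> t0 t1; apply: le_trans (geom_le n.+1 t0 t1).
rewrite mulr_natl -[X in _ *+ X]subn0 -sumr_const_nat.
apply: ler_sum_nat => i /andP[_]; rewrite ltnS => h.
by apply: ler_wiXn2l => //; exact: ltW.
Qed.

(** Moving to an intermediate radius [rho] leaves a geometric factor [t ^+ n] with which polynomial
    factors and tails are paid for. *)
Lemma between (r : R) : 0 <= r -> r < 1 ->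
  exists rho, [/\ 0 < rho, rho < 1, r < rho & exists2 t, r = t * rho & 0 <= t < 1].
Proof.
move=> r0 r1; exists ((1 + r) / 2).
have h : 0 < (1 + r) / 2 by lra.
split; [lra..|]; exists (r / ((1 + r) / 2)); first by rewrite divfK // gt_eqF.
by apply/andP; split; [apply: divr_ge0 => //; exact: ltW|rewrite ltr_pdivrMr //; lra].
Qed.

Lemma tame_geo a r : tame a -> 0 <= r -> r < 1 ->
  exists M t, [/\ 0 <= M, 0 <= t < 1 &
    forall n q, nm q <= r -> nm (a n * q ^+ n) <= M * t ^+ n].
Proof.
move=> ta r0 r1; have [rho [h1 h2 h3 [t e ht]]] := between r0 r1.
have [M HM] := ta rho (ltW h1) h2.
have M0 : 0 <= M by apply: le_trans (HM 0%N); rewrite mulr_ge0 ?nm_ge0 ?exprn_ge0 // ltW.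
exists M, t; split=> // n q hq; rewrite nmM nmX.
apply: (@le_trans _ _ (nm (a n) * r ^+ n)).
  by rewrite ler_wpM2l ?nm_ge0 // lerXn2r ?nnegrE ?nm_ge0.
rewrite e exprMn mulrCA mulrC ler_wpM2r ?exprn_ge0 //; first by case/andP: ht.
Qed.

Lemma tame_summable a r : tame a -> 0 <= r -> r < 1 ->
  exists M, forall q, nm q <= r -> abs_summable (fun n => a n * q ^+ n) M.
Proof.
move=> ta r0 r1; have [M [t [M0 /andP[t0 t1] H]]] := tame_geo ta r0 r1.
exists (M / (1 - t)) => q hq n; apply: le_trans.
  by apply: ler_sum => i _; exact: (H i q hq).
by rewrite -mulr_sumr ler_wpM2l // geom_le.
Qed.

Lemma ev_cvg a q : tame a -> nm q < 1 -> series (fun n => a n * q ^+ n) @ \oo --> ev a q.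
Proof.
move=> ta q1; have [M H] := tame_summable ta (nm_ge0 q) q1.
exact: (csum_cvg (H q (lexx _))).
Qed.

Lemma evE a q l : series (fun n => a n * q ^+ n) @ \oo --> l -> ev a q = l.
Proof. exact: csumE. Qed.

Lemma ev_bound a r : tame a -> 0 <= r -> r < 1 ->
  exists M, forall q, nm q <= r -> nm (ev a q) <= M.
Proof.
move=> ta r0 r1; have [M H] := tame_summable ta r0 r1.
by exists M => q hq; apply: csum_le; exact: H.
Qed.

Lemma eq_ev a b q : a =1 b -> ev a q = ev b q.
Proof. by move=> /funext ->. Qed.

Lemma eq_tame a b : a =1 b -> tame a -> tame b.
Proof. by move=> /funext ->. Qed.

Lemma tame_le a b : (forall n, nm (b n) <= nm (a n)) -> tame a -> tame b.
Proof.
move=> h ta rho h1 h2; have [M H] := ta rho h1 h2.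
by exists M => n; apply: le_trans (H n); rewrite ler_wpM2r ?exprn_ge0.
Qed.

Lemma tame1 : tame (fun _ => 1).
Proof.
by move=> rho h1 h2; exists 1 => n; rewrite nm1 mul1r exprn_ile1 // ltW.
Qed.

Lemma tameD a b : tame a -> tame b -> tame (fun n => a n + b n).
Proof.
move=> ta tb rho h1 h2; have [M H] := ta rho h1 h2; have [K HK] := tb rho h1 h2.
exists (M + K) => n; apply: le_trans (lerD (H n) (HK n)).
by rewrite -mulrDl ler_wpM2r ?exprn_ge0 // nmD.
Qed.

Lemma tameZ x a : tame a -> tame (fun n => x * a n).
Proof.
move=> ta rho h1 h2; have [M H] := ta rho h1 h2.
by exists (nm x * M) => n; rewrite nmM -mulrA ler_wpM2l ?nm_ge0.
Qed.

Lemma tame_mulSn a : tame a -> tame (fun n => n.+1%:R * a n).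
Proof.
move=> ta rho h1 h2; have [s [s0 s1 _ [t e /andP[t0 t1]]]] := between h1 h2.
have [M H] := ta s (ltW s0) s1.
exists ((1 - t)^-1 * M) => n; rewrite nmM nm_nat e exprMn mulrACA.
by apply: ler_pM; rewrite ?mulr_ge0 ?nm_ge0 ?exprn_ge0 ?ler0n // ?mulSn_geom_le // ltW.
Qed.

Lemma tame_natpow k : tame (fun n => n.+1%:R ^+ k).
Proof.
elim: k => [|k IH]; first by apply: eq_tame tame1 => n; rewrite expr0.
by apply: eq_tame (tame_mulSn IH) => n; rewrite exprS.
Qed.

Lemma tame_poly a k : (forall n, nm (a n) <= n.+1%:R ^+ k) -> tame a.
Proof. by move=> h; apply: tame_le (tame_natpow k) => n; rewrite nmX nm_nat. Qed.

Lemma tame_shift a : tame a -> tame (fun n => a n.+1).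
Proof.
move=> ta rho h1 h2; have [s [s0 s1 h3 _]] := between h1 h2.
have [M H] := ta s (ltW s0) s1.
exists (s^-1 * M) => n.
rewrite -(ler_pM2l s0) mulVKf ?gt_eqF //; apply: le_trans (H n.+1).
rewrite mulrCA exprS ler_wpM2l ?nm_ge0 // ler_wpM2l ?(ltW s0) //.
by rewrite lerXn2r ?nnegrE // ltW.
Qed.

Definition ps_cons x a n : C := if n is n'.+1 then a n' else x.

Lemma tame_cons x a : tame a -> tame (ps_cons x a).
Proof.
move=> ta rho h1 h2; have [M H] := ta rho h1 h2.
exists (Num.max (nm x) M) => -[|n] /=; first by rewrite expr0 mulr1 le_max lexx.
rewrite le_max; apply/orP; right; apply: le_trans (H n).
by rewrite ler_wpM2l ?nm_ge0 // ler_wiXn2l // ltW.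
Qed.

Lemma tame_unshift a : tame (fun n => a n.+1) -> tame a.
Proof. by move/(tame_cons (a 0%N)); apply: eq_tame => -[|n]. Qed.

Lemma tame_muln a : tame a -> tame (fun n => n%:R * a n).
Proof.
by move=> ta; apply: tame_le (tame_mulSn ta) => n; rewrite !nmM ler_wpM2r ?nm_ge0 // !nm_nat ler_nat.
Qed.

Lemma tame_deriv a : tame a -> tame (fun n => n.+1%:R * a n.+1).
Proof. by move=> ta; exact: tame_shift (tame_muln ta). Qed.

Lemma evD a b q : tame a -> tame b -> nm q < 1 ->
  ev (fun n => a n + b n) q = ev a q + ev b q.
Proof.
move=> ta tb h; apply: evE.
rewrite (_ : series _ = series (fun n => a n * q ^+ n) \+ series (fun n => b n * q ^+ n)).
  by apply: cvgD; exact: ev_cvg.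
apply/funext => n; rewrite /series /= -big_split; apply: eq_bigr => i _; exact: mulrDl.
Qed.

Lemma evZ x a q : tame a -> nm q < 1 -> ev (fun n => x * a n) q = x * ev a q.
Proof.
move=> ta h; apply: evE.
rewrite (_ : series _ = fun n => x * series (fun n => a n * q ^+ n) n).
  by apply: cvgM; [exact: cvg_cst|exact: ev_cvg].
apply/funext => n; rewrite /series /= mulr_sumr; apply: eq_bigr => i _.
by rewrite mulrA.
Qed.

Lemma ev_shift a q : tame a -> nm q < 1 -> ev a q = a 0%N + q * ev (fun n => a n.+1) q.
Proof.
move=> ta h; apply: evE; rewrite -cvg_shiftS.
rewrite (_ : (fun n => _) = fun n => a 0%N + q * series (fun n => a n.+1 * q ^+ n) n).
  apply: cvgD; first exact: cvg_cst.
  apply: cvgM; [exact: cvg_cst|apply: ev_cvg => //; exact: tame_shift].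
apply/funext => n; rewrite /series /= big_nat_recl // expr0 mulr1; congr (_ + _).
by rewrite mulr_sumr; apply: eq_bigr => i _; rewrite exprS mulrCA.
Qed.

Lemma ev_cst x q : ev (ps_cons x (fun _ => 0)) q = x.
Proof.
apply: evE; rewrite -cvg_shiftS.
rewrite (_ : (fun n => _) = cst x); first exact: cvg_cst.
apply/funext => n; rewrite /series /= big_nat_recl // expr0 mulr1 big1 ?addr0 //.
by move=> i _; rewrite mul0r.
Qed.

Lemma tame0 : tame (fun _ => 0).
Proof. by move=> rho h1 h2; exists 0 => n; rewrite nm0 mul0r. Qed.

Lemma tame_cst x : tame (ps_cons x (fun _ => 0)).
Proof. exact: tame_cons tame0. Qed.

Definition cprod a b n : C := \sum_(0 <= i < n.+1) a i * b (n - i)%N.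

Lemma tame_cprod a b : tame a -> tame b -> tame (cprod a b).
Proof.
(* The n-th coefficient is a sum of n + 1 products, each bounded by [M * K]; dividing by n + 1
   absorbs their number, and [tame_mulSn] puts the factor back. *)
move=> ta tb; suff : tame (fun n => (cprod a b n) / n.+1%:R).
  move=> /tame_mulSn; apply: eq_tame => n.
  by rewrite mulrC divfK // pnatr_eq0.
move=> rho h1 h2; have [M H] := ta rho h1 h2; have [K HK] := tb rho h1 h2.
exists (M * K) => n; rewrite nmM nmV nm_nat mulrAC ler_pdivrMr ?ltr0n //.
apply: (@le_trans _ _ (\sum_(0 <= i < n.+1) M * K)); last first.
  by rewrite sumr_const_nat subn0 mulr_natr.
apply: (@le_trans _ _ ((\sum_(0 <= i < n.+1) nm (a i * b (n - i)%N)) * rho ^+ n)).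
  by rewrite ler_wpM2r ?exprn_ge0 // nm_sum.
rewrite mulr_suml; apply: ler_sum_nat => i /andP[_]; rewrite ltnS => hi.
rewrite -{2}(subnKC hi) exprD nmM mulrACA.
by apply: ler_pM => //; rewrite mulr_ge0 ?nm_ge0 ?exprn_ge0.
Qed.

Lemma sum_antidiag (F : nat -> nat -> C) n :
  \sum_(0 <= k < n) \sum_(0 <= i < k.+1) F i (k - i)%N =
  \sum_(0 <= i < n) \sum_(0 <= j < n - i) F i j.
Proof.
elim: n => [|n IH]; first by rewrite !big_geq.
rewrite big_nat_recr //= IH [RHS]big_nat_recr //= subSnn big_nat1.
rewrite big_nat_recr //= subnn addrA; congr (_ + _).
rewrite -big_split; apply: eq_big_nat => i /andP[_ hi].
by rewrite subSn ?big_nat_recr // ltnW.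
Qed.

Lemma mulSn2_geom_cvg (t : R) : 0 <= t -> t < 1 ->
  n.+1%:R ^+ 2 * t ^+ n @[n --> \oo] --> (0 : R).
Proof.
move=> t0 t1; have [s [s0 s1 _ [u e /andP[u0 u1]]]] := between t0 t1.
have [M HM] := tame_natpow 2 (ltW s0) s1.
have M0 : 0 <= M by apply: le_trans (HM 0%N); rewrite mulr_ge0 ?nm_ge0 ?exprn_ge0 // ltW.
have c0 : M * u ^+ n @[n --> \oo] --> (0 : R).
  rewrite -(mulr0 M); apply: cvgM; first exact: cvg_cst.
  by apply: cvg_expr; rewrite ger0_norm.
apply: (squeeze_cvgr _ (cvg_cst 0) c0); near=> n.
rewrite mulr_ge0 ?exprn_ge0 ?ler0n //= e exprMn [u ^+ _ * _]mulrC mulrA.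
by rewrite ler_wpM2r ?exprn_ge0 //; have := HM n; rewrite nmX nm_nat.
Unshelve. all: by end_near. Qed.

(** The product of the n-th partial sums differs from the n-th partial sum of the Cauchy product by
    at most n^2 terms, all with [i + j >= n] and hence of size at most [M * K * t ^+ n]. *)
Lemma ev_cprod a b q : tame a -> tame b -> nm q < 1 ->
  ev (cprod a b) q = ev a q * ev b q.
Proof.
move=> ta tb hq; apply: evE.
have [M [s [M0 /andP[s0 s1] H]]] := tame_geo ta (nm_ge0 q) hq.
have [K [u [K0 /andP[u0 u1] HK]]] := tame_geo tb (nm_ge0 q) hq.
pose t := Num.max s u.
have t0 : 0 <= t by rewrite le_max s0.
have t1 : t < 1 by rewrite gt_max s1 u1.
pose A := series (fun n => a n * q ^+ n); pose B := series (fun n => b n * q ^+ n).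
have AB : (fun n => A n * B n) @ \oo --> ev a q * ev b q.
  by apply: cvgM; exact: ev_cvg.
have dif n : nm (A n * B n - series (fun n => cprod a b n * q ^+ n) n) <=
     M * K * (n.+1%:R ^+ 2 * t ^+ n).
  have -> : series (fun n => cprod a b n * q ^+ n) n =
     \sum_(0 <= i < n) \sum_(0 <= j < n - i) (a i * q ^+ i) * (b j * q ^+ j).
    rewrite -(sum_antidiag (fun i j => (a i * q ^+ i) * (b j * q ^+ j))).
    rewrite /series /=; apply: eq_bigr => k _; rewrite /cprod mulr_suml.
    apply: eq_big_nat => i /andP[_]; rewrite ltnS => hi.
    by rewrite -{2}(subnKC hi) exprD mulrACA.
  rewrite /A /B /series /= mulr_suml -sumrB.
  apply: le_trans (nm_sum _ _ _) _.
  apply: (@le_trans _ _ (\sum_(0 <= i < n) (n%:R * (M * K * t ^+ n)))); last first.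
    rewrite sumr_const_nat subn0 -[_ *+ n]mulr_natl mulrA -expr2 mulrCA.
    rewrite ler_wpM2l ?mulr_ge0 // ler_wpM2r ?exprn_ge0 // lerXn2r ?nnegrE ?ler0n // ler_nat.
    exact: leqnSn.
  apply: ler_sum_nat => i /andP[_ hi].
  rewrite mulr_sumr (@big_cat_nat _ _ _ (n - i)%N 0 n) ?leq_subr //= addrAC subrr add0r.
  apply: le_trans (nm_sum _ _ _) _.
  apply: (@le_trans _ _ (\sum_(n - i <= j < n) (M * K * t ^+ n))); last first.
    rewrite sumr_const_nat -[leLHS]mulr_natl ler_wpM2r ?mulr_ge0 ?exprn_ge0 // ler_nat.
    exact: leq_subr.
  apply: ler_sum_nat => j /andP[h1 h2].
  rewrite nmM; apply: le_trans (ler_pM _ _ (H i q (lexx _)) (HK j q (lexx _))) _;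
    rewrite ?nm_ge0 //.
  rewrite mulrACA ler_wpM2l ?mulr_ge0 //.
  apply: (@le_trans _ _ (t ^+ i * t ^+ j)).
    by apply: ler_pM; rewrite ?exprn_ge0 // lerXn2r ?nnegrE // le_max lexx ?orbT.
  by rewrite -exprD ler_wiXn2l ?(ltW t1) //; lia.
have key : (fun n => A n * B n - series (fun n => cprod a b n * q ^+ n) n) @ \oo --> (0 : C).
  apply: (@cvg_nm_le _ _ _ _ _ _ (fun n => M * K * (n.+1%:R ^+ 2 * t ^+ n))).
    by near=> n; rewrite sub0r nmN; exact: dif.
  by rewrite -(mulr0 (M * K)); apply: cvgM; [exact: cvg_cst|exact: mulSn2_geom_cvg].
have e : (fun n => A n * B n - (A n * B n - series (fun n => cprod a b n * q ^+ n) n)) =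
   series (fun n => cprod a b n * q ^+ n).
  by apply/funext => n /=; rewrite opprB addrC subrK.
have h : (fun n => A n * B n - (A n * B n - series (fun n => cprod a b n * q ^+ n) n))
   @ \oo --> ev a q * ev b q - 0 by exact: (cvgB AB key).
by move: h; rewrite e subr0.
Unshelve. all: by end_near. Qed.

End PowerSeries.

(** * Real derivatives in epsilon form *)

Section RealDer.
Variable R : realType.

Lemma real_der_eps (f : R -> R) (x d : R) : is_derive x 1 f d ->
  forall e, 0 < e -> exists2 s, 0 < s &
    forall h, `|h| < s -> `|f (x + h) - f x - h * d| <= e * `|h|.
Proof.
move=> [/cvg_ex[l H] dE] e e0.
have el : l = d by rewrite -dE; symmetry; apply: cvg_lim.
rewrite {}el in H; move/cvgrPdist_lt : H => /(_ e e0).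
rewrite near_withinE => /nbhs_ballP[s /= s0 hs]; exists s => // h hh.
have [->|h0] := eqVneq h 0; first by rewrite addr0 subrr mul0r subr0 normr0 mulr0.
have := hs h; rewrite /ball /= sub0r normrN => /(_ hh h0).
rewrite /GRing.scale /= mulr1 => /ltW hl.
have -> : f (x + h) - f x - h * d = - (h * (d - h^-1 * (f (h + x) - f x))).
  by rewrite [h + x]addrC; field.
by rewrite normrN normrM mulrC ler_wpM2r.
Qed.

Lemma real_der0 (f : R -> R) (x : R) : (forall e, 0 < e -> exists2 s, 0 < s &
    forall h, `|h| < s -> `|f (x + h) - f x| <= e * `|h|) -> is_derive x 1 f 0.
Proof.
move=> H.
have H' : (h^-1 *: ((f \o shift x) (h *: 1) - f x)) @[h --> 0^'] --> 0.
  apply/cvgrPdist_le => e e0; have [s s0 hs] := H e e0.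
  rewrite near_withinE; apply/nbhs_ballP; exists s => //= h.
  rewrite /ball /= sub0r normrN => hh h0; rewrite sub0r normrN /GRing.scale /= mulr1.
  rewrite normrM normrV ?unitfE // mulrC ler_pdivrMr ?normr_gt0 //.
  by rewrite [h + x]addrC hs.
by split; [apply/cvg_ex; exists 0|exact: (cvg_lim _ H')].
Qed.

End RealDer.

(** * The complex exponential and the nome *)

Section CExp.
Variable R : realType.
Local Notation C := (cplx R).
Implicit Types (z w t : C).

Lemma cder_epsP (f : C -> C) t d : cder f t d <->
  (forall e : R, 0 < e -> exists2 s : R, 0 < s & forall x, nm (x - t) < s ->
     nm (f x - f t - (x - t) * d) <= e * nm (x - t)).
Proof.
split.
  move=> /cder_slopeP[g [/cvg_nm_at gd _ fg]] e e0.
  have [s s0 hs] := gd e e0; exists s => // x hx.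
  have -> : f x - f t - (x - t) * d = (x - t) * (g x - d) by rewrite {1}fg; ring.
  rewrite nmM mulrC.
  by rewrite ler_wpM2r ?nm_ge0 // nmBC ltW // hs.
move=> H; pose g x := if x == t then d else (f x - f t) / (x - t).
have fE x : f x = f t + (x - t) * g x.
  rewrite /g; case: eqP => [->|/eqP xt]; first by rewrite subrr mul0r addr0.
  by rewrite mulrC divfK ?subr_eq0 // addrC subrK.
apply: (@cder_slope _ _ _ _ g); last by near=> x; exact: fE.
apply/cvg_nm_at => e e0; have e20 : 0 < e / 2 by rewrite divr_gt0.
have [s s0 hs] := H (e / 2) e20; exists s => // x hx.
have [xt|xt] := eqVneq x t; first by rewrite /g xt eqxx subrr nm0.
have n0 : 0 < nm (x - t) by rewrite nm_gt0 subr_eq0.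
rewrite nmBC -(ltr_pM2l n0) -nmM mulrBr.
have -> : (x - t) * g x = f x - f t by rewrite [f x]fE [f t + _]addrC addrK.
apply: le_lt_trans (hs x hx) _; rewrite mulrC ltr_pM2l //; lra.
Unshelve. all: by end_near. Qed.

Lemma cexp0 : cexp 0 = 1 :> C.
Proof. by rewrite /cexp /= expR0 cos0 sin0 mul1r. Qed.

Lemma cexpD z w : cexp (z + w) = cexp z * cexp w.
Proof.
rewrite /cexp ReD ImD expRD cosD sinD rmorphM /= [RHS]mulrACA; congr (_ * _).
by apply/eqP; rewrite eq_complex /=; apply/andP; split; apply/eqP; ring.
Qed.

Lemma nm_cexp z : nm (cexp z) = expR (complex.Re z).
Proof.
rewrite /cexp nmM nm_real ger0_norm ?expR_ge0 //.
by rewrite [nm (_ +i* _)]nmE /= cos2Dsin2 sqrtr1 mulr1.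
Qed.

Lemma cexp_neq0 z : cexp z != 0.
Proof. by rewrite -nm_gt0 nm_cexp expR_gt0. Qed.

Lemma cexpN z : cexp (- z) = (cexp z)^-1.
Proof.
apply: (mulfI (cexp_neq0 z)); rewrite -cexpD subrr cexp0 mulfV //.
exact: cexp_neq0.
Qed.

Lemma cexp_nat n z : cexp (n%:R * z) = cexp z ^+ n.
Proof.
elim: n => [|n IH]; first by rewrite mul0r cexp0 expr0.
by rewrite exprS -IH -cexpD -natr1 mulrDl mul1r addrC.
Qed.

Lemma cder_cexp0 : cder (@cexp R) 0 1.
Proof.
apply/cder_epsP => e e0.
(* The remainder is split below into three pieces of size at most [e' * N], [2 * e' * N] and
   [3 * e' * N], so [e / 8] suffices; [e' <= 1] forces [N <= 1], which the third piece uses. *)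
have [e' [e'0 e'1 e'e]] : exists e', [/\ 0 < e', e' <= 1 & e' <= e / 8].
  exists (Num.min (e / 8) 1); rewrite lt_min ltr01 andbT !ge_min !lexx orbT.
  by split=> //; lra.
have [s1 s10 h1] := real_der_eps (is_derive_expR 0) e'0.
have [s2 s20 h2] := real_der_eps (is_derive_sin 0) e'0.
have [s3 s30 h3] := real_der_eps (is_derive_cos 0) e'0.
exists (Num.min (Num.min s1 s2) (Num.min s3 e')).
  by rewrite !lt_min s10 s20 s30 e'0.
move=> [x y]; rewrite subr0 !lt_min => /andP[/andP[a1 a2] /andP[a3 a4]].
set N := nm _ in a1 a2 a3 a4 *.
have xN : `|x| <= N := Re_le_nm (x +i* y).
have yN : `|y| <= N := Im_le_nm (x +i* y).
have {}h1 := h1 x (le_lt_trans xN a1).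
have {}h2 := h2 y (le_lt_trans yN a2).
have {}h3 := h3 y (le_lt_trans yN a3).
move: h1 h2 h3; rewrite !add0r expR0 sin0 cos0 oppr0 mulr0 addr0 !subr0 !mulr1 => h1 h2 h3.
have N0 : 0 <= N := nm_ge0 _.
have x1 : `|x| <= 1 by lra.
rewrite cexp0 ?mulr1 /cexp /=.
have -> : (expR x)%:C * (cos y +i* sin y) - 1 - (x +i* y) =
  (expR x - 1 - x)%:C * (cos y +i* sin y) + ((cos y - 1) +i* (sin y - y))
   + x%:C * ((cos y - 1) +i* sin y) :> C.
  by apply/eqP; rewrite eq_complex /=; apply/andP; split; apply/eqP; ring.
apply: le_trans (nmD _ _) _; apply: le_trans (lerD (nmD _ _) (lexx _)) _.
rewrite !nmM !nm_real.
have -> : nm (cos y +i* sin y) = 1 by rewrite nmE /= cos2Dsin2 sqrtr1.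
have b1 := nm_le_ReIm ((cos y - 1) +i* (sin y - y)).
have b2 := nm_le_ReIm ((cos y - 1) +i* sin y).
rewrite /= in b1 b2.
have b3 : `|sin y| <= `|sin y - y| + `|y|.
  by rewrite -{1}[sin y](subrK y); exact: ler_normD.
have c1 : e' * `|x| <= e' * N by rewrite ler_pM2l.
have c2 : e' * `|y| <= e' * N by rewrite ler_pM2l.
have c3 : `|x| * nm ((cos y - 1) +i* sin y) <= N * (3 * e').
  apply: ler_pM => //; first exact: nm_ge0.
  apply: le_trans b2 _; apply: le_trans (lerD (lexx _) b3) _.
  have : e' * N <= e' by rewrite -[leRHS]mulr1 ler_pM2l //; lra.
  lra.
have c4 : e' * N <= e / 8 * N by rewrite ler_wpM2r.
have c5 : 0 <= e * N by rewrite mulr_ge0 // ltW.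
rewrite ?mulr1; lra.
Qed.

Lemma cder_cexp z : cder (@cexp R) z (cexp z).
Proof.
have h : cder (fun x : C => x - z) z 1.
  by apply: cder_eq (cderB (cder_id z) (cder_cst z z)) _; rewrite subr0.
have := @cder_comp _ _ _ z 1 1 h; rewrite subrr => /(_ _ cder_cexp0).
move=> /(cderZ (cexp z)); under eq_fun do rewrite -cexpD addrC subrK.
by rewrite !mulr1.
Qed.

Lemma cos_eq1 (x : R) : 0 <= x < pi *+ 2 -> cos x = 1 -> x = 0.
Proof.
move=> /andP[x0 x1] cx; have [xp|xp] := leP x pi.
  by apply: (@cos_inj R); rewrite ?in_itv /= ?x0 ?xp ?lexx ?pi_ge0 // cos0.
have : pi *+ 2 - x = 0.
  apply: (@cos_inj R); rewrite ?in_itv /= ?lexx ?pi_ge0 //.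
    by apply/andP; split; [lra|rewrite mulr2n; lra].
  by rewrite cos0 addrC cosD2pi cosN.
by move/eqP; rewrite subr_eq0 => /eqP h; rewrite h ltxx in x1.
Qed.

Lemma twopii_neq0 : twopii R != 0 :> C.
Proof.
rewrite eq_complex /= negb_and; apply/orP; right.
by rewrite mulf_neq0 ?pnatr_eq0 // gt_eqF // pi_gt0.
Qed.

Lemma twopii_sqr : twopii R ^+ 2 = - 4 * (pi ^+ 2)%:C :> C.
Proof.
apply/eqP; rewrite expr2 eq_complex /=; apply/andP; split; apply/eqP; last first.
  by rewrite !(mulr0,mul0r,addr0,oppr0,sub0r,add0r).
by rewrite !(mulr0,mul0r,addr0,oppr0,sub0r,add0r,subr0) /=; ring.
Qed.

Lemma nomeD z w : nome (z + w) = nome z * nome w.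
Proof. by rewrite /nome mulrDr cexpD. Qed.

Lemma nomeN z : nome (- z) = (nome z)^-1.
Proof. by rewrite /nome mulrN cexpN. Qed.

Lemma nome_neq0 z : nome z != 0.
Proof. exact: cexp_neq0. Qed.

Lemma nome_nat n z : nome (n%:R * z) = nome z ^+ n.
Proof. by rewrite /nome mulrCA cexp_nat. Qed.

Lemma nome0 : nome 0 = 1 :> C.
Proof. by rewrite /nome mulr0 cexp0. Qed.

Lemma nome1 : nome 1 = 1 :> C.
Proof.
rewrite /nome mulr1 /cexp /= expR0 mul1r.
by rewrite mulr_natl cos2pi sin2pi.
Qed.

Lemma nome_int (n : int) : nome (n%:~R) = 1 :> C.
Proof.
have h m : nome (m%:R) = 1 :> C.
  by rewrite -[m%:R]mulr1 nome_nat nome1 expr1n.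
case: n => n; first exact: h.
by rewrite NegzE mulrNz nomeN h invr1.
Qed.

Lemma nomeD1 z : nome (z + 1) = nome z.
Proof. by rewrite nomeD nome1 mulr1. Qed.

Lemma nm_nome z : nm (nome z) = expR (- (2 * pi * complex.Im z)).
Proof. by rewrite /nome nm_cexp; case: z => x y /=; rewrite mul0r sub0r. Qed.

Lemma nm_nome_lt1 z : upper_half z -> nm (nome z) < 1.
Proof.
by move=> h; rewrite nm_nome -expR0 ltr_expR oppr_lt0 !mulr_gt0 // pi_gt0.
Qed.

Lemma cder_nome z : cder (@nome R) z (twopii R * nome z).
Proof.
have h : cder (fun t : C => twopii R * t) z (twopii R).
  by apply: cder_eq (cderZ (twopii R) (cder_id z)) _; rewrite mulr1.
by apply: cder_eq (cder_comp h (cder_cexp _)) _; rewrite mulrC.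
Qed.

Lemma nome_real_eq1 (x : R) : nome (x%:C : C) = 1 -> exists n : int, x = n%:~R.
Proof.
move=> H; exists (Num.floor x); pose y := x - (Num.floor x)%:~R.
have y0 : 0 <= y by rewrite subr_ge0 floor_le.
have y1 : y < 1 by rewrite ltrBlDl; have := floorD1_gt x; rewrite intrD.
have ny : nome (y%:C : C) = 1.
  by rewrite /y rmorphB /= nomeD nomeN rmorph_int nome_int invr1 mulr1.
apply/eqP; rewrite -subr_eq0 -/y; apply/eqP.
have p0 := pi_gt0 R.
suff : 2 * pi * y = 0.
  by move/eqP; rewrite !mulf_eq0 pnatr_eq0 (gt_eqF p0) /= => /eqP.
apply: cos_eq1.
  rewrite !mulr_ge0 ?pi_ge0 //= -[pi *+ 2]mulr_natl -[ltRHS]mulr1 ltr_pM2l //.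
  by rewrite mulr_gt0.
move: ny; rewrite /nome /cexp /= => /eqP; rewrite eq_complex /= => /andP[/eqP + _].
by rewrite !(mul0r,mulr0,subr0,addr0,add0r,oppr0,expR0,mul1r).
Qed.

Lemma nome_eq1 z : nome z = 1 -> exists n : int, z = n%:~R.
Proof.
move=> H; have : expR (- (2 * pi * complex.Im z)) = expR 0 by rewrite -nm_nome H nm1 expR0.
move=> /expR_inj /eqP.
rewrite oppr_eq0 !mulf_eq0 pnatr_eq0 (gt_eqF (pi_gt0 R)) /= => /eqP z0.
case: z z0 H => x y /= -> H; have [n e] := nome_real_eq1 H.
by exists n; rewrite e -(rmorph_int (real_complex R)).
Qed.

Lemma nome_inj z w : nome z = nome w -> exists n : int, z = w + n%:~R.
Proof.
move=> h; have [|n e] := @nome_eq1 (z - w); last by exists n; rewrite -e addrC subrK.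
by rewrite nomeD nomeN h mulfV // nome_neq0.
Qed.

End CExp.

(** * Termwise differentiation *)

Section EvDeriv.
Variable R : realType.
Local Notation C := (cplx R).
Implicit Types (a b c : nat -> C) (q x : C) (r rho : R).

(** Second-order Taylor bound for a monomial, uniform on a disc. The factor [r ^+ 2] on the left
    avoids the exponent n - 2, which would be truncated for n < 2. *)
Lemma exprn_second_order q x r n : 0 <= r -> nm q <= r -> nm x <= r ->
  r ^+ 2 * nm (x ^+ n - q ^+ n - (x - q) * (n%:R * q ^+ n.-1)) <=
  n%:R ^+ 2 * r ^+ n * nm (x - q) ^+ 2.
Proof.
move=> r0 hq hx; elim: n => [|n IH].
  by rewrite mul0r mulr0 subr0 subrr nm0 mulr0 mulr_ge0 ?exprn_ge0 ?nm_ge0 // expr0n /= mul0r.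
have -> : x ^+ n.+1 - q ^+ n.+1 - (x - q) * (n.+1%:R * q ^+ n.+1.-1) =
  x * (x ^+ n - q ^+ n - (x - q) * (n%:R * q ^+ n.-1)) + n%:R * q ^+ n.-1 * (x - q) ^+ 2.
  case: n {IH} => [|n]; first by rewrite /= expr1 expr1 expr0; ring.
  by rewrite /= -[n.+2%:R]natr1 !exprS; ring.
set A := _ - _ - _ in IH *.
have d0 : 0 <= nm (x - q) ^+ 2 by rewrite exprn_ge0 // nm_ge0.
apply: (@le_trans _ _ (r * (n%:R ^+ 2 * r ^+ n * nm (x - q) ^+ 2) +
   n%:R * r ^+ n.+1 * nm (x - q) ^+ 2)).
  apply: (@le_trans _ _ (r * (r ^+ 2 * nm A) +
     r ^+ 2 * (n%:R * nm q ^+ n.-1 * nm (x - q) ^+ 2))).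
    rewrite [r * _]mulrCA -mulrDr ler_wpM2l ?exprn_ge0 //.
    apply: le_trans (nmD _ _) _; rewrite !nmM !nmX nm_nat lerD2r.
    by rewrite ler_wpM2r ?nm_ge0.
  apply: lerD; first by rewrite ler_wpM2l.
  case: n {IH A} => [|n]; first by rewrite !mul0r mulr0.
  rewrite mulrA ler_wpM2r // mulrCA ler_wpM2l ?ler0n //= -[n.+2]addn2 exprD mulrC.
  by rewrite ler_wpM2r ?exprn_ge0 // lerXn2r ?nnegrE ?nm_ge0.
have -> : r * (n%:R ^+ 2 * r ^+ n * nm (x - q) ^+ 2) + n%:R * r ^+ n.+1 * nm (x - q) ^+ 2 =
  (n%:R ^+ 2 + n%:R) * r ^+ n.+1 * nm (x - q) ^+ 2 by rewrite [r ^+ n.+1]exprS; ring.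
rewrite ler_wpM2r // ler_wpM2r ?exprn_ge0 //.
by rewrite -natrX -natrD -natrX ler_nat; lia.
Qed.

(** The second-order bounds for the monomials, summed at a radius [r] between the modulus of [q] and
    1, converge because [n ^+ 2 * a n] is still tame; their sum is the quadratic remainder wanted by
    [cder_quad]. *)
Lemma cder_ev a q : tame a -> nm q < 1 ->
  cder (ev a) q (ev (fun n => n.+1%:R * a n.+1) q).
Proof.
move=> ta hq; have [r [r0 r1 hr _]] := between (nm_ge0 q) hq.
have td := tame_deriv ta.
have ta2 : tame (fun n => n%:R ^+ 2 * a n).
  by apply: eq_tame (tame_muln (tame_muln ta)) => n; rewrite mulrA.
have [M HM] := tame_summable ta2 (ltW r0) r1.
have rr : nm (r%:C : C) <= r by rewrite nm_real ger0_norm // ltW.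
apply: (@cder_quad _ _ _ _ (M / r ^+ 2) (r - nm q)); first by rewrite subr_gt0.
move=> x hx.
have xr : nm x < r by have := nm_triB x q; lra.
have hx1 : nm x < 1 by lra.
have -> : ev a x - ev a q - (x - q) * ev (fun n => n.+1%:R * a n.+1) q =
  csum (fun n => a n * (x ^+ n - q ^+ n - (x - q) * (n%:R * q ^+ n.-1))).
  symmetry; apply: csumE.
  have h : (fun n => series (fun n => n.+1%:R * a n.+1 * q ^+ n) n) @ \oo -->
     ev (fun n => n.+1%:R * a n.+1) q by exact: ev_cvg.
  have h' : (fun n => series (fun n => n%:R * a n * q ^+ n.-1) n) @ \oo -->
     ev (fun n => n.+1%:R * a n.+1) q.
    rewrite -cvg_shiftS; apply: (slim_eq _ h) => n.
    by rewrite /series /= big_nat_recl //= !mul0r add0r.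
  have H := slimB (slimB (ev_cvg ta hx1) (ev_cvg ta hq)) (slimM (@slim_cst R (x - q)) h').
  apply: (slim_eq _ H) => n.
  rewrite /series /= mulr_sumr -!sumrB; apply: eq_bigr => i _; ring.
apply: csum_le => n.
apply: (@le_trans _ _ (\sum_(0 <= k < n)
   nm (k%:R ^+ 2 * a k * (r%:C) ^+ k) * (nm (x - q) ^+ 2 / r ^+ 2))).
  apply: ler_sum => k _; rewrite !nmM !nmX nm_nat nm_real (ger0_norm (ltW r0)).
  have := exprn_second_order k (ltW r0) (ltW hr) (ltW xr).
  set A := nm _ => hA.
  rewrite mulrA ler_pdivlMr ?exprn_gt0 //.
  rewrite [leLHS](_ : _ = nm (a k) * (r ^+ 2 * A)); last by ring.
  rewrite [leRHS](_ : _ = nm (a k) * (k%:R ^+ 2 * r ^+ k * nm (x - q) ^+ 2)); last by ring.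
  by rewrite ler_wpM2l ?nm_ge0.
rewrite -mulr_suml [leRHS](_ : _ = M * (nm (x - q) ^+ 2 / r ^+ 2)); last by ring.
rewrite ler_wpM2r ?divr_ge0 ?exprn_ge0 ?nm_ge0 ?(ltW r0) //.
exact: HM.
Qed.

Lemma ev_tail a r : tame a -> 0 <= r -> r < 1 -> exists M t, [/\ 0 <= M, 0 <= t < 1 &
  forall q n, nm q <= r -> nm (ev a q - series (fun n => a n * q ^+ n) n) <= M * t ^+ n].
Proof.
move=> ta r0 r1; have [M [t [M0 /andP[t0 t1] H]]] := tame_geo ta r0 r1.
exists (M / (1 - t)), t; rewrite t0 t1 divr_ge0 ?subr_ge0 ?(ltW t1) //; split=> // q n hq.
apply: csum_tail_le; last by apply/cvg_ex; exists (ev a q); apply: ev_cvg => //; lra.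
move=> m; apply: (@le_trans _ _ (\sum_(0 <= k < m) M * t ^+ n * t ^+ k)).
  by apply: ler_sum => k _; rewrite -mulrA -exprD; exact: H.
rewrite -mulr_sumr [leRHS]mulrAC ler_wpM2l ?mulr_ge0 ?exprn_ge0 //.
exact: geom_le.
Qed.

End EvDeriv.

(** * q-series on the upper half-plane *)

Section QSeries.
Variable R : realType.
Local Notation C := (cplx R).
Local Notation H := (@upper_half R).
Implicit Types (a b c : nat -> C) (q t : C) (f g : C -> C).

(** Stands for a function holomorphic on [H], invariant under [t + 1] and bounded at the cusp. The
    coefficients are exposed because identities are decided by the first few of them. *)
Definition qser f a := tame a /\ forall t, H t -> f t = ev a (nome t).

Lemma near_upper (t : C) (P : C -> Prop) : H t -> (forall x, H x -> P x) ->
  \forall x \near t, P x.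
Proof.
move=> Ht HP; apply: (near_nm Ht) => x hx; apply: HP; rewrite /upper_half /=.
by have := Im_le_nm (x - t); rewrite ImB ler_norml => /andP[]; lra.
Qed.

Lemma cder_upper f g t d : H t -> (forall x, H x -> f x = g x) -> cder f t d -> cder g t d.
Proof. by move=> Ht e; apply: cder_near; exact: near_upper. Qed.

Lemma qser_tame f a : qser f a -> tame a. Proof. by case. Qed.

Lemma eq_qser f g a : (forall t, H t -> f t = g t) -> qser f a -> qser g a.
Proof. by move=> e [ta h]; split=> // t Ht; rewrite -e // h. Qed.

Lemma eq_qser_coef f a b : a =1 b -> qser f a -> qser f b.
Proof. by move=> /funext ->. Qed.

Lemma qser_cst x : qser (fun _ => x) (ps_cons x (fun _ => 0)).
Proof. by split; [exact: tame_cst|move=> t _; rewrite ev_cst]. Qed.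

Lemma qserD f g a b : qser f a -> qser g b ->
  qser (fun t => f t + g t) (fun n => a n + b n).
Proof.
move=> [ta ha] [tb hb]; split; first exact: tameD.
by move=> t Ht; rewrite ha // hb // evD //; exact: nm_nome_lt1.
Qed.

Lemma qserZ x f a : qser f a -> qser (fun t => x * f t) (fun n => x * a n).
Proof.
move=> [ta ha]; split; first exact: tameZ.
by move=> t Ht; rewrite ha // evZ //; exact: nm_nome_lt1.
Qed.

Lemma qserB f g a b : qser f a -> qser g b ->
  qser (fun t => f t - g t) (fun n => a n - b n).
Proof.
move=> ha /(qserZ (-1)) hb; apply: eq_qser (eq_qser_coef _ (qserD ha hb)) => [t _|n];
by rewrite mulN1r.
Qed.

Lemma qserM f g a b : qser f a -> qser g b -> qser (fun t => f t * g t) (cprod a b).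
Proof.
move=> [ta ha] [tb hb]; split; first exact: tame_cprod.
by move=> t Ht; rewrite ha // hb // ev_cprod //; exact: nm_nome_lt1.
Qed.

Lemma qserX f a n : qser f a -> exists b, qser (fun t => f t ^+ n) b.
Proof.
move=> ha; elim: n => [|n [b hb]].
  by exists (ps_cons 1 (fun _ => 0)); apply: eq_qser (qser_cst 1) => t _; rewrite expr0.
by exists (cprod a b); apply: eq_qser (qserM ha hb) => t _; rewrite exprS.
Qed.

Lemma qser_cder f a t : qser f a -> H t ->
  cder f t (twopii R * ev (fun n => n%:R * a n) (nome t)).
Proof.
move=> [ta ha] Ht; have q1 := nm_nome_lt1 Ht.
apply: (@cder_upper (fun t => ev a (nome t))) => //; first by move=> x /ha.
apply: cder_eq (cder_comp (cder_nome t) (cder_ev ta q1)) _.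
rewrite [ev (fun n => n%:R * a n) _]ev_shift //; last exact: tame_muln.
by rewrite mul0r add0r mulrC mulrA.
Qed.

Lemma qser_derivable f a : qser f a -> holomorphic_on H f.
Proof. by move=> h t Ht; exact: cder_derivable (qser_cder h Ht). Qed.

Lemma qser_qD f a : qser f a -> qser (qD f) (fun n => n%:R * a n).
Proof.
move=> h; split; first exact: tame_muln (qser_tame h).
by move=> t Ht; rewrite /qD (cderE (qser_cder h Ht)) mulKf // twopii_neq0.
Qed.

Lemma qDE f t d : cder f t (twopii R * d) -> qD f t = d.
Proof. by move=> h; rewrite /qD (cderE h) mulKf // twopii_neq0. Qed.

Lemma qser_cderD f a t : qser f a -> H t -> cder f t (twopii R * qD f t).
Proof.
by move=> h Ht; apply: cder_eq (qser_cder h Ht) _; rewrite (qDE (qser_cder h Ht)).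
Qed.

(* Averaging over the points [j/K + iy] isolates the n-th coefficient. *)
Lemma root_of_unity_sum (K m : nat) : (0 < K)%N ->
  \sum_(0 <= j < K) nome ((m%:R / K%:R : C)) ^+ j = (if (K %| m)%N then K%:R else 0).
Proof.
move=> K0; have K0' : K%:R != 0 :> C by rewrite pnatr_eq0 -lt0n.
case: ifP => [/dvdnP[c ->]|nd].
  have -> : nome (((c * K)%N%:R / K%:R) : C) = 1.
    by rewrite natrM mulfK // -[c%:R]mulr1 nome_nat nome1 expr1n.
  by under eq_bigr do rewrite expr1n; rewrite sumr_const_nat subn0.
set w := nome _; have w1 : w - 1 != 0.
  rewrite subr_eq0; apply/eqP => /nome_eq1[n]; move/(congr1 (fun z => z * K%:R)).
  rewrite divfK // => e.
  have : (m%:Z = n * K%:Z)%R.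
    have /(congr1 (@complex.Re R)) : (m%:Z%:~R = (n * K%:Z)%:~R :> C) by rewrite intrM; exact: e.
    rewrite -!(rmorph_int (real_complex R)) /= => /eqP; rewrite eqr_int => /eqP -> //.
  by move/(congr1 absz); rewrite abszM /= => e'; rewrite e' dvdn_mull in nd.
apply: (mulfI w1); rewrite mulr0.
have -> : (w - 1) * \sum_(0 <= j < K) w ^+ j = w ^+ K - 1.
  have -> (n : nat) : (w - 1) * \sum_(0 <= j < n) w ^+ j = w ^+ n - 1; last by [].
  elim: n => [|n IH]; first by rewrite big_geq // mulr0 expr0 subrr.
  by rewrite big_nat_recr //= mulrDr IH exprS; ring.
rewrite /w -nome_nat mulrC divfK // -[m%:R]mulr1 nome_nat nome1 expr1n subrr //.
Qed.

(** Cauchy's estimate on the circle through [rho], without an integral. In the series cut at [K]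
    terms the average over [K] equidistant points isolates [a n] exactly, and the neglected tail
    [B * s ^+ K] disappears as [K] grows. *)
Lemma qser_coef_le f a (y M : R) n : 0 < y -> qser f a ->
  (forall x : R, nm (f (x +i* y)) <= M) -> nm (a n) * nm (nome (0 +i* y : C)) ^+ n <= M.
Proof.
move=> y0 [ta hf] hM; set rho := nome (0 +i* y).
have rho1 : nm rho < 1 by exact: nm_nome_lt1.
have [B [s [B0 /andP[s0 s1] hB]]] := ev_tail ta (nm_ge0 rho) rho1.
have key K : (n < K)%N -> nm (a n) * nm rho ^+ n <= M + B * s ^+ K.
  move=> nK; have K0 : (0 < K)%N by apply: leq_trans nK.
  have K0' : K%:R != 0 :> C by rewrite pnatr_eq0 -lt0n.
  pose w := nome (K%:R^-1 : C).
  pose tj (j : nat) : C := (j%:R / K%:R) +i* y.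
  have tjE j : nome (tj j) = rho * w ^+ j.
    rewrite /rho /w -nome_nat -nomeD; congr nome.
    have -> : (j%:R / K%:R : C) = (j%:R / K%:R : R)%:C.
      by rewrite rmorphM fmorphV !rmorph_nat.
    by apply/eqP; rewrite eq_complex /= add0r addr0 !eqxx.
  have w1 : nm w = 1.
    rewrite /w nm_nome (_ : complex.Im _ = 0) ?mulr0 ?oppr0 ?expR0 //.
    by have -> : (K%:R^-1 : C) = (K%:R^-1 : R)%:C by rewrite fmorphV rmorph_nat.
  pose S (q : C) := series (fun l => a l * q ^+ l) K.
  (* The exponent [K - n] plays the role of [- n], since [w] is a K-th root of unity. *)
  have e : \sum_(0 <= j < K) w ^+ (j * (K - n)) * S (nome (tj j)) = K%:R * (a n * rho ^+ n).
    rewrite /S /series /=.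
    under eq_bigr do rewrite mulr_sumr.
    rewrite exchange_big_nat /=.
    rewrite (eq_big_nat _ _ (F2 := fun l => a l * rho ^+ l * (if l == n then K%:R else 0))).
      rewrite (bigD1_seq n) ?mem_index_iota ?iota_uniq //= eqxx big1 ?addr0 1?mulrC // => i.
      by move=> /negbTE ->; rewrite mulr0.
    move=> l /andP[_ lK].
    have -> : (if l == n then K%:R else 0) = (if (K %| l + (K - n))%N then K%:R else 0) :> C.
      case: eqP => [->|ln]; first by rewrite subnKC ?dvdnn // ltnW.
      case: ifP => // /dvdnP[c hc].
      have : (c * K < 2 * K)%N by rewrite -hc; lia.
      rewrite ltn_mul2r K0 /= => c2; case: c hc c2 => [|[|]] // hc _; lia.
    rewrite -root_of_unity_sum // mulr_sumr; apply: eq_bigr => j _.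
    have -> : nome ((l + (K - n))%:R / K%:R) = w ^+ (l + (K - n)) by rewrite /w -nome_nat.
    rewrite tjE [(rho * _) ^+ l]exprMn -!exprM mulnDl exprD [(j * l)%N]mulnC [(j * (K - n))%N]mulnC; ring.
  have h : K%:R * (nm (a n) * nm rho ^+ n) <= K%:R * (M + B * s ^+ K).
    rewrite -nmX -nmM -[X in X * _]nm_nat -nmM -e.
    apply: le_trans (nm_sum _ _ _) _.
    rewrite mulr_natl -[X in _ *+ X]subn0 -sumr_const_nat.
    apply: ler_sum => j _; rewrite nmM nmX w1 expr1n mul1r.
    have ej : nm (nome (tj j)) <= nm rho by rewrite tjE nmM nmX w1 expr1n mulr1.
    rewrite -[S _](subrK (f (tj j))) addrC; apply: le_trans (nmD _ _) _.
    by apply: lerD; [exact: hM|rewrite nmBC hf //; exact: hB].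
  by rewrite ler_pM2l ?ltr0n // in h.
have c0 : M + B * s ^+ K @[K --> \oo] --> M.
  rewrite -[X in _ --> X](addr0 M) -[X in _ + X](mulr0 B).
  apply: cvgD; first exact: cvg_cst.
  by apply: cvgM; [exact: cvg_cst|apply: cvg_expr; rewrite ger0_norm].
rewrite -[leRHS](cvg_lim _ c0) //; apply: limr_ge; first by apply/cvg_ex; exists M.
by near=> K; apply: key; near: K; exists n.+1.
Unshelve. all: by end_near. Qed.

Lemma qser_eq0 f a : qser f a -> (forall t, H t -> f t = 0) -> forall n, a n = 0.
Proof.
move=> h f0 n; have := @qser_coef_le f a 1 0 n ltr01 h.
have hh : forall x : R, nm (f (x +i* 1)) <= 0.
  by move=> x; rewrite f0 ?nm0 // /upper_half /=.
move=> /(_ hh); rewrite pmulr_lle0 ?exprn_gt0 ?nm_gt0 ?nome_neq0 // => h0.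
by apply/eqP; rewrite -nm_eq0 eq_le h0 nm_ge0.
Qed.

Lemma cprod_eq0 a b : (forall n, cprod a b n = 0) -> (forall n, a n = 0) \/ (forall n, b n = 0).
Proof.
move=> h; apply: contrapT => /not_orP[na nb].
have ex c : ~ (forall n, c n = 0) -> exists n, c n != 0.
  by move=> nc; apply: contrapT => hn; apply: nc => n; apply: contrapT => /eqP; eauto.
have [m am hm] := ex_minnP (ex _ na); have [n bn hn] := ex_minnP (ex _ nb).
have := h (m + n)%N; rewrite /cprod (bigD1_seq m) ?mem_index_iota ?iota_uniq //=; last lia.
rewrite addKn big1_seq ?addr0 => [/eqP|i /andP[im]].
  by rewrite mulf_eq0 (negbTE am) (negbTE bn).
rewrite mem_index_iota => /andP[_ hi].
have [him|him] := ltnP i m.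
  suff -> : a i = 0 by rewrite mul0r.
  by apply/eqP; apply: contraTT him => /hm; rewrite leqNgt.
suff -> : b (m + n - i)%N = 0 by rewrite mulr0.
apply/eqP; apply/negPn/negP => /hn; move/eqP: im; lia.
Qed.

(** The q-series form an integral domain, because lowest nonzero terms multiply. A factor such as
    [lW] can thus be cancelled from an identity although it has zeros in [H]. *)
Lemma qser_mul_eq0 f g a b : qser f a -> qser g b -> (forall t, H t -> f t * g t = 0) ->
  (forall t, H t -> f t = 0) \/ (forall t, H t -> g t = 0).
Proof.
move=> ha hb fg0; have z0 (x : nat -> C) : (forall n, x n = 0) -> forall q, ev x q = 0.
  by move=> x0 q; apply: csumE; apply: slim_eq (@slim_cst R 0) => n;
    rewrite /series /= big1 // => i _; rewrite x0 mul0r.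
have [/z0 h|/z0 h] := cprod_eq0 (qser_eq0 (qserM ha hb) fg0); [left|right] => t Ht.
  by case: ha => _ ->.
by case: hb => _ ->.
Qed.

Lemma qser_limit f a : qser f a -> value_at_infty f (a 0%N).
Proof.
move=> [ta hf] e e0.
have r0 : (0 : R) <= 2^-1 by rewrite invr_ge0 ler0n.
have r1 : 2^-1 < 1 :> R by lra.
have [M hM] := ev_bound (tame_shift ta) r0 r1.
have M0 : 0 <= M by apply: le_trans (nm_ge0 _) (hM 0 _); rewrite nm0.
pose d := Num.min 2^-1 (e / (M + 1)).
have d0 : 0 < d by rewrite lt_min divr_gt0 ?andbT //; lra.
exists (- ln d / (2 * pi)) => t Ht hy.
have p0 : 0 < 2 * pi :> R by rewrite mulr_gt0 // pi_gt0.
have hq : nm (nome t) < d.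
  rewrite nm_nome -[ltRHS]lnK ?posrE // ltr_expR ltrNl.
  by rewrite ltr_pdivrMr // mulrC in hy.
move: hq; rewrite lt_min => /andP[h1 h2].
rewrite normE ltcR hf // ev_shift //; last by lra.
rewrite addrC addKr nmM; have hM' := hM _ (ltW h1).
rewrite ltr_pdivlMr in h2; last lra.
apply: le_lt_trans h2; rewrite ler_wpM2l ?nm_ge0 //; lra.
Qed.

End QSeries.

(** * Power series with a prescribed logarithmic derivative *)

Section PowerSeriesExp.
Variable R : realType.
Local Notation C := (cplx R).
Local Notation H := (@upper_half R).
Implicit Types (a b c : nat -> C) (q t : C) (f g : C -> C).

(* The first n+1 coefficients, in reverse order, of the series b with b_0 = 1
   and (q d/dq) b = c b. *)
Fixpoint psexp_table c (n : nat) : seq C :=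
  if n is n'.+1 then
    (\sum_(0 <= k < n'.+1) c k.+1 * (psexp_table c n')`_k) / n'.+1%:R :: psexp_table c n'
  else [:: 1].

Definition psexp c n : C := (psexp_table c n)`_0.

Lemma psexp_tableE c n k : (k <= n)%N -> (psexp_table c n)`_k = psexp c (n - k).
Proof.
elim: n k => [|n IH] [|k] //= kn.
by rewrite IH.
Qed.

Lemma psexp0 c : psexp c 0 = 1. Proof. by []. Qed.

Lemma psexpS c n :
  n.+1%:R * psexp c n.+1 = \sum_(0 <= k < n.+1) c k.+1 * psexp c (n - k).
Proof.
rewrite /psexp /= mulrC divfK ?pnatr_eq0 //; apply: eq_big_nat => k /andP[_ kn].
by rewrite psexp_tableE.
Qed.

Lemma psexp_ode c : c 0%N = 0 -> (fun n => n%:R * psexp c n) =1 cprod c (psexp c).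
Proof.
move=> c0 [|n]; rewrite /cprod; first by rewrite big_nat1 c0 !mul0r.
by rewrite psexpS [RHS]big_nat_recl // c0 mul0r add0r.
Qed.

Lemma bernoulli (x : R) n : 0 <= x -> 1 + n%:R * x <= (1 + x) ^+ n.
Proof.
move=> x0; elim: n => [|n IH]; first by rewrite mul0r addr0 expr0.
rewrite exprS; apply: (@le_trans _ _ ((1 + x) * (1 + n%:R * x))); last first.
  by rewrite ler_wpM2l // addr_ge0.
rewrite -natr1 -subr_ge0 [leRHS](_ : _ = n%:R * x ^+ 2); last by ring.
by rewrite mulr_ge0 ?exprn_ge0.
Qed.

(** After rescaling by a radius [s], the recurrence multiplies the partial sums of the absolute
    values by at most 1 + A/(n+1) at each step. Bernoulli's inequality bounds this by
    ((n+2)/(n+1))^A, so they grow polynomially; this is why the bound [A] is rounded up to an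
    integer. *)
Lemma tame_psexp c : tame c -> tame (psexp c).
Proof.
move=> tc r r0 r1; have [s [s0 s1 _ [t e /andP[t0 t1]]]] := between r0 r1.
have [M0 HM] := tc s (ltW s0) s1.
have [A hA] : exists A : nat, M0 <= A%:R.
  by exists (Num.bound `|M0|); apply: le_trans (ler_norm _) (ltW (archi_boundP (normr_ge0 _))).
have HA n : nm (c n) * s ^+ n <= A%:R by apply: le_trans (HM n) hA.
pose B n := nm (psexp c n) * s ^+ n.
have B0 n : 0 <= B n by rewrite mulr_ge0 ?nm_ge0 ?exprn_ge0 // ltW.
have rec n : n.+1%:R * B n.+1 <= A%:R * \sum_(0 <= k < n.+1) B k.
  rewrite /B mulrA.
  have -> : n.+1%:R * nm (psexp c n.+1) = nm (n.+1%:R * psexp c n.+1) by rewrite nmM nm_nat.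
  rewrite psexpS.
  apply: le_trans (ler_wpM2r _ (nm_sum _ _ _)) _; first by rewrite exprn_ge0 // ltW.
  rewrite mulr_suml mulr_sumr [leRHS]big_nat_rev /=.
  apply: ler_sum_nat => k /andP[_ kn]; rewrite add0n subSS nmM.
  rewrite [leLHS](_ : _ = nm (c k.+1) * s ^+ k.+1 * (nm (psexp c (n - k)) * s ^+ (n - k))).
    by rewrite ler_wpM2r // B0.
  have -> : s ^+ n.+1 = s ^+ k.+1 * s ^+ (n - k) by rewrite -exprD; congr (_ ^+ _); lia.
  ring.
have S n : \sum_(0 <= k < n.+1) B k <= n.+1%:R ^+ A.
  elim: n => [|n IH]; first by rewrite big_nat1 /B nm1 expr0 mulr1 expr1n.
  rewrite big_nat_recr //=; set S := \sum_(_ <= _ < _) _ in IH *.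
  have n0 : (0 : R) < n.+1%:R by rewrite ltr0n.
  have h : B n.+1 <= A%:R * S / n.+1%:R by rewrite ler_pdivlMr // mulrC; exact: rec.
  apply: (@le_trans _ _ (S * (1 + A%:R * n.+1%:R^-1))).
    by rewrite mulrDr mulr1 lerD2l [leRHS]mulrA [S * _]mulrC.
  have -> : n.+2%:R = n.+1%:R * (1 + n.+1%:R^-1) :> R.
    by rewrite mulrDr mulr1 mulfV ?gt_eqF // natr1.
  rewrite exprMn; apply: ler_pM => //.
  - by apply: sumr_ge0 => i _; exact: B0.
  - by apply: bernoulli; rewrite invr_ge0.
have [K HK] := @tame_natpow R A t t0 t1.
exists K => n; apply: le_trans (HK n).
rewrite nmX nm_nat e exprMn mulrCA mulrC ler_wpM2r ?exprn_ge0 //.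
apply: le_trans (S n); rewrite big_nat_recr //= lerDr.
by apply: sumr_ge0 => i _; exact: B0.
Qed.

Definition psexpf c t : C := ev (psexp c) (nome t).

Lemma qser_psexp c : tame c -> qser (psexpf c) (psexp c).
Proof. by move=> tc; split=> //; exact: tame_psexp. Qed.

Lemma psexp_qD f c t : qser f c -> c 0%N = 0 -> H t ->
  cder (psexpf c) t (twopii R * (f t * psexpf c t)).
Proof.
move=> h c0 Ht; have tc := qser_tame h.
apply: cder_eq (qser_cder (qser_psexp tc) Ht) _; congr (_ * _).
rewrite (eq_ev _ (psexp_ode c0)) ev_cprod //; last exact: nm_nome_lt1.
  by case: h => _ ->.
exact: tame_psexp.
Qed.

(** The product has derivative 0, so only its constant coefficient 1 survives. In particular
    [psexpf c] has no zero and its inverse is again a q-series. *)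
Lemma psexpf_inv c t : tame c -> c 0%N = 0 -> H t ->
  psexpf c t * psexpf (fun n => -1 * c n) t = 1.
Proof.
move=> tc c0 Ht; pose c' n := -1 * c n.
have hc : qser (fun t => ev c (nome t)) c by [].
have hc' := qserZ (-1) hc.
have c'0 : c' 0%N = 0 by rewrite /c' c0 mulr0.
have hp := qserM (qser_psexp tc) (qser_psexp (qser_tame hc')).
have der : forall t, H t -> qD (fun t => psexpf c t * psexpf c' t) t = 0.
  move=> x Hx; apply: qDE; apply: cder_eq (cderM (psexp_qD hc c0 Hx) (psexp_qD hc' c'0 Hx)) _.
  by rewrite mulr0; ring.
have z := qser_eq0 (qser_qD hp) der.
case: hp => tp -> //; rewrite ev_shift //; last exact: nm_nome_lt1.
rewrite (_ : (fun n => cprod _ _ n.+1) = fun _ => 0); last first.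
  apply/funext => n; have /eqP := z n.+1; rewrite mulf_eq0 pnatr_eq0 /=.
  by move=> /eqP h; exact: h.
rewrite (_ : ev _ _ = 0) ?mulr0 ?addr0; last first.
  apply: csumE; apply: slim_eq (@slim_cst R 0) => n.
  by rewrite /series /= big1 // => i _; rewrite mul0r.
by rewrite /cprod big_nat1 !psexp0 mulr1.
Qed.

Lemma psexpf_neq0 c t : tame c -> c 0%N = 0 -> H t -> psexpf c t != 0.
Proof.
move=> tc c0 Ht; apply/eqP => h; have /eqP := psexpf_inv tc c0 Ht.
by rewrite h mul0r eq_sym oner_eq0.
Qed.

End PowerSeriesExp.

(** * Functions determined by their logarithmic derivative *)

Section Constancy.
Variable R : realType.
Local Notation C := (cplx R).
Local Notation H := (@upper_half R).
Implicit Types (f g : C -> C) (t : C).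

(** Retracts the line onto [0, 1], so that a segment in [H] becomes a path defined for every real
    parameter that never leaves [H]. *)
Definition clamp (s : R) : R := Num.max 0 (Num.min s 1).

Lemma clamp_itv s : 0 <= clamp s <= 1.
Proof. by rewrite /clamp le_max lexx /= ge_max ler01 ge_min lexx orbT. Qed.

Lemma clamp_lip s s' : `|clamp s - clamp s'| <= `|s - s'|.
Proof.
wlog ss : s s' / s <= s'.
  move=> h; have [|/ltW] := leP s s'; first exact: h.
  by move/h; rewrite distrC [in leRHS]distrC.
rewrite [leRHS]ler0_norm ?subr_le0 // ler_norml /clamp /Order.max /Order.min.
case: (ltP s 1) => h1; case: (ltP s' 1) => h2; rewrite ?ltr01;
  case: (ltP 0 s) => h3; case: (ltP 0 s') => h4; apply/andP; split; lra.
Qed.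

Lemma cder0_const f t0 t1 : (forall t, H t -> cder f t 0) -> H t0 -> H t1 -> f t0 = f t1.
Proof.
move=> df H0 H1; pose g s : C := t0 + (clamp s)%:C * (t1 - t0).
have Hg s : H (g s).
  rewrite /upper_half /g /= ImD; have /andP[c0 c1] := clamp_itv s.
  have -> : complex.Im ((clamp s)%:C * (t1 - t0)) = clamp s * (complex.Im t1 - complex.Im t0).
    by case: (t1) (t0) => [? ?] [? ?] /=; rewrite mul0r addr0.
  move: H0 H1; rewrite /upper_half /= => H0 H1.
  have [c2|c2] := leP (clamp s) (1/2).
    have := mulr_ge0 c0 (ltW H1); nra.
  nra.
have g0 : g 0 = t0 by rewrite /g /clamp min_l // max_l // mul0r addr0.
have g1 : g 1 = t1 by rewrite /g /clamp min_l // max_r // mul1r addrC subrK.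
have key (P : C -> R) : (forall z, `|P z| <= nm z) -> (forall z w, P (z - w) = P z - P w) ->
   P (f t0) = P (f t1).
  move=> P1 P2; rewrite -g0 -g1.
  apply: (@is_derive_0_is_cst _ (fun s => P (f (g s)))) => s.
  (* The path [g] is only Lipschitz at its two ends, which is enough because [f] has derivative
     0. *)
  apply: real_der0 => e e0.
  set L := nm (t1 - t0) + 1; have L0 : 0 < L by have := nm_ge0 (t1 - t0); rewrite /L; lra.
  have := df _ (Hg s) => /cder_epsP /(_ (e / L)); rewrite divr_gt0 // => /(_ isT)[d d0 hd].
  exists (d / L); first by rewrite divr_gt0.
  move=> h; rewrite ltr_pdivlMr // => hh.
  have hl : nm (g (s + h) - g s) <= `|h| * L.
    have -> : g (s + h) - g s = (clamp (s + h) - clamp s)%:C * (t1 - t0).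
      by rewrite /g rmorphB; ring.
    rewrite nmM nm_real; apply: ler_pM; rewrite ?nm_ge0 //; last by rewrite /L; lra.
    by apply: le_trans (clamp_lip _ _) _; rewrite [s + h]addrC addrK.
  have := hd (g (s + h)) (le_lt_trans hl hh); rewrite mulr0 subr0 => hf.
  rewrite -P2; apply: le_trans (P1 _) _; apply: le_trans hf _.
  by rewrite mulrAC ler_pdivrMr // -mulrA ler_pM2l.
have kr := key (@complex.Re R) (@Re_le_nm R) (@ReB R).
have ki := key (@complex.Im R) (@Im_le_nm R) (@ImB R).
by apply/eqP; rewrite eq_complex kr ki !eqxx.
Qed.

(** The quotient has derivative 0. This is how the effect of the Fricke involution on [lFB] is
    found, where only logarithmic derivatives are accessible. *)
Lemma logder_const f g : (forall t, H t -> f t != 0) -> (forall t, H t -> g t != 0) ->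
  (forall t, H t -> exists l, cder f t (l * f t) /\ cder g t (l * g t)) ->
  exists2 k : C, k != 0 & forall t, H t -> f t = k * g t.
Proof.
move=> f0 g0 fg; have Hi : H (0 +i* 1) by rewrite /upper_half /=.
exists (f (0 +i* 1) / g (0 +i* 1)); first by rewrite mulf_neq0 ?invr_neq0 ?f0 ?g0.
move=> t Ht; rewrite (@cder0_const (fun t => f t / g t) _ t) ?divfK ?g0 // => x Hx.
have [l [hf hg]] := fg x Hx.
apply: cder_eq (cderM hf (cderV hg (g0 x Hx))) _.
by field; exact: g0.
Qed.

End Constancy.

(** * Sums over divisors *)

Lemma sum_divisorsE (V : nmodType) (F : nat -> V) n : (0 < n)%N ->
  \sum_(d <- divisors n) F d = \sum_(1 <= d < n.+1 | (d %| n)%N) F d.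
Proof.
case: n => // n _; rewrite -[RHS]big_filter; apply: perm_big; apply: uniq_perm.
- exact: divisors_uniq.
- by rewrite filter_uniq // iota_uniq.
move=> d; rewrite mem_filter mem_index_iota -dvdn_divisors //.
case: (boolP (d %| n.+1)%N) => //= dn; have := dvdn_leq (ltn0Sn n) dn.
by have := dvdn_gt0 (ltn0Sn n) dn; rewrite ltnS => -> ->.
Qed.

Lemma perm_codivisors n : (0 < n)%N -> perm_eq [seq (n %/ d)%N | d <- divisors n] (divisors n).
Proof.
case: n => // n _; have K d : (d %| n.+1)%N -> (n.+1 %/ (n.+1 %/ d) = d)%N.
  by move=> dn; rewrite divnA // mulKn.
apply: uniq_perm; rewrite ?divisors_uniq //.
  rewrite map_inj_in_uniq ?divisors_uniq // => d e.
  rewrite -!dvdn_divisors // => hd he h.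
  by rewrite -(K d hd) h K.
move=> d; apply/mapP/idP => [[e]|]; rewrite -!dvdn_divisors // => h.
  by move=> ->; apply/dvdnP; exists e; rewrite mulnC divnK.
exists (n.+1 %/ d)%N; rewrite -?dvdn_divisors ?K //.
by apply/dvdnP; exists d; rewrite mulnC divnK.
Qed.

Lemma sum_codivisors (V : nmodType) (F : nat -> V) n : (0 < n)%N ->
  \sum_(d <- divisors n) F (n %/ d)%N = \sum_(d <- divisors n) F d.
Proof. by move=> n0; rewrite -[RHS](perm_big _ (perm_codivisors n0)) big_map. Qed.

Lemma sum_divisors_mul (V : nmodType) (F : nat -> V) k n : (0 < k)%N -> (0 < n)%N ->
  \sum_(d <- divisors n | (k %| d)%N) F d =
  if (k %| n)%N then \sum_(d <- divisors (n %/ k)) F (k * d)%N else 0.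
Proof.
move=> k0; case: n => // n _.
case: ifP => [/dvdnP[m e]|nk].
  have m0 : (0 < m)%N by case: m e => //.
  rewrite e mulnK // -big_filter -[RHS](big_map (fun d => (k * d)%N) xpredT F).
  apply: perm_big; apply: uniq_perm.
  - by rewrite filter_uniq ?divisors_uniq.
  - by rewrite map_inj_uniq ?divisors_uniq // => x y /eqP; rewrite eqn_pmul2l // => /eqP.
  move=> d; rewrite mem_filter -dvdn_divisors ?muln_gt0 ?m0 //.
  apply/andP/mapP => [[/dvdnP[c ->] h]|[c]].
    by exists c; [rewrite -dvdn_divisors // -(dvdn_pmul2r k0)|rewrite mulnC].
  by rewrite -dvdn_divisors // => h ->; rewrite dvdn_mulr // mulnC dvdn_pmul2r.
rewrite big_seq_cond big1 // => d; rewrite -dvdn_divisors // => /andP[h1 h2].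
by rewrite (dvdn_trans h2 h1) in nk.
Qed.

Lemma sum_divisors_codiv (V : nmodType) (F : nat -> V) k n : (0 < k)%N -> (0 < n)%N ->
  \sum_(d <- divisors n | (k %| n %/ d)%N) F d =
  if (k %| n)%N then \sum_(d <- divisors (n %/ k)) F d else 0.
Proof.
move=> k0; case: n => // n _.
have -> : \sum_(d <- divisors n.+1 | (k %| n.+1 %/ d)%N) F d =
   \sum_(d <- divisors n.+1 | (k %| n.+1 %/ d)%N) F (n.+1 %/ (n.+1 %/ d))%N.
  rewrite big_seq_cond [RHS]big_seq_cond; apply: eq_bigr => d.
  rewrite -dvdn_divisors // => /andP[h _].
  by rewrite divnA // mulKn.
rewrite -(big_map (fun d => (n.+1 %/ d)%N) (fun d => (k %| d)%N) (fun d => F (n.+1 %/ d)%N)).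
rewrite (perm_big _ (perm_codivisors (ltn0Sn n))) sum_divisors_mul //.
case: ifP => // /dvdnP[m e].
have m0 : (0 < m)%N by case: m e.
rewrite e mulnK // -[RHS]sum_codivisors // big_seq [RHS]big_seq; apply: eq_bigr => d _.
by rewrite mulnC divnMl.
Qed.

(** * The series E_2 and the q-expansions of part (1) *)

Section Eisenstein2.
Variable R : realType.
Local Notation C := (cplx R).
Local Notation H := (@upper_half R).
Implicit Types (a b c : nat -> C) (q t : C) (f g : C -> C).

Definition sig (n : nat) : C := if n is 0%N then 0 else (\sum_(d <- divisors n) d)%N%:R.

Lemma sigE n : (0 < n)%N -> sig n = \sum_(d <- divisors n) d%:R.
Proof. by case: n => // n _; rewrite /sig natr_sum. Qed.

Lemma sum_divisors_le n : (0 < n)%N -> (\sum_(d <- divisors n) d <= n * n)%N.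
Proof.
case: n => // n _; rewrite sum_divisorsE //; apply: (@leq_trans (\sum_(1 <= d < n.+2) n.+1)).
  rewrite big_mkcond /=; apply: leq_sum => d _; case: ifP => // dn.
  exact: dvdn_leq dn.
by rewrite sum_nat_const_nat subn1.
Qed.

Lemma tame_sig : tame sig.
Proof.
apply: (@tame_poly _ _ 2) => -[|n]; first by rewrite nm0 exprn_ge0.
rewrite /sig nm_nat -natrX ler_nat.
by apply: leq_trans (sum_divisors_le _) _ => //; rewrite -mulnn leq_mul.
Qed.

Definition e2c (n : nat) : C := if n is 0%N then 1 else - 24 * sig n.

Lemma tame_e2c : tame e2c.
Proof.
apply: tame_unshift; apply: (@tame_shift _ (fun n => - 24 * sig n)).
exact: tameZ tame_sig.
Qed.

Lemma E2E q : nm q < 1 -> E2 q = ev e2c q.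
Proof.
move=> hq; rewrite /E2; set u := fun n => _.
have hs : u @ \oo --> ev sig q.
  apply: slim_eq (ev_cvg tame_sig hq) => n; rewrite /u /series /=.
  case: n => [|n]; first by rewrite !big_geq.
  by rewrite big_nat_recl //= mul0r add0r big_add1.
rewrite (cvg_lim _ hs) // [ev e2c q]ev_shift //; last exact: tame_e2c.
rewrite [ev sig q]ev_shift //; last exact: tame_sig.
rewrite add0r.
have -> : ev (fun n => e2c n.+1) q = - 24 * ev (fun n => sig n.+1) q.
  by rewrite -evZ //; exact: tame_shift tame_sig.
by rewrite /=; ring.
Qed.

Lemma slim_sub (u : nat -> C) (l : C) (phi : nat -> nat) : (forall n, (n <= phi n)%N) ->
  u @ \oo --> l -> (fun n => u (phi n)) @ \oo --> l.
Proof.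
move=> hphi /cvg_nmP h; apply/cvg_nmP => e /h [N _ hN].
by exists N => // n /= hn; apply: hN => /=; apply: leq_trans (hphi n).
Qed.

(** The coefficients of f(d t) when [a] are those of f(t). *)
Definition dil d a n : C := if (d %| n)%N then a (n %/ d)%N else 0.

Lemma tame_dil d a : (0 < d)%N -> tame a -> tame (dil d a).
Proof.
move=> d0 ta r r0 r1; have [M hM] := ta r r0 r1.
have M0 : 0 <= M by apply: le_trans (hM 0%N); rewrite mulr_ge0 ?nm_ge0 ?exprn_ge0.
exists M => n; rewrite /dil; case: ifP => [/dvdnP[m ->]|_]; last by rewrite nm0 mul0r.
rewrite mulnK //; apply: le_trans (hM m); rewrite ler_wpM2l ?nm_ge0 //.
by rewrite ler_wiXn2l ?(ltW r1) // leq_pmulr.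
Qed.

Lemma ev_dil d a q : (0 < d)%N -> tame a -> nm q < 1 -> ev (dil d a) q = ev a (q ^+ d).
Proof.
move=> d0 ta hq.
have hqd : nm (q ^+ d) < 1 by rewrite nmX exprn_ilt1 ?nm_ge0 // -lt0n.
have h1 := slim_sub (fun n => leq_pmull n d0) (ev_cvg (tame_dil d0 ta) hq).
have h2 := ev_cvg ta hqd.
apply: slim_uniq h1 _; apply: slim_eq h2 => n; rewrite /series /=.
elim: n => [|n IH]; first by rewrite muln0 !big_geq.
rewrite big_nat_recr //= IH mulnS addnC.
rewrite (@big_cat_nat _ _ _ (d * n)%N 0 (d * n + d)%N) ?leq_addr //=; congr (_ + _).
rewrite big_nat_shift -(prednK d0) big_nat_recl // big1_seq ?addr0.
  by rewrite addn0 /dil dvdn_mulr // mulKn ?prednK // exprM.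
move=> i /andP[_]; rewrite mem_index_iota => /andP[_ hi].
rewrite /dil dvdn_addr ?prednK ?dvdn_mulr // gtnNdvd ?mul0r //.
by rewrite -[X in (_ < X)%N](prednK d0).
Qed.

Lemma qser_dil d f a : (0 < d)%N -> qser f a -> qser (fun t => f (d%:R * t)) (dil d a).
Proof.
move=> d0 [ta h]; split; first exact: tame_dil.
move=> t Ht; rewrite h ?ev_dil -?nome_nat //; first exact: nm_nome_lt1.
rewrite /upper_half /= -(ltr_pMn2r d0) mul0rn in Ht *.
have -> : d%:R = (d%:R : R)%:C :> C by rewrite rmorph_nat.
by move: Ht; case: t => x y /=; rewrite mul0r addr0 mulr_natl.
Qed.

Definition P t : C := E2 (nome t).

Lemma qser_P : qser P e2c.
Proof. by split; [exact: tame_e2c|move=> t Ht; rewrite /P E2E ?nm_nome_lt1]. Qed.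

Lemma calEtE4 t : calEt 4 t = (4 * P (2 * t) - P t) / 3.
Proof. by rewrite /calEt /calE /P nome_nat. Qed.
Lemma calEtE3 t : calEt 3 t = (9 * P (3 * t) - P t) / 8.
Proof. by rewrite /calEt /calE /P nome_nat. Qed.
Lemma calEtE2 t : calEt 2 t = (4 * P (4 * t) - P (2 * t)) / 3.
Proof. by rewrite /calEt /calE /P !nome_nat. Qed.

Lemma qser_lin d e x y z : (0 < d)%N -> (0 < e)%N ->
  qser (fun t => (x * P (d%:R * t) - y * P (e%:R * t)) / z)
       (fun n => (x * dil d e2c n - y * dil e e2c n) / z).
Proof.
move=> d0 e0; have h1 := qserZ x (qser_dil d0 qser_P); have h2 := qserZ y (qser_dil e0 qser_P).
apply: eq_qser (eq_qser_coef _ (qserZ z^-1 (qserB h1 h2))) => [t _|n]; by rewrite mulrC.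
Qed.

Lemma has_qseriesP (f : C -> C) (b : nat -> C) (x : C) (a : nat -> C) :
  qser (fun t => f (nome t)) b -> b 0%N = 1 -> (forall n, (0 < n)%N -> b n = x * a n) ->
  has_qseries f x a.
Proof.
move=> [tb h] b0 bn t Ht; rewrite h //.
have := ev_cvg tb (nm_nome_lt1 Ht); rewrite -cvg_shiftS => H1.
rewrite -cvg_shiftS; apply: slim_eq H1 => n.
rewrite /series /= big_nat_recl // expr0 mulr1 b0 big_add1 /= mulr_sumr; congr (_ + _).
by apply: eq_bigr => i _; rewrite bn // mulrA.
Qed.

Lemma sigma_aux (P : nat -> nat -> bool) (z : int) n :
  \sum_(d <- divisors n) ((P d n)%:R : int)%:~R * z%:~R * d%:R =
  z%:~R * \sum_(d <- divisors n | P d n) d%:R :> C.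
Proof.
rewrite mulr_sumr [RHS]big_mkcond; apply: eq_bigr => d _.
by case: (P d n); rewrite ?mul1r ?mul0r.
Qed.

(** Every list in the theorem is a combination of two divisibility indicators, which reduces the
    twisted divisor sums to dilations of [sig]. For [sigma] the divisor itself is the multiple of
    [j], whence the factor [j], which is absent for [sigmac]. *)
Lemma sigma_ind (chi : seq int) (x y : int) j k n : (0 < j)%N -> (0 < k)%N -> (0 < n)%N ->
  (forall d, (chi`_(d %% size chi)%N) = (j %| d)%:R * x + (k %| d)%:R * y) ->
  sigma R 1 chi n = x%:~R * (j%:R * dil j sig n) + y%:~R * (k%:R * dil k sig n).
Proof.
move=> j0 k0 n0 h; rewrite /sigma.
under eq_bigr => d _ do rewrite h intrD !intrM expr1 mulrDl.
have aux i : (0 < i)%N -> \sum_(d <- divisors n | (i %| d)%N) d%:R = i%:R * dil i sig n :> C.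
  move=> i0; rewrite sum_divisors_mul // /dil; case: ifP => hi; last by rewrite mulr0.
  by rewrite sigE ?divn_gt0 ?(dvdn_leq n0 hi) // mulr_sumr; apply: eq_bigr => d _; rewrite natrM.
rewrite big_split /= (sigma_aux (fun d n => j %| d)%N) (sigma_aux (fun d n => k %| d)%N).
by rewrite !aux.
Qed.

Lemma sigmac_ind (chi : seq int) (x y : int) j k n : (0 < j)%N -> (0 < k)%N -> (0 < n)%N ->
  (forall d, (chi`_(d %% size chi)%N) = (j %| d)%:R * x + (k %| d)%:R * y) ->
  sigmac R 1 chi n = x%:~R * dil j sig n + y%:~R * dil k sig n.
Proof.
move=> j0 k0 n0 h; rewrite /sigmac.
under eq_bigr => d _ do rewrite h intrD !intrM expr1 mulrDl.
have aux i : (0 < i)%N -> \sum_(d <- divisors n | (i %| n %/ d)%N) d%:R = dil i sig n :> C.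
  by move=> i0; rewrite sum_divisors_codiv // /dil; case: ifP => hi //; rewrite sigE ?divn_gt0 ?(dvdn_leq n0 hi).
rewrite big_split /= (sigma_aux (fun d n => j %| n %/ d)%N) (sigma_aux (fun d n => k %| n %/ d)%N).
by rewrite !aux.
Qed.

Lemma dil_e2c d n : (0 < n)%N -> dil d e2c n = - 24 * dil d sig n.
Proof.
move=> n0; rewrite /dil; case: ifP => [/dvdnP[m e]|_]; last by rewrite mulr0.
have d0 : (0 < d)%N by case: d e => //; rewrite muln0 => e; rewrite e in n0.
by rewrite e mulnK //; case: m e => [|m] // e; rewrite e in n0.
Qed.

Lemma dil1 a n : dil 1 a n = a n.
Proof. by rewrite /dil dvd1n divn1. Qed.

Lemma dil_0 d a : dil d a 0 = a 0%N.
Proof. by rewrite /dil dvdn0 div0n. Qed.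

Lemma calE_qseries (f : C -> C) (d e : nat) (x y z : C) (k : C) (s : nat -> C) :
  (0 < d)%N -> (0 < e)%N -> z != 0 -> x - y = z ->
  (forall t, f (nome t) = (x * P (d%:R * t) - y * P (e%:R * t)) / z) ->
  (forall n, (0 < n)%N -> k * s n = - 24 * (x * dil d sig n - y * dil e sig n) / z) ->
  has_qseries f k s.
Proof.
move=> d0 e0 z0 xy hf hs; have hq := qser_lin x y z d0 e0.
apply: has_qseriesP (eq_qser _ hq) _ _; first by move=> t _; rewrite hf.
  by rewrite !dil_0 /= !mulr1 xy mulfV.
move=> n n0 /=; rewrite hs //. rewrite !dil_e2c //; congr (_ / _); ring.
Qed.

Lemma calE4_qseries : has_qseries (@calE R 4) 8 (@sigma R 1 [:: -1; 1]) /\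
      has_qseries (@calE R 4) 8 (@sigmac R 1 [:: -3; 1]).
Proof.
have hf t : calE 4 (nome t) = (4 * P (2%:R * t) - 1 * P (1%:R * t)) / 3.
  by rewrite !mul1r -calEtE4.
split; apply: (@calE_qseries _ 2 1 4 1 3) => //; rewrite ?pnatr_eq0 //; try by ring.
- move=> n n0; rewrite (@sigma_ind _ 1 (-2) 1 2) //; first by rewrite !dil1; field.
  move=> d /=; rewrite dvd1n /dvdn; have : (d %% 2 < 2)%N by rewrite ltn_mod.
 
  by case: (d %% 2)%N => [|[|//]] _.
- move=> n n0; rewrite (@sigmac_ind _ 1 (-4) 1 2) //; first by rewrite !dil1; field.
  move=> d /=; rewrite dvd1n /dvdn; have : (d %% 2 < 2)%N by rewrite ltn_mod.
 
  by case: (d %% 2)%N => [|[|//]] _.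
Qed.

Lemma calE3_qseries : has_qseries (@calE R 3) 3 (@sigma R 1 [:: -2; 1; 1]) /\
      has_qseries (@calE R 3) 3 (@sigmac R 1 [:: -8; 1; 1]).
Proof.
have hf t : calE 3 (nome t) = (9 * P (3%:R * t) - 1 * P (1%:R * t)) / 8.
  by rewrite !mul1r -calEtE3.
split; apply: (@calE_qseries _ 3 1 9 1 8) => //; rewrite ?pnatr_eq0 //; try by ring.
- move=> n n0; rewrite (@sigma_ind _ 1 (-3) 1 3) //; first by rewrite !dil1; field.
  move=> d /=; rewrite dvd1n /dvdn; have : (d %% 3 < 3)%N by rewrite ltn_mod.
 
  by case: (d %% 3)%N => [|[|[|//]]] _.
- move=> n n0; rewrite (@sigmac_ind _ 1 (-9) 1 3) //; first by rewrite !dil1; field.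
  move=> d /=; rewrite dvd1n /dvdn; have : (d %% 3 < 3)%N by rewrite ltn_mod.
 
  by case: (d %% 3)%N => [|[|[|//]]] _.
Qed.

Lemma calE2_qseries : has_qseries (@calE R 2) 4 (@sigma R 1 [:: -1; 0; 1; 0]) /\
      has_qseries (@calE R 2) 8 (@sigmac R 1 [:: -3; 0; 1; 0]).
Proof.
have hf t : calE 2 (nome t) = (4 * P (4%:R * t) - 1 * P (2%:R * t)) / 3.
  by rewrite !mul1r -calEtE2.
have h24 d : (2 %| d)%N = (2 %| d %% 4)%N.
  by rewrite {1}(divn_eq d 4) dvdn_addr // dvdn_mull.
split; apply: (@calE_qseries _ 4 2 4 1 3) => //; rewrite ?pnatr_eq0 //; try by ring.
- move=> n n0; rewrite (@sigma_ind _ 1 (-2) 2 4) //; first by field.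
  move=> d /=; rewrite h24 /dvdn; have : (d %% 4 < 4)%N by rewrite ltn_mod.
 
  by case: (d %% 4)%N => [|[|[|[|//]]]] _.
- move=> n n0; rewrite (@sigmac_ind _ 1 (-4) 2 4) //; first by field.
  move=> d /=; rewrite h24 /dvdn; have : (d %% 4 < 4)%N by rewrite ltn_mod.
 
  by case: (d %% 4)%N => [|[|[|[|//]]]] _.
Qed.

End Eisenstein2.

(** * Lower bounds for 1 - nome z *)

Section TrigBounds.
Variable R : realType.
Local Notation C := (cplx R).
Implicit Types (z w t : C).

Lemma cos_ge_half (t : R) : `|t| <= pi / 4 -> 1 / 2 <= cos t.
Proof.
rewrite -cos_norm => ht; have p0 := pi_gt0 R.
apply: (@le_trans _ _ (cos (pi / 4))).
  have h0 : 0 <= cos (pi / 4 : R) by apply: cos_ge0_pihalf; apply/andP; split; lra.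
  have h1 : cos (pi / 4) ^+ 2 = 1 / 2 :> R.
    have := cos_mulr2n (pi / 4 : R); have -> : (pi / 4 : R) *+ 2 = pi / 2 by field.
    rewrite cos_pihalf => /esym/eqP; rewrite subr_eq0 => /eqP; lra.
  nra.
have i1 : pi / 4 \in `[0, (pi : R)]%R by rewrite in_itv /=; apply/andP; split; lra.
have i2 : `|t| \in `[0, pi]%R by rewrite in_itv /= normr_ge0 /=; lra.
by rewrite leNgt (ltr_cos i1 i2) -leNgt.
Qed.

Lemma sin_lower (t : R) : 0 <= t <= 3 / 4 * pi -> t / 8 <= sin t.
Proof.
move=> /andP[t0 t1]; have p0 := pi_gt0 R.
have [h|h] := leP t (pi / 4).
  have d1 x : x \in `]0, t[%R -> is_derive x 1 (@sin R) (cos x) by move=> _; exact: is_derive_sin.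
  have d2 : {within `[0, t]%classic, continuous (@sin R)}.
    by apply/continuous_subspaceT => x; exact: continuous_sin.
  have [c] := MVT_segment t0 d1 d2; rewrite in_itv /= => /andP[c0 c1].
  rewrite sin0 !subr0 => ->; have : 1 / 2 <= cos c.
    by apply: cos_ge_half; rewrite ger0_norm; lra.
  nra.
have : 1 / 2 <= cos (t - pi / 2) by apply: cos_ge_half; rewrite ler_norml; lra.
rewrite cosBpihalf => h2; have := pihalf_lt2 R; lra.
Qed.

Lemma sinh_lower (u : R) : u ^+ 2 <= (expR u - expR (- u)) ^+ 2.
Proof.
wlog u0 : u / 0 <= u.
  move=> h; have [|/ltW u0] := leP 0 u; first exact: h.
  have := h (- u); rewrite opprK sqrrN -[X in _ -> _ <= X]sqrrN opprB; apply; lra.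
rewrite lerXn2r ?nnegrE //; last first.
  have h1 := expR_ge1Dx u; have h2 : expR (- u) <= 1 by rewrite -expR0 ler_expR; lra.
  lra.
have := expR_ge1Dx u; have h2 : expR (- u) <= 1 by rewrite -expR0 ler_expR; lra.
by lra.
Qed.

(** The square of the quotient of 1 - nome z by nome (z/2) is, in modulus, 4 sinh(pi y)^2 + 4 sin(pi
    x)^2, and both terms have linear lower bounds before squaring. The strip must stay away from the
    zeros 1 and -1. *)
Lemma one_sub_nome_lower z : `|complex.Re z| <= 3 / 4 ->
  nm z * nm (nome (z / 2)) <= 8 * nm (1 - nome z).
Proof.
case: z => x y /= hx; have p2 := pi_ge2 R.
set w := nome _.
have e1 : nome (x +i* y) = w ^+ 2.
  by rewrite /w -nome_nat mulrC divfK // pnatr_eq0.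
suff h : (nm (x +i* y) * nm w) ^+ 2 <= (8 * nm (1 - nome (x +i* y))) ^+ 2.
  by rewrite ler_sqr ?nnegrE ?mulr_ge0 ?nm_ge0 in h.
pose E := expR (- (pi * y)).
have Ew : nm w = E.
  rewrite /w nm_nome; congr (expR (- _)).
  have -> : (2^-1 : C) = (2^-1 : R)%:C by rewrite fmorphV rmorph_nat.
  by rewrite /= mulr0 add0r; field.
have E0 : 0 < E by exact: expR_gt0.
have eq1 : nm (1 - nome (x +i* y)) ^+ 2 = E ^+ 2 * ((expR (pi * y) - E) ^+ 2 + 4 * sin (pi * x) ^+ 2).
  have EE : E * expR (pi * y) = 1 by rewrite /E -expRD addNr expR0.
  rewrite sqr_nm /nome /cexp /= !(mul0r, mulr0, sub0r, addr0, add0r, subr0).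
  have -> : expR (- (2 * pi * y)) = E ^+ 2.
    by rewrite /E expr2 -expRD; congr expR; ring.
  have -> : 2 * pi * x = (pi * x) *+ 2 by ring.
  rewrite cos_mulr2n sin_mulr2n -mulr_natl -[in X in X = _]mulr_natl.
  have := cos2Dsin2 (pi * x); set c := cos _; set s := sin _ => cs.
  have -> : E ^+ 2 * ((expR (pi * y) - E) ^+ 2 + 4 * s ^+ 2) =
    (E * expR (pi * y) - E ^+ 2) ^+ 2 + 4 * E ^+ 2 * s ^+ 2 by ring.
  rewrite EE; have -> : s ^+ 2 = 1 - c ^+ 2 by lra.
  have -> : (- (E ^+ 2 * (c * s *+ 2))) ^+ 2 = 4 * E ^+ 4 * c ^+ 2 * s ^+ 2 by ring.
  have -> : s ^+ 2 = 1 - c ^+ 2 by lra.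
  ring.
rewrite !exprMn eq1 Ew sqr_nm /= mulrC mulrCA ler_pM2l ?exprn_gt0 //.
have h1 := sinh_lower (pi * y); rewrite -/E in h1.
have h2 : (x / 4) ^+ 2 <= sin (pi * x) ^+ 2.
  have : `|x| / 4 <= sin (pi * `|x|).
    have x0 := normr_ge0 x; have p0 := pi_gt0 R.
    have a1 : 2 * `|x| <= pi * `|x| by rewrite ler_wpM2r.
    have a2 : pi * `|x| <= pi * (3 / 4) by rewrite ler_pM2l.
    apply: le_trans (@sin_lower (pi * `|x|) _); first by lra.
    by apply/andP; split; lra.
  move=> h; have : (`|x| / 4) ^+ 2 <= sin (pi * `|x|) ^+ 2.
    by rewrite lerXn2r ?nnegrE // ?(le_trans _ h) // divr_ge0.
  case: (ger0P x) => _ //; by rewrite mulrN sinN sqrrN mulNr sqrrN.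
have h3 : y ^+ 2 <= (pi * y) ^+ 2.
  by rewrite exprMn ler_peMl ?sqr_ge0 // exprn_ege1 //; lra.
have e64 : (8 : R) ^+ 2 = 64 by ring.
rewrite e64 -/E; nra.
Qed.

End TrigBounds.

(** * Tannery's theorem and the exchange of summations *)

Section Tannery.
Variable R : realType.
Local Notation C := (cplx R).

Lemma slim_nm_near (u : nat -> C) (l : C) : u @ \oo --> l -> forall e : R, 0 < e ->
  \forall n \near \oo, `|nm l - nm (u n)| < e.
Proof.
move=> /cvg_nmP h e /h; apply: filterS => n hn; apply: le_lt_trans hn.
rewrite ler_norml; have h1 := nm_triB l (u n); have h2 := nm_triB (u n) l.
by rewrite nmBC in h2; lra.
Qed.

Lemma nonneg_series_cvg (v : nat -> R) V : (forall k, 0 <= v k) ->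
  (forall n, \sum_(0 <= k < n) v k <= V) -> cvgn (series v).
Proof.
move=> v0 hV; apply: (@real_series_cvg _ _ V) => n.
by under eq_bigr do rewrite ger0_norm //.
Qed.

Lemma nonneg_tail (v : nat -> R) V : (forall k, 0 <= v k) ->
  (forall n, \sum_(0 <= k < n) v k <= V) -> forall e, 0 < e ->
  exists N, forall n m, (N <= n)%N -> \sum_(n <= k < m) v k <= e.
Proof.
move=> v0 hV e e0; have /cvg_ex[l hl] := nonneg_series_cvg v0 hV.
have mono : nondecreasing_seq (series v) by apply: nondecreasing_series => n _ _.
have le_l n : series v n <= l.
  rewrite -(cvg_lim _ hl) //; apply: nondecreasing_cvgn_le => //.
  by apply/cvg_ex; exists l.
move/cvgrPdist_lt : (hl) => /(_ e e0)[N _ hN]; exists N => n m Nn.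
have [mn|nm] := leqP m n; first by rewrite big_geq // ltW.
have := hN n Nn; rewrite /= ger0_norm ?subr_ge0 // => h.
have : series v m = series v n + \sum_(n <= k < m) v k.
  by rewrite /series /= -big_cat_nat //= ltnW.
have := le_l m; lra.
Qed.

Lemma slim_sum (u : nat -> nat -> C) (L : nat -> C) n :
  (forall k, (k < n)%N -> (fun j => u j k) @ \oo --> L k) ->
  (fun j => \sum_(0 <= k < n) u j k) @ \oo --> \sum_(0 <= k < n) L k.
Proof.
elim: n => [|n IH] h.
  by rewrite big_geq //; apply: slim_eq (@slim_cst R 0) => j; rewrite big_geq.
rewrite big_nat_recr //=; have h1 := slimD (IH (fun k kn => h k (leqW kn))) (h n (ltnSn n)).
by apply: slim_eq h1 => j; rewrite big_nat_recr.
Qed.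

(** Dominated convergence for sums of growing length [K j]: a tail common to all [j] is cut off by
    means of [v], and finitely many terms remain. It is applied to duplication sums of length
    2^j. *)
Lemma tannery (u : nat -> nat -> C) (L : nat -> C) (v : nat -> R) V (K : nat -> nat) :
  (forall k, 0 <= v k) -> (forall n, \sum_(0 <= k < n) v k <= V) ->
  (forall k, (fun j => u j k) @ \oo --> L k) ->
  (\forall j \near \oo, forall k, (k < K j)%N -> nm (u j k) <= v k) ->
  (forall n, \forall j \near \oo, (n <= K j)%N) ->
  series L @ \oo --> csum L /\
  (fun j => \sum_(0 <= k < K j) u j k) @ \oo --> csum L.
Proof.
move=> v0 hV uL uv hK.
have Lv k : nm (L k) <= v k.
  apply: (cvg_nm_bound (uL k)); near=> j.
  have := near uv j; apply => //; have : (k.+1 <= K j)%N by near: j; exact: hK.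
  by [].
have sL : abs_summable L V by move=> n; apply: le_trans (hV n); apply: ler_sum.
have cL := csum_cvg sL; split=> //.
apply/cvg_nmP => e e0; have e30 : 0 < e / 4 by rewrite divr_gt0.
have [N hN] := nonneg_tail v0 hV e30.
have tL : nm (csum L - series L N) <= e / 4.
  apply: csum_tail_le; last by apply/cvg_ex; exists (csum L).
  move=> m; apply: le_trans (hN N (N + m)%N (leqnn N)).
  by rewrite (big_nat_shift _ N m); apply: ler_sum => i _; exact: Lv.
have fin := slim_sum (fun k (_ : (k < N)%N) => uL k).
move/cvg_nmP : fin => /(_ (e / 4) e30) fin.
near=> j.
have Kj : (N <= K j)%N by near: j; exact: hK.
have uvj : forall k, (k < K j)%N -> nm (u j k) <= v k by near: j.
have f : nm (\sum_(0 <= k < N) L k - \sum_(0 <= k < N) u j k) < e / 4 by near: j.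
rewrite (@big_cat_nat _ _ _ N 0 (K j)) //=.
have t : nm (\sum_(N <= k < K j) u j k) <= e / 4.
  apply: le_trans (nm_sum _ _ _) _; apply: le_trans (hN N (K j) (leqnn N)).
  by apply: ler_sum_nat => k /andP[_ h]; exact: uvj.
have -> : csum L - (\sum_(0 <= k < N) u j k + \sum_(N <= k < K j) u j k) =
  (csum L - series L N) + (\sum_(0 <= k < N) L k - \sum_(0 <= k < N) u j k)
    - \sum_(N <= k < K j) u j k.
  by rewrite /series /=; ring.
apply: le_lt_trans (nmB _ _) _; have := nmD (csum L - series L N)
  (\sum_(0 <= k < N) L k - \sum_(0 <= k < N) u j k); lra.
Unshelve. all: by end_near. Qed.

(** Square partial sums approximate both orders of summation at once: by the product majorant, each
    side differs from the n by n square by at most [U] times a tail of [u]. *)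
Lemma double_series_swap (a : nat -> nat -> C) (u : nat -> R) U (Rm Lc : nat -> C) :
  (forall k, 0 <= u k) -> (forall n, \sum_(0 <= k < n) u k <= U) ->
  (forall m c, nm (a m c) <= u m * u c) ->
  (forall m, series (a m) @ \oo --> Rm m) ->
  (forall c, series (fun m => a m c) @ \oo --> Lc c) ->
  (fun n => series Rm n - series Lc n) @ \oo --> (0 : C).
Proof.
move=> u0 hU hu hR hL; apply/cvg_nmP => e e0.
have U0 : 0 <= U by apply: le_trans (hU 0%N); rewrite big_geq.
have d0 : 0 < e / (2 * U + 1) by rewrite divr_gt0 //; lra.
have [N hN] := nonneg_tail u0 hU d0.
set d := e / _ in d0 hN.
exists N => // n /= Nn.
have tail (b : nat -> C) (l : C) x : 0 <= x -> (forall k, nm (b k) <= x * u k) ->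
   series b @ \oo --> l -> nm (l - series b n) <= x * d.
  move=> x0 hb bl; rewrite -(csumE bl); apply: csum_tail_le; last by apply/cvg_ex; exists l.
  move=> m; apply: (@le_trans _ _ (\sum_(0 <= k < m) x * u (n + k)%N)).
    by apply: ler_sum => k _.
  rewrite -mulr_sumr ler_wpM2l //; apply: le_trans (hN n (n + m)%N Nn).
  by rewrite (big_nat_shift _ n m).
have h1 : nm (series Rm n - \sum_(0 <= m < n) \sum_(0 <= c < n) a m c) <= U * d.
  rewrite /series /= -sumrB; apply: le_trans (nm_sum _ _ _) _.
  apply: (@le_trans _ _ (\sum_(0 <= m < n) u m * d)); last first.
    by rewrite -mulr_suml ler_wpM2r // ltW.
  by apply: ler_sum => m _; exact: (tail _ _ _ (u0 m) (hu m) (hR m)).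
have h2 : nm (series Lc n - \sum_(0 <= m < n) \sum_(0 <= c < n) a m c) <= U * d.
  rewrite exchange_big_nat /= /series /= -sumrB; apply: le_trans (nm_sum _ _ _) _.
  apply: (@le_trans _ _ (\sum_(0 <= m < n) u m * d)); last first.
    by rewrite -mulr_suml ler_wpM2r // ltW.
  apply: ler_sum => c _; apply: (tail _ _ _ (u0 c) _ (hL c)) => m.
  by rewrite mulrC.
rewrite sub0r nmN; set S := \sum_(0 <= m < n) _ in h1 h2.
have -> : series Rm n - series Lc n = (series Rm n - S) - (series Lc n - S) by ring.
apply: le_lt_trans (nmB _ _) _; apply: le_lt_trans (lerD h1 h2) _.
have : d * (2 * U + 1) = e by rewrite divfK // gt_eqF //; lra.
nra.
Qed.

Lemma inv_sq_sum n : \sum_(0 <= k < n) (k.+1%:R ^+ 2)^-1 <= 2 :> R.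
Proof.
suff : (0 < n)%N -> \sum_(0 <= k < n) (k.+1%:R ^+ 2)^-1 <= 2 - n%:R^-1 :> R.
  case: n => [|n] h; first by rewrite big_geq.
  by apply: le_trans (h isT) _; rewrite gerBl invr_ge0.
elim: n => [//|[|n] IH] _; first by rewrite big_nat1 expr1n invr1; lra.
rewrite big_nat_recr //=; apply: le_trans (lerD (IH isT) (lexx _)) _.
set x : R := n.+1%:R; have x0 : 0 < x by rewrite ltr0n.
have -> : n.+2%:R = x + 1 :> R by rewrite natr1.
rewrite -subr_ge0.
have -> : 2 - (x + 1)^-1 - (2 - x^-1 + ((x + 1) ^+ 2)^-1) = (x * (x + 1) ^+ 2)^-1.
  by field; apply/andP; split; lra.
by rewrite invr_ge0 mulr_ge0 ?exprn_ge0 //; lra.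
Qed.

End Tannery.

(** * Partial fractions by repeated duplication *)

Section PartialFractions.
Variable R : realType.
Local Notation C := (cplx R).
Local Notation H := (@upper_half R).
Implicit Types (z w t : C).

(** This is -1 / (4 sin(pi z)^2), and [kap z] below is i cot(pi z). *)
Definition phi z : C := nome z / (1 - nome z) ^+ 2.
Definition kap z : C := (1 + nome z) / (1 - nome z).

Lemma natC (n : nat) : n%:R = (n%:R : R)%:C :> C.
Proof. by rewrite rmorph_nat. Qed.

Lemma nome_half (w : C) : nome ((w + 1) / 2) = - nome (w / 2).
Proof.
rewrite mulrDl nomeD; suff -> : nome (1 / 2 : C) = -1 by rewrite mulrN1.
rewrite /nome /cexp; have -> : twopii R * (1 / 2) = 0 +i* pi.
  rewrite mul1r (_ : (2^-1 : C) = (2^-1 : R)%:C); last by rewrite fmorphV rmorph_nat.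
  by apply/eqP; rewrite eq_complex /=; apply/andP; split; apply/eqP; field.
by rewrite /= expR0 mul1r cospi sinpi; apply/eqP; rewrite eq_complex /= oppr0 !eqxx.
Qed.

Lemma nome_double (w : C) : nome w = nome (w / 2) ^+ 2.
Proof. by rewrite -nome_nat mulrC divfK // pnatr_eq0. Qed.

Lemma one_sub_sq_neq0 (x : C) : 1 - x ^+ 2 != 0 -> 1 - x != 0 /\ 1 + x != 0.
Proof.
have -> : 1 - x ^+ 2 = (1 - x) * (1 + x) by ring.
by rewrite mulf_eq0 negb_or => /andP[-> ->].
Qed.

Lemma phi_dup w : nome w != 1 -> phi (w / 2) + phi ((w + 1) / 2) = 4 * phi w.
Proof.
move=> h; rewrite /phi nome_half (nome_double w); set x := nome (w / 2).
have h3 : 1 - x ^+ 2 != 0 by rewrite -nome_double subr_eq0 eq_sym.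
have [h1 h2] := one_sub_sq_neq0 h3.
by field; rewrite h1 h3 ?opprK ?(addrC x) ?h2.
Qed.

Lemma kap_dup w : nome w != 1 -> kap (w / 2) + kap ((w + 1) / 2) = 2 * kap w.
Proof.
move=> h; rewrite /kap nome_half (nome_double w); set x := nome (w / 2).
have h3 : 1 - x ^+ 2 != 0 by rewrite -nome_double subr_eq0 eq_sym.
have [h1 h2] := one_sub_sq_neq0 h3.
by field; rewrite h1 h3 ?opprK ?(addrC x) ?h2.
Qed.

(** Iterating the duplication formula spreads [F z] over 2^(j+1) points of a finer and finer scale;
    after division by [x ^+ j.+1] each term tends to a polar term of [F], which yields its partial
    fraction expansion. *)
Lemma dup_sum (F : C -> C) (x : C) z j :
  (forall w, nome w != 1 -> F (w / 2) + F ((w + 1) / 2) = x * F w) ->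
  (forall w, F (w + 1) = F w) -> nome z != 1 ->
  \sum_(0 <= k < 2 ^ j.+1) F ((z + k%:R) / 2 ^+ j.+1) = x ^+ j.+1 * F z.
Proof.
move=> Fd Fp z1; have p0 i : (2 : C) ^+ i != 0 by rewrite expf_neq0 // pnatr_eq0.
elim: j.+1 => {j} [|j IH].
  by rewrite expn0 big_nat1 expr0 addr0 expr0 divr1 mul1r.
rewrite expnS mul2n -addnn (@big_cat_nat _ _ _ (2 ^ j)%N) ?leq_addr //= (big_nat_shift _ (2 ^ j) (2 ^ j)) -big_split /=.
rewrite [x ^+ j.+1]exprS -mulrA -IH mulr_sumr; apply: eq_bigr => k _.
rewrite -Fd; last first.
  apply: contra z1 => /eqP h.
  have : nome ((z + k%:R) / 2 ^+ j) ^+ (2 ^ j) = 1 by rewrite h expr1n.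
  rewrite -nome_nat natrX mulrC divfK // nomeD => /eqP.
  by rewrite -[k%:R]mulr1 nome_nat nome1 expr1n mulr1.
congr (F _ + F _); rewrite [2 ^+ j.+1]exprS.
  by field; rewrite p0.
rewrite natrD natrX; field; by rewrite p0.
Qed.

(** By periodicity the upper half of the range is moved one unit down, which centres the points at
    0, where the lower bound for 1 - nome applies. *)
Lemma dup_sum_sym (F : C -> C) (x : C) z j :
  (forall w, nome w != 1 -> F (w / 2) + F ((w + 1) / 2) = x * F w) ->
  (forall w, F (w + 1) = F w) -> nome z != 1 ->
  \sum_(0 <= k < 2 ^ j) (F ((z + k%:R) / 2 ^+ j.+1) + F ((z - k.+1%:R) / 2 ^+ j.+1)) = x ^+ j.+1 * F z.
Proof.
move=> Fd Fp z1; have p0 i : (2 : C) ^+ i != 0 by rewrite expf_neq0 // pnatr_eq0.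
rewrite -(dup_sum j Fd Fp z1) expnS mul2n -addnn [RHS](@big_cat_nat _ _ _ (2 ^ j)%N) ?leq_addr //=.
rewrite big_split /=; congr (_ + _); rewrite (big_nat_shift _ (2 ^ j) (2 ^ j)) [RHS]big_nat_rev /=.
apply: eq_big_nat => k /andP[_ kj]; rewrite add0n -[LHS]Fp; congr F.
rewrite natrD natrB // natrX exprS; field; by rewrite p0.
Qed.

Lemma phiD1 z : phi (z + 1) = phi z. Proof. by rewrite /phi nomeD1. Qed.
Lemma kapD1 z : kap (z + 1) = kap z. Proof. by rewrite /kap nomeD1. Qed.

Lemma pow2_scale_cvg (a : C) : (fun j => a / 2 ^+ j.+1) @ \oo --> (0 : C).
Proof.
apply: (@cvg_nm_le _ _ _ _ _ _ (fun j => nm a * (2^-1) ^+ j.+1)).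
  near=> j; rewrite sub0r nmN nmM nmV nmX nm_nat exprVn //.
rewrite -(mulr0 (nm a)); apply: cvgM; first exact: cvg_cst.
rewrite (cvg_shiftS (fun j => (2^-1 : R) ^+ j)).
apply: cvg_expr; rewrite ger0_norm ?invr_ge0 //; lra.
Unshelve. all: by end_near. Qed.

Lemma nome_scale_cvg (a : C) : (fun j => nome (a / 2 ^+ j.+1)) @ \oo --> (1 : C).
Proof.
have /cvg_nm_at h := cder_continuous (cder_nome (0 : C)); rewrite nome0 in h.
apply/cvg_nmP => e /h [s s0 hs].
have /cvg_nmP /(_ s s0) := pow2_scale_cvg a; apply: filterS => j hj.
by apply: hs; rewrite nmBC.
Qed.

Lemma nome_diff_scale_cvg (a : C) : a != 0 ->
  (fun j => 2 ^+ j.+1 * (1 - nome (a / 2 ^+ j.+1))) @ \oo --> - (twopii R * a).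
Proof.
move=> a0; have /cder_slopeP [g [/cvg_nm_at gd g0 gE]] := cder_nome (0 : C).
have hg : (fun j => g (a / 2 ^+ j.+1)) @ \oo --> twopii R.
  rewrite nome0 mulr1 in gd; apply/cvg_nmP => e /gd [s s0 hs].
  have /cvg_nmP /(_ s s0) := pow2_scale_cvg a; apply: filterS => j hj.
  by apply: hs; rewrite nmBC.
have := slimM (@slim_cst R (- a)) hg; rewrite mulNr mulrC.
apply: slim_eq => j; rewrite gE nome0 subr0.
by field; rewrite expf_neq0 // pnatr_eq0.
Qed.

Lemma phi_scale_cvg (a : C) : a != 0 ->
  (fun j => phi (a / 2 ^+ j.+1) / 4 ^+ j.+1) @ \oo --> (twopii R ^+ 2 * a ^+ 2)^-1.
Proof.
move=> a0; have t0 := twopii_neq0 R.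
have h := nome_diff_scale_cvg a0.
have n0 : - (twopii R * a) != 0 by rewrite oppr_eq0 mulf_neq0.
have hV := slimV h n0.
have := slimM (nome_scale_cvg a) (slimM hV hV).
have -> : 1 * ((- (twopii R * a))^-1 * (- (twopii R * a))^-1) = (twopii R ^+ 2 * a ^+ 2)^-1.
  by field; rewrite ?a0 ?t0.
apply: slim_eq => j /=; rewrite /phi.
have -> : (4 : C) ^+ j.+1 = (2 ^+ j.+1) ^+ 2.
  by rewrite -exprM mulnC exprM; congr (_ ^+ _); ring.
by rewrite !invfM -!exprVn; ring.
Qed.

Lemma kap_scale_cvg (a : C) : a != 0 ->
  (fun j => kap (a / 2 ^+ j.+1) / 2 ^+ j.+1) @ \oo --> - (2 / (twopii R * a)).
Proof.
move=> a0; have t0 := twopii_neq0 R.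
have h := nome_diff_scale_cvg a0.
have n0 : - (twopii R * a) != 0 by rewrite oppr_eq0 mulf_neq0.
have := slimM (slimD (@slim_cst R 1) (nome_scale_cvg a)) (slimV h n0).
have -> : (1 + 1) * (- (twopii R * a))^-1 = - (2 / (twopii R * a)).
  by field; rewrite ?a0 ?t0.
by apply: slim_eq => j /=; rewrite /kap !invfM; ring.
Qed.

(** The distances from [z] to the integers grow at least linearly; this supplies the majorants of
    order 1/(k+1)^2. *)
Definition off_integers z (d : R) := 0 < d /\
  forall k : nat, d * k.+1%:R <= nm (z + k%:R) /\ d * k.+1%:R <= nm (z - k.+1%:R).

Lemma off_integers_neq0 z d k : off_integers z d -> z + k%:R != 0 /\ z - k.+1%:R != 0.
Proof.
move=> [d0 /(_ k) [h1 h2]]; have p : 0 < d * k.+1%:R by rewrite mulr_gt0 // ltr0n.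
by rewrite -!nm_gt0 !(lt_le_trans p).
Qed.

Lemma off_integers_upper z : complex.Im z != 0 -> exists d, off_integers z d.
Proof.
move=> y0; have yp : 0 < `|complex.Im z| by rewrite normr_gt0.
set y := `|_| in yp; pose A := 1 + (nm z + 1) / y.
have A0 : 0 < A by rewrite /A ltr_pwDl // divr_ge0 ?addr_ge0 ?nm_ge0 // ltW.
have key w (n : nat) : complex.Im w = complex.Im z -> n%:R <= nm w + (nm z + 1) -> A^-1 * n%:R <= nm w.
  move=> iw hn; rewrite mulrC ler_pdivrMr // /A mulrDr mulr1; apply: le_trans hn _.
  rewrite lerD2l mulrCA ler_peMr ?addr_ge0 ?nm_ge0 //.
  by rewrite ler_pdivlMr // mul1r /y -iw Im_le_nm.
exists A^-1; split; first by rewrite invr_gt0.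
move=> k; split; apply: key.
- by rewrite ImD natC /= addr0.
- by rewrite -natr1; have := nm_triB (k%:R : C) (- z); rewrite opprK nm_nat nmN [k%:R + z]addrC; lra.
- by rewrite ImB natC /= subr0.
- by have := nm_triB (k.+1%:R : C) z; rewrite nm_nat nmBC; have := nm_ge0 z; lra.
Qed.

Lemma Re_div_pow (w : C) j : complex.Re (w / 2 ^+ j) = complex.Re w / 2 ^+ j.
Proof.
have -> : ((2 : C) ^+ j)^-1 = ((2 : R) ^+ j)^-1%:C by rewrite fmorphV rmorphXn rmorph_nat.
by case: w => x y /=; rewrite mulr0 subr0.
Qed.

(** The integer contributes at most 1/2 and, once 2 |z| <= 2^j, the point [z] at most 1/4; hence the
    width 3/4 of the strip. *)
Lemma near_Re_small z : \forall j \near \oo, forall k, (k < 2 ^ j)%N ->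
  `|complex.Re ((z + k%:R) / 2 ^+ j.+1)| <= 3 / 4 /\
  `|complex.Re ((z - k.+1%:R) / 2 ^+ j.+1)| <= 3 / 4.
Proof.
exists (Num.bound (2 * nm z)) => // j /= hj k kj.
have b0 : 2 * nm z <= 2 ^+ j.
  have h : 0 <= 2 * nm z by rewrite mulr_ge0 // nm_ge0.
  apply: le_trans (ltW (archi_boundP h)) _; rewrite -natrX ler_nat.
  by apply: leq_trans hj _; rewrite ltnW // ltn_expl.
have p0 : 0 < (2 : R) ^+ j by rewrite exprn_gt0.
have k1 : k.+1%:R <= 2 ^+ j :> R by rewrite -natrX ler_nat.
have k0 : (0 : R) <= k%:R by [].
have r := Re_le_nm z; rewrite ler_norml in r; case/andP: r => r1 r2.
rewrite !Re_div_pow ReD ReB !natC /= -natr1 in k1 *.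
rewrite !normrM !normfV [ `|2 ^+ _| ]ger0_norm ?exprn_ge0 // exprS.
have p1 : 0 < 2 * (2 : R) ^+ j by rewrite mulr_gt0.
rewrite !ler_pdivrMr // !ler_norml; split; apply/andP; split; lra.
Qed.

Lemma phi_bound w : w != 0 -> `|complex.Re w| <= 3 / 4 -> nm (phi w) <= 64 / nm w ^+ 2.
Proof.
move=> w0 hw; have n0 : 0 < nm w by rewrite nm_gt0.
have h0 : 0 < nm (nome (w / 2)) by rewrite nm_gt0 nome_neq0.
have h := one_sub_nome_lower hw.
have d0 : 0 < nm (1 - nome w) by have := mulr_gt0 n0 h0; lra.
have e : nm (nome w) = nm (nome (w / 2)) ^+ 2 by rewrite -nmX -nome_double.
rewrite /phi nmM nmV nmX e ler_pdivrMr ?exprn_gt0 // mulrAC ler_pdivlMr ?exprn_gt0 //.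
rewrite -exprMn mulrC.
have -> : 64 * nm (1 - nome w) ^+ 2 = (8 * nm (1 - nome w)) ^+ 2 by ring.
by rewrite lerXn2r ?nnegrE ?mulr_ge0 ?nm_ge0.
Qed.

(** Euler's expansion of pi^2 / sin(pi z)^2, from Tannery's theorem applied to the duplication sums
    of [phi]. *)
Lemma sum_inv_sq_shifted z d : off_integers z d -> nome z != 1 ->
  series (fun k => (z + k%:R) ^- 2 + (z - k.+1%:R) ^- 2) @ \oo --> twopii R ^+ 2 * phi z.
Proof.
move=> sz z1; have t0 := twopii_neq0 R.
have [d0 hd] := sz.
pose u j k := (phi ((z + k%:R) / 2 ^+ j.+1) + phi ((z - k.+1%:R) / 2 ^+ j.+1)) / 4 ^+ j.+1.
pose L k := (twopii R) ^- 2 * ((z + k%:R) ^- 2 + (z - k.+1%:R) ^- 2).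
pose v (k : nat) : R := 128 / d ^+ 2 * (k.+1%:R ^+ 2)^-1.
have := @tannery R u L v (128 / d ^+ 2 * 2) (fun j => 2 ^ j)%N.
case.
- by move=> k; rewrite /v mulr_ge0 ?divr_ge0 ?invr_ge0 ?exprn_ge0 ?ler0n // ltW.
- by move=> n; rewrite -mulr_sumr ler_wpM2l ?inv_sq_sum // divr_ge0 ?exprn_ge0 // ltW.
- move=> k; have [n1 n2] := off_integers_neq0 k sz.
  have := slimD (phi_scale_cvg n1) (phi_scale_cvg n2).
  have -> : (twopii R ^+ 2 * (z + k%:R) ^+ 2)^-1 + (twopii R ^+ 2 * (z - k.+1%:R) ^+ 2)^-1 = L k.
    by rewrite /L !invfM; ring.
  by apply: slim_eq => j; rewrite /u; ring.
- have hs := near_Re_small z; near=> j => k kj.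
  have [r1 r2] : `|complex.Re ((z + k%:R) / 2 ^+ j.+1)| <= 3 / 4 /\
     `|complex.Re ((z - k.+1%:R) / 2 ^+ j.+1)| <= 3 / 4 by move: k kj; near: j.
  have [n1 n2] := off_integers_neq0 k sz.
  have p0 : (2 : C) ^+ j.+1 != 0 by rewrite expf_neq0 // pnatr_eq0.
  have p0' : (0 : R) < 4 ^+ j.+1 by rewrite exprn_gt0.
  have bnd w : d * k.+1%:R <= nm w -> w != 0 -> `|complex.Re (w / 2 ^+ j.+1)| <= 3 / 4 ->
     nm (phi (w / 2 ^+ j.+1)) / 4 ^+ j.+1 <= 64 / (d * k.+1%:R) ^+ 2.
    move=> hw w0 rw; rewrite ler_pdivrMr //.
    apply: le_trans (phi_bound _ rw) _; first by rewrite mulf_neq0 ?invr_neq0.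
    have w00 : 0 < nm w by rewrite nm_gt0.
    rewrite nmM nmV nmX nm_nat exprMn exprVn invfM invrK -exprM mulnC exprM.
    have -> : (2 : R) ^+ 2 = 4 by ring.
    rewrite mulrA ler_wpM2r ?(ltW p0') // ler_wpM2l //.
    have dk : 0 < d * k.+1%:R by rewrite mulr_gt0 // ltr0n.
    by rewrite lef_pV2 ?posrE ?exprn_gt0 // lerXn2r ?nnegrE ?nm_ge0 // ltW.
  rewrite /u nmM nmV nmX nm_nat.
  apply: le_trans (ler_wpM2r _ (nmD _ _)) _; first by rewrite invr_ge0 ltW.
  have [h1 h2] := hd k; rewrite mulrDl.
  apply: le_trans (lerD (bnd _ h1 n1 r1) (bnd _ h2 n2 r2)) _.
  rewrite /v exprMn invfM le_eqVlt; apply/orP; left; apply/eqP; ring.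
- move=> n; exists n => // j /= nj; apply: leq_trans nj _.
  by rewrite ltnW // ltn_expl.
move=> cL uL.
have e : csum L = phi z.
  apply: (slim_uniq uL); apply: slim_eq (@slim_cst R (phi z)) => j.
  rewrite /u -mulr_suml (dup_sum_sym j phi_dup phiD1 z1) mulrAC mulfV ?mul1r ?expf_neq0 ?pnatr_eq0 //.
have := slimM (@slim_cst R (twopii R ^+ 2)) cL; rewrite e; apply: slim_eq => n.
rewrite /series /= mulr_sumr; apply: eq_bigr => k _; by rewrite /L mulVKf // expf_neq0.
Unshelve. all: by end_near. Qed.

(** A single cotangent decays only like 1/k. In the sum of two of them the numerator is 1 - nome (a
    + b); for the pairs used below [a + b] does not depend on k, so the pair decays like 1/k^2. *)
Lemma kap_pair_bound a b : a != 0 -> b != 0 -> `|complex.Re a| <= 3 / 4 -> `|complex.Re b| <= 3 / 4 ->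
  nm (kap a + kap b) * (nm a * nm b) * nm (nome ((a + b) / 2)) <= 128 * nm (1 - nome (a + b)).
Proof.
move=> a0 b0 ra rb; have na : 0 < nm a by rewrite nm_gt0.
have nb : 0 < nm b by rewrite nm_gt0.
have ha0 : 0 < nm (nome (a / 2)) by rewrite nm_gt0 nome_neq0.
have hb0 : 0 < nm (nome (b / 2)) by rewrite nm_gt0 nome_neq0.
have ha := one_sub_nome_lower ra; have hb := one_sub_nome_lower rb.
have da : 0 < nm (1 - nome a) by have := mulr_gt0 na ha0; lra.
have db : 0 < nm (1 - nome b) by have := mulr_gt0 nb hb0; lra.
have xa : 1 - nome a != 0 by rewrite -nm_gt0.
have xb : 1 - nome b != 0 by rewrite -nm_gt0.
have -> : kap a + kap b = 2 * (1 - nome (a + b)) / ((1 - nome a) * (1 - nome b)).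
  by rewrite /kap nomeD; field; rewrite ?xa ?xb.
have e2 : nm (nome ((a + b) / 2)) = nm (nome (a / 2)) * nm (nome (b / 2)).
  by rewrite mulrDl nomeD nmM.
have := ler_pM (mulr_ge0 (ltW na) (ltW ha0)) (mulr_ge0 (ltW nb) (ltW hb0)) ha hb.
rewrite e2; set ea := nm (nome (a / 2)); set eb := nm (nome (b / 2)).
rewrite !nmM nmV !nmM nm_nat.
have := nm_ge0 (1 - nome (a + b)); set X := nm (1 - nome (a + b)); move=> X0 h.
rewrite [leLHS](_ : _ = 2 * X * (nm a * ea * (nm b * eb)) /
  (nm (1 - nome a) * nm (1 - nome b))); last by ring.
rewrite ler_pdivrMr ?mulr_gt0 //.
apply: (@le_trans _ _ (2 * X * (8 * nm (1 - nome a) * (8 * nm (1 - nome b))))).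
  by rewrite ler_wpM2l // mulr_ge0.
rewrite le_eqVlt; apply/orP; left; apply/eqP; ring.
Qed.

(** Euler's expansion of pi cot(pi z), the terms being paired to make the sum absolutely
    convergent. *)
Lemma sum_inv_shifted z d : off_integers z d -> nome z != 1 ->
  series (fun k => (z + k%:R)^-1 + (z - k.+1%:R)^-1) @ \oo --> - (twopii R / 2 * kap z).
Proof.
move=> sz z1; have t0 := twopii_neq0 R.
have [d0 hd] := sz.
pose u j k := (kap ((z + k%:R) / 2 ^+ j.+1) + kap ((z - k.+1%:R) / 2 ^+ j.+1)) / 2 ^+ j.+1.
pose L k := - (2 / twopii R) * ((z + k%:R)^-1 + (z - k.+1%:R)^-1).
(* Such a [B] exists because the left side tends to the modulus of 2 pi i (2z - 1), while the nome
   on the right tends to 1. *)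
have [B hB] : exists B : R, 0 <= B /\ \forall j \near \oo,
   2 ^+ j.+1 * nm (1 - nome ((2 * z - 1) / 2 ^+ j.+1)) <= B * nm (nome ((2 * z - 1) / 2 / 2 ^+ j.+1)).
  have c1 := slim_nm_near (nome_scale_cvg ((2 * z - 1) / 2)).
  rewrite nm1 in c1.
  have zz : 2 * z - 1 != 0 \/ 2 * z - 1 = 0 by case: (eqVneq (2 * z - 1) 0); [right|left].
  case: zz => [zz|->]; last first.
    exists 0; split=> //; near=> j; rewrite mul0r nome0 subrr nm0 mulr0 mul0r //.
  have c2 := slim_nm_near (nome_diff_scale_cvg zz).
  set A := nm (- _) in c2; have A0 : 0 <= A := nm_ge0 _.
  exists (2 * (A + 1)); split; first by lra.
  have half0 : (0 : R) < 1 / 2 by lra.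
  have f1 := c1 _ half0; have f2 := c2 _ ltr01.
  near=> j.
  have h1 : `|1 - nm (nome ((2 * z - 1) / 2 / 2 ^+ j.+1))| < 1 / 2 by near: j; exact: f1.
  have h2 : `|A - nm (2 ^+ j.+1 * (1 - nome ((2 * z - 1) / 2 ^+ j.+1)))| < 1 by near: j; exact: f2.
  rewrite nmM nmX nm_nat in h2.
  move: h1 h2; rewrite !ltr_norml => /andP[h1 h1'] /andP[h2 h2'].
  nra.
case: hB => B0 hB.
pose v (k : nat) : R := 128 * B / d ^+ 2 * (k.+1%:R ^+ 2)^-1.
have := @tannery R u L v (128 * B / d ^+ 2 * 2) (fun j => 2 ^ j)%N.
case.
- by move=> k; rewrite /v !mulr_ge0 ?divr_ge0 ?invr_ge0 ?exprn_ge0 ?ler0n ?mulr_ge0 // ltW.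
- by move=> n; rewrite -mulr_sumr ler_wpM2l ?inv_sq_sum // divr_ge0 ?exprn_ge0 ?mulr_ge0 // ltW.
- move=> k; have [n1 n2] := off_integers_neq0 k sz.
  have := slimD (kap_scale_cvg n1) (kap_scale_cvg n2).
  have -> : - (2 / (twopii R * (z + k%:R))) + - (2 / (twopii R * (z - k.+1%:R))) = L k.
    by rewrite /L !invfM; ring.
  by apply: slim_eq => j; rewrite /u; ring.
- have hs := near_Re_small z; near=> j => k kj.
  have [r1 r2] : `|complex.Re ((z + k%:R) / 2 ^+ j.+1)| <= 3 / 4 /\
     `|complex.Re ((z - k.+1%:R) / 2 ^+ j.+1)| <= 3 / 4 by move: k kj; near: j.
  have [n1 n2] := off_integers_neq0 k sz.
  have p0 : (2 : C) ^+ j.+1 != 0 by rewrite expf_neq0 // pnatr_eq0.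
  have p0' : (0 : R) < 2 ^+ j.+1 by rewrite exprn_gt0.
  have hBj : 2 ^+ j.+1 * nm (1 - nome ((2 * z - 1) / 2 ^+ j.+1)) <=
     B * nm (nome ((2 * z - 1) / 2 / 2 ^+ j.+1)) by near: j.
  set a := (z + k%:R) / 2 ^+ j.+1 in r1; set b := (z - k.+1%:R) / 2 ^+ j.+1 in r2.
  have a0 : a != 0 by rewrite mulf_neq0 ?invr_neq0.
  have b0 : b != 0 by rewrite mulf_neq0 ?invr_neq0.
  have ab : a + b = (2 * z - 1) / 2 ^+ j.+1.
    by rewrite /a /b -mulrDl -natr1; congr (_ / _); ring.
  have ab2 : (a + b) / 2 = (2 * z - 1) / 2 / 2 ^+ j.+1 by rewrite ab mulrAC.
  have := kap_pair_bound a0 b0 r1 r2; rewrite ab2 ab => h.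
  set N := nm (nome _) in h hBj; have N0 : 0 < N by rewrite nm_gt0 nome_neq0.
  set X := nm (1 - _) in h hBj.
  have [h1 h2] := hd k; have dk : 0 < d * k.+1%:R by rewrite mulr_gt0 // ltr0n.
  have na : nm a = nm (z + k%:R) / 2 ^+ j.+1 by rewrite nmM nmV nmX nm_nat.
  have nb : nm b = nm (z - k.+1%:R) / 2 ^+ j.+1 by rewrite nmM nmV nmX nm_nat.
  rewrite na nb in h.
  have -> : v k = 128 * B / (d * k.+1%:R) ^+ 2.
    by rewrite /v exprMn (invfM (d ^+ 2)) !mulrA.
  rewrite ler_pdivlMr ?exprn_gt0 // /u nmM nmV nmX nm_nat -/a -/b.
  set Y := nm (kap a + _) in h *; have Y0 : 0 <= Y by exact: nm_ge0.
  rewrite -(ler_pM2r N0); set T := (2 : R) ^+ j.+1 in p0' h hBj *.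
  apply: (@le_trans _ _ (128 * (T * X))); last by rewrite -mulrA ler_wpM2l.
  have h' : Y * (nm (z + k%:R) * nm (z - k.+1%:R)) / T ^+ 2 * N <= 128 * X.
    apply: le_trans h; rewrite le_eqVlt; apply/orP; left; apply/eqP.
    by field; rewrite gt_eqF.
  have T0 : T != 0 by rewrite gt_eqF.
  have hT := ler_wpM2l (ltW p0') h'.
  have -> : 128 * (T * X) = T * (128 * X) by ring.
  apply: le_trans hT.
  have -> : T * (Y * (nm (z + k%:R) * nm (z - k.+1%:R)) / T ^+ 2 * N) =
    Y / T * (nm (z + k%:R) * nm (z - k.+1%:R)) * N by field.
  rewrite ler_wpM2r ?(ltW N0) // ler_wpM2l ?divr_ge0 ?(ltW p0') // expr2.
  by apply: ler_pM => //; exact: ltW.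
- move=> n; exists n => // j /= nj; apply: leq_trans nj _.
  by rewrite ltnW // ltn_expl.
move=> cL uL.
have e : csum L = kap z.
  apply: (slim_uniq uL); apply: slim_eq (@slim_cst R (kap z)) => j.
  rewrite /u -mulr_suml (dup_sum_sym j kap_dup kapD1 z1) mulrAC mulfV ?mul1r ?expf_neq0 ?pnatr_eq0 //.
have := slimM (@slim_cst R (- (twopii R / 2))) cL; rewrite e mulNr; apply: slim_eq => n.
rewrite /series /= mulr_sumr; apply: eq_bigr => k _; rewrite /L.
by move: (_ + _) => s; field.
Unshelve. all: by end_near. Qed.

End PartialFractions.

(** * Lattice sums in one variable, the Basel sum and the Lambert series *)

Section E2Transformation.
Variable R : realType.
Local Notation C := (cplx R).
Local Notation H := (@upper_half R).
Implicit Types (z w t tau : C).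

(* pairs (k, -k-1) regrouped as (m, -m) *)
Lemma regroup_cvg (F : C -> C) z l : series (fun k => F (z + k%:R) + F (z - k.+1%:R)) @ \oo --> l ->
  (fun n => F (z - n.+1%:R)) @ \oo --> (0 : C) ->
  series (fun m => F (z + m.+1%:R) + F (z - m.+1%:R)) @ \oo --> l - F z.
Proof.
move=> h h0; rewrite -cvg_shiftS in h.
have := slimB (slimB h (@slim_cst R (F z))) h0; rewrite subr0.
apply: slim_eq => n; rewrite /series /=.
elim: n => [|n IH]; first by rewrite big_nat1 big_geq // addr0; ring.
rewrite big_nat_recr //= [RHS]big_nat_recr //= -IH big_nat_recr //=; ring.
Qed.

Lemma inv_shift_cvg0 z (k : nat) : (0 < k)%N -> (fun n => ((z - n.+1%:R)^-1) ^+ k) @ \oo --> (0 : C).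
Proof.
move=> k0; apply/cvg_nmP => e e0.
exists (Num.bound (nm z + (e^-1 + 1))) => // n /= hn; rewrite sub0r nmN nmX nmV.
have b0 : 0 <= nm z + (e^-1 + 1) by rewrite !addr_ge0 ?nm_ge0 ?invr_ge0 // ltW.
have h : nm z + (e^-1 + 1) < n.+1%:R.
  by apply: lt_le_trans (archi_boundP b0) _; rewrite ler_nat; apply: leq_trans hn _.
have h2 : e^-1 + 1 < nm (z - n.+1%:R).
  by have := nm_triB (n.+1%:R : C) z; rewrite nm_nat nmBC; lra.
have ei : 0 < e^-1 by rewrite invr_gt0.
set N := nm _ in h2 *; have N1 : 1 < N by lra.
have N0 : 0 < N by lra.
apply: (@le_lt_trans _ _ N^-1).
  rewrite -[leRHS]expr1 ler_wiXn2l ?invr_ge0 ?(ltW N0) // invf_le1 //; exact: ltW.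
by rewrite invf_plt ?posrE //; lra.
Qed.

Lemma nome_neq1_im z : complex.Im z != 0 -> nome z != 1.
Proof.
move=> y0; apply/eqP => /nome_eq1[n e]; move: y0.
by rewrite e -(rmorph_int (real_complex R)) /= eqxx.
Qed.

Lemma sum_inv_sq_pm z : complex.Im z != 0 ->
  series (fun m => (z + m.+1%:R) ^- 2 + (z - m.+1%:R) ^- 2) @ \oo --> twopii R ^+ 2 * phi z - z ^- 2.
Proof.
move=> y0; have [d sz] := off_integers_upper y0.
apply: (@regroup_cvg (fun w => w ^- 2)); first exact: sum_inv_sq_shifted sz (nome_neq1_im y0).
by apply: slim_eq (@inv_shift_cvg0 z 2 isT) => n; rewrite exprVn.
Qed.

Lemma sum_inv_pm z : complex.Im z != 0 ->
  series (fun m => (z + m.+1%:R)^-1 + (z - m.+1%:R)^-1) @ \oo --> - (twopii R / 2 * kap z) - z^-1.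
Proof.
move=> y0; have [d sz] := off_integers_upper y0.
apply: (@regroup_cvg (fun w => w^-1)); first exact: sum_inv_shifted sz (nome_neq1_im y0).
by apply: slim_eq (@inv_shift_cvg0 z 1 isT) => n; rewrite expr1.
Qed.

(** Euler's expansion at 1/2 gives pi^2/8 for the sum over odd integers, which is 3/4 of the whole
    sum. *)
Lemma basel : series (fun n => (n.+1%:R : C) ^- 2) @ \oo --> ((pi ^+ 2 / 6)%:C : C).
Proof.
have s2 : abs_summable (fun n => (n.+1%:R : C) ^- 2) 2.
  move=> n; apply: le_trans (inv_sq_sum R n).
  by apply: ler_sum => k _; rewrite nmV nmX nm_nat.
have c2 := csum_cvg s2; set l := csum _ in c2.
have h20 : (2 : C) != 0 by rewrite pnatr_eq0.
have sz : off_integers (1 / 2 : C) (2^-1 : R).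
  have half : (1 / 2 : C) = (1 / 2 : R)%:C by rewrite rmorphM fmorphV rmorph_nat rmorph1.
  split; first by rewrite invr_gt0.
  move=> k; rewrite half !natC -rmorphD -rmorphB !nm_real -(natr1 k).
  have k0 : (0 : R) <= k%:R by [].
  by split; [rewrite ger0_norm; lra|rewrite ler0_norm; lra].
have nh : nome (1 / 2 : C) = -1.
  have := nome_half (0 : C); rewrite add0r => ->; by rewrite mul0r nome0.
have n1 : nome (1 / 2 : C) != 1.
  by rewrite nh -subr_eq0 -opprD oppr_eq0 (_ : 1 + 1 = 2) // pnatr_eq0.
have := sum_inv_sq_shifted sz n1; rewrite /phi nh twopii_sqr.
have -> : - 4 * (pi ^+ 2)%:C * (-1 / (1 - -1) ^+ 2) = (pi ^+ 2)%:C :> C by field.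
move=> hodd.
have odd : series (fun k => ((2 * k).+1%:R : C) ^- 2) @ \oo --> ((pi ^+ 2)%:C / 8 : C).
  have -> : (pi ^+ 2)%:C / 8 = 8^-1 * (pi ^+ 2)%:C :> C by rewrite mulrC.
  apply: (slim_eq _ (slimM (@slim_cst R 8^-1) hodd)) => n; rewrite /series /= mulr_sumr; apply: eq_bigr => k _.
  have -> : 1 / 2 + k%:R = (2 * k).+1%:R / 2 :> C by field.
  have -> : 1 / 2 - k.+1%:R = - ((2 * k).+1%:R / 2) :> C by field.
  have x0 : (2 * k).+1%:R != 0 :> C by rewrite pnatr_eq0.
  by rewrite sqrrN; field.
have split2 : (fun n => series (fun n => (n.+1%:R : C) ^- 2) (2 * n)%N) @ \oo --> l.
  by apply: slim_sub c2 => n; rewrite leq_pmull.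
have := slimD odd (slimM (@slim_cst R 4^-1) c2).
have e n : series (fun k => ((2 * k).+1%:R : C) ^- 2) n + 4^-1 * series (fun n => (n.+1%:R : C) ^- 2) n
  = series (fun n => (n.+1%:R : C) ^- 2) (2 * n)%N.
  elim: n => [|n IH]; first by rewrite muln0 /series /= !big_geq // mulr0 addr0.
  have -> : (2 * n.+1 = (2 * n).+2)%N by lia.
  rewrite /series /= in IH *; rewrite [RHS]big_nat_recr //= [in RHS]big_nat_recr //= -IH.
  rewrite [in LHS]big_nat_recr //= [X in _ + _ * X]big_nat_recr //=.
  have -> : (2 * n).+2%:R = 2 * n.+1%:R :> C by rewrite -natrM; congr (_%:R); lia.
  have x0 : n.+1%:R != 0 :> C by rewrite pnatr_eq0.
  have -> : (2 * n.+1%:R : C) ^- 2 = 4^-1 * n.+1%:R ^- 2 by field.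
  ring.
move=> h; have := slim_uniq (slim_eq e h) split2 => el.
have -> : ((pi ^+ 2 / 6)%:C : C) = l.
  have -> : ((pi ^+ 2 / 6)%:C : C) = (pi ^+ 2)%:C / 6 by rewrite rmorphM fmorphV rmorph_nat.
  have h34 : 3 / 4 * l = (pi ^+ 2)%:C / 8.
    transitivity (l - 4^-1 * l); first by field.
    by rewrite -{1}el addrK.
  have n34 : (3 / 4 : C) != 0 by rewrite mulf_neq0 ?invr_neq0 ?pnatr_eq0.
  by apply: (mulfI n34); rewrite h34; field.
exact: c2.
Qed.

Lemma ev_geom q : nm q < 1 -> ev (fun _ => 1) q = (1 - q)^-1 :> C.
Proof.
move=> hq; have q0 : 1 - q != 0.
  by rewrite subr_eq0; apply: contraTneq hq => <-; rewrite nm1 ltxx.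
have e := ev_shift (@tame1 R) hq.
apply: (mulfI q0); rewrite mulfV // mulrBl mul1r {1}e; ring.
Qed.

Lemma ev_id q : nm q < 1 -> ev (fun n => n%:R) q = q / (1 - q) ^+ 2 :> C.
Proof.
move=> hq; have q0 : 1 - q != 0.
  by rewrite subr_eq0; apply: contraTneq hq => <-; rewrite nm1 ltxx.
have tid : tame (fun n => n%:R : C).
  by apply: eq_tame (tame_muln (@tame1 R)) => n; rewrite mulr1.
have e := ev_shift tid hq.
have e2 : ev (fun n => n.+1%:R) q = ev (fun n => n%:R) q + (1 - q)^-1 :> C.
  rewrite -(ev_geom hq) -evD //; last exact: tame1.
  by apply: eq_ev => n; rewrite natr1.
rewrite e2 add0r in e.
have : (1 - q) * ev (fun n => n%:R) q = q / (1 - q) by rewrite mulrBl mul1r {1}e; ring.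
by move=> e3; apply: (mulfI q0); rewrite e3; field.
Qed.

Lemma sum_codiv n : (0 < n)%N -> \sum_(1 <= m < n.+1 | (m %| n)%N) (n %/ m)%:R = @sig R n.
Proof.
move=> n0; rewrite -(sum_divisorsE (fun m => (n %/ m)%:R : C)) //.
by rewrite (sum_codivisors (fun m => m%:R : C)) // sigE.
Qed.

(** The partial sum with [M] terms is the power series of the divisor sums [S M] restricted to
    codivisors at most [M]. They agree with [sig] up to index [M], and beyond it the difference is
    at most [sig], so the error is a tail of a convergent power series. *)
Lemma lambert_cvg q : nm q < 1 ->
  series (fun m => q ^+ m.+1 / (1 - q ^+ m.+1) ^+ 2) @ \oo --> ev (@sig R) q.
Proof.
move=> hq.
have tid : tame (fun n => n%:R : C).
  by apply: eq_tame (tame_muln (@tame1 R)) => n; rewrite mulr1.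
pose S M n : C := \sum_(0 <= m < M) dil m.+1 (fun n => n%:R) n.
have tS M : tame (S M).
  elim: M => [|M IH].
    by apply: eq_tame (@tame0 R) => n; rewrite /S big_geq.
  apply: eq_tame (tameD IH (tame_dil (ltn0Sn M) tid)) => n; by rewrite /S big_nat_recr.
have eS M : series (fun m => q ^+ m.+1 / (1 - q ^+ m.+1) ^+ 2) M = ev (S M) q.
  rewrite /series /=; elim: M => [|M IH].
    rewrite big_geq //; symmetry; apply: csumE; apply: slim_eq (@slim_cst R 0) => n.
    by rewrite /series /= big1 // => i _; rewrite /S big_geq // mul0r.
  rewrite big_nat_recr //= IH -ev_id; last by rewrite nmX exprn_ilt1 ?nm_ge0.
  rewrite -ev_dil // -evD //; last exact: tame_dil.
  by apply: eq_ev => n; rewrite /S [RHS]big_nat_recr.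
have Sn M n : (n <= M)%N -> S M n = @sig R n.
  move=> nM; case: n nM => [|n] nM.
    by rewrite /S big1 // => i _; rewrite /dil dvdn0 div0n.
  rewrite -sum_codiv // /S.
  have -> : \sum_(0 <= m < M) dil m.+1 (fun n => n%:R) n.+1 =
     \sum_(1 <= m < M.+1) (if (m %| n.+1)%N then (n.+1 %/ m)%:R else 0) :> C.
    by rewrite big_add1.
  rewrite (@big_cat_nat _ _ _ n.+2) //= -big_mkcond /= [X in _ + X]big1_seq ?addr0 // => i /andP[_].
  rewrite mem_index_iota => /andP[hi _]; case: ifP => // /(dvdn_leq (ltn0Sn n)); lia.
have SM M n : nm (@sig R n - S M n) <= nm (@sig R n).
  case: n => [|n]; first by rewrite Sn // subrr.
  have -> : @sig R n.+1 - S M n.+1 = \sum_(M <= m < (M + n.+1)%N) dil m.+1 (fun n => n%:R) n.+1.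
    rewrite -(@Sn (M + n.+1)%N); last by rewrite leq_addl.
    by rewrite /S (@big_cat_nat _ _ _ M 0 (M + n.+1)%N) ?leq_addr //= addrAC subrr add0r.
  have nn (m1 m2 : nat) : exists k : nat, \sum_(m1 <= m < m2) dil m.+1 (fun n => n%:R) n.+1 = k%:R :> C.
    elim/big_ind : _ => [|x y [k ->] [j ->]|i _]; first by exists 0%N.
      by exists (k + j)%N; rewrite natrD.
    by rewrite /dil; case: ifP => _; [exists (n.+1 %/ i.+1)%N|exists 0%N].
  rewrite -(@Sn (M + n.+1)%N n.+1) ?leq_addl //.
  rewrite [X in _ <= nm X](_ : _ = S M n.+1 + \sum_(M <= m < (M + n.+1)%N) dil m.+1 (fun n => n%:R) n.+1); last first.
    by rewrite /S (@big_cat_nat _ _ _ M 0 (M + n.+1)%N) ?leq_addr.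
  have [k ->] := nn M (M + n.+1)%N; rewrite /S; have [j ->] := nn 0%N M.
  by rewrite -natrD !nm_nat ler_nat leq_addl.
have [A [t [A0 /andP[t0 t1] hA]]] := tame_geo (@tame_sig R) (nm_ge0 q) hq.
apply: (@cvg_nm_le _ _ _ _ _ _ (fun M => A / (1 - t) * t ^+ M)); last first.
  rewrite -(mulr0 (A / (1 - t))); apply: cvgM; first exact: cvg_cst.
  by apply: cvg_expr; rewrite ger0_norm.
near=> M; rewrite eS.
have -> : ev (@sig R) q - ev (S M) q = csum (fun n => (@sig R n - S M n) * q ^+ n).
  symmetry; apply: csumE.
  apply: slim_eq (slimB (ev_cvg (@tame_sig R) hq) (ev_cvg (tS M) hq)) => n.
  by rewrite /series /= -sumrB; apply: eq_bigr => i _; rewrite mulrBl.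
have bd n : nm ((@sig R n - S M n) * q ^+ n) <= A * t ^+ n.
  by apply: le_trans (hA n q (lexx _)); rewrite !nmM ler_wpM2r ?nm_ge0.
have z : series (fun n => (@sig R n - S M n) * q ^+ n) M = 0.
  rewrite /series /= big_nat big1 // => i /andP[_ iM].
  by rewrite Sn ?subrr ?mul0r // ltnW.
rewrite -[csum _]subr0 -z; apply: csum_tail_le; last first.
  apply/cvg_ex; exists (ev (@sig R) q - ev (S M) q).
  apply: slim_eq (slimB (ev_cvg (@tame_sig R) hq) (ev_cvg (tS M) hq)) => n.
  by rewrite /series /= -sumrB; apply: eq_bigr => i _; rewrite mulrBl.
move=> n; apply: (@le_trans _ _ (\sum_(0 <= k < n) A * t ^+ M * t ^+ k)).
  by apply: ler_sum => k _; rewrite -mulrA -exprD; exact: bd.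
rewrite -mulr_sumr [leRHS]mulrAC ler_wpM2l ?mulr_ge0 ?exprn_ge0 //.
exact: geom_le.
Unshelve. all: by end_near. Qed.

End E2Transformation.

Lemma nome_cexp (R : realType) (t : cplx R) : nome t = cexp (twopii R * t).
Proof. by []. Qed.

Lemma natS_sumn (R : realType) n : (0 < n)%N -> sig R n = (sumn (divisors n))%:R.
Proof. by case: n => // n _; rewrite /sig sumnE. Qed.

Lemma ev_opp (R : realType) (a : nat -> cplx R) (q : cplx R) :
  ev a (- q) = ev (fun n => (-1) ^+ n * a n) q.
Proof.
rewrite /ev; congr csum; apply: funext => n.
by rewrite [in LHS]exprNn mulrCA mulrA.
Qed.

Opaque nome ev E2.

(** * The transformation law of E_2 *)

Section E2Law.
Variable R : realType.
Local Notation C := (cplx R).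
Local Notation H := (@upper_half R).
Implicit Types (z w t tau : C).

Lemma upper_neq0 tau : H tau -> tau != 0.
Proof. by rewrite /upper_half /= => h; apply: contraTneq h => ->; rewrite ltxx. Qed.

Lemma ImV z : complex.Im z^-1 = - (complex.Im z / nm z ^+ 2).
Proof. by rewrite sqr_nm; case: z => x y /=; rewrite ?mulNr. Qed.

Lemma Im_realM (x : R) z : complex.Im (x%:C * z) = x * complex.Im z.
Proof. by case: z => a b /=; rewrite mul0r addr0. Qed.
Lemma Im_natM (n : nat) z : complex.Im (n%:R * z) = n%:R * complex.Im z.
Proof. by rewrite natC Im_realM. Qed.

Lemma upper_natM (n : nat) tau : (0 < n)%N -> H tau -> H (n%:R * tau).
Proof. by move=> n0; rewrite /upper_half /= Im_natM => h; rewrite mulr_gt0 // ltr0n. Qed.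

Lemma upper_NV tau : H tau -> H (- tau^-1).
Proof.
move=> ht; have t0 := upper_neq0 ht; rewrite /upper_half /=.
have -> : complex.Im (- tau^-1) = - complex.Im tau^-1 by case: (tau^-1).
by rewrite ImV opprK divr_gt0 ?exprn_gt0 ?nm_gt0.
Qed.

Lemma phiN z : phi (- z) = phi z.
Proof.
rewrite /phi nomeN; have n0 := nome_neq0 z; set e := nome z in n0 *.
have [->|e1] := eqVneq e 1; first by rewrite invr1 subrr.
have h : 1 - e != 0 by rewrite subr_eq0 eq_sym.
by field; rewrite h n0 /= subr_eq0 e1.
Qed.

Section FixedTau.
Variable tau : C.
Hypothesis Ht : H tau.

Let t0 : tau != 0 := upper_neq0 Ht.
(** The double sum of [f] converges only conditionally. Its companion [g] is the integral in x of
    (m' t - x)^-2 + (m' t + x)^-2, with m' = m + 1 and t = [tau], over the unit interval centred at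
    c + 1, that is the midpoint approximation of [f]: the difference is absolutely summable in both
    variables, while [g] telescopes in c. *)
Let f (m c : nat) : C :=
  (m.+1%:R * tau + c.+1%:R) ^- 2 + (m.+1%:R * tau - c.+1%:R) ^- 2.
Let h (m : nat) (x : C) : C := (m.+1%:R * tau - x)^-1 - (m.+1%:R * tau + x)^-1.
Let g (m c : nat) : C := h m (c.+1%:R + 1 / 2) - h m (c%:R + 1 / 2).
(** Closed form, by the cotangent expansion, of the sum of [h m x] over m. Its nonzero limit for
    large x is the source of the anomaly. *)
Let Hs (x : C) : C := tau^-1 * (twopii R / 2 * kap (x / tau) + tau / x).

Let Imt : 0 < complex.Im tau := Ht.

Lemma f_sum_c m : series (f m) @ \oo -->
  twopii R ^+ 2 * phi (m.+1%:R * tau) - (m.+1%:R * tau) ^- 2.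
Proof. by apply: sum_inv_sq_pm; rewrite Im_natM mulf_neq0 ?pnatr_eq0 // gt_eqF. Qed.

Lemma Im_div_tau (x : R) : x != 0 -> complex.Im (x%:C / tau) != 0.
Proof.
move=> x0; rewrite Im_realM mulf_neq0 // ImV oppr_eq0 mulf_neq0 ?gt_eqF ?invr_gt0 //.
by rewrite exprn_gt0 ?nm_gt0.
Qed.

Lemma f_sum_m c : series (fun m => f m c) @ \oo -->
  tau ^- 2 * (twopii R ^+ 2 * phi (c.+1%:R / tau) - (c.+1%:R / tau) ^- 2).
Proof.
have y0 : complex.Im (c.+1%:R / tau) != 0 by rewrite natC Im_div_tau // pnatr_eq0.
apply: (slim_eq _ (slimM (@slim_cst R (tau ^- 2)) (sum_inv_sq_pm y0))) => n.
rewrite /series /= mulr_sumr; apply: eq_bigr => m _; rewrite mulrDr -!invfM -!exprMn /f.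
have -> : tau * (c.+1%:R / tau + m.+1%:R) = m.+1%:R * tau + c.+1%:R by field.
have -> : tau * (c.+1%:R / tau - m.+1%:R) = - (m.+1%:R * tau - c.+1%:R) by field.
by rewrite sqrrN.
Qed.

Lemma h_sum_m (x : R) : x != 0 -> series (fun m => h m x%:C) @ \oo --> Hs x%:C.
Proof.
move=> x0; have y0 := Im_div_tau x0.
have xC : x%:C != 0 :> C by rewrite -nm_gt0 nm_real normr_gt0.
have := slimM (@slim_cst R (- tau^-1)) (sum_inv_pm y0).
have -> : - tau^-1 * (- (twopii R / 2 * kap (x%:C / tau)) - (x%:C / tau)^-1) = Hs x%:C.
  by rewrite /Hs; field; rewrite xC t0.
apply: slim_eq => n; rewrite /series /= mulr_sumr; apply: eq_bigr => m _.
have e1 : m.+1%:R * tau - x%:C = - tau * (x%:C / tau - m.+1%:R) by field.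
have e2 : m.+1%:R * tau + x%:C = tau * (x%:C / tau + m.+1%:R) by field.
by rewrite /h e1 e2 !invfM invrN; ring.
Qed.

Let k0 := complex.Im tau / (complex.Im tau + nm tau).

Lemma k0_gt0 : 0 < k0.
Proof. by rewrite divr_gt0 // ltr_wpDr ?nm_ge0. Qed.

(** The first bound is the imaginary part. The second follows by eliminating m between it and the
    triangle inequality for x = (m t + x) - m t, which explains the value of [k0]. *)
Lemma lattice_lower (m : nat) (x : R) :
  m%:R * complex.Im tau <= nm (m%:R * tau + x%:C) /\ k0 * `|x| <= nm (m%:R * tau + x%:C).
Proof.
have a1 : m%:R * complex.Im tau <= nm (m%:R * tau + x%:C).
  apply: le_trans (Im_le_nm _); rewrite ImD Im_natM /= addr0.
  exact: ler_norm.
split=> //; set N := nm _ in a1 *.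
have a2 : `|x| <= N + m%:R * nm tau.
  rewrite -(nm_real x) -(nm_nat R m) -nmM.
  have -> : x%:C = (m%:R * tau + x%:C) - m%:R * tau :> C by ring.
  exact: nmB.
have T0 := nm_ge0 tau; have I0 := Imt.
rewrite /k0 mulrAC ler_pdivrMr; last by rewrite ltr_wpDr.
apply: le_trans (ler_wpM2l (ltW I0) a2) _.
rewrite mulrDr mulrDr mulrC lerD2l mulrA ler_wpM2r // mulrC //.
Qed.

(** The midpoint error at z is exactly -1 / (4 z^2 (z^2 - 1/4)). Of its four linear factors two are
    bounded below in terms of m and two in terms of c, which gives the product majorant required for
    exchanging the summations. *)
Lemma fg_bound m c : nm (f m c - g m c) <=
  (k0 * complex.Im tau)^-1 * (m.+1%:R ^+ 2)^-1 * ((k0 * complex.Im tau)^-1 * (c.+1%:R ^+ 2)^-1).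
Proof.
have kp := k0_gt0; have I0 := Imt.
pose M : R := m.+1%:R; pose c1 : R := c.+1%:R.
have M0 : 0 < M by rewrite ltr0n.
have c10 : 0 < c1 by rewrite ltr0n.
have c11 : 1 <= c1 by rewrite ler1n.
have key (s : R) z : `|s| = 1 -> z = m.+1%:R * tau + (s * c1)%:C ->
  nm (z ^- 2 - ((z - 1 / 2)^-1 - (z + 1 / 2)^-1)) <=
    (k0 * complex.Im tau) ^- 2 * (M ^+ 2)^-1 * (c1 ^+ 2)^-1 / 2.
  move=> s1 zE.
  have hc : (1 / 2 : C) = (1 / 2 : R)%:C by rewrite rmorphM fmorphV rmorph_nat rmorph1.
  have [z1 z2] := lattice_lower m.+1 (s * c1); rewrite -zE in z1 z2.
  have [za _] := lattice_lower m.+1 (s * c1 - 1 / 2).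
  have [_ zb] := lattice_lower m.+1 (s * c1 + 1 / 2).
  have ea : m.+1%:R * tau + (s * c1 - 1 / 2)%:C = z - 1 / 2 by rewrite rmorphB /= hc addrA -zE.
  have eb : m.+1%:R * tau + (s * c1 + 1 / 2)%:C = z + 1 / 2 by rewrite rmorphD /= hc addrA -zE.
  rewrite ea in za; rewrite eb in zb.
  rewrite normrM s1 mul1r (ger0_norm (ltW c10)) in z2.
  have zb' : k0 * (c1 / 2) <= nm (z + 1 / 2).
    apply: le_trans zb; rewrite ler_wpM2l ?(ltW kp) //.
    have h12 : `|1 / 2 : R| = 1 / 2 by rewrite ger0_norm //; lra.
    have := ler_normB (s * c1 + 1 / 2) (1 / 2); rewrite addrK h12 normrM s1 mul1r (ger0_norm (ltW c10)).
    lra.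
  have MI : 0 < M * complex.Im tau by rewrite mulr_gt0.
  have kc : 0 < k0 * c1 by rewrite mulr_gt0.
  have kc2 : 0 < k0 * (c1 / 2) by rewrite mulr_gt0 // divr_gt0.
  have n1 : z != 0 by rewrite -nm_gt0; exact: lt_le_trans kc z2.
  have n2 : z - 1 / 2 != 0 by rewrite -nm_gt0; exact: lt_le_trans MI za.
  have n3 : z + 1 / 2 != 0 by rewrite -nm_gt0; exact: lt_le_trans kc2 zb'.
  have -> : z ^- 2 - ((z - 1 / 2)^-1 - (z + 1 / 2)^-1) =
     - 4^-1 * (z * z * ((z - 1 / 2) * (z + 1 / 2)))^-1.
    rewrite -[LHS]mul1r -[RHS]mul1r.
    have n2' : z * 2 - 1 != 0.
      by rewrite (_ : z * 2 - 1 = 2 * (z - 1 / 2)); [rewrite mulf_neq0 // pnatr_eq0|field].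
    have n3' : z * 2 + 1 != 0.
      by rewrite (_ : z * 2 + 1 = 2 * (z + 1 / 2)); [rewrite mulf_neq0 // pnatr_eq0|field].
    by field; rewrite n1 n2' n3'.
  rewrite nmM nmN !nmV nm_nat !nmM.
  have A1 := ler_pM (ltW MI) (ltW kc) z1 z2.
  have A2 := ler_pM (ltW MI) (ltW kc2) za zb'.
  have A3 := ler_pM (mulr_ge0 (ltW MI) (ltW kc)) (mulr_ge0 (ltW MI) (ltW kc2)) A1 A2.
  set D := nm z * nm z * _ in A3 *.
  set D' := _ * _ in A3.
  have D'E : D' = (k0 * complex.Im tau) ^+ 2 * M ^+ 2 * c1 ^+ 2 / 2 by rewrite /D'; field.
  have D'0 : 0 < D' by exact: mulr_gt0 (mulr_gt0 MI kc) (mulr_gt0 MI kc2).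
  have D0 : 0 < D by exact: lt_le_trans D'0 A3.
  apply: (@le_trans _ _ (4^-1 * D'^-1)).
    by rewrite ler_wpM2l ?invr_ge0 // lef_pV2.
  rewrite D'E le_eqVlt; apply/orP; left; apply/eqP.
  have I1 : complex.Im tau != 0 by rewrite gt_eqF.
  have k1 : k0 != 0 by rewrite gt_eqF.
  have M1 : M != 0 by rewrite gt_eqF.
  have c1' : c1 != 0 by rewrite gt_eqF.
  by move: (M) (c1) M1 c1' => y1 y2 Y1 Y2; field; rewrite I1 k1 Y1 Y2.
have cC : (c1%:C : C) = c.+1%:R by rewrite natC.
have k1 := key 1 (m.+1%:R * tau + c.+1%:R) (normr1 _).
have k2 := key (-1) (m.+1%:R * tau - c.+1%:R) (normrN1 _).
rewrite mul1r mulN1r rmorphN /= cC in k1 k2.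
have {}k1 := k1 erefl; have {}k2 := k2 erefl.
rewrite /f /g /h.
have -> : (m.+1%:R * tau + c.+1%:R) ^- 2 + (m.+1%:R * tau - c.+1%:R) ^- 2 -
  ((m.+1%:R * tau - (c.+1%:R + 1 / 2))^-1 - (m.+1%:R * tau + (c.+1%:R + 1 / 2))^-1 -
   ((m.+1%:R * tau - (c%:R + 1 / 2))^-1 - (m.+1%:R * tau + (c%:R + 1 / 2))^-1)) =
  ((m.+1%:R * tau + c.+1%:R) ^- 2 - ((m.+1%:R * tau + c.+1%:R - 1 / 2)^-1 - (m.+1%:R * tau + c.+1%:R + 1 / 2)^-1)) +
  ((m.+1%:R * tau - c.+1%:R) ^- 2 - ((m.+1%:R * tau - c.+1%:R - 1 / 2)^-1 - (m.+1%:R * tau - c.+1%:R + 1 / 2)^-1)).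
  have -> : m.+1%:R * tau - (c.+1%:R + 1 / 2) = m.+1%:R * tau - c.+1%:R - 1 / 2 by ring.
  have -> : m.+1%:R * tau + (c.+1%:R + 1 / 2) = m.+1%:R * tau + c.+1%:R + 1 / 2 by ring.
  have -> : m.+1%:R * tau - (c%:R + 1 / 2) = m.+1%:R * tau - c.+1%:R + 1 / 2 by field.
  have -> : m.+1%:R * tau + (c%:R + 1 / 2) = m.+1%:R * tau + c.+1%:R - 1 / 2 by field.
  ring.
apply: le_trans (nmD _ _) _; apply: le_trans (lerD k1 k2) _.
rewrite le_eqVlt; apply/orP; left; apply/eqP; rewrite -/M -/c1 -exprVn; field.
by rewrite !gt_eqF.
Qed.

Lemma h_cvg0 m : (fun n => h m (n%:R + 1 / 2)) @ \oo --> (0 : C).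
Proof.
have h1 := @inv_shift_cvg0 R (m.+1%:R * tau - 1 / 2) 1 isT.
have h2 := @inv_shift_cvg0 R (- (m.+1%:R * tau) - 1 / 2) 1 isT.
rewrite -cvg_shiftS.
have h3 := slimD h1 h2; rewrite addr0 in h3.
apply: slim_eq h3 => n; rewrite /= /h !expr1.
have -> : m.+1%:R * tau - (n.+1%:R + 1 / 2) = m.+1%:R * tau - 1 / 2 - n.+1%:R by ring.
have -> : m.+1%:R * tau + (n.+1%:R + 1 / 2) = - (- (m.+1%:R * tau) - 1 / 2 - n.+1%:R) by ring.
by rewrite invrN opprK.
Qed.

Lemma halfC (n : nat) : n%:R + 1 / 2 = (n%:R + 1 / 2 : R)%:C :> C.
Proof. by rewrite rmorphD rmorphM fmorphV !rmorph_nat rmorph1. Qed.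

(** For x > 0 the point x / tau lies in the lower half-plane, so its nome tends to infinity and (1 +
    w)/(1 - w) tends to -1. *)
Lemma kap_cvg : (fun n => kap ((n%:R + 1 / 2) / tau)) @ \oo --> (-1 : C).
Proof.
pose v := complex.Im tau / nm tau ^+ 2.
have v0 : 0 < v by rewrite divr_gt0 ?exprn_gt0 ?nm_gt0.
have pv : 0 < pi * v by rewrite mulr_gt0 // pi_gt0.
apply/cvg_nmP => e e0.
exists (Num.bound ((pi * v * e)^-1)) => // n /= hn.
have b0 : 0 <= (pi * v * e)^-1 by rewrite invr_ge0 ltW // mulr_gt0.
have hn' : (pi * v * e)^-1 < n%:R by apply: lt_le_trans (archi_boundP b0) _; rewrite ler_nat.
set x : R := n%:R + 1 / 2; have x0 : 0 < x by rewrite /x; lra.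
rewrite halfC -/x; set w := nome (x%:C / tau).
have ew : nm w = expR (2 * (pi * v * x)).
  by rewrite /w nm_nome Im_realM ImV -/v; congr expR; ring.
have l : 2 * (pi * v * x) <= nm (1 - w).
  have := nm_triB w 1; rewrite nm1 nmBC ew; have := expR_ge1Dx (2 * (pi * v * x)); lra.
have pvx : 0 < pi * v * x by rewrite mulr_gt0.
have d0 : 0 < nm (1 - w) by lra.
have w1 : 1 - w != 0 by rewrite -nm_gt0.
rewrite /kap -/w (_ : -1 - (1 + w) / (1 - w) = - (2 / (1 - w))); last by field.
rewrite nmN nmM nmV nm_nat ltr_pdivrMr //.
have pve := mulr_gt0 pv e0.
have a0 : 1 < pi * v * e * n%:R by rewrite -(ltr_pM2l pve) mulfV ?gt_eqF // in hn'.
have : pi * v * e * n%:R <= pi * v * e * x by rewrite ler_wpM2l ?(ltW pve) // /x; lra.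
move=> a1; have : e * (2 * (pi * v * x)) <= e * nm (1 - w) by rewrite ler_pM2l.
have -> : e * (2 * (pi * v * x)) = 2 * (pi * v * e * x) by ring.
by move=> a3; lra.
Qed.

Lemma Hs_cvg : (fun n => Hs (n%:R + 1 / 2)) @ \oo --> - (twopii R / (2 * tau)).
Proof.
have i0 : (fun n => (n%:R + 1 / 2 : C)^-1) @ \oo --> (0 : C).
  rewrite -cvg_shiftS.
  have h1 := slimM (@slim_cst R (-1)) (@inv_shift_cvg0 R (- (1 / 2)) 1 isT); rewrite mulr0 in h1.
  apply: slim_eq h1 => n; rewrite /= expr1.
  have -> : - (1 / 2) - n.+1%:R = - (n.+1%:R + 1 / 2) :> C by ring.
  by rewrite invrN mulN1r opprK.
have h1 := slimM (@slim_cst R tau^-1) (slimD (slimM (@slim_cst R (twopii R / 2)) kap_cvg) (slimM (@slim_cst R tau) i0)).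
rewrite (_ : - (twopii R / (2 * tau)) = tau^-1 * (twopii R / 2 * -1 + tau * 0)); last by field.
by apply: slim_eq h1 => n.
Qed.

(** Summed over c first, [f] gives the Lambert series at tau; summed over m first, the one at
    -1/tau. The sums of [g] are -Hs(1/2) in the first order and lim Hs - Hs(1/2) in the second.
    Their difference, the limit -2 pi i / (2 tau), becomes the anomalous term. *)
Lemma P_inv : P (- tau^-1) = tau ^+ 2 * P tau + 12 * tau / twopii R.
Proof.
have p0 := twopii_neq0 R.
have kp := k0_gt0; have I0 := Imt.
have A0 : 0 <= (k0 * complex.Im tau)^-1 by rewrite invr_ge0 ltW // mulr_gt0.
have xn0 (n : nat) : (n%:R + 1 / 2 : R) != 0 by rewrite gt_eqF // ltr_wpDl.
have g_c m : series (g m) @ \oo --> - h m (1 / 2).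
  have h1 := slimB (h_cvg0 m) (@slim_cst R (h m (1 / 2))); rewrite sub0r in h1.
  apply: slim_eq h1 => n; rewrite /series /=; elim: n => [|n IH].
    by rewrite big_geq // add0r subrr.
  by rewrite big_nat_recr //= -IH /g; ring.
have g_m c : series (fun m => g m c) @ \oo --> Hs (c.+1%:R + 1 / 2) - Hs (c%:R + 1 / 2).
  have h1 := h_sum_m (xn0 c.+1); have h2 := h_sum_m (xn0 c); rewrite -!halfC in h1 h2.
  by apply: slim_eq (slimB h1 h2) => n; rewrite /series /= -sumrB.
have sw := @double_series_swap R (fun m c => f m c - g m c)
  (fun k => (k0 * complex.Im tau)^-1 * (k.+1%:R ^+ 2)^-1) ((k0 * complex.Im tau)^-1 * 2)
  (fun m => twopii R ^+ 2 * phi (m.+1%:R * tau) - (m.+1%:R * tau) ^- 2 - - h m (1 / 2))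
  (fun c => tau ^- 2 * (twopii R ^+ 2 * phi (c.+1%:R / tau) - (c.+1%:R / tau) ^- 2) -
     (Hs (c.+1%:R + 1 / 2) - Hs (c%:R + 1 / 2))).
have {}sw := fun a b c d => sw a b fg_bound c d.
have {}sw : (fun n => series (fun m => twopii R ^+ 2 * phi (m.+1%:R * tau) - (m.+1%:R * tau) ^- 2 - - h m (1 / 2)) n
   - series (fun c => tau ^- 2 * (twopii R ^+ 2 * phi (c.+1%:R / tau) - (c.+1%:R / tau) ^- 2) -
     (Hs (c.+1%:R + 1 / 2) - Hs (c%:R + 1 / 2))) n) @ \oo --> (0 : C).
  apply: sw.
  - by move=> k; rewrite mulr_ge0 // invr_ge0 exprn_ge0.
  - by move=> n; rewrite -mulr_sumr ler_wpM2l // inv_sq_sum.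
  - move=> m; have h1 := slimB (@f_sum_c m) (g_c m).
    have h2 : (fun n => series (f m) n - series (g m) n) =1 series (fun c => f m c - g m c).
      by move=> n; rewrite /series /= -sumrB.
    exact: (slim_eq h2 h1).
  - move=> c; have h1 := slimB (@f_sum_m c) (g_m c).
    have h2 : (fun n => series (fun m => f m c) n - series (fun m => g m c) n) =1 series (fun m => f m c - g m c).
      by move=> n; rewrite /series /= -sumrB.
    exact: (slim_eq h2 h1).
have hq := nm_nome_lt1 Ht.
have Ht' := upper_NV Ht; have hq' := nm_nome_lt1 Ht'.
have XR := slimB (slimM (@slim_cst R (twopii R ^+ 2)) (lambert_cvg hq))
   (slimM (@slim_cst R (tau ^- 2)) (@basel R)).
have XL := slimB (slimM (@slim_cst R (tau ^- 2 * twopii R ^+ 2)) (lambert_cvg hq')) (@basel R).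
have hh := h_sum_m (xn0 0%N); rewrite -halfC add0r in hh.
have Hc := Hs_cvg.
clear g_c g_m; clearbody g; clearbody Hs; clearbody h.
have key := slimB (slimB (slimD XR hh) sw) (slimB XL (slimB Hc (@slim_cst R (Hs (1 / 2))))).
have E : twopii R ^+ 2 * ev (@sig R) (nome tau) - tau ^- 2 * (pi ^+ 2 / 6)%:C + Hs (1 / 2) - 0 -
   (tau ^- 2 * twopii R ^+ 2 * ev (@sig R) (nome (- tau^-1)) - (pi ^+ 2 / 6)%:C
     - (- (twopii R / (2 * tau)) - Hs (1 / 2))) = 0.
  apply: (slim_uniq key); apply: slim_eq (@slim_cst R 0) => n.
  rewrite /series /=.
  have tel : \sum_(0 <= c < n) (Hs (c.+1%:R + 1 / 2) - Hs (c%:R + 1 / 2)) = Hs (n%:R + 1 / 2) - Hs (1 / 2).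
    elim: n => [|n IH]; first by rewrite big_geq // add0r subrr.
    by rewrite big_nat_recr //= IH; ring.
  have e1 : \sum_(0 <= m < n) twopii R ^+ 2 * phi (m.+1%:R * tau) =
     twopii R ^+ 2 * \sum_(0 <= m < n) nome tau ^+ m.+1 / (1 - nome tau ^+ m.+1) ^+ 2.
    by rewrite mulr_sumr; apply: eq_bigr => m _; rewrite /phi nome_nat.
  have e2 : \sum_(0 <= m < n) (m.+1%:R * tau) ^- 2 = tau ^- 2 * \sum_(0 <= m < n) (m.+1%:R) ^- 2.
    by rewrite mulr_sumr; apply: eq_bigr => m _; rewrite exprMn invfM mulrC.
  have e3 : \sum_(0 <= c < n) tau ^- 2 * (twopii R ^+ 2 * phi (c.+1%:R / tau) - (c.+1%:R / tau) ^- 2) =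
    tau ^- 2 * twopii R ^+ 2 * (\sum_(0 <= m < n) nome (- tau^-1) ^+ m.+1 / (1 - nome (- tau^-1) ^+ m.+1) ^+ 2)
    - \sum_(0 <= m < n) (m.+1%:R) ^- 2.
    rewrite mulr_sumr -sumrB; apply: eq_bigr => m _.
    rewrite -[phi (_ / _)]phiN -mulrN {1}/phi nome_nat mulrBr mulrA; congr (_ - _).
      by rewrite !mulrA.
    have x0 : m.+1%:R != 0 :> C by rewrite pnatr_eq0.
    by move: (m.+1%:R : C) x0 => y y0; field; rewrite y0 t0.
  have eX : \sum_(0 <= m < n) (twopii R ^+ 2 * phi (m.+1%:R * tau) - (m.+1%:R * tau) ^- 2 - - h m (1 / 2)) =
    twopii R ^+ 2 * \sum_(0 <= m < n) nome tau ^+ m.+1 / (1 - nome tau ^+ m.+1) ^+ 2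
     - tau ^- 2 * \sum_(0 <= m < n) (m.+1%:R) ^- 2 + \sum_(0 <= m < n) h m (1 / 2).
    rewrite -e1 -e2 -sumrB -big_split /=; apply: eq_bigr => m _; by rewrite opprK.
  have eL : \sum_(0 <= c < n) (tau ^- 2 * (twopii R ^+ 2 * phi (c.+1%:R / tau) - (c.+1%:R / tau) ^- 2)
       - (Hs (c.+1%:R + 1 / 2) - Hs (c%:R + 1 / 2))) =
     tau ^- 2 * twopii R ^+ 2 * (\sum_(0 <= m < n) nome (- tau^-1) ^+ m.+1 / (1 - nome (- tau^-1) ^+ m.+1) ^+ 2)
    - \sum_(0 <= m < n) (m.+1%:R) ^- 2 - (Hs (n%:R + 1 / 2) - Hs (1 / 2)).
    by rewrite -e3 -tel -sumrB.
  have alg (T2 it S1 S2 x1 S1' H1 H2 : C) : 0 = T2 * S1 - it * S2 + x1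
    - (T2 * S1 - it * S2 + x1 - (it * T2 * S1' - S2 - (H1 - H2)))
    - (it * T2 * S1' - S2 - (H1 - H2)) by ring.
  rewrite eX eL {e1 e2 e3 tel eX eL}; exact: alg.
have sigP t : H t -> ev (@sig R) (nome t) = (1 - P t) / 24.
  move=> ht; have hqt := nm_nome_lt1 ht.
  rewrite /P E2E // [ev (@e2c R) _]ev_shift //; last exact: tame_e2c.
  rewrite [ev (@sig R) _]ev_shift //; last exact: tame_sig.
  have -> : ev (fun n => @e2c R n.+1) (nome t) = - 24 * ev (fun n => @sig R n.+1) (nome t).
    by rewrite -evZ //; exact: tame_shift (@tame_sig R).
  by rewrite /=; field.
rewrite !sigP // in E.
have z6 : ((pi ^+ 2 / 6)%:C : C) = - (twopii R ^+ 2 / 24).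
  by rewrite twopii_sqr rmorphM fmorphV rmorph_nat /=; field.
rewrite z6 in E.
(* The coefficient of [P (- tau^-1)] in the relation [E]. *)
have n24 : twopii R ^+ 2 / (24 * tau ^+ 2) != 0.
  by rewrite mulf_neq0 ?invr_neq0 ?mulf_neq0 ?expf_neq0 ?pnatr_eq0.
apply/eqP; rewrite -subr_eq0; apply/eqP; apply: (mulfI n24); rewrite mulr0 -{}E.
by generalize (P (- tau^-1)) (P tau) (Hs (1 / 2)) => p1 p2 x; field; rewrite t0 p0.
Qed.

End FixedTau.
End E2Law.

(** * Gamma_0(N): generators, cosets and cusps *)

Section Matrices.

Definition mx2 (a b c d : int) : 'M[int]_2 :=
  \matrix_(i, j) (if i == 0 then (if j == 0 then a else b) else (if j == 0 then c else d)).

Lemma mx2_00 a b c d : mx2 a b c d 0 0 = a. Proof. by rewrite mxE. Qed.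
Lemma mx2_01 a b c d : mx2 a b c d 0 1 = b. Proof. by rewrite mxE. Qed.
Lemma mx2_10 a b c d : mx2 a b c d 1 0 = c. Proof. by rewrite mxE. Qed.
Lemma mx2_11 a b c d : mx2 a b c d 1 1 = d. Proof. by rewrite mxE. Qed.
Definition mx2E := (mx2_00, mx2_01, mx2_10, mx2_11).

Lemma ord2P (P : 'I_2 -> Prop) : P 0 -> P 1 -> forall i, P i.
Proof.
move=> h0 h1 [[|[|//]] hi].
  by have -> : Ordinal hi = 0 by apply/val_inj.
by have -> : Ordinal hi = 1 by apply/val_inj.
Qed.

Lemma mx2_eta (g : 'M[int]_2) : g = mx2 (g 0 0) (g 0 1) (g 1 0) (g 1 1).
Proof. by apply/matrixP; apply: ord2P; apply: ord2P; rewrite !mxE. Qed.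

Lemma mul2E (g h : 'M[int]_2) i j : (g *m h) i j = g i 0 * h 0 j + g i 1 * h 1 j.
Proof.
rewrite mxE !big_ord_recl big_ord0 addr0.
by have -> : lift ord0 ord0 = 1 :> 'I_2 by apply/val_inj.
Qed.

Lemma det2E (g : 'M[int]_2) : \det g = g 0 0 * g 1 1 - g 0 1 * g 1 0.
Proof.
rewrite (expand_det_row _ 0) !big_ord_recl big_ord0 addr0 /cofactor !det_mx11 !mxE /=.
have -> : lift ord0 ord0 = 1 :> 'I_2 by apply/val_inj.
have -> : lift 1 0 = 0 :> 'I_2 by apply/val_inj.
by rewrite expr0 mul1r expr1 mulN1r mulrN.
Qed.

Lemma mx2M a b c d a' b' c' d' : mx2 a b c d *m mx2 a' b' c' d' =
  mx2 (a * a' + b * c') (a * b' + b * d') (c * a' + d * c') (c * b' + d * d').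
Proof. by apply/matrixP; apply: ord2P; apply: ord2P; rewrite mul2E !mx2E. Qed.

Lemma mx2_1 : 1%:M = mx2 1 0 0 1.
Proof. by apply/matrixP; apply: ord2P; apply: ord2P; rewrite !mxE. Qed.

Lemma SL2ZE g : SL2Z g <-> g 0 0 * g 1 1 - g 0 1 * g 1 0 = 1.
Proof. by rewrite /SL2Z /= det2E. Qed.

Lemma SL2Z_mul g h : SL2Z g -> SL2Z h -> SL2Z (g *m h).
Proof. by rewrite /SL2Z /= det_mulmx => -> ->; rewrite mulr1. Qed.

Definition inv2 (g : 'M[int]_2) := mx2 (g 1 1) (- g 0 1) (- g 1 0) (g 0 0).

Lemma inv2K g : SL2Z g -> g *m inv2 g = 1%:M.
Proof.
move=> /SL2ZE h; rewrite {1}[g]mx2_eta /inv2 mx2M mx2_1.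
by congr mx2; lia.
Qed.

Lemma inv2Kl g : SL2Z g -> inv2 g *m g = 1%:M.
Proof.
move=> /SL2ZE h; rewrite {2}[g]mx2_eta /inv2 mx2M mx2_1.
by congr mx2; lia.
Qed.

Lemma SL2Z_inv g : SL2Z g -> SL2Z (inv2 g).
Proof. by move=> /SL2ZE h; apply/SL2ZE; rewrite /inv2 !mx2E; lia. Qed.

Lemma invmx2E g : SL2Z g -> invmx g = inv2 g.
Proof.
move=> h; have u : g \in unitmx by rewrite unitmxE h unitr1.
by rewrite -[invmx g]mulmx1 -(inv2K h) mulKmx.
Qed.

Lemma Gamma0_SL N g : Gamma0 N g -> SL2Z g. Proof. by case. Qed.

Lemma Gamma0_mul N g h : Gamma0 N g -> Gamma0 N h -> Gamma0 N (g *m h).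
Proof.
move=> [g1 g2] [h1 h2]; split; first exact: SL2Z_mul.
by rewrite mul2E rpredD // ?(dvdz_mulr _ g2) ?(dvdz_mull _ h2).
Qed.

Lemma Gamma0_inv N g : Gamma0 N g -> Gamma0 N (inv2 g).
Proof. by move=> [g1 g2]; split; [exact: SL2Z_inv|rewrite mx2E rpredN]. Qed.

Lemma Gamma0_1 N : Gamma0 N 1%:M.
Proof. by rewrite mx2_1; split; [apply/SL2ZE; rewrite !mx2E|rewrite mx2E dvdz0]. Qed.

Definition Tm (n : int) := mx2 1 n 0 1.
Definition Um (n : int) := mx2 1 0 n 1.

Lemma Gamma0_T N n : Gamma0 N (Tm n).
Proof. by split; [apply/SL2ZE; rewrite !mx2E; lia|rewrite mx2E dvdz0]. Qed.

Lemma Gamma0_U N n : Gamma0 N (Um (N%:Z * n)).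
Proof. by split; [apply/SL2ZE; rewrite !mx2E; lia|rewrite mx2E dvdz_mulr]. Qed.

Lemma translationE h : translation h = Tm h%:Z.
Proof. by apply/matrixP; apply: ord2P; apply: ord2P; rewrite !mxE. Qed.

Lemma int_unitP (a b : int) : a * b = 1 -> a = 1 \/ a = -1.
Proof. by move=> h; have /pred2P : a \in intUnitRing.unitz by apply: (@intUnitRing.unitzPl _ b); rewrite mulrC. Qed.

Lemma nearest (c d : int) : c != 0 -> exists n : int, 2 * `|d + n * c|%R <= `|c|%R.
Proof.
move=> c0; pose m := (d %% c)%Z; pose k := (d %/ c)%Z.
have e : d = k * c + m by exact: divz_eq.
have m0 : 0 <= m by exact: modz_ge0.
have m1 : m < `|c| by exact: ltz_mod.
have [h|h] := leP (2 * m) `|c|.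
  exists (- k); rewrite e; lia.
have [cp|cn] := leP 0 c.
  exists (- k - 1); rewrite e; lia.
exists (- k + 1); rewrite e; lia.
Qed.

(* Euclidean reduction of the bottom row *)
Lemma Gamma0_ind N (K : 'M[int]_2 -> Prop) : (1 < N < 5)%N ->
  K 1%:M -> K (mx2 (-1) 0 0 (-1)) -> (forall g h, K g -> K h -> K (g *m h)) ->
  (forall n, K (Tm n)) -> (forall n, K (Um (N%:Z * n))) ->
  forall g, Gamma0 N g -> K g.
Proof.
move=> hN K1 KN1 KM KT KU.
suff H m : forall g, Gamma0 N g -> (`|g 1%R 0%R| <= m)%N -> K g.
  by move=> g hg; exact: (H `|g 1%R 0%R|%N g hg (leqnn _)).
have back g h : SL2Z h -> K (g *m inv2 h) -> K h -> K g.
  by move=> hh h1 h2; rewrite -[g]mulmx1 -(inv2Kl hh) mulmxA; exact: KM.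
have base g : Gamma0 N g -> g 1%R 0%R = 0 -> K g.
  move=> [/SL2ZE hd _] c0; rewrite c0 mulr0 subr0 in hd.
  have : (g 0 0 = 1 /\ g 1 1 = 1) \/ (g 0 0 = -1 /\ g 1 1 = -1).
    by case: (int_unitP hd) => z; rewrite z in hd *; [left|right]; lia.
  case=> [[a1 d1]|[a1 d1]].
    by rewrite [g]mx2_eta c0 a1 d1; exact: KT.
  have -> : g = mx2 (-1) 0 0 (-1) *m Tm (- g 0 1).
    by rewrite [LHS]mx2_eta c0 a1 d1 mx2M; congr mx2; lia.
  exact: KM.
elim: m => [|m IH] g hg hm.
  by apply: base => //; apply/eqP; rewrite -absz_eq0 -leqn0.
have [c0|c0] := eqVneq (g 1%R 0%R) 0; first exact: base.
have [n hn] := nearest (g 1%R 1%R) c0.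
have hg1 := Gamma0_mul hg (Gamma0_T N n).
set g1 := g *m Tm n in hg1.
have c1 : g1 1%R 0%R = g 1%R 0%R by rewrite /g1 mul2E !mx2E; lia.
have d1 : g1 1%R 1%R = g 1%R 1%R + n * g 1%R 0%R by rewrite /g1 mul2E !mx2E; lia.
have SLT : SL2Z (inv2 (Tm n)) by exact: SL2Z_inv (Gamma0_SL (Gamma0_T N n)).
have Kinv x : SL2Z x -> inv2 (inv2 x) = x.
  by move=> _; rewrite [RHS]mx2_eta /inv2 !mx2E !opprK.
suff K1' : K g1.
  apply: (back g (inv2 (Tm n))) => //.
    by rewrite Kinv // ; exact: (Gamma0_SL (Gamma0_T N n)).
  by rewrite /inv2 !mx2E oppr0; exact: (KT (- n)).
case: (hg1) => /SL2ZE hdet1 /dvdzP[c' hc'].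
have d1n0 : g1 1%R 1%R != 0.
  apply/eqP => z; rewrite z mulr0 sub0r hc' in hdet1.
  have : N%:Z * (- (g1 0 1 * c')) = 1 by rewrite -hdet1; ring.
  by move=> /int_unitP; lia.
have Nd0 : N%:Z * g1 1%R 1%R != 0 by rewrite mulf_neq0 //; lia.
(* The first reduction gives |d| <= |c|/2 and this one |c'| <= N |d|/2, so |c'| <= N |c|/4. The
   decrease is strict for N < 4, and for N = 4 unless 2 |d| = |c|; in that case the determinant
   forces d = 1 or -1 and c = 2 or -2, so N divides 2. *)
have [k hk] := nearest (g1 1%R 0%R) Nd0.
have hg2 := Gamma0_mul hg1 (Gamma0_U N k).
set g2 := g1 *m Um _ in hg2.
have c2 : g2 1%R 0%R = g1 1%R 0%R + k * (N%:Z * g1 1%R 1%R) by rewrite /g2 mul2E !mx2E; ring.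
have lt2 : (`|g2 1%R 0%R| < `|g 1%R 0%R|)%N.
  rewrite c2; rewrite -d1 in hn; rewrite normrM in hk.
  case/andP: hN => N1 N5; rewrite c1 in hk hdet1 hc' *.
  move: (g1 1%R 1%R) (g 1%R 0%R) (g1 0 0) (g1 0 1) hn hk hdet1 hc' c0 d1n0.
  move=> D c A B hn hk hdet hc' c0 /eqP d0.
  set x := c + _ in hk *.
  have [e|/eqP ne] := eqVneq (2 * `|D|) `|c|.
    have {}e : c = 2 * D \/ c = - (2 * D) by lia.
    have u : D * (A - 2 * B) = 1 \/ D * (A + 2 * B) = 1 by case: e => e; [left|right]; rewrite e in hdet; nia.
    have {}u : D = 1 \/ D = -1.
      by case: u; exact: int_unitP.
    have N2 : N = 2%N.
      have c2' : c = 2 \/ c = -2 by lia.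
      have : N = 2%N \/ N = 3%N \/ N = 4%N by lia.
      by case=> [//|[|] z]; rewrite z in hc'; lia.
    by rewrite N2 in hk; lia.
  have : 2 * `|x| <= 4 * `|D| by nia.
  lia.
have KI : K g2 by apply: IH => //; rewrite -ltnS; exact: leq_trans lt2 hm.
apply: (back g1 (inv2 (Um (N%:Z * k)))).
- exact: SL2Z_inv (Gamma0_SL (Gamma0_U N k)).
- by rewrite Kinv //; exact: (Gamma0_SL (Gamma0_U N k)).
by rewrite /inv2 !mx2E oppr0 -mulrN; exact: KU.
Qed.

(** The product of the inversion and a translation, sending i oo to the cusp 0; [Vm] below sends it
    to 1/2. *)
Definition STm (j : int) := mx2 0 (-1) 1 j.
Definition Vm := mx2 1 0 2 1.

Lemma SL_ST j : SL2Z (STm j). Proof. by apply/SL2ZE; rewrite !mx2E; lia. Qed.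
Lemma SL_V : SL2Z Vm. Proof. by apply/SL2ZE; rewrite !mx2E. Qed.

(** The coset of [g] depends on its bottom row (c, d) modulo N. If N divides c it is trivial, if c
    is invertible modulo N the representative is [STm j] with j = d/c, and only c = 2 modulo 4
    remains. The three cases are the cusps i oo, 0 and 1/2. *)
Lemma coset_rep N g : (1 < N < 5)%N -> SL2Z g ->
  [\/ Gamma0 N g, exists j : int, exists2 h, Gamma0 N h & g = h *m STm j |
      N = 4%N /\ exists2 h, Gamma0 N h & g = h *m Vm].
Proof.
move=> hN hg; have /SL2ZE hd := hg.
have mk x : SL2Z x -> (N%:Z %| (g *m inv2 x) 1%R 0%R)%Z -> exists2 h, Gamma0 N h & g = h *m x.
  move=> hx hdv; exists (g *m inv2 x); last by rewrite -mulmxA inv2Kl // mulmx1.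
  by split=> //; apply: SL2Z_mul => //; exact: SL2Z_inv.
have st j : (N%:Z %| g 1%R 0%R * j - g 1%R 1%R)%Z -> exists2 h, Gamma0 N h & g = h *m STm j.
  by move=> h; apply: mk; [exact: SL_ST|rewrite mul2E !mx2E /=; have -> : g 1%R 0%R * j + g 1%R 1%R * - 1 = g 1%R 0%R * j - g 1%R 1%R by ring].
set a := g 0 0 in hd; set b := g 0 1 in hd; set c := g 1 0 in hd st *; set d := g 1 1 in hd st *.
have [/dvdzP[q hq]|nd] := boolP (N%:Z %| c)%Z; first by constructor 1; split=> //; apply/dvdzP; exists q.
case/andP: hN => N1 N5.
have [nq|nq] := boolP ((N == 4%N) && ((c %% 4)%Z == 2)).
  case/andP: nq => /eqP N4 /eqP c2; constructor 3; split=> //; apply: mk; first exact: SL_V.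
  rewrite mul2E !mx2E mulr1 N4 -/c -/d.
  have hc := divz_eq c 4; rewrite c2 in hc.
  have [e he] : exists e, d = 2 * e + 1.
    have := divz_eq d 2; have := @modz_ge0 d 2 isT; have := @ltz_pmod d 2 isT.
    move=> x1 x2 x3; have [z|z] : (d %% 2)%Z = 0 \/ (d %% 2)%Z = 1 by lia.
      by exfalso; move: hd; rewrite hc x3 z; nia.
    by exists (d %/ 2)%Z; lia.
  apply/dvdzP; exists ((c %/ 4)%Z - e); rewrite {1}hc he; lia.
constructor 2.
have := divz_eq c N%:Z; set q := (c %/ _)%Z; set m := (c %% _)%Z => hc.
have m0 : 0 <= m by apply: modz_ge0; lia.
have m1 : m < N%:Z by apply: ltz_pmod; lia.
have mn0 : m != 0 by apply: contra nd => /eqP z; apply/dvdzP; exists q; lia.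
have wit j u : m * j - d = u * N%:Z -> (N%:Z %| c * j - d)%Z.
  by move=> e; apply/dvdzP; exists (u + q * j); rewrite hc; lia.
have dE := divz_eq d N%:Z.
have cases : [\/ m = 1, (N = 3%N /\ m = 2) | (N = 4%N /\ m = 3)].
  have : (N = 2%N \/ N = 3%N \/ N = 4%N) by lia.
  case=> [e|[e|e]]; rewrite e in m1.
  - by constructor 1; lia.
  - by have [z|z] : m = 1 \/ m = 2; [lia|constructor 1|constructor 2; split].
  have : m = 1 \/ m = 2 \/ m = 3 by lia.
  case=> [z|[z|z]]; [by constructor 1| |by constructor 3; split].
  by move: nq; rewrite e /= -[(c %% 4)%Z]/(c %% 4%N%:Z)%Z -e -/m z.
(* In each case m is its own inverse modulo N, so j = m d is the quotient d/c. *)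
case: cases => [z|[e z]|[e z]].
- by exists d; apply: st; apply: (wit d 0); rewrite z; lia.
- by exists (2 * d); apply: st; apply: (wit (2 * d) d); rewrite z e; lia.
- by exists (3 * d); apply: st; apply: (wit (3 * d) (2 * d)); rewrite z e; lia.
Qed.

End Matrices.

(** * The action on the upper half-plane *)

Section Action.
Variable R : realType.
Local Notation C := (cplx R).
Implicit Types (g h : 'M[int]_2) (t : C).

Lemma intC_real (n : int) : exists r : R, (n%:~R : C) = r%:C /\ r = n%:~R.
Proof. by exists n%:~R; split => //; rewrite rmorph_int. Qed.

Lemma ReIm_jf g t : complex.Re (jfactor g t) = (g 1 0)%:~R * complex.Re t + (g 1 1)%:~R /\
  complex.Im (jfactor g t) = (g 1 0)%:~R * complex.Im t.
Proof.
rewrite /jfactor.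
have [c [-> ->]] := intC_real (g 1 0); have [d [-> ->]] := intC_real (g 1 1).
by case: t => x y /=; split; ring.
Qed.

Lemma det_neq0 g : SL2Z g -> g 1 0 = 0 -> g 1 1 != 0.
Proof. by move=> /SL2ZE h c0; apply/eqP => d0; rewrite c0 d0 in h; lia. Qed.

Lemma jfactor_neq0 g t : SL2Z g -> upper_half t -> jfactor g t != 0.
Proof.
move=> hg ht; apply/eqP => h; have [e1 e2] := ReIm_jf g t.
move: e1 e2; rewrite h /= => e1 /esym/eqP; rewrite mulf_eq0 [X in _ || X]gt_eqF // orbF intr_eq0 => /eqP c0.
move: e1; rewrite c0 mul0r add0r => /esym/eqP; rewrite intr_eq0; apply/negP.
exact: det_neq0.
Qed.

Lemma mobius_upper g t : SL2Z g -> upper_half t -> upper_half (mobius g t).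
Proof.
move=> hg ht; have j0 := jfactor_neq0 hg ht.
have e : mobius g t * jfactor g t = (g 0 0)%:~R * t + (g 0 1)%:~R by rewrite /mobius divfK.
have [e1 e2] := ReIm_jf g t.
move/SL2ZE: hg => hd; have {}hd : ((g 0 0)%:~R * (g 1 1)%:~R - (g 0 1)%:~R * (g 1 0)%:~R : R) = 1.
  by rewrite -!intrM -intrB hd.
rewrite /upper_half /= in ht *.
move: e1 e2 j0 e; case: (jfactor g t) => u v; case: (mobius g t) => p q /= e1 e2 j0 e.
move: e hd e1 e2.
have [a [-> ->]] := intC_real (g 0 0); have [b [-> ->]] := intC_real (g 0 1).
move: (((g 1 0)%:~R : R)) (((g 1 1)%:~R : R)) => c d.
case: t ht => x y /= ht [f1 f2] hd e1 e2.
have key : q * (u ^+ 2 + v ^+ 2) = y.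
  have -> : q * (u ^+ 2 + v ^+ 2) = u * (p * v + q * u) - v * (p * u - q * v) by ring.
  rewrite f1 f2 e1 e2; transitivity (y * ((g 0 0)%:~R * d - (g 0 1)%:~R * c)); last by rewrite hd mulr1.
  by ring.
have m0 : 0 <= u ^+ 2 + v ^+ 2 by rewrite addr_ge0 // sqr_ge0.
rewrite ltNge; apply/negP => q0.
have : q * (u ^+ 2 + v ^+ 2) <= 0 by rewrite mulr_le0_ge0.
by rewrite key leNgt ht.
Qed.

(** Taken with the two rows of a matrix g, this gives both the cocycle relation for [jfactor] and
    the composition law for [mobius]. *)
Lemma mobius_num h t (p q : int) : SL2Z h -> upper_half t ->
  (p * h 0 0 + q * h 1 0)%:~R * t + (p * h 0 1 + q * h 1 1)%:~R =
  (p%:~R * mobius h t + q%:~R) * jfactor h t :> C.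
Proof.
move=> hh ht; have j0 := jfactor_neq0 hh ht.
have e : mobius h t * jfactor h t = (h 0 0)%:~R * t + (h 0 1)%:~R by rewrite /mobius divfK.
rewrite mulrDl -mulrA e /jfactor !intrD !intrM; ring.
Qed.

Lemma jfactorM g h t : SL2Z h -> upper_half t ->
  jfactor (g *m h) t = jfactor g (mobius h t) * jfactor h t.
Proof. by move=> hh ht; rewrite {1}/jfactor !mul2E mobius_num. Qed.

Lemma mobiusM g h t : SL2Z g -> SL2Z h -> upper_half t ->
  mobius (g *m h) t = mobius g (mobius h t).
Proof.
move=> hg hh ht; rewrite {1}/mobius jfactorM // !mul2E mobius_num //.
have j0 := jfactor_neq0 hh ht.
by rewrite -mulf_div divff // mulr1.
Qed.

Lemma jfactor_T n t : jfactor (Tm n) t = 1.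
Proof. by rewrite /jfactor !mx2E mul0r add0r. Qed.
Lemma mobius_T n t : mobius (Tm n) t = t + n%:~R.
Proof. by rewrite /mobius jfactor_T !mx2E mul1r divr1. Qed.
Lemma jfactor_U n t : jfactor (Um n) t = n%:~R * t + 1.
Proof. by rewrite /jfactor !mx2E. Qed.
Lemma mobius_U n t : mobius (Um n) t = t / (n%:~R * t + 1).
Proof. by rewrite /mobius jfactor_U !mx2E mul1r addr0. Qed.
Lemma jfactor_1 t : jfactor 1%:M t = 1.
Proof. by rewrite mx2_1 (jfactor_T 0). Qed.
Lemma mobius_1 t : mobius 1%:M t = t.
Proof. by rewrite mx2_1 (mobius_T 0) addr0. Qed.
Lemma jfactor_N1 t : jfactor (mx2 (-1) 0 0 (-1)) t = -1.
Proof. by rewrite /jfactor !mx2E mul0r add0r. Qed.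
Lemma mobius_N1 t : mobius (mx2 (-1) 0 0 (-1)) t = t.
Proof. by rewrite /mobius jfactor_N1 !mx2E addr0 mulrN1z mulN1r invrN1 mulrN1 opprK. Qed.
Lemma jfactor_ST j t : jfactor (STm j) t = t + j%:~R.
Proof. by rewrite /jfactor !mx2E mul1r. Qed.
Lemma mobius_ST j t : mobius (STm j) t = - (t + j%:~R)^-1.
Proof. by rewrite /mobius jfactor_ST !mx2E mul0r add0r mulrN1z mulN1r. Qed.
Lemma jfactor_V t : jfactor Vm t = 2 * t + 1.
Proof. by rewrite /jfactor !mx2E. Qed.
Lemma mobius_V t : mobius Vm t = t / (2 * t + 1).
Proof. by rewrite /mobius jfactor_V !mx2E mul1r addr0. Qed.

Lemma mobiusK g t : SL2Z g -> upper_half t -> mobius (inv2 g) (mobius g t) = t.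
Proof. by move=> hg ht; rewrite -mobiusM ?inv2Kl ?mobius_1 //; exact: SL2Z_inv. Qed.
End Action.

(** * Cusps and their widths *)

Section Cusps.
Implicit Types (g h : 'M[int]_2).

Lemma cusp_ofM (p s x : rat) : x != 0 -> cusp_of (p * x) (s * x) = cusp_of p s.
Proof.
move=> x0; rewrite /cusp_of mulf_eq0 (negbTE x0) orbF; case: eqVneq => // s0.
by congr Some; rewrite -mulf_div divff // mulr1.
Qed.

Lemma SL2Z_col0 h : SL2Z h -> h 1 0 = 0 -> h 0 0 != 0.
Proof. by move=> /SL2ZE e c0; apply/eqP => a0; rewrite a0 c0 in e; lia. Qed.

Lemma cusp_actM g h : SL2Z h -> cusp_act (g *m h) None = cusp_act g (cusp_act h None).
Proof.
move=> hh; rewrite [LHS]/= [cusp_act h None]/= /cusp_of !mul2E.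
have [c0|c0] := eqVneq ((h 1 0)%:~R : rat) 0.
  have c0' : h 1 0 = 0 by apply/eqP; rewrite -(intr_eq0 rat) c0.
  rewrite c0' !mulr0 !addr0 !intrM /=.
  have a0 : ((h 0 0)%:~R : rat) != 0 by rewrite intr_eq0; exact: SL2Z_col0.
  by rewrite -/(cusp_of _ _) cusp_ofM.
rewrite /= -/(cusp_of _ _) !intrD !intrM.
have e (x y : rat) : x * (h 0 0)%:~R + y * (h 1 0)%:~R =
    (x * ((h 0 0)%:~R / (h 1 0)%:~R) + y) * (h 1 0)%:~R.
  by rewrite mulrDl -!mulrA mulVf // mulr1.
by rewrite !e cusp_ofM.
Qed.

Lemma cusp_rep (s : option rat) : exists2 g, SL2Z g & cusp_act g None = s.
Proof.
case: s => [x|]; last first.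
  exists 1%:M; first by rewrite mx2_1; apply/SL2ZE; rewrite !mx2E.
  by rewrite mx2_1 /= !mx2E /cusp_of eqxx.
have cop : coprimez (numq x) (denq x) by rewrite coprimezE coprime_num_den.
have [[u v] /= huv] := coprimezP _ _ cop.
exists (mx2 (numq x) (- v) (denq x) u); first by apply/SL2ZE; rewrite !mx2E -huv; ring.
by rewrite /= !mx2E /cusp_of intr_eq0 denq_eq0 /= divq_num_den.
Qed.

(** The lower left entry of the conjugated translation is - c^2 h, and it alone decides
    membership. *)
Lemma width_cond N g (h : nat) : SL2Z g ->
  (Gamma0 N (g *m translation h *m invmx g) <-> (N%:Z %| g 1%R 0%R ^+ 2 * h%:Z)%Z).
Proof.
move=> hg; rewrite invmx2E // translationE.
have hs : SL2Z (g *m Tm h%:Z *m inv2 g).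
  by apply: SL2Z_mul; [apply: SL2Z_mul => //; exact: (Gamma0_SL (Gamma0_T 1 _))|exact: SL2Z_inv].
have e : (g *m Tm h%:Z *m inv2 g) 1%R 0%R = - (g 1%R 0%R ^+ 2 * h%:Z).
  by rewrite !mul2E !mx2E; ring.
by split=> [[_]|hd]; [rewrite e rpredN|split=> //; rewrite e rpredN].
Qed.

Lemma width_Gamma0 N g : Gamma0 N g -> is_width (Gamma0 N) g 1.
Proof.
move=> [hg hc]; split=> //; apply/width_cond => //.
by rewrite mulr1 expr2 dvdz_mulr.
Qed.

Lemma width_ST N h j : (0 < N)%N -> Gamma0 N h -> is_width (Gamma0 N) (h *m STm j) N.
Proof.
move=> N0 [hh hc]; have hs := SL2Z_mul hh (SL_ST j).
split=> //; first by apply/width_cond => //; rewrite dvdz_mull.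
move=> m m0 /width_cond => /(_ hs).
rewrite mul2E !mx2E mulr0 add0r mulr1 => hd.
have : (N%:Z %| m%:Z)%Z.
  move/SL2ZE: hh => hd1; case/dvdzP: hc => c hc; case/dvdzP: hd => e he.
  (* With rows (a, b) and (c', d) of [h] and a d = 1 + b c', one has m = (a d)^2 m - b c' (2 + b c')
     m; N divides d^2 m in the first term and c' in the second. *)
  apply/dvdzP; exists (h 0 0 ^+ 2 * e - (h 0 1 * c) * (2 + h 0 1 * h 1%R 0%R) * m%:Z).
  have a1 : h 0 0 * h 1 1 = 1 + h 0 1 * h 1 0 by rewrite -hd1; ring.
  transitivity (m%:Z * (h 0 0 * h 1 1) ^+ 2 - (h 0 1 * h 1 0) * (2 + h 0 1 * h 1%R 0%R) * m%:Z).
    by rewrite a1; ring.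
  transitivity (h 0 0 ^+ 2 * (h 1 1 ^+ 2 * m%:Z) - (h 0 1 * h 1 0) * (2 + h 0 1 * h 1%R 0%R) * m%:Z).
    by ring.
  by rewrite he {1}hc; ring.
by rewrite dvdzE /= => /dvdn_leq; apply.
Qed.

Lemma width_V h : Gamma0 4 h -> is_width (Gamma0 4) (h *m Vm) 1.
Proof.
move=> [hh /dvdzP[c hc]]; have hs := SL2Z_mul hh SL_V.
split=> //; apply/width_cond => //; rewrite mul2E !mx2E mulr1 hc.
by apply/dvdzP; exists ((c * 2 + h 1 1) ^+ 2); ring.
Qed.

End Cusps.

(** * Automorphy, multipliers and orders from q-series *)

Section Automorphy.
Variable R : realType.
Local Notation C := (cplx R).
Local Notation H := (@upper_half R).
Implicit Types (g h : 'M[int]_2) (t : C) (f : C -> C).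

Lemma intr_natC (n : nat) : n%:~R = n%:R :> C. Proof. by []. Qed.

Lemma upper_addz t (n : int) : H t -> H (t + n%:~R).
Proof.
rewrite /upper_half /= ImD => ht.
have [x [-> _]] := @intC_real R n; by rewrite /= addr0.
Qed.

Lemma upper_divn t (n : nat) : (0 < n)%N -> H t -> H (t / n%:R).
Proof.
move=> n0; rewrite /upper_half /= mulrC natC.
have -> : (n%:R%:C)^-1 = (n%:R^-1)%:C :> C by rewrite fmorphV.
by rewrite Im_realM => ht; rewrite mulr_gt0 // invr_gt0 ltr0n.
Qed.

Lemma nome_addz t (n : int) : nome (t + n%:~R) = nome t :> C.
Proof. by rewrite nomeD nome_int mulr1. Qed.

Lemma qser_addz f a t (n : int) : qser f a -> H t -> f (t + n%:~R) = f t.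
Proof. by move=> [_ h] ht; rewrite !h ?nome_addz //; exact: upper_addz. Qed.

Definition fricke (N : nat) t : C := - (N%:R * t)^-1.

Lemma fricke_upper N t : (0 < N)%N -> H t -> H (fricke N t).
Proof. by move=> N0 ht; apply: upper_NV; exact: upper_natM. Qed.

Lemma natC_neq0 (N : nat) : (0 < N)%N -> N%:R != 0 :> C.
Proof. by rewrite pnatr_eq0 lt0n. Qed.

Lemma frickeK N t : (0 < N)%N -> H t -> fricke N (fricke N t) = t.
Proof.
move=> N0 ht; have t0 := upper_neq0 ht; have n0 := natC_neq0 N0.
by rewrite /fricke; field; rewrite n0 t0.
Qed.

Definition aut N k f := forall g, Gamma0 N g -> exists2 e : C, e = 1 \/ e = -1 &
  forall t, H t -> f (mobius g t) = e * jfactor g t ^+ k * f t.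

(** The function [f'] carries the expansion of [f] at the cusp 0. The constant stays unspecified
    because [logder_const] produces it without a value. *)
Definition companion N k f f' := exists2 kap : C, kap != 0 &
  forall t, H t -> f (fricke N t) = kap * t ^+ k * f' t.

Lemma companion_sym N k f f' : (0 < N)%N -> companion N k f f' -> companion N k f' f.
Proof.
move=> N0 [kap k0 h]; have n0 := natC_neq0 N0.
exists (kap^-1 * (- N%:R) ^+ k); first by rewrite mulf_neq0 ?invr_neq0 ?expf_neq0 ?oppr_eq0.
move=> t ht; have t0 := upper_neq0 ht; have hw := fricke_upper N0 ht.
have := h _ hw; rewrite frickeK // => ->.
have -> : fricke N t = (- N%:R * t)^-1 by rewrite /fricke mulNr invrN.
rewrite exprVn exprMn.
have x0 : (- N%:R) ^+ k != 0 :> C by rewrite expf_neq0 ?oppr_eq0.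
have y0 : t ^+ k != 0 by rewrite expf_neq0.
move: ((- N%:R) ^+ k) (t ^+ k) (f' _) x0 y0 => x y z x0 y0.
by field; rewrite x0 y0 k0.
Qed.

(** The lower triangular generators are Fricke conjugates of translations, so invariance under them
    is periodicity of the companion. *)
Lemma mobius_UE N n t : (0 < N)%N -> H t ->
  mobius (Um (N%:Z * n)) t = fricke N (fricke N t + (- n)%:~R).
Proof.
move=> N0 ht; have t0 := upper_neq0 ht; have n0 := natC_neq0 N0.
have hU : SL2Z (Um (N%:Z * n)) := Gamma0_SL (Gamma0_U N n).
have := jfactor_neq0 hU ht; rewrite jfactor_U mobius_U intrM intr_natC => j0.
have -> : fricke N t + (- n)%:~R = - ((N%:R * n%:~R * t + 1) / (N%:R * t)).
  by rewrite /fricke mulrNz; field; rewrite n0 t0.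
by rewrite /fricke; field; rewrite n0 t0 j0.
Qed.

(** Only generators need checking: upper triangular ones act through the periodicity of [f], lower
    triangular ones through that of [f'], and -1 contributes the sign (-1)^k. *)
Lemma aut_of_companion N k f f' a a' : (1 < N < 5)%N -> qser f a -> qser f' a' ->
  companion N k f f' -> aut N k f.
Proof.
move=> hN qf qf' cf; have N0 : (0 < N)%N by case/andP: hN; lia.
have [kap' k0' cf'] := companion_sym N0 cf; case: cf => kap k0 cf.
pose K g := SL2Z g /\ exists2 e : C, e = 1 \/ e = -1 &
  forall t, H t -> f (mobius g t) = e * jfactor g t ^+ k * f t.
suff KK g : Gamma0 N g -> K g by move=> g /KK[].
move: g; apply: Gamma0_ind => //.
- split; first exact: (Gamma0_SL (Gamma0_1 N)).
  by exists 1; [left|move=> t ht; rewrite mobius_1 jfactor_1 expr1n !mul1r].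
- split; first by apply/SL2ZE; rewrite !mx2E.
  exists ((-1) ^+ k); first by rewrite -signr_odd; case: odd; [right|left].
  by move=> t ht; rewrite mobius_N1 jfactor_N1 -exprMn mulrNN mulr1 expr1n mul1r.
- move=> g h [hg [e he eg]] [hh [e' he' eh]]; split; first exact: SL2Z_mul.
  exists (e * e').
    by case: he he' => -> [] ->; rewrite ?mulr1 ?mul1r ?mulrN1 ?opprK; [left|right|right|left].
  move=> t ht; rewrite mobiusM // jfactorM // eg ?eh //; last exact: mobius_upper.
  by rewrite exprMn; ring.
- move=> n; split; first exact: (Gamma0_SL (Gamma0_T N n)).
  exists 1; first by left.
  by move=> t ht; rewrite mobius_T jfactor_T expr1n !mul1r (qser_addz _ qf).
move=> n; split; first exact: (Gamma0_SL (Gamma0_U N n)).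
exists 1; first by left.
move=> t ht; have hw := fricke_upper N0 ht; have hs := upper_addz (- n) hw.
rewrite mobius_UE // cf // (qser_addz _ qf') // cf' // jfactor_U mul1r.
have e : f t = kap * kap' * (fricke N t * t) ^+ k * f t.
  by rewrite -{1}(frickeK N0 ht) cf // cf' // exprMn; ring.
have t0 := upper_neq0 ht; have n0 := natC_neq0 N0.
have e2 : (fricke N t + (- n)%:~R) * t = (((N%:Z * n)%:~R * t + 1) * (fricke N t * t)).
  by rewrite /fricke intrM intr_natC mulrNz; field; rewrite n0 t0.
rewrite [in RHS]e; transitivity (kap * kap' * (((fricke N t + (- n)%:~R) * t) ^+ k) * f t).
  by rewrite exprMn; ring.
by rewrite e2 exprMn; ring.
Qed.

(** A single point where [f] does not vanish determines the sign attached to each matrix, and this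
    uniqueness makes the sign multiplicative. *)
Lemma aut_multiplier N k f t0 : aut N k f -> H t0 -> f t0 != 0 ->
  exists v, multiplier_system (Gamma0 N) v /\
   forall g t, Gamma0 N g -> H t -> f (mobius g t) = v g * jfactor g t ^+ k * f t.
Proof.
move=> hf h0 f0.
pose v g : C := f (mobius g t0) / (jfactor g t0 ^+ k * f t0).
have D g : SL2Z g -> jfactor g t0 ^+ k * f t0 != 0.
  by move=> hg; rewrite mulf_neq0 // expf_neq0 // jfactor_neq0.
have vE g e : SL2Z g -> (forall t, H t -> f (mobius g t) = e * jfactor g t ^+ k * f t) -> v g = e.
  by move=> hg he; rewrite /v he // -(mulrA e) mulfK // D.
have vP g : Gamma0 N g -> (v g = 1 \/ v g = -1) /\
    forall t, H t -> f (mobius g t) = v g * jfactor g t ^+ k * f t.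
  by move=> hg; have [e he e1] := hf _ hg; rewrite (vE g e) //; exact: Gamma0_SL hg.
exists v; split; last by move=> g t /vP[_]; apply.
split=> [g /vP[[->|->] _]|g g' hg hg']; rewrite ?normrN ?normr1 //.
have [_ vg] := vP _ hg; have [_ vg'] := vP _ hg'.
have sg := Gamma0_SL hg; have sg' := Gamma0_SL hg'.
apply: vE; first exact: SL2Z_mul.
move=> t ht; rewrite mobiusM // jfactorM // vg ?vg' //; last exact: mobius_upper.
by rewrite exprMn; ring.
Qed.

Definition has_ord f m := exists a, [/\ qser f a, forall n, (n < m)%N -> a n = 0 & a m != 0].

Lemma ev_shiftn (a : nat -> C) m (q : C) : tame a -> nm q < 1 -> (forall n, (n < m)%N -> a n = 0) ->
  tame (fun n => a (m + n)%N) /\ ev a q = q ^+ m * ev (fun n => a (m + n)%N) q.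
Proof.
elim: m a => [|m IH] a ta hq h; first by split; rewrite ?expr0 ?mul1r.
have [t1 e1] := IH _ (tame_shift ta) hq (fun n hn => h n.+1 hn).
by split => //; rewrite (ev_shift ta hq) h // add0r e1 exprS mulrA.
Qed.

(** At a cusp of width N the parameter is q^(1/N); the shift by [j] only multiplies the coefficients
    by roots of unity. *)
Lemma qexp_scale f a m (x : C) N (j : int) : (0 < N)%N -> qser f a -> (forall n, (n < m)%N -> a n = 0) ->
  q_expansion (fun t => x * f ((t + j%:~R) / N%:R)) (m%:R / N%:R) N
    (fun n => x * a (m + n)%N * nome (j%:~R / N%:R) ^+ (m + n)).
Proof.
move=> N0 [ta qf] am t ht; set s := (t + _) / _.
have hs : H s by apply: upper_divn => //; exact: upper_addz.
have hq := nm_nome_lt1 hs; have [t1 e1] := ev_shiftn ta hq am.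
rewrite qf // e1 mulrA.
have := slimM (@slim_cst R (x * nome s ^+ m)) (ev_cvg t1 hq).
apply: slim_eq => n; rewrite /series /= mulr_sumr; apply: eq_bigr => i _.
have -> : cexp (twopii R * (m%:R / N%:R + i%:R / N%:R)%:C * t) = nome ((m + i)%:R * (t / N%:R)) :> C.
  have -> : (m%:R / N%:R + i%:R / N%:R)%:C = (m + i)%:R / N%:R :> C.
    by rewrite -mulrDl -natrD rmorphM /= fmorphV /= -!natC.
  by rewrite nome_cexp; congr cexp; rewrite -!mulrA; congr (_ * (_ * _)); rewrite mulrC.
have -> : nome s = nome (t / N%:R) * nome (j%:~R / N%:R) by rewrite -nomeD -mulrDl.
rewrite nome_nat; move: (nome _) (nome _) (a _) => u v z; rewrite !exprMn !exprD; ring.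
Qed.

Lemma qser_holo_inf f a (x : C) N (j : int) : (0 < N)%N -> qser f a ->
  holomorphic_at_infty (fun t => x * f ((t + j%:~R) / N%:R)).
Proof.
move=> N0 qf; exists (0%:R / N%:R), N, (fun n => x * a (0 + n)%N * nome (j%:~R / N%:R) ^+ (0 + n)).
by split; [rewrite mul0r|exact: N0|apply: qexp_scale].
Qed.

Lemma ord_leading f m (x : C) N (j : int) : (0 < N)%N -> x != 0 -> has_ord f m ->
  leading_exponent (fun t => x * f ((t + j%:~R) / N%:R)) (m%:R / N%:R).
Proof.
move=> N0 x0 [a [qf a0 am]]; exists N, (fun n => x * a (m + n)%N * nome (j%:~R / N%:R) ^+ (m + n)).
split; [exact: N0| |exact: qexp_scale].
by rewrite addn0 !mulf_neq0 // expf_neq0 // nome_neq0.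
Qed.

Lemma eq_holo_inf f (g : C -> C) : (forall t, H t -> f t = g t) -> holomorphic_at_infty f -> holomorphic_at_infty g.
Proof.
move=> e [al [h [a [x y z]]]]; exists al, h, a.
by split; [exact: x|exact: y|move=> t ht; rewrite -e //; exact: z].
Qed.

Lemma eq_leading f (g : C -> C) al : (forall t, H t -> f t = g t) -> leading_exponent f al -> leading_exponent g al.
Proof.
move=> e [h [a [x y z]]]; exists h, a.
by split; [exact: x|exact: y|move=> t ht; rewrite -e //; exact: z].
Qed.

Lemma slash_aut N k f h x : aut N k f -> Gamma0 N h -> SL2Z x -> exists2 e : C, e != 0 &
  forall t, H t -> slash k f (h *m x) t = e * slash k f x t.
Proof.
move=> af hh hx; have [e he e1] := af _ hh; exists e.
  by case: he => ->; rewrite ?oppr_eq0 oner_eq0.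
move=> t ht; have sh := Gamma0_SL hh; have ux := mobius_upper hx ht.
have j0 : jfactor h (mobius x t) ^+ k != 0 by rewrite expf_neq0 // jfactor_neq0.
have j1 : jfactor x t ^+ k != 0 by rewrite expf_neq0 // jfactor_neq0.
rewrite /slash mobiusM // jfactorM // e1 // exprMn.
move: (jfactor h _ ^+ k) (jfactor x t ^+ k) j0 j1 => u v u0 v0.
by field; rewrite u0 v0.
Qed.

Lemma slash_1 k f t : slash k f 1%:M t = f t.
Proof. by rewrite /slash mobius_1 jfactor_1 expr1n invr1 mul1r. Qed.

Lemma slash_ST N k f f' (j : int) : (0 < N)%N -> companion N k f f' -> exists2 x : C, x != 0 &
  forall t, H t -> slash k f (STm j) t = x * f' ((t + j%:~R) / N%:R).
Proof.
move=> N0 [kap k0 cf]; have n0 := natC_neq0 N0.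
exists (kap / N%:R ^+ k); first by rewrite mulf_neq0 ?invr_neq0 ?expf_neq0.
move=> t ht; have ht' := upper_addz j ht; have hs := upper_divn N0 ht'.
rewrite /slash jfactor_ST mobius_ST.
have t0 := upper_neq0 ht'; move: (t + _) ht' hs t0 => s hs hs' s0.
have -> : - s^-1 = fricke N (s / N%:R) by rewrite /fricke mulrC divfK.
rewrite cf // expr_div_n.
have u0 : s ^+ k != 0 by rewrite expf_neq0.
have v0 : (N%:R : C) ^+ k != 0 by rewrite expf_neq0.
move: (s ^+ k) (N%:R ^+ k) u0 v0 (f' _) => u v u0 v0 z.
by field; rewrite u0 v0.
Qed.

(** Guarded by N = 4 so that one set of cusp lemmas serves all levels: for N = 2 and 3 every cusp is
    equivalent to i oo or 0. *)
Definition half_cusp N k f f3 := N = 4%N -> exists2 x : C, x != 0 &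
  forall t, H t -> slash k f Vm t = x * f3 t.

Lemma addz_div1 t : (t + (0 : int)%:~R) / 1%:R = t :> C.
Proof. by rewrite addr0 divr1. Qed.

Lemma cusp_holo N k f f' f3 a a' a3 g : (1 < N < 5)%N -> aut N k f -> companion N k f f' ->
  half_cusp N k f f3 -> qser f a -> qser f' a' -> qser f3 a3 -> SL2Z g ->
  holomorphic_at_infty (slash k f g).
Proof.
move=> hN af cf hf qf qf' qf3 hg; have N0 : (0 < N)%N by case/andP: hN; lia.
case: (coset_rep hN hg) => [h|[j [h hh ->]]|[N4 [h hh ->]]].
- have [e e0 E] := slash_aut af h (Gamma0_SL (Gamma0_1 N)).
  apply: (eq_holo_inf _ (qser_holo_inf e 0 (ltn0Sn 0) qf)) => t ht.
  by rewrite addz_div1 -[g]mulmx1 E // slash_1.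
- have [e e0 E] := slash_aut af hh (SL_ST j); have [x x0 X] := slash_ST j N0 cf.
  apply: (eq_holo_inf _ (qser_holo_inf (e * x) j N0 qf')) => t ht.
  by rewrite E // X // mulrA.
- have [e e0 E] := slash_aut af hh SL_V; have [x x0 X] := hf N4.
  apply: (eq_holo_inf _ (qser_holo_inf (e * x) 0 (ltn0Sn 0) qf3)) => t ht.
  by rewrite addz_div1 E // X // mulrA.
Qed.

Lemma modular_form_intro N k f f' f3 a a' a3 t0 : (1 < N < 5)%N -> companion N k f f' ->
  half_cusp N k f f3 -> qser f a -> qser f' a' -> qser f3 a3 -> H t0 -> f t0 != 0 ->
  modular_form (Gamma0 N) k f.
Proof.
move=> hN cf hf qf qf' qf3 h0 f0; have af := aut_of_companion hN qf qf' cf.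
split; first exact: qser_derivable qf.
  exact: aut_multiplier af h0 f0.
by move=> g hg; apply: (cusp_holo hN af cf hf qf qf' qf3).
Qed.

Lemma order_inf N k f m h : (0 < N)%N -> aut N k f -> has_ord f m -> Gamma0 N h ->
  order_at (Gamma0 N) k f (Cusp R (cusp_act h None)) m%:R.
Proof.
move=> N0 af of_ hh; have [e e0 E] := slash_aut af hh (Gamma0_SL (Gamma0_1 N)).
exists h, 1%N, (m%:R / 1%:R); split; [exact: Gamma0_SL hh|by []|idtac|idtac|idtac].
- exact: width_Gamma0.
- apply: (eq_leading _ (ord_leading 0 (ltn0Sn 0) e0 of_)) => t ht.
  by rewrite addz_div1 -[h]mulmx1 E // slash_1.
by rewrite mul1r divr1.
Qed.

Lemma order_zero N k f f' m h j : (0 < N)%N -> aut N k f -> companion N k f f' ->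
  has_ord f' m -> Gamma0 N h ->
  order_at (Gamma0 N) k f (Cusp R (cusp_act (h *m STm j) None)) m%:R.
Proof.
move=> N0 af cf of_ hh; have [e e0 E] := slash_aut af hh (SL_ST j).
have [x x0 X] := slash_ST j N0 cf.
exists (h *m STm j), N, (m%:R / N%:R); split; [exact: (SL2Z_mul (Gamma0_SL hh) (SL_ST j))|by []|idtac|idtac|idtac].
- exact: width_ST.
- apply: (eq_leading _ (ord_leading j N0 (mulf_neq0 e0 x0) of_)) => t ht.
  by rewrite E // X // mulrA.
by rewrite mulrC divfK // pnatr_eq0 -lt0n.
Qed.

Lemma order_half k f f3 m h : aut 4 k f -> half_cusp 4 k f f3 -> has_ord f3 m -> Gamma0 4 h ->
  order_at (Gamma0 4) k f (Cusp R (cusp_act (h *m Vm) None)) m%:R.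
Proof.
move=> af hf of_ hh; have [e e0 E] := slash_aut af hh SL_V; have [x x0 X] := hf erefl.
exists (h *m Vm), 1%N, (m%:R / 1%:R); split; [exact: (SL2Z_mul (Gamma0_SL hh) SL_V)|by []|idtac|idtac|idtac].
- exact: width_V.
- apply: (eq_leading _ (ord_leading 0 (ltn0Sn 0) (mulf_neq0 e0 x0) of_)) => t ht.
  by rewrite addz_div1 E // X // mulrA.
by rewrite mul1r divr1.
Qed.

End Automorphy.

Opaque P.

(** * Levels 2 and 3 *)

Section Level.
Variable R : realType.
Local Notation C := (cplx R).
Local Notation H := (@upper_half R).
Implicit Types (t : C) (f : C -> C).
Variables (N r : nat) (k0 : C).
Hypotheses (N1 : (1 < N < 5)%N) (rN : (r * N.+1 = 12)%N) (k00 : k0 != 0).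
Local Notation n_ := (N%:R : C).

(* For (N, r) = (2, 4) and (3, 3) one has r (N + 1) = 12; this makes N r the
   anomaly of [lE] and [lEh] under the Fricke involution, which exchanges them. *)
Definition lE t := (n_ ^+ 2 * P (n_ * t) - P t) / (n_ ^+ 2 - 1).
Definition lEh t := n_ * (P t - P (n_ * t)) / (n_ ^+ 2 - 1).
Definition lW t := (n_ * P (n_ * t) - P t) / (n_ - 1).

Definition lEc n := (n_ ^+ 2 * dil N (@e2c R) n - 1 * dil 1 (@e2c R) n) / (n_ ^+ 2 - 1).
Definition lEhc n := (n_ * dil 1 (@e2c R) n - n_ * dil N (@e2c R) n) / (n_ ^+ 2 - 1).
Definition lWc n := (n_ * dil N (@e2c R) n - 1 * dil 1 (@e2c R) n) / (n_ - 1).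

Let N0 : (0 < N)%N. Proof. by case/andP: N1; lia. Qed.
Let n0 : n_ != 0. Proof. exact: natC_neq0. Qed.
Let n10 : n_ - 1 != 0.
Proof. by rewrite subr_eq0 -[1]/(1%:R) eqr_nat; apply/eqP; case/andP: N1; lia. Qed.
Let np0 : n_ + 1 != 0.
Proof. by rewrite natr1 natC_neq0. Qed.
Let n20 : n_ ^+ 2 - 1 != 0.
Proof. by rewrite subr_sqr_1 mulf_neq0 ?n10 ?np0. Qed.
Let r0 : (0 < r)%N. Proof. by case: r rN. Qed.
Let rC0 : (r%:R : C) != 0. Proof. exact: natC_neq0. Qed.
Let rE : 12 = r%:R * (n_ + 1) :> C.
Proof. by rewrite natr1 -natrM rN. Qed.
Let tp0 : twopii R != 0 := @twopii_neq0 R.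

Lemma qser_lE : qser lE lEc.
Proof.
apply: eq_qser (qser_lin (n_ ^+ 2) 1 (n_ ^+ 2 - 1) N0 (ltn0Sn 0)) => t ht.
by rewrite /lE mul1r mul1r.
Qed.
Lemma qser_lEh : qser lEh lEhc.
Proof.
apply: eq_qser (qser_lin n_ n_ (n_ ^+ 2 - 1) (ltn0Sn 0) N0) => t ht.
by rewrite mul1r /lEh; congr (_ / _); exact/esym/mulrBr.
Qed.
Lemma qser_lW : qser lW lWc.
Proof.
apply: eq_qser (qser_lin n_ 1 (n_ - 1) N0 (ltn0Sn 0)) => t ht.
by rewrite /lW mul1r mul1r.
Qed.

Lemma dil_e2c0 d : dil d (@e2c R) 0 = 1. Proof. by rewrite dil_0. Qed.
Lemma sig1 : sig R 1 = 1.
Proof. by rewrite sigE // (_ : divisors 1 = [:: 1%N]) // big_seq1. Qed.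
Lemma dil_N1 : dil N (@e2c R) 1 = 0.
Proof. by rewrite /dil dvdn1; case: eqP => // e; case/andP: N1; lia. Qed.
Lemma dil_11 : dil 1 (@e2c R) 1 = -24. 
Proof. by rewrite dil1 -[e2c R 1]/(-24 * sig R 1) sig1 mulr1. Qed.

Lemma lEc0 : lEc 0 = 1.
Proof. by rewrite /lEc !dil_e2c0 !mulr1 divff. Qed.
Lemma lEc1 : lEc 1 = 24 / (n_ ^+ 2 - 1).
Proof. by rewrite /lEc dil_N1 dil_11 mulr0 sub0r mul1r opprK. Qed.
Lemma lEhc0 : lEhc 0 = 0.
Proof. by rewrite /lEhc !dil_e2c0 subrr mul0r. Qed.
Lemma lEhc1 : lEhc 1 = - 24 * n_ / (n_ ^+ 2 - 1).
Proof. by rewrite /lEhc dil_N1 dil_11 mulr0 subr0 [n_ * _]mulrC. Qed.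
Lemma lWc0 : lWc 0 = 1.
Proof. by rewrite /lWc !dil_e2c0 !mulr1 divff. Qed.
Lemma lWc1 : lWc 1 = 24 / (n_ - 1).
Proof. by rewrite /lWc dil_N1 dil_11 mulr0 sub0r mul1r opprK. Qed.

Lemma lEhE t : lEh t = lE t - lW t.
Proof.
rewrite /lEh /lE /lW; move: (P t) (P (n_ * t)) => x y.
by field; rewrite n10 n20.
Qed.

Lemma P_frickeN t : H t -> P (n_ * fricke N t) = t ^+ 2 * P t + 12 * t / twopii R.
Proof.
move=> ht; have t0 := upper_neq0 ht.
have e : n_ * fricke N t = - t^-1 by rewrite /fricke; field; rewrite n0 t0.
by rewrite e; exact: P_inv.
Qed.

Lemma P_fricke t : H t ->
  P (fricke N t) = n_ ^+ 2 * t ^+ 2 * P (n_ * t) + 12 * (n_ * t) / twopii R.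
Proof. by move=> ht; rewrite -exprMn; exact: P_inv (upper_natM N0 ht). Qed.

Lemma lE_fricke t : H t -> lE (fricke N t) = n_ * t ^+ 2 * lEh t + n_ * r%:R * t / twopii R.
Proof.
move=> ht; rewrite /lE /lEh P_frickeN // P_fricke // rE.
move: (P t) (P _) (twopii R) tp0 (r%:R : C) => x y p p0 s.
by field; rewrite n20 p0.
Qed.

Lemma lEh_fricke t : H t -> lEh (fricke N t) = n_ * t ^+ 2 * lE t + n_ * r%:R * t / twopii R.
Proof.
move=> ht; rewrite /lE /lEh P_frickeN // P_fricke // rE.
move: (P t) (P _) (twopii R) tp0 (r%:R : C) => x y p p0 s.
by field; rewrite n20 p0.
Qed.

Lemma lW_fricke t : H t -> lW (fricke N t) = - n_ * t ^+ 2 * lW t.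
Proof.
move=> ht; rewrite /lW P_frickeN // P_fricke //.
move: (P t) (P _) (twopii R) tp0 => x y p p0.
by field; rewrite n10 p0.
Qed.

(** Dividing the logarithmic derivative by [r] makes the root itself a q-series: classically
    eta(t)^4/eta(2t)^2 for N = 2 and eta(t)^3/eta(3t) for N = 3. *)
Definition lb := psexpf (fun n => r%:R^-1 * lEhc n).
Definition lFB t := lb t ^+ r.
(** The constant term 1 of [lE] is the logarithmic derivative of the factor q of [lFC]; it is
    removed because [psexp] applies to series without constant term. *)
Definition lc := psexpf (fun n => r%:R^-1 * (lEc n - ps_cons 1 (fun=> 0) n)).
Definition lFC t := k0 * nome t * lc t ^+ r.

Let qb : qser (fun t => r%:R^-1 * lEh t) (fun n => r%:R^-1 * lEhc n).
Proof. exact: qserZ qser_lEh. Qed.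
Let qc : qser (fun t => r%:R^-1 * (lE t - 1)) (fun n => r%:R^-1 * (lEc n - ps_cons 1 (fun=> 0) n)).
Proof. exact: qserZ (qserB qser_lE (qser_cst 1)). Qed.
Let b0 : r%:R^-1 * lEhc 0 = 0. Proof. by rewrite lEhc0 mulr0. Qed.
Let c0 : r%:R^-1 * (lEc 0 - ps_cons 1 (fun=> 0) 0%N) = 0. Proof. by rewrite lEc0 /= subrr mulr0. Qed.

Lemma qser_lb : qser lb (psexp (fun n => r%:R^-1 * lEhc n)).
Proof. exact: qser_psexp (qser_tame qb). Qed.
Lemma qser_lc : qser lc (psexp (fun n => r%:R^-1 * (lEc n - ps_cons 1 (fun=> 0) n))).
Proof. exact: qser_psexp (qser_tame qc). Qed.
Lemma lb_neq0 t : H t -> lb t != 0. Proof. exact: psexpf_neq0 (qser_tame qb) b0. Qed.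
Lemma lc_neq0 t : H t -> lc t != 0. Proof. exact: psexpf_neq0 (qser_tame qc) c0. Qed.
Lemma lFB_neq0 t : H t -> lFB t != 0. Proof. by move=> /lb_neq0 h; rewrite expf_neq0. Qed.
Lemma lFC_neq0 t : H t -> lFC t != 0.
Proof.
by move=> /lc_neq0 h; apply: mulf_neq0; [apply: mulf_neq0; [exact: k00|exact: nome_neq0]|exact: expf_neq0].
Qed.

Lemma cder_lFB t : H t -> cder lFB t (twopii R * lEh t * lFB t).
Proof.
move=> ht; have h := cderX r (psexp_qD qb b0 ht); apply: (cder_eq h).
rewrite -/lb /lFB; case: r r0 rC0 => // s _ s0; rewrite /= exprS.
move: (s.+1%:R : C) (lb t) (lb t ^+ s) s0 (lEh t) (twopii R) => u v w s0 x y.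
by field.
Qed.

Lemma cder_lFC t : H t -> cder lFC t (twopii R * lE t * lFC t).
Proof.
move=> ht; have h1 := cderX r (psexp_qD qc c0 ht).
have h2 := cderM (cderZ k0 (cder_nome t)) h1; apply: (cder_eq h2).
rewrite -/lc /lFC; case: r r0 rC0 => // s _ s0; rewrite /= !exprS.
move: (s.+1%:R : C) (lc t) (lc t ^+ s) (nome t) s0 (lE t) (twopii R) => u v w z s0 x y.
by field.
Qed.

Lemma qD_lFB t : H t -> qD lFB t = lEh t * lFB t.
Proof. by move=> ht; apply: qDE; rewrite mulrA; exact: cder_lFB. Qed.
Lemma qD_lFC t : H t -> qD lFC t = lE t * lFC t.
Proof. by move=> ht; apply: qDE; rewrite mulrA; exact: cder_lFC. Qed.

Lemma cder_fricke t : H t -> cder (fricke N) t ((n_ * t ^+ 2)^-1).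
Proof.
move=> ht; have t0 := upper_neq0 ht.
have nt0 : n_ * t != 0 by rewrite mulf_neq0.
have h := cderN (cderV (cderZ n_ (cder_id t)) nt0); apply: (cder_eq h).
by field; rewrite n0 t0.
Qed.

(** The logarithmic derivative of [lFB] after the involution is 2 pi i E + r/t: the anomaly of [lEh]
    supplies exactly the r/t that belongs to the factor [t ^+ r]. *)
Lemma lFB_companion : companion N r lFB lFC.
Proof.
have [|||k kn0 e] := @logder_const R (fun t => lFB (fricke N t)) (fun t => t ^+ r * lFC t).
- by move=> t ht; apply/lFB_neq0/fricke_upper.
- by move=> t ht; rewrite mulf_neq0 ?lFC_neq0 // expf_neq0 // upper_neq0.
- move=> t ht; have t0 := upper_neq0 ht; have hw := fricke_upper N0 ht.
  exists (twopii R * lE t + r%:R / t); split.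
    have h := cder_comp (cder_fricke ht) (cder_lFB hw); apply: (cder_eq h).
    rewrite lEh_fricke //; move: (lFB _) (lE t) (twopii R) tp0 (r%:R : C) => u v p p0 s.
    by field; rewrite n0 t0 p0.
  have h := cderM (cderX r (cder_id t)) (cder_lFC ht); apply: (cder_eq h).
  case: r r0 => // s _; rewrite /= !exprS.
  move: (s.+1%:R : C) (t ^+ s) (lFC t) (lE t) (twopii R) => u v w x y.
  by field.
by exists k => // t ht; rewrite e // mulrA.
Qed.

Lemma lFC_companion : companion N r lFC lFB.
Proof. exact: companion_sym N0 lFB_companion. Qed.

Lemma lE_quasi g t : Gamma0 N g -> H t ->
  lE (mobius g t) = jfactor g t ^+ 2 * lE t + r%:R / twopii R * (g 1 0)%:~R * jfactor g t.
Proof.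
pose K g := SL2Z g /\ forall t, H t ->
  lE (mobius g t) = jfactor g t ^+ 2 * lE t + r%:R / twopii R * (g 1 0)%:~R * jfactor g t.
suff KK : forall g, Gamma0 N g -> K g by move=> hg ht; apply: (KK g hg).2.
move: {g t} @K; set s : C := r%:R / twopii R => K.
apply: Gamma0_ind => //.
- split; first exact: (Gamma0_SL (Gamma0_1 N)).
  by move=> t ht; rewrite mobius_1 jfactor_1 mx2_1 mx2E mulr0 mul0r addr0 expr1n mul1r.
- split; first by apply/SL2ZE; rewrite !mx2E.
  by move=> t ht; rewrite mobius_N1 jfactor_N1 mx2E mulr0 mul0r addr0 sqrrN expr1n mul1r.
- move=> g h [hg eg] [hh eh]; split; first exact: SL2Z_mul.
  move=> t ht; have hm := mobius_upper hh ht.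
  rewrite mobiusM // jfactorM // eg // eh // exprMn mul2E intrD !intrM.
  have j0 := jfactor_neq0 hh ht.
  have me : mobius h t * jfactor h t = (h 0 0)%:~R * t + (h 0 1)%:~R by rewrite /mobius divfK.
  have dt : ((h 0 0)%:~R * (h 1 1)%:~R - (h 0 1)%:~R * (h 1 0)%:~R : C) = 1.
    by rewrite -!intrM -intrB; move/SL2ZE: hh => ->.
  (* The additivity of the anomalous term along a product of matrices; it uses det h = 1. *)
  have key : jfactor g (mobius h t) * jfactor h t * (h 1 0)%:~R + (g 1 0)%:~R =
    ((g 1 0)%:~R * (h 0 0)%:~R + (g 1 1)%:~R * (h 1 0)%:~R) * jfactor h t.
    rewrite [X in X * _ * _]/jfactor mulrDl -(mulrA _ (mobius h t)) me.
    rewrite /jfactor; transitivity (((g 1 0)%:~R * ((h 0 0)%:~R * t + (h 0 1)%:~R) +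
      (g 1 1)%:~R * ((h 1 0)%:~R * t + (h 1 1)%:~R)) * (h 1 0)%:~R + (g 1 0)%:~R *
      ((h 0 0)%:~R * (h 1 1)%:~R - (h 0 1)%:~R * (h 1 0)%:~R) : C); first by rewrite dt mulr1.
    by ring.
  move: (jfactor g _) (jfactor h t) ((h 1 0)%:~R : C) ((g 1 0)%:~R : C) (lE t) key => x y c c' z key.
  transitivity ((x * y) ^+ 2 * z + s * (x * y * c + c') * x); first by ring.
  by rewrite key; ring.
- move=> n; split; first exact: (Gamma0_SL (Gamma0_T N n)).
  move=> t ht; rewrite mobius_T jfactor_T mx2E mulr0 mul0r addr0 expr1n mul1r.
  exact: qser_addz qser_lE ht.
move=> n; split; first exact: (Gamma0_SL (Gamma0_U N n)).
move=> t ht; have hw := fricke_upper N0 ht; have hs := upper_addz (- n) hw.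
rewrite mobius_UE // lE_fricke // (qser_addz _ qser_lEh hw) lEh_fricke // jfactor_U mx2E intrM intr_natC.
have t0 := upper_neq0 ht.
have e2 : fricke N t + (- n)%:~R = - ((n_ * n%:~R * t + 1) / (n_ * t)).
  by rewrite /fricke mulrNz; field; rewrite n0 t0.
rewrite e2 /s; move: (lE t) (n%:~R : C) (twopii R) tp0 (r%:R : C) => u v p p0 q.
by field; rewrite n0 t0 p0.
Qed.

End Level.

(** * Descent under the Fricke involution *)

Section Descent.
Variable R : realType.
Local Notation C := (cplx R).
Local Notation H := (@upper_half R).
Implicit Types (t : C) (f : C -> C).

Lemma expr_small (d e : R) : 0 <= d < 1 -> 0 < e -> exists k, d ^+ k < e.
Proof.
move=> /andP[d0 d1] e0.
have h : (fun n => d ^+ n) @ \oo --> (0 : R) by apply: cvg_expr; rewrite ger0_norm.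
have /cvgrPdist_lt /(_ e e0) [k _ hk] := h.
by exists k; have := hk k (leqnn k); rewrite /= sub0r normrN ger0_norm // exprn_ge0.
Qed.

Lemma Re_addz t (n : int) : complex.Re (t + n%:~R) = complex.Re t + n%:~R.
Proof. by rewrite ReD; have [x [-> ->]] := @intC_real R n. Qed.
Lemma Im_addz t (n : int) : complex.Im (t + n%:~R) = complex.Im t.
Proof. by rewrite ImD; have [x [-> ->]] := @intC_real R n; rewrite /= addr0. Qed.

Lemma centered (x : R) : exists n : int, `|x + n%:~R| <= 1 / 2.
Proof.
exists (- Num.floor (x + 1 / 2)); rewrite mulrNz.
have h1 := floor_le (x + 1 / 2); have h2 := floorD1_gt (x + 1 / 2).
rewrite intrD in h2; rewrite ler_norml; apply/andP; split; lra.
Qed.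

Lemma ImNV t : complex.Im (- t^-1) = complex.Im t / nm t ^+ 2.
Proof. by rewrite -[RHS]opprK -ImV; case: (t^-1). Qed.

Lemma Im_fricke N t : (0 < N)%N ->
  complex.Im (fricke N t) = complex.Im t / (N%:R * nm t ^+ 2).
Proof.
move=> N0; rewrite /fricke ImNV Im_natM nmM nm_nat.
have N0' : (N%:R : R) != 0 by rewrite pnatr_eq0 -lt0n.
have [->|z0] := eqVneq (nm t) 0; first by rewrite !mulr0 expr0n /= !mulr0 invr0 !mulr0.
by field; rewrite N0' z0.
Qed.

(* Below height [y1] and in the strip |Re t| <= 1/2 one has N |t|^2 <= N (1/4 + y1^2) < 1,
   so the involution raises the imaginary part by a fixed factor. *)
Lemma fricke_descent N (y1 : R) (Q : C -> Prop) : (0 < N)%N -> 0 < y1 ->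
  N%:R * (1 / 4 + y1 ^+ 2) < 1 ->
  (forall t (n : int), H t -> Q (t + n%:~R) -> Q t) ->
  (forall t, H t -> Q (fricke N t) -> Q t) ->
  (forall t, H t -> `|complex.Re t| <= 1 / 2 -> y1 <= complex.Im t -> Q t) ->
  forall t, H t -> Q t.
Proof.
move=> N0 y0 hd QT QW QB; set d := N%:R * _ in hd.
have N0' : 0 < (N%:R : R) by rewrite ltr0n.
have d0 : 0 < d by rewrite mulr_gt0 // addr_gt0 ?exprn_gt0 //; lra.
suff main k : forall t, H t -> y1 * d ^+ k <= complex.Im t -> Q t.
  move=> t ht; have [|k hk] := @expr_small d (complex.Im t / y1) _ (divr_gt0 ht y0).
    by rewrite (ltW d0) hd.
  by apply: (main k) => //; rewrite mulrC -ler_pdivlMr // ltW.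
elim: k => [|k IH] t0 ht0 h0.
  have [n hn] := centered (complex.Re t0); apply: (QT _ n) => //.
  by apply: QB; [exact: upper_addz|rewrite Re_addz|rewrite Im_addz; rewrite expr0 mulr1 in h0].
have [n hn] := centered (complex.Re t0); apply: (QT _ n) => //.
have ht := upper_addz n ht0; rewrite -(Im_addz t0 n) in h0; rewrite -Re_addz in hn.
move: (t0 + _) ht h0 hn => t ht h hn.
have [yt|yt] := leP y1 (complex.Im t); first exact: QB.
apply: QW => //; apply: IH; first exact: fricke_upper.
have i0 : 0 < complex.Im t by [].
rewrite Im_fricke // sqr_nm.
have le : N%:R * (complex.Re t ^+ 2 + complex.Im t ^+ 2) <= d.
  rewrite /d ler_pM2l //.
  have : complex.Re t ^+ 2 <= 1 / 4.
    by rewrite -real_normK ?num_real //; move: (normr_ge0 (complex.Re t)) => ?; nra.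
  nra.
have p0 : 0 < N%:R * (complex.Re t ^+ 2 + complex.Im t ^+ 2).
  by rewrite mulr_gt0 // ltr_wpDl ?sqr_ge0 // exprn_gt0.
rewrite ler_pdivlMr //; apply: le_trans h; rewrite (exprSr d) (mulrA y1) ler_pM2l //.
by rewrite mulr_gt0 // exprn_gt0.
Qed.

(* Invariance reduces the bound to large imaginary part, where the coefficient
   estimate improves |f| <= M to |f| <= th M with th < 1; iterate. *)
Lemma invariant_eq0 N (y1 : R) f a : (0 < N)%N -> 57 / 200 <= y1 ->
  N%:R * (1 / 4 + y1 ^+ 2) < 1 -> qser f a -> a 0%N = 0 ->
  (forall t, H t -> f (fricke N t) = f t) -> forall t, H t -> f t = 0.
Proof.
move=> N0 y1l hd qf a0 fw.
have y0 : 0 < y1 by lra.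
have spread M : (forall t, H t -> y1 <= complex.Im t -> nm (f t) <= M) ->
    forall t, H t -> nm (f t) <= M.
  move=> hM; apply: (fricke_descent N0 y0 hd).
  - by move=> t n ht; rewrite (qser_addz _ qf).
  - by move=> t ht; rewrite fw.
  - by move=> t ht _; exact: hM.
have small t : y1 <= complex.Im t -> nm (nome t) <= expR (- (2 * pi * y1)).
  by move=> h; rewrite nm_nome ler_expR lerN2 ler_pM2l // mulr_gt0 // pi_gt0.
have e1 : expR (- (2 * pi * y1)) < 1 :> R.
  by rewrite -[ltRHS]expR0 ltr_expR oppr_lt0 mulr_gt0 // mulr_gt0 // pi_gt0.
have ta := qser_tame qf; have fE := qf.2.
have [M hM] : exists M, forall t, H t -> nm (f t) <= M.
  have [M hM] := ev_bound ta (expR_ge0 _) e1; exists M; apply: spread => t ht hy.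
  by rewrite fE //; apply/hM/small.
(* Coefficients are estimated at height [y1 / 10] while the series is evaluated at height at least
   [y1], so the n-th term gains [rho ^+ n]. *)
pose rho : R := expR (- (2 * pi * (y1 * (9 / 10)))).
have rho0 : 0 < rho by exact: expR_gt0.
(* With [57 / 200 <= y1] and pi >= 2 the exponent exceeds 1, hence exp of it exceeds 2 and [rho] is
   below 1/2. The geometric tail from index 1 then has sum [th = rho / (1 - rho) < 1]; this is the
   origin of 57/200. *)
have rho2 : rho < 100 / 201.
  have X1 : rho * expR (2 * pi * (y1 * (9 / 10))) = 1 by rewrite /rho -expRD addNr expR0.
  have X2 := expR_ge1Dx (2 * pi * (y1 * (9 / 10)) : R); have hp := pi_ge2 R.
  have : 2 * (57 / 200) <= pi * y1 by apply: ler_pM => //; lra.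
  by move: (expR _) X1 X2 => X; nra.
pose th := rho / (1 - rho).
have th0 : 0 <= th.
  by apply: divr_ge0; [exact: ltW|rewrite subr_ge0; apply: ltW (lt_trans rho2 _); lra].
have th1 : th < 1 by rewrite ltr_pdivrMr; lra.
have step B : (forall t, H t -> nm (f t) <= B) -> forall t, H t -> nm (f t) <= th * B.
  move=> hB; apply: spread => t ht hy.
  have B0 : 0 <= B by apply: le_trans (hB t ht); exact: nm_ge0.
  have ca n : nm (a n) * nm (nome (0 +i* (y1 / 10) : C)) ^+ n <= B.
    by apply: (qser_coef_le n _ qf) => [|x]; [lra|apply: hB; rewrite /upper_half /=; lra].
  have term n : nm (a n * nome t ^+ n) <= B * rho ^+ n.
    have /= n0 := nome_neq0 (0 +i* (y1 / 10) : C).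
    have n1 : 0 < nm (nome (0 +i* (y1 / 10) : C)) ^+ n by rewrite exprn_gt0 // nm_gt0.
    rewrite nmM nmX; apply: le_trans (_ : _ <= (nm (a n) * nm (nome (0 +i* (y1 / 10) : C)) ^+ n) * rho ^+ n) _; last first.
      by rewrite ler_wpM2r // exprn_ge0 // ltW.
    rewrite -mulrA ler_wpM2l ?nm_ge0 // -exprMn lerXn2r ?nnegrE ?mulr_ge0 ?nm_ge0 ?(ltW rho0) //.
    apply: le_trans (small _ hy) _; rewrite nm_nome /= /rho -expRD ler_expR.
    by rewrite le_eqVlt; apply/orP; left; apply/eqP; field.
  have sm : abs_summable (fun n => a n * nome t ^+ n) (th * B).
    case=> [|n]; first by rewrite big_nil mulr_ge0.
    rewrite big_nat_recl // a0 mul0r nm0 add0r.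
    apply: le_trans (_ : _ <= \sum_(0 <= k < n) (B * rho) * rho ^+ k) _.
      by apply: ler_sum => k _; rewrite -mulrA -exprS.
    have -> : th * B = B * rho * (1 - rho)^-1 by rewrite /th; ring.
    rewrite -mulr_sumr; apply: ler_wpM2l; first by apply: mulr_ge0 => //; exact: ltW.
    by apply: geom_le; [exact: ltW|apply: lt_trans rho2 _; lra].
  by rewrite fE //; exact: csum_le sm.
have it k : forall t, H t -> nm (f t) <= th ^+ k * M.
  elim: k => [|k IH]; first by move=> t; rewrite mul1r; exact: hM.
  by rewrite exprS -mulrA; exact: step.
move=> t ht; apply/eqP; rewrite -nm_eq0; apply/negP => /negP ne.
have p0 : 0 < nm (f t) by rewrite lt_neqAle eq_sym ne nm_ge0.
have M0 : 0 < M by apply: lt_le_trans (hM t ht).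
have [|k hk] := @expr_small th (nm (f t) / M) _ (divr_gt0 p0 M0); first by rewrite th0 th1.
have := it k t ht; rewrite leNgt => /negP; apply.
by rewrite -ltr_pdivlMr.
Qed.

End Descent.

(** * The vanishing lemma and first coefficients *)

Section Vanish.
Variable R : realType.
Local Notation C := (cplx R).
Local Notation H := (@upper_half R).
Implicit Types (t : C) (f : C -> C).

Lemma qser_nomeM f a : qser f a -> qser (fun t => nome t * f t) (ps_cons 0 a).
Proof.
move=> [ta fE]; split; first exact: tame_cons.
move=> t ht; rewrite fE // (ev_shift (tame_cons 0 ta)) ?add0r //; exact: nm_nome_lt1.
Qed.

Lemma qser_nomeX n : exists a, qser (fun t : C => nome t ^+ n) a.
Proof.
elim: n => [|n [a IH]].
  by exists (ps_cons 1 (fun=> 0)); apply: eq_qser (qser_cst 1) => t _; rewrite expr0.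
by exists (ps_cons 0 a); apply: eq_qser (qser_nomeM IH) => t _; rewrite exprS.
Qed.

Lemma qser_drop f a s : qser f a -> (forall n, (n < s)%N -> a n = 0) ->
  exists g b, qser g b /\ forall t, H t -> f t = nome t ^+ s * g t.
Proof.
move=> [ta fE] h; exists (fun t => ev (fun n => a (s + n)%N) (nome t)), (fun n => a (s + n)%N).
have hd t : H t -> nm (nome t) < 1 := @nm_nome_lt1 R t.
split; last by move=> t ht; rewrite fE //; have [_ ->] := ev_shiftn ta (hd t ht) h.
split=> //; have [|t1 _] := @ev_shiftn R a s 0 ta _ h => //; by rewrite nm0 ltr01.
Qed.

Variables (N r : nat) (k0 : C) (y1 : R).
Hypotheses (N1 : (1 < N < 5)%N) (rN : (r * N.+1 = 12)%N) (k00 : k0 != 0).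
Hypotheses (y1l : 57 / 200 <= y1) (hy1 : N%:R * (1 / 4 + y1 ^+ 2) < 1).
Let N0 : (0 < N)%N. Proof. by case/andP: N1; lia. Qed.
Local Notation FB := (@lFB R N r).
Local Notation FC := (@lFC R N r k0).

(** In the product of [f] with its companion the unknown constant cancels, because the involution is
    applied to both factors. *)
Lemma companion_prod k f f' t : companion N k f f' -> H t ->
  f (fricke N t) * f' (fricke N t) = (- N%:R * t ^+ 2) ^+ k * (f t * f' t).
Proof.
move=> [kap kap0 h] ht; have t0 := upper_neq0 ht; have n0 := @natC_neq0 R N N0.
have hw := fricke_upper N0 ht; have w0 := upper_neq0 hw.
rewrite h //; have := h _ hw; rewrite frickeK // => ->.
have -> : (- N%:R * t ^+ 2) ^+ k * (kap * fricke N t ^+ k * f' (fricke N t) * f' t) =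
  kap * (- N%:R * t ^+ 2 * fricke N t) ^+ k * f' (fricke N t) * f' t by rewrite [in RHS]exprMn; ring.
have -> : - N%:R * t ^+ 2 * fricke N t = t by rewrite /fricke; field; rewrite n0 t0.
by ring.
Qed.

Lemma qser_lb_inv : exists a, qser (fun t => (@lb R N r t)^-1) a.
Proof.
have tc : tame (fun n => r%:R^-1 * @lEhc R N n) by apply: tameZ; exact: qser_tame (qser_lEh N1 rN k00).
have c0 : r%:R^-1 * @lEhc R N 0 = 0 by rewrite lEhc0 // mulr0.
eexists; apply: eq_qser (qser_psexp (tameZ (-1) tc)) => t ht.
have e := psexpf_inv tc c0 ht; rewrite -/(lb N r t) in e.
have b0 := lb_neq0 N1 rN k00 ht; apply: (mulfI b0); rewrite e divff //.
Qed.

Lemma qser_lc_inv : exists a, qser (fun t => (@lc R N r t)^-1) a.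
Proof.
have tc : tame (fun n => r%:R^-1 * (@lEc R N n - ps_cons 1 (fun=> 0) n)).
  by apply: tameZ; exact: qser_tame (qserB (qser_lE N1 rN k00) (qser_cst 1)).
have c0 : r%:R^-1 * (@lEc R N 0 - ps_cons 1 (fun=> 0) 0%N) = 0 by rewrite (lEc0 N1 rN k00) /= subrr mulr0.
eexists; apply: eq_qser (qser_psexp (tameZ (-1) tc)) => t ht.
have e := psexpf_inv tc c0 ht; rewrite -/(lc N r t) in e.
have b0 := lc_neq0 N1 rN k00 ht; apply: (mulfI b0); rewrite e divff //.
Qed.

(* The quotient [(G G')^m / (FB FC)^n] has weight 0, is invariant under the
   Fricke involution and vanishes at the cusp. *)
Lemma vanish G G' a a' s k m n : qser G a -> qser G' a' -> (forall i, (i < s)%N -> a i = 0) ->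
  companion N k G G' -> (m * k = n * r)%N -> (n < s * m)%N -> forall t, H t -> G t = 0.
Proof.
move=> qG qG' hs cG mk nsm.
have [G1 [b1 [qG1 eG]]] := qser_drop qG hs.
have [bi qbi] := qser_lb_inv; have [ci qci] := qser_lc_inv.
have [x1 q1] := qserX m qG1; have [x2 q2] := qserX m qG'.
have [x3 q3] := qserX r qbi; have [x4 q4] := qserX r qci.
have [x5 q5] := qserX n (qserZ k0^-1 (qserM q3 q4)).
(* [G ^+ m] vanishes to order at least [s * m] at the cusp and [FC ^+ n] to order [n]; one power of
   q is set aside so that the quotient visibly has no constant term. *)
have [x6 q6] := @qser_nomeX (s * m - n.+1).
have qpsi := qser_nomeM (qserM q6 (qserM (qserM q1 q2) q5)).
pose psi t := (G t * G' t) ^+ m / (FB t * FC t) ^+ n.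
have epsi : forall t, H t -> nome t * (nome t ^+ (s * m - n.+1) *
    (G1 t ^+ m * G' t ^+ m * (k0^-1 * ((lb N r t)^-1 ^+ r * (lc N r t)^-1 ^+ r)) ^+ n)) = psi t.
  move=> t ht; rewrite /psi /lFB /lFC (eG _ ht).
  have b0 := lb_neq0 N1 rN k00 ht; have c0 := lc_neq0 N1 rN k00 ht; have e0 := nome_neq0 t.
  have -> : k0^-1 * ((lb N r t)^-1 ^+ r * (lc N r t)^-1 ^+ r) =
     nome t / (lb N r t ^+ r * (k0 * nome t * lc N r t ^+ r)).
    rewrite !exprVn; have := expf_neq0 r b0; have := expf_neq0 r c0.
    move: (lb N r t ^+ r) (lc N r t ^+ r) => u v v0 u0; field.
    by rewrite e0 v0 u0 k00.
  move: (lb N r t ^+ r * _) => D; move: (nome t) (G1 t) (G' t) => u v w.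
  rewrite !expr_div_n !exprMn -exprM.
  have hd : (s * m = (s * m - n.+1) + n.+1)%N by rewrite subnK.
  move: (s * m - n.+1)%N hd => d ->.
  rewrite exprD exprS; move: (u ^+ d) (u ^+ n) (D ^+ n) => x1' x2' x3'; ring.
have inv : forall t, H t -> psi (fricke N t) = psi t.
  move=> t ht.
  have [tB tC] := (lFB_neq0 N1 rN k00 ht, lFC_neq0 N1 rN k00 ht).
  have e1 := companion_prod cG ht; have e2 := companion_prod (lFB_companion N1 rN k00) ht.
  transitivity (((- N%:R * t ^+ 2) ^+ k * (G t * G' t)) ^+ m /
     ((- N%:R * t ^+ 2) ^+ r * (FB t * FC t)) ^+ n).
    by congr (_ ^+ m / _ ^+ n); [exact: e1|exact: e2].
  rewrite /psi; have t0 := upper_neq0 ht; have n0 := @natC_neq0 R N N0.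
  have z0 : - N%:R * t ^+ 2 != 0 :> C by rewrite mulf_neq0 ?oppr_eq0 // expf_neq0.
  move: (G t * G' t) (FB t * FC t) (- N%:R * t ^+ 2) z0 => u v z z0.
  rewrite !exprMn -!exprM [(k * m)%N]mulnC mk [(r * n)%N]mulnC.
  have x0 := expf_neq0 (n * r) z0.
  by rewrite -mulf_div divff // mul1r.
have psi0 : forall t, H t -> psi t = 0.
  exact: (invariant_eq0 N0 y1l hy1 (eq_qser epsi qpsi) (erefl _) inv).
have GG : forall t, H t -> G t * G' t = 0.
  move=> t ht; have := psi0 t ht; rewrite /psi => /eqP; rewrite mulf_eq0 invr_eq0.
  have [tB tC] := (lFB_neq0 N1 rN k00 ht, lFC_neq0 N1 rN k00 ht).
  rewrite [X in _ || X]expf_eq0 [X in _ || (_ && X)](negbTE (mulf_neq0 tB tC)) andbF orbF.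
  by rewrite expf_eq0 => /andP[_ /eqP].
have [//|z] := qser_mul_eq0 qG qG' GG.
have [kap kap0 h] := companion_sym N0 cG.
move=> t ht; have hw := fricke_upper N0 ht; have t0 := upper_neq0 ht.
have := h t ht; rewrite (z _ hw) => /esym/eqP; rewrite mulf_eq0 mulf_eq0 (negbTE kap0) /=.
by rewrite expf_eq0 (negbTE t0) andbF /= => /eqP.
Qed.

(** The constant is absorbed into [f'], which makes the relation stable under sums and differences,
    unlike [companion]. *)
Definition comp1 k f f' := forall t, H t -> f (fricke N t) = t ^+ k * f' t.

Lemma comp1_companion k f f' : comp1 k f f' -> companion N k f f'.
Proof. by move=> h; exists 1; [exact: oner_neq0|move=> t ht; rewrite h // mul1r]. Qed.

Lemma companion_comp1 k f f' : companion N k f f' ->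
  exists2 kap : C, kap != 0 & comp1 k f (fun t => kap * f' t).
Proof. by move=> [kap k0' h]; exists kap => // t ht; rewrite h // mulrCA mulrA. Qed.

Lemma comp1B k f g f' g' : comp1 k f f' -> comp1 k g g' ->
  comp1 k (fun t => f t - g t) (fun t => f' t - g' t).
Proof. by move=> h1 h2 t ht; rewrite h1 // h2 // mulrBr. Qed.

Lemma comp1D k f g f' g' : comp1 k f f' -> comp1 k g g' ->
  comp1 k (fun t => f t + g t) (fun t => f' t + g' t).
Proof. by move=> h1 h2 t ht; rewrite h1 // h2 // mulrDr. Qed.

Lemma comp1X k f f' n : comp1 k f f' -> comp1 (k * n) (fun t => f t ^+ n) (fun t => f' t ^+ n).
Proof. by move=> h1 t ht; rewrite h1 // exprMn exprM. Qed.

Lemma comp1V k l f g f' g' : (forall t, H t -> g' t != 0) -> comp1 (k + l) f f' -> comp1 l g g' ->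
  comp1 k (fun t => f t / g t) (fun t => f' t / g' t).
Proof.
move=> g0 h1 h2 t ht; rewrite h1 // h2 // exprD; have t0 := upper_neq0 ht.
by have := g0 t ht; have := expf_neq0 l t0; move: (t ^+ l) => x x0 y0; field; rewrite x0 y0.
Qed.

(** Two coefficients are all that the vanishing lemma asks for in the weights occurring here. *)
Definition qjet f (x y : C) := exists a, [/\ qser f a, a 0%N = x & a 1%N = y].

Lemma qjet_eq f x y x' y' : qjet f x y -> x = x' -> y = y' -> qjet f x' y'.
Proof. by move=> h <- <-. Qed.
Lemma eq_qjet f g x y : (forall t, H t -> f t = g t) -> qjet f x y -> qjet g x y.
Proof. by move=> e [a [q a0 a1]]; exists a; split=> //; exact: eq_qser e q. Qed.
Lemma qjet_cst x : qjet (fun=> x) x 0.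
Proof. by exists (ps_cons x (fun=> 0)); split=> //; exact: qser_cst. Qed.
Lemma qjetD f g x y x' y' : qjet f x y -> qjet g x' y' -> qjet (fun t => f t + g t) (x + x') (y + y').
Proof.
by move=> [a [q a0 a1]] [b [p b0 b1]]; exists (fun n => a n + b n); split; [exact: qserD|rewrite a0 b0|rewrite a1 b1].
Qed.
Lemma qjetB f g x y x' y' : qjet f x y -> qjet g x' y' -> qjet (fun t => f t - g t) (x - x') (y - y').
Proof.
by move=> [a [q a0 a1]] [b [p b0 b1]]; exists (fun n => a n - b n); split; [exact: qserB|rewrite a0 b0|rewrite a1 b1].
Qed.
Lemma qjetZ z f x y : qjet f x y -> qjet (fun t => z * f t) (z * x) (z * y).
Proof.
by move=> [a [q a0 a1]]; exists (fun n => z * a n); split; [exact: qserZ|rewrite a0|rewrite a1].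
Qed.
Lemma qjetM f g x y x' y' : qjet f x y -> qjet g x' y' ->
  qjet (fun t => f t * g t) (x * x') (x * y' + y * x').
Proof.
move=> [a [q <- <-]] [b [p <- <-]]; exists (cprod a b); split; first exact: qserM.
  by rewrite /cprod big_nat1.
by rewrite /cprod big_nat_recr //= big_nat1.
Qed.
Lemma qjetX f y n : qjet f 1 y -> qjet (fun t => f t ^+ n) 1 (n%:R * y).
Proof.
move=> h; elim: n => [|n IH]; first by rewrite mul0r; apply: eq_qjet (qjet_cst 1) => t _; rewrite expr0.
apply: qjet_eq (eq_qjet _ (qjetM h IH)) _ _; [by move=> t _; rewrite exprS|by rewrite mulr1|].
by rewrite mulr1 mul1r -[n.+1%:R](@natr1 C n) mulrDl mul1r.
Qed.
Lemma qjet_qD f x y : qjet f x y -> qjet (qD f) 0 y.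
Proof.
move=> [a [q _ <-]]; exists (fun n => n%:R * a n); split; first exact: qser_qD.
  by rewrite mul0r.
by rewrite mul1r.
Qed.

Lemma qjet_lFB : qjet FB 1 (@lEhc R N 1).
Proof.
apply: qjet_eq (qjetX r (_ : qjet (lb N r) 1 (r%:R^-1 * lEhc R N 1))) _ _ => //.
  exists (psexp (fun n => r%:R^-1 * lEhc R N n)); split; first exact: qser_lb N1 rN k00.
    exact: psexp0.
  by have := psexpS (fun n => r%:R^-1 * lEhc R N n) 0; rewrite mul1r big_nat1 psexp0 mulr1.
by rewrite mulrA divff ?mul1r //; apply: natC_neq0; case: (r) rN.
Qed.

Lemma qjet_lFC : qjet FC 0 k0.
Proof.
have h : qjet (fun t => lc N r t ^+ r) 1 (r%:R * psexp (fun n => r%:R^-1 * (@lEc R N n - ps_cons 1 (fun=> 0) n)) 1).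
  apply: qjetX; exists (psexp (fun n => r%:R^-1 * (@lEc R N n - ps_cons 1 (fun=> 0) n))).
  by split; [exact: qser_lc N1 rN k00|exact: psexp0|].
have hn : qjet (fun t : C => nome t) 0 1.
  exists (ps_cons 0 (ps_cons 1 (fun=> 0))); split=> //.
  by apply: eq_qser (qser_nomeM (qser_cst 1)) => t _; rewrite mulr1.
apply: qjet_eq (eq_qjet _ (qjetM (qjetZ k0 hn) h)) _ _ => //.
  by rewrite mulr0 mul0r.
by rewrite mulr0 mul0r add0r mulr1 mulr1.
Qed.

End Vanish.

(** * Forms common to levels 2 and 3 *)

Section LevelForms.
Variable R : realType.
Local Notation C := (cplx R).
Local Notation H := (@upper_half R).
Implicit Types (t : C) (f : C -> C).
Variables (N r : nat) (k0 : C).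
Hypotheses (N1 : (1 < N < 5)%N) (rN : (r * N.+1 = 12)%N) (k00 : k0 != 0).
Let N0 : (0 < N)%N. Proof. by case/andP: N1; lia. Qed.
Let n0 : N%:R != 0 :> C. Proof. exact: natC_neq0. Qed.
Local Notation E := (@lE R N).
Local Notation Eh := (@lEh R N).
Local Notation FB := (@lFB R N r).
Local Notation FC := (@lFC R N r k0).
Local Notation e1 := (24 / (N%:R ^+ 2 - 1) : C).
Local Notation h1 := (- 24 * N%:R / (N%:R ^+ 2 - 1) : C).

Lemma qD_lE_fricke t : H t -> qD E (fricke N t) = N%:R ^+ 2 * t ^+ 4 * qD Eh t +
  2 * N%:R ^+ 2 * t ^+ 3 * Eh t / twopii R + N%:R ^+ 2 * r%:R * t ^+ 2 / twopii R ^+ 2.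
Proof.
move=> ht; have hw := fricke_upper N0 ht; have t0 := upper_neq0 ht; have p0 := @twopii_neq0 R.
have hl := cder_comp (cder_fricke N1 rN k00 ht) (qser_cderD (qser_lE N1 rN k00) hw).
have hr := cderD (cderM (cderZ N%:R (cderX 2 (cder_id t))) (qser_cderD (qser_lEh N1 rN k00) ht))
  (cderZ (N%:R * r%:R / twopii R) (cder_id t)).
have e x : H x -> E (fricke N x) = N%:R * x ^+ 2 * Eh x + N%:R * r%:R / twopii R * x.
  by move=> hx; rewrite (lE_fricke N1 rN k00) //; congr (_ + _); rewrite mulrAC.
have := cderE (cder_upper ht e hl); rewrite (cderE hr).
move: (qD E _) (qD Eh t) (Eh t) (r%:R : C) (twopii R) p0 => x y z s p p0 h.
have -> : x = N%:R * t ^+ 2 / p * (p * x * (N%:R * t ^+ 2)^-1) by field; rewrite p0 n0 t0.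
by rewrite -h; field.
Qed.

(** With this coefficient [r] the anomalies of the square and of the derivative cancel, so a modular
    form of weight 4 results; [lXh] is its transform under the involution. *)
Definition lX t := E t ^+ 2 - r%:R * qD E t.
Definition lXh t := N%:R ^+ 2 * (Eh t ^+ 2 - r%:R * qD Eh t).

Lemma comp1_lX : comp1 N 4 lX lXh.
Proof.
move=> t ht; rewrite /lX /lXh qD_lE_fricke // (lE_fricke N1 rN k00) //.
have p0 := @twopii_neq0 R.
by move: (qD Eh t) (Eh t) (r%:R : C) (twopii R) p0 => y z s p p0; field.
Qed.

Lemma qjet_lE : qjet E 1 e1.
Proof.
exists (lEc R N); split; [exact: qser_lE N1 rN k00|exact: lEc0 N1 rN k00|exact: lEc1 N1 rN k00].
Qed.
Lemma qjet_lEh : qjet Eh 0 h1.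
Proof.
exists (lEhc R N); split; [exact: qser_lEh N1 rN k00|exact: lEhc0|exact: lEhc1 N1 rN k00].
Qed.
Lemma qjet_lW : qjet (lW N) 1 (24 / (N%:R - 1) : C).
Proof.
exists (lWc R N); split; [exact: qser_lW N1 rN k00|exact: lWc0 N1 rN k00|exact: lWc1 N1 rN k00].
Qed.

Lemma qjet_lX : qjet lX 1 (2 * e1 - r%:R * e1).
Proof.
apply: qjet_eq (qjetB (qjetX 2 qjet_lE) (qjetZ r%:R (qjet_qD qjet_lE))) _ _ => //.
by rewrite mulr0 subr0.
Qed.

Lemma qjet_lXh : exists y, qjet lXh 0 y.
Proof.
eexists; apply: qjet_eq (qjetZ (N%:R ^+ 2) (qjetB (qjetM qjet_lEh qjet_lEh) (qjetZ r%:R (qjet_qD qjet_lEh)))) _ (erefl _).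
by rewrite !mulr0 subr0 mulr0.
Qed.

Lemma qjet_lFBV : qjet (fun t => (FB t)^-1) 1 (- h1).
Proof.
have tc : tame (fun n => r%:R^-1 * @lEhc R N n) by apply: tameZ; exact: qser_tame (qser_lEh N1 rN k00).
have c0 : r%:R^-1 * @lEhc R N 0 = 0 by rewrite lEhc0 // mulr0.
have hi : qjet (fun t => (@lb R N r t)^-1) 1 (- (r%:R^-1 * h1)).
  exists (psexp (fun n => -1 * (r%:R^-1 * lEhc R N n))); split; [|exact: psexp0|].
    apply: eq_qser (qser_psexp (tameZ (-1) tc)) => t ht.
    have e := psexpf_inv tc c0 ht; rewrite -/(lb N r t) in e.
    have b0 := lb_neq0 N1 rN k00 ht; apply: (mulfI b0); rewrite e divff //.
  have := psexpS (fun n => -1 * (r%:R^-1 * lEhc R N n)) 0; rewrite mul1r big_nat1 psexp0 mulr1 => ->.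
  by rewrite (lEhc1 N1 rN k00) mulN1r.
apply: qjet_eq (eq_qjet _ (qjetX r hi)) _ _ => //; first by move=> t ht; rewrite exprVn.
by rewrite mulrN mulrA divff ?mul1r //; apply: natC_neq0; case: (r) rN.
Qed.

Lemma qser_lFCV f a : qser f a -> a 0%N = 0 -> exists b, qser (fun t => f t / FC t) b.
Proof.
move=> qf a0; have [|g [b [qg eg]]] := @qser_drop R f a 1 qf; first by case.
have [ci qci] := qser_lc_inv N1 rN k00; have [x qx] := qserX r qci.
exists (cprod b (fun n => k0^-1 * x n)); apply: eq_qser (qserM qg (qserZ k0^-1 qx)) => t ht.
rewrite (eg _ ht) expr1 /lFC exprVn.
have e0 := nome_neq0 t; have l0 := expf_neq0 r (lc_neq0 N1 rN k00 ht).
by move: (lc N r t ^+ r) (g t) (nome t) l0 e0 => u v w u0 w0; field; rewrite u0 w0 k00.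
Qed.

Definition lFA t := FB t + FC t.

Lemma lFB_comp1 : exists2 kap : C, kap != 0 & comp1 N r FB (fun t => kap * FC t).
Proof. exact: companion_comp1 (lFB_companion N1 rN k00). Qed.
Lemma lFC_comp1 : exists2 kap : C, kap != 0 & comp1 N r FC (fun t => kap * FB t).
Proof. exact: companion_comp1 (lFC_companion N1 rN k00). Qed.

Lemma qjet_has_ord0 f x y : x != 0 -> qjet f x y -> has_ord f 0.
Proof. by move=> x0 [a [q a0 _]]; exists a; split=> //; rewrite a0. Qed.
Lemma qjet_has_ord1 f y : y != 0 -> qjet f 0 y -> has_ord f 1.
Proof. by move=> x0 [a [q a0 a1]]; exists a; split=> //; [case|rewrite a1]. Qed.

Lemma ord_lFB : has_ord FB 0.
Proof. exact: qjet_has_ord0 (oner_neq0 _) (qjet_lFB N1 rN k00). Qed.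
Lemma ord_lFC : has_ord FC 1.
Proof. exact: qjet_has_ord1 k00 (qjet_lFC N1 rN k00). Qed.
Lemma ord_lFA : has_ord lFA 0.
Proof.
have q := qjetD (qjet_lFB N1 rN k00) (qjet_lFC N1 rN k00); apply: qjet_has_ord0 q.
by rewrite addr0 oner_neq0.
Qed.

Lemma lFA_companion : exists2 f, companion N r lFA f & has_ord f 0.
Proof.
have [k1 k10 c1] := lFB_comp1; have [k2 k20 c2] := lFC_comp1.
exists (fun t => k1 * FC t + k2 * FB t); first exact: comp1_companion (comp1D c1 c2).
have q := qjetD (qjetZ k1 (qjet_lFC N1 rN k00)) (qjetZ k2 (qjet_lFB N1 rN k00)).
by apply: qjet_has_ord0 q; rewrite mulr0 add0r mulr1.
Qed.

End LevelForms.

(** * Level 2 *)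

Section LevelTwo.
Variable R : realType.
Local Notation C := (cplx R).
Local Notation H := (@upper_half R).
Implicit Types (t : C).

Lemma N1_2 : (1 < 2 < 5)%N. Proof. by []. Qed.
Lemma rN_2 : (4 * 3 = 12)%N. Proof. by []. Qed.
Lemma k00_2 : 64 != 0 :> C. Proof. by rewrite pnatr_eq0. Qed.
Lemma y1l_2 : 57 / 200 <= 2 / 5 :> R. Proof. lra. Qed.
Lemma hy1_2 : 2%:R * (1 / 4 + (2 / 5) ^+ 2) < 1 :> R. Proof. lra. Qed.
Local Notation E := (@lE R 2).
Local Notation W := (@lW R 2).
Local Notation FB := (@lFB R 2 4).
Local Notation FC := (@lFC R 2 4 64).

(** The weight 4 equals r, so one factor [FB * FC] balances [G * G'], and a double zero at the cusp
    beats the simple zero of [FC]. *)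
Lemma vanish_qjet2 G G' a' : qjet G 0 0 -> qser G' a' -> companion 2 4 G G' -> forall t, H t -> G t = 0.
Proof.
move=> [a [q a0 a1]] q' c.
by apply: (vanish N1_2 rN_2 k00_2 y1l_2 hy1_2 (s:=2) (m:=1) (n:=1) q q' _ c) => // -[|[|]].
Qed.

(** Both sides have weight 4 and begin with 1 - 16 q. *)
Lemma riccati_2 t : H t -> E t ^+ 2 - 4 * qD E t = FB t.
Proof.
have [kap kap0 c2] := lFB_comp1 N1_2 rN_2 k00_2.
have [y [b [qb _ _]]] := qjet_lXh N1_2 rN_2 k00_2.
have [b' [qb' _ _]] := qjet_lFC N1_2 rN_2 k00_2.
have q : qjet (fun t => lX 2 4 t - FB t) 0 0.
  apply: qjet_eq (qjetB (qjet_lX N1_2 rN_2 k00_2) (qjet_lFB N1_2 rN_2 k00_2)) _ _; first by rewrite subrr.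
  by rewrite (lEhc1 N1_2 rN_2 k00_2); field.
have v := vanish_qjet2 q (qserB qb (qserZ kap qb')) (comp1_companion (comp1B (comp1_lX N1_2 rN_2 k00_2) c2)).
by move=> ht; have /eqP := v t ht; rewrite subr_eq0 => /eqP.
Qed.

(** Both sides have weight 4 and begin with 1 + 48 q; the coefficient 48 = -16 + 64 is what fixes
    the normalization of [FC]. *)
Lemma W_sqr_2 t : H t -> W t ^+ 2 = FB t + FC t.
Proof.
have [k1 k10 c1] := lFB_comp1 N1_2 rN_2 k00_2; have [k2 k20 c2] := lFC_comp1 N1_2 rN_2 k00_2.
have [b' [qb' _ _]] := qjet_lFC N1_2 rN_2 k00_2; have [b [qb _ _]] := qjet_lFB N1_2 rN_2 k00_2.
have cW : comp1 2 2 W (fun t => - 2 * W t).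
  by move=> x hx; rewrite (lW_fricke N1_2 rN_2 k00_2) //; ring.
have q : qjet (fun t => W t ^+ 2 - (FB t + FC t)) 0 0.
  apply: qjet_eq (qjetB (qjetX 2 (qjet_lW N1_2 rN_2 k00_2))
    (qjetD (qjet_lFB N1_2 rN_2 k00_2) (qjet_lFC N1_2 rN_2 k00_2))) _ _; first by rewrite addr0 subrr.
  by rewrite (lEhc1 N1_2 rN_2 k00_2); field.
have [w qw] := qserX 2 (qserZ (- 2) (qser_lW N1_2 rN_2 k00_2)).
have v := vanish_qjet2 q (qserB qw (qserD (qserZ k1 qb') (qserZ k2 qb)))
   (comp1_companion (comp1B (comp1X 2 cW) (comp1D c1 c2))).
by move=> ht; have /eqP := v t ht; rewrite subr_eq0 => /eqP.
Qed.

Lemma E_W_2 t : H t -> lEh 2 t = E t - W t. Proof. by move=> _; exact: lEhE N1_2 rN_2 k00_2 t. Qed.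

(** Differentiating the identity for the square of [W] gives this relation multiplied by [W], which
    is then cancelled in the domain of q-series. *)
Lemma qD_W_2 t : H t -> 2 * qD W t = E t * W t - FB t.
Proof.
have qW := qser_lW N1_2 rN_2 k00_2.
have [b' [qb' _ _]] := qjet_lFC N1_2 rN_2 k00_2; have [b [qb _ _]] := qjet_lFB N1_2 rN_2 k00_2.
have qF := qserB (qserZ 2 (qser_qD qW)) (qserB (qserM (qser_lE N1_2 rN_2 k00_2) qW) qb).
have FW x : H x -> W x * (2 * qD W x - (E x * W x - FB x)) = 0.
  move=> hx; have p0 := @twopii_neq0 R.
  have l := cderX 2 (qser_cderD qW hx).
  have rr := cderD (qser_cderD qb hx) (qser_cderD qb' hx).
  have := cderE (cder_upper hx W_sqr_2 l); rewrite (cderE rr).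
  rewrite (qD_lFB N1_2 rN_2 k00_2) // (qD_lFC N1_2 rN_2 k00_2) // E_W_2 //= expr1.
  have e := W_sqr_2 hx; have -> : FC x = W x ^+ 2 - FB x by rewrite e addrC addKr.
  move: (qD W x) (W x) (E x) (FB x) (twopii R) p0 => d w a f p p0 h.
  apply: (mulfI p0); rewrite mulr0; transitivity (2%:R * w * (p * d) - p * (w * (a * w - f))); first by ring.
  by rewrite -h; ring.
have [z|z] := qser_mul_eq0 qW qF FW.
  by move=> ht; exfalso; have := qser_eq0 qW z 0%N; rewrite (lWc0 N1_2 rN_2 k00_2) => /eqP; rewrite oner_eq0.
by move=> ht; have /eqP := z t ht; rewrite subr_eq0 => /eqP.
Qed.

End LevelTwo.

(** * Level 3 *)

Section LevelThree.
Variable R : realType.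
Local Notation C := (cplx R).
Local Notation H := (@upper_half R).
Implicit Types (t : C).

Lemma N1_3 : (1 < 3 < 5)%N. Proof. by []. Qed.
Lemma rN_3 : (3 * 4 = 12)%N. Proof. by []. Qed.
Lemma k00_3 : 27 != 0 :> C. Proof. by rewrite pnatr_eq0. Qed.
(** At level 3 the height must lie below 1/sqrt(12) = 0.2886..., while [invariant_eq0] wants at
    least 0.285. *)
Lemma y1l_3 : 57 / 200 <= 57 / 200 :> R. Proof. by []. Qed.
Lemma hy1_3 : 3%:R * (1 / 4 + (57 / 200) ^+ 2) < 1 :> R. Proof. lra. Qed.
Local Notation E := (@lE R 3).
Local Notation W := (@lW R 3).
Local Notation FB := (@lFB R 3 3).
Local Notation FC := (@lFC R 3 3 27).

(** The cubic theta function a(q) = 1 + 6 q + ... of the Borweins. Defined as this quotient, it is a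
    single-valued q-series for which the Riccati equation is immediate; that it is a square root of
    [W] is proved afterwards. *)
Definition cubic_a t := lX 3 3 t * (FB t)^-1.

Lemma qjet_a : qjet cubic_a 1 6.
Proof.
apply: qjet_eq (qjetM (qjet_lX N1_3 rN_3 k00_3) (qjet_lFBV N1_3 rN_3 k00_3)) _ _; first by rewrite mulr1.
by field.
Qed.

Lemma riccati_3 t : H t -> E t ^+ 2 - 3 * qD E t = cubic_a t * FB t.
Proof. by move=> ht; rewrite /cubic_a divfK // (lFB_neq0 N1_3 rN_3 k00_3). Qed.

(** The transform is [lXh] divided by a multiple of [FC]; it is a q-series because [lXh] vanishes at
    the cusp, which makes up for the simple zero of [FC]. *)
Lemma a_comp1 : exists f b, comp1 3 1 cubic_a f /\ qser f b.
Proof.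
have [kap kap0 c2] := lFB_comp1 N1_3 rN_3 k00_3.
have [y [b [qb b0 _]]] := qjet_lXh N1_3 rN_3 k00_3.
have [x qx] := qser_lFCV N1_3 rN_3 k00_3 qb b0.
exists (fun t => lXh 3 3 t / (kap * FC t)), (fun n => kap^-1 * x n); split.
  have h0 : forall t, H t -> kap * FC t != 0.
    by move=> t ht; rewrite mulf_neq0 // (lFC_neq0 N1_3 rN_3 k00_3).
  exact: comp1V h0 (comp1_lX N1_3 rN_3 k00_3 : comp1 3 (1 + 3) _ _) c2.
by apply: eq_qser (qserZ kap^-1 qx) => t ht; have := lFC_neq0 N1_3 rN_3 k00_3 ht; move: (lXh 3 3 t) (FC t) => u v v0; field; rewrite v0 kap0.
Qed.

Lemma a_sqr t : H t -> cubic_a t ^+ 2 = W t.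
Proof.
have [a' [b [ca qa']]] := a_comp1; have [a [qa a0 _]] := qjet_a.
have cW : comp1 3 2 W (fun t => - 3 * W t).
  by move=> x hx; rewrite (lW_fricke N1_3 rN_3 k00_3) //; ring.
have qW := qser_lW N1_3 rN_3 k00_3.
have [u qu] := qserX 2 qa'.
have [x [qx x0 _]] := qjetB (qjetX 2 qjet_a) (qjet_lW N1_3 rN_3 k00_3).
(* In weight 2 the constant coefficient suffices: the cube has weight 6 and a zero of order 3 at the
   cusp, against order 2 for [FC ^+ 2]. *)
have v := vanish N1_3 rN_3 k00_3 y1l_3 hy1_3 (s:=1) (m:=3) (n:=2) qx (qserB qu (qserZ (- 3) qW)) _
   (comp1_companion (comp1B (comp1X 2 ca) cW)).
move=> ht; apply/eqP; rewrite -subr_eq0; apply/eqP; apply: v => //.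
by case=> // _; rewrite x0 subrr.
Qed.

(** Both sides have weight 3 = r and begin with 1 + 18 q, where 18 = -9 + 27. *)
Lemma a_cube t : H t -> cubic_a t ^+ 3 = FB t + FC t.
Proof.
have [a' [b [ca qa']]] := a_comp1.
have [k1 k10 c1] := lFB_comp1 N1_3 rN_3 k00_3; have [k2 k20 c2] := lFC_comp1 N1_3 rN_3 k00_3.
have [b1 [qb1 _ _]] := qjet_lFC N1_3 rN_3 k00_3; have [b2 [qb2 _ _]] := qjet_lFB N1_3 rN_3 k00_3.
have [u qu] := qserX 3 qa'.
have [x [qx x0 x1]] := qjetB (qjetX 3 qjet_a)
   (qjetD (qjet_lFB N1_3 rN_3 k00_3) (qjet_lFC N1_3 rN_3 k00_3)).
have v := vanish N1_3 rN_3 k00_3 y1l_3 hy1_3 (s:=2) (m:=1) (n:=1) qx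
  (qserB qu (qserD (qserZ k1 qb1) (qserZ k2 qb2))) _
   (comp1_companion (comp1B (comp1X 3 ca) (comp1D c1 c2))).
move=> ht; apply/eqP; rewrite -subr_eq0; apply/eqP; apply: v => //.
case=> [|[|//]] _; first by rewrite x0 addr0 subrr.
by rewrite x1 (lEhc1 N1_3 rN_3 k00_3); field.
Qed.

Lemma E_W_3 t : H t -> lEh 3 t = E t - cubic_a t ^+ 2.
Proof. by move=> ht; rewrite a_sqr //; exact: lEhE N1_3 rN_3 k00_3 t. Qed.

Lemma qD_a t : H t -> 3 * qD cubic_a t = E t * cubic_a t - FB t.
Proof.
have [a [qa a0 _]] := qjet_a.
have [b' [qb' _ _]] := qjet_lFC N1_3 rN_3 k00_3; have [b [qb _ _]] := qjet_lFB N1_3 rN_3 k00_3.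
have qF := qserB (qserZ 3 (qser_qD qa)) (qserB (qserM (qser_lE N1_3 rN_3 k00_3) qa) qb).
have [u qu] := qserX 2 qa.
have FW x : H x -> cubic_a x ^+ 2 * (3 * qD cubic_a x - (E x * cubic_a x - FB x)) = 0.
  move=> hx; have p0 := @twopii_neq0 R.
  have l := cderX 3 (qser_cderD qa hx).
  have rr := cderD (qser_cderD qb hx) (qser_cderD qb' hx).
  have := cderE (cder_upper hx a_cube l); rewrite (cderE rr).
  rewrite (qD_lFB N1_3 rN_3 k00_3) // (qD_lFC N1_3 rN_3 k00_3) // E_W_3 //=.
  have e := a_cube hx; have -> : FC x = cubic_a x ^+ 3 - FB x by rewrite e addrC addKr.
  move: (qD cubic_a x) (cubic_a x) (E x) (FB x) (twopii R) p0 => d w a' f p p0 h.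
  apply: (mulfI p0); rewrite mulr0.
  transitivity (3%:R * w ^+ 2 * (p * d) - p * (w ^+ 2 * (a' * w - f))); first by ring.
  by rewrite -h; ring.
have [z|z] := qser_mul_eq0 qu qF FW.
  move=> ht; exfalso; have z' x : H x -> cubic_a x = 0.
    by move=> hx; have /eqP := z x hx; rewrite expf_eq0 /= => /eqP.
  by have := qser_eq0 qa z' 0%N; rewrite a0 => /eqP; rewrite oner_eq0.
by move=> ht; have /eqP := z t ht; rewrite subr_eq0 => /eqP.
Qed.

End LevelThree.

(** * Zeros and elliptic points *)

Section Elliptic.
Variable R : realType.
Local Notation C := (cplx R).
Local Notation H := (@upper_half R).
Implicit Types (t : C) (f : C -> C).

(* [1/2 + i sqrt(4/N - 1)/2], a root of [N x^2 - N x + 1] *)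
Definition ell_pt (N : nat) : C := (1 / 2) +i* (Num.sqrt (4 / N%:R - 1) / 2).

Lemma ell_pt_upper N : (1 < N < 4)%N -> H (ell_pt N).
Proof.
move=> hN; rewrite /upper_half /=; apply: divr_gt0; last by [].
rewrite sqrtr_gt0 subr_gt0; case/andP: hN => h1 h2.
by rewrite ltr_pdivlMr ?mul1r ?ltr_nat ?ltr0n //; lia.
Qed.

Lemma ell_ptE N : (1 < N < 4)%N -> N%:R * ell_pt N ^+ 2 - N%:R * ell_pt N + 1 = 0.
Proof.
move=> hN; have N0 : (0 < N)%N by case/andP: hN; lia.
have n0 : (N%:R : R) != 0 by rewrite pnatr_eq0 -lt0n.
have s2 : Num.sqrt (4 / N%:R - 1) ^+ 2 = 4 / N%:R - 1 :> R.
  rewrite sqr_sqrtr // subr_ge0 ler_pdivlMr ?ltr0n // mul1r ler_nat; case/andP: hN; lia.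
rewrite /ell_pt natC; move: (Num.sqrt _) s2 => s s2; apply/eqP; rewrite eq_complex /=.
apply/andP; split; apply/eqP; last by field.
transitivity (N%:R / 4 - N%:R * s ^+ 2 / 4 - N%:R / 2 + 1); first by field.
by rewrite s2; field.
Qed.

Lemma ell_pt_fricke N : (1 < N < 4)%N -> fricke N (ell_pt N) = ell_pt N + (-1 : int)%:~R.
Proof.
move=> hN; have e := ell_ptE hN; have h := ell_pt_upper hN; have t0 := upper_neq0 h.
have N0 : (0 < N)%N by case/andP: hN; lia.
have n0 := @natC_neq0 R N N0; rewrite /fricke mulrN1z.
move: (ell_pt N) t0 e => p p0 e.
apply: (@mulIf _ (N%:R * p)); first by rewrite mulf_neq0.
by rewrite mulNr mulVf ?mulf_neq0 //; apply/eqP; rewrite -subr_eq0 -[X in X == _]opprK oppr_eq0 -[X in _ == X]e; apply/eqP; ring.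
Qed.

(** At the elliptic point p the involution acts as a translation, so periodicity and the Fricke law
    give W(p) (1 + N p^2) = 0; the second factor equals N p, which is not 0. *)
Lemma vanish_at_ell N r k0 : (1 < N < 4)%N -> (r * N.+1 = 12)%N -> k0 != 0 :> C -> lW N (ell_pt N) = 0 :> C.
Proof.
move=> hN rN k00; have N1 : (1 < N < 5)%N by lia.
have h := ell_pt_upper hN; have e := lW_fricke N1 rN k00 h.
rewrite ell_pt_fricke // (qser_addz _ (qser_lW N1 rN k00)) // in e.
have q := ell_ptE hN; have N0 : (0 < N)%N by lia.
have t0 := upper_neq0 h; have n0 := @natC_neq0 R N N0.
have : lW N (ell_pt N) * (1 + N%:R * ell_pt N ^+ 2) = 0.
  by rewrite mulrDr mulr1 {1}e; ring.
move=> /eqP; rewrite mulf_eq0 => /orP[/eqP//|].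
have -> : 1 + N%:R * ell_pt N ^+ 2 = N%:R * ell_pt N.
  by apply/eqP; rewrite -subr_eq0 -[X in _ == X]q; apply/eqP; ring.
by rewrite mulf_eq0 (negbTE n0) (negbTE t0).
Qed.

(** The orbit of [p] is stable under translations and, since the involution normalizes the group and
    moves [p] by an integer, under the involution. The descent then leaves only the zeros above
    height [y1]. *)
Lemma zeros_in_orbit N y1 f k a p : (1 < N < 4)%N -> 0 < y1 -> N%:R * (1 / 4 + y1 ^+ 2) < 1 ->
  qser f a -> companion N k f f -> H p ->
  (exists n : int, fricke N p = p + n%:~R) ->
  (forall t, H t -> `|complex.Re t| <= 1 / 2 -> y1 <= complex.Im t -> f t = 0 ->
     exists n : int, t = p + n%:~R) ->
  forall t, H t -> f t = 0 -> exists2 g, Gamma0 N g & mobius g p = t.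
Proof.
move=> hN y0 hd qf cf hp [m wp] base.
have N0 : (0 < N)%N by lia.
have n0 := @natC_neq0 R N N0.
pose O t := exists2 g, Gamma0 N g & mobius g p = t.
have OT t (n : int) : H t -> O t -> O (t + n%:~R).
  move=> ht [g hg <-]; exists (Tm n *m g); first by apply: Gamma0_mul => //; exact: Gamma0_T.
  by rewrite mobiusM ?mobius_T //; [exact: (Gamma0_SL (Gamma0_T N n))|exact: Gamma0_SL hg].
have OW t : H t -> O t -> O (fricke N t).
  move=> ht [g hg e].
  have [sg /dvdzP[c hc]] := hg.
  (* The conjugate of [g] by the Fricke involution. *)
  pose g' := mx2 (g 1 1) (- c) (- (N%:Z * g 0 1)) (g 0 0).
  have hg' : Gamma0 N g'.
    split; last by rewrite mx2E rpredN dvdz_mulr.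
    by apply/SL2ZE; rewrite !mx2E; move/SL2ZE: sg => <-; rewrite hc; ring.
  exists (g' *m Tm m); first by apply: Gamma0_mul => //; exact: Gamma0_T.
  have sg' := Gamma0_SL hg'.
  rewrite mobiusM //; last exact: (Gamma0_SL (Gamma0_T N m)).
  rewrite mobius_T -wp -e.
  have hw := fricke_upper N0 hp; have := jfactor_neq0 sg' hw; have := jfactor_neq0 sg hp.
  have := upper_neq0 (mobius_upper sg hp).
  have p0 := upper_neq0 hp.
  rewrite /mobius /jfactor !mx2E hc /fricke !mulrNz !intrM intr_natC.
  move: n0 p0.
  generalize ((g 0 0)%:~R : C), ((g 0 1)%:~R : C), (c%:~R : C), ((g 1 1)%:~R : C), (N%:R : C), p.
  move=> a' b c' d n q n0' q0 h1 h2 h3.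
  have h4 : a' * q + b != 0 by apply: contraNneq h1 => ->; rewrite mul0r.
  have -> : d * - (n * q)^-1 + - c' = - ((c' * n * q + d) / (n * q)) by field; rewrite n0' q0.
  have -> : - (n * b) * - (n * q)^-1 + a' = (a' * q + b) / q by field; rewrite n0' q0.
  by field; rewrite n0' q0 h2 h4.
apply: (fricke_descent N0 y0 hd (Q := fun t => f t = 0 -> O t)).
- move=> t n ht IH z; rewrite -[t](addrK n%:~R) -mulrNz; apply: OT; first exact: upper_addz.
  by apply: IH; rewrite (qser_addz _ qf).
- move=> t ht IH z; rewrite -(frickeK N0 ht); apply: OW; first exact: fricke_upper.
  by apply: IH; case: cf => kap k0 ->; rewrite // z mulr0.
- move=> t ht h1 h2 z; have [n ->] := base t ht h1 h2 z; apply: OT => //.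
  by exists 1%:M; [exact: Gamma0_1|exact: mobius_1].
Qed.

End Elliptic.

(** * Numerical estimates *)

Section Numeric.
Variable R : realType.
Local Notation C := (cplx R).
Local Notation H := (@upper_half R).
Implicit Types (t q : C) (a : nat -> C).

(** It suffices that cos(3/2) > 0. From sin(1/4) <= 1/4 one gets cos(1/2) >= 7/8, and the
    triplication formula gives cos(3/2) = c (c^2 - 3 s^2) > 0. *)
Lemma pi_gt3 : 3 < pi :> R.
Proof.
have p2 := pi_ge2 R; rewrite ltNge; apply/negP => p3.
have s4 : 0 <= sin (1 / 4 : R) <= 1 / 4.
  apply/andP; split; first by apply: sin_ge0_pi; apply/andP; split; lra.
  have l : 0 <= 1 / 4 :> R by lra.
  have d1 x : x \in `]0, (1 / 4 : R)[%R -> is_derive x 1 (@sin R) (cos x) by move=> _; exact: is_derive_sin.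
  have d2 : {within `[0, (1 / 4 : R)]%classic, continuous (@sin R)}.
    by apply/continuous_subspaceT => x; exact: continuous_sin.
  have [c _] := MVT_segment l d1 d2; rewrite sin0 !subr0 => ->.
  have := cos_le1 c; lra.
have c2 : 7 / 8 <= cos (1 / 2 : R).
  have -> : 1 / 2 = 1 / 4 + 1 / 4 :> R by field.
  rewrite cosD; have := cos2Dsin2 (1 / 4 : R); case/andP: s4 => h1 h2; nra.
have c3 : 0 < cos (3 / 2 : R).
  have -> : 3 / 2 = 1 / 2 + (1 / 2 + 1 / 2) :> R by field.
  rewrite !(cosD, sinD); have := cos2Dsin2 (1 / 2 : R).
  move: (cos _) (sin _) c2 => c s c2 e.
  have -> : c * (c * c - s * s) - s * (s * c + c * s) = c * (c ^+ 2 - 3 * s ^+ 2) by ring.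
  have : s ^+ 2 = 1 - c ^+ 2 by lra.
  by move=> ->; nra.
have i1 : (3 / 2 : R) \in `[0, (pi : R)]%R by rewrite in_itv /=; apply/andP; split; lra.
have i2 : (pi / 2 : R) \in `[0, (pi : R)]%R by rewrite in_itv /=; apply/andP; split; lra.
have [h|h] := leP (pi / 2 : R) (3 / 2); last lra.
have : cos (3 / 2 : R) <= cos (pi / 2) by rewrite leNgt (ltr_cos i1 i2) -leNgt.
by rewrite cos_pihalf; lra.
Qed.

(** From exp(32 d) >= (1 + d)^32 by five squarings, each rounded down to a short decimal so that
    only checks on small rational numbers remain. *)
Lemma expR_lower (x d e1 e2 e3 e4 e5 : R) : 0 <= d -> 32 * d <= x -> 0 <= e1 -> 0 <= e2 -> 0 <= e3 -> 0 <= e4 ->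
  e1 <= (1 + d) ^+ 2 -> e2 <= e1 ^+ 2 -> e3 <= e2 ^+ 2 -> e4 <= e3 ^+ 2 -> e5 <= e4 ^+ 2 -> e5 <= expR x.
Proof.
move=> d0 hd p1 p2 p3 p4 h1 h2 h3 h4 h5; apply: (@le_trans _ _ (expR (32%:R * d))); last by rewrite ler_expR.
have sq (u v : R) : 0 <= u -> u <= v -> u ^+ 2 <= v ^+ 2.
  by move=> u0 uv; rewrite lerXn2r // nnegrE // (le_trans u0).
have g0 : 1 + d <= expR d := expR_ge1Dx d.
have d1 : 0 <= 1 + d by lra.
have g1 : e1 <= expR d ^+ 2 := le_trans h1 (sq _ _ d1 g0).
have g2 := le_trans h2 (sq _ _ p1 g1); have g3 := le_trans h3 (sq _ _ p2 g2).
have g4 := le_trans h4 (sq _ _ p3 g3); have g5 := le_trans h5 (sq _ _ p4 g4).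
by rewrite expRM_natl; rewrite -!exprM in g5.
Qed.

Lemma nome_small t (y x rho : R) : y <= complex.Im t -> 0 < y -> 0 < rho -> rho^-1 <= expR x -> x <= 6 * y ->
  nm (nome t) <= rho.
Proof.
move=> hy y0 r0 hx xy; rewrite nm_nome expRN -[leRHS]invrK lef_pV2 ?posrE ?expR_gt0 ?invr_gt0 //.
apply: le_trans hx _; rewrite ler_expR; apply: le_trans xy _.
have := pi_gt3; nra.
Qed.

Lemma geo_sum (F : nat -> R) n0 (th : R) K : 0 <= th < 1 ->
  (forall n, (n0 <= n)%N -> 0 <= F n /\ F n.+1 <= th * F n) ->
  \sum_(n0 <= n < K) F n <= F n0 / (1 - th).
Proof.
move=> /andP[t0 t1] h; have i0 : 0 < (1 - th)^-1 by rewrite invr_gt0; lra.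
have [Kn|/ltnW nK] := leqP K n0.
  by rewrite big_geq //; have [f0 _] := h n0 (leqnn _); rewrite mulr_ge0 // ltW.
rewrite -(subnKC nK); move: (K - n0)%N => m.
apply: (@le_trans _ _ ((F n0 - F (n0 + m)%N) / (1 - th))); last first.
  by rewrite ler_pM2r //; have [f0 _] := h (n0 + m)%N (leq_addr _ _); lra.
elim: m => [|m IH]; first by rewrite addn0 big_geq // subrr mul0r.
rewrite addnS big_nat_recr ?leq_addr //=.
apply: le_trans (lerD IH (lexx _)) _.
have [f0 f1] := h (n0 + m)%N (leq_addr _ _).
rewrite -subr_ge0.
have -> : (F n0 - F (n0 + m).+1) / (1 - th) - ((F n0 - F (n0 + m)%N) / (1 - th) + F (n0 + m)%N)
   = (th * F (n0 + m)%N - F (n0 + m).+1) / (1 - th) by field; lra.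
by rewrite mulr_ge0 ?subr_ge0 // ltW.
Qed.

Lemma head_tail_sum (F : nat -> R) m (S1 S2 : R) : (2 <= m)%N -> (forall n, 0 <= F n) ->
  \sum_(2 <= n < m) F n <= S1 -> (forall K, \sum_(m <= n < K) F n <= S2) ->
  forall K, \sum_(2 <= n < K) F n <= S1 + S2.
Proof.
move=> m2 F0 h1 h2 K; apply: (@le_trans _ _ (\sum_(2 <= n < m + K) F n)).
  have [K2|/ltnW K2] := leqP K 2; first by rewrite [leLHS]big_geq // sumr_ge0.
  rewrite [leRHS](@big_cat_nat _ _ _ K) //=; last exact: leq_addl.
  by rewrite lerDl sumr_ge0.
by rewrite (@big_cat_nat _ _ _ m) //= ?leq_addr //; apply: lerD.
Qed.

Lemma pow_diff_le q q0 (rho : R) n : nm q <= rho -> nm q0 <= rho ->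
  nm (q ^+ n - q0 ^+ n) <= n%:R * rho ^+ n.-1 * nm (q - q0).
Proof.
move=> hq hq0; have r0 : 0 <= rho by apply: le_trans hq; exact: nm_ge0.
rewrite subrXX nmM mulrC ler_wpM2r ?nm_ge0 //.
apply: le_trans (nm_sum _ _ _) _.
apply: (@le_trans _ _ (\sum_(i < n) rho ^+ n.-1)); last by rewrite sumr_const card_ord mulr_natl.
apply: ler_sum => i _; rewrite nmM !nmX.
have -> : rho ^+ n.-1 = rho ^+ (n.-1 - i) * rho ^+ i.
  by rewrite -exprD subnK //; case: n i => [[]|n i] //=; rewrite -ltnS.
by apply: ler_pM; rewrite ?exprn_ge0 ?nm_ge0 // lerXn2r ?nnegrE ?nm_ge0.
Qed.

(** On the disc the linear term dominates: the other terms together change by at most S |q - q0|,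
    less than the change of the linear one. *)
Lemma ev_inj a (rho S : R) q q0 : tame a -> rho < 1 -> nm q <= rho -> nm q0 <= rho ->
  (forall K, \sum_(2 <= n < K) n%:R * nm (a n) * rho ^+ n.-1 <= S) -> S < nm (a 1%N) ->
  ev a q = ev a q0 -> q = q0.
Proof.
move=> ta r1 hq hq0 hS Sa e.
have c1 := ev_cvg ta (le_lt_trans hq r1); have c2 := ev_cvg ta (le_lt_trans hq0 r1).
have := slimB (slimB c1 c2) (@slim_cst R (a 1%N * (q - q0))); rewrite e subrr sub0r => c.
have : nm (- (a 1%N * (q - q0))) <= S * nm (q - q0).
  apply: (cvg_nm_bound c); exists 2%N; first exact: I.
  move=> K K2; rewrite [X in nm X <= _](_ : _ = \sum_(2 <= n < K) (a n * q ^+ n - a n * q0 ^+ n)); last first.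
    rewrite /series -sumrB (big_ltn (ltnW K2)) (big_ltn K2).
    by rewrite !expr0 subrr add0r !expr1 -mulrBr addrAC subrr add0r.
  apply: le_trans (nm_sum _ _ _) _.
  apply: le_trans (_ : _ <= (\sum_(2 <= n < K) n%:R * nm (a n) * rho ^+ n.-1) * nm (q - q0)) _; last first.
    by apply: ler_wpM2r; [exact: nm_ge0|exact: hS].
  rewrite mulr_suml; apply: ler_sum => i _; rewrite -mulrBr nmM.
  have := ler_wpM2l (nm_ge0 (a i)) (pow_diff_le i hq hq0).
  by congr (_ <= _); ring.
rewrite nmN nmM => h; apply/eqP; rewrite -subr_eq0 -nm_eq0; apply/negPn/negP => ne.
have p0 : 0 < nm (q - q0) by rewrite lt_neqAle eq_sym ne nm_ge0.
by move: h; rewrite (ler_pM2r p0) leNgt Sa.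
Qed.

Lemma nm_sig_le n : nm (sig R n) <= n%:R ^+ 2.
Proof.
case: n => [|n]; first by rewrite nm0 sqr_ge0.
by rewrite /sig nm_nat expr2 -natrM ler_nat; exact: sum_divisors_le.
Qed.

Lemma lWc_sig N n : (0 < n)%N -> lWc R N n = 24 / (N%:R - 1) * (sig R n - N%:R * dil N (sig R) n).
Proof. by move=> n0; rewrite /lWc !dil_e2c // dil1; ring. Qed.

Lemma lWc_bound N n : (1 < N)%N -> (0 < n)%N ->
  nm (lWc R N n) <= 24 / (N%:R - 1) * (1 + N%:R^-1) * n%:R ^+ 2.
Proof.
move=> N1 n0; rewrite lWc_sig // nmM.
have N0 : 0 < N%:R :> R by rewrite ltr0n; lia.
have N10 : 0 < N%:R - 1 :> R by rewrite subr_gt0 ltr1n.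
have -> : nm (24 / (N%:R - 1) : C) = 24 / (N%:R - 1).
  have -> : 24 / (N%:R - 1) = (24 / (N%:R - 1) : R)%:C :> C.
    by rewrite rmorphM /= fmorphV /= rmorphB /= !rmorph_nat rmorph1.
  by rewrite nm_real ger0_norm // divr_ge0 // ltW.
rewrite -mulrA ler_wpM2l ?divr_ge0 ?(ltW N10) //.
apply: le_trans (nmB _ _) _; rewrite mulrDl mul1r lerD ?nm_sig_le // nmM nm_nat /dil.
case: ifP => [/dvdnP[m ->]|_]; last by rewrite nm0 mulr0 mulr_ge0 ?invr_ge0 ?sqr_ge0 // ltW.
rewrite mulnK; last by lia.
have := nm_sig_le m; rewrite natrM exprMn => h.
have -> : (N%:R : R)^-1 * (m%:R ^+ 2 * N%:R ^+ 2) = N%:R * m%:R ^+ 2 by field; lra.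
by rewrite ler_wpM2l // ltW.
Qed.

End Numeric.

(** * Location of the zeros of W *)

Section Zeros.
Variable R : realType.
Local Notation C := (cplx R).
Local Notation H := (@upper_half R).
Implicit Types (t q : C) (a : nat -> C).

Lemma sqrt_ge (x y : R) : 0 <= y -> y ^+ 2 <= x -> y <= Num.sqrt x.
Proof. by move=> y0 h; rewrite -(ger0_norm y0) -sqrtr_sqr ler_wsqrtr. Qed.

Lemma lWc_val N n (w : int) : (1 < N)%N -> (0 < n)%N ->
  ((sumn (divisors n))%:Z - (if (N %| n)%N then (N * sumn (divisors (n %/ N)))%N else 0%N)%:Z = w)%R ->
  lWc R N n = 24 / (N%:R - 1) * w%:~R.
Proof.
move=> N1 n0 <-; rewrite lWc_sig // natS_sumn // /dil intrB; congr (_ * (_ - _)).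
case: ifP => [/dvdnP[m e]|_]; last by rewrite mulr0.
rewrite natS_sumn ?[RHS]natrM // e mulnK //; last by lia.
by case: m e => // e; rewrite e in n0.
Qed.

Lemma nm_lWc_val N n (w : nat) : (1 < N)%N -> (0 < n)%N ->
  ((sumn (divisors n))%:Z - (if (N %| n)%N then (N * sumn (divisors (n %/ N)))%N else 0%N)%:Z = w%:Z)%R ->
  nm (lWc R N n) = 24 / (N%:R - 1) * w%:R.
Proof.
move=> N1 n0 h; rewrite (lWc_val N1 n0 h).
have -> : 24 / (N%:R - 1) * (w%:Z)%:~R = (24 / (N%:R - 1) * w%:R : R)%:C :> C.
  by rewrite !rmorphM /= fmorphV /= rmorphB /= !rmorph_nat rmorph1.
rewrite nm_real ger0_norm // mulr_ge0 // divr_ge0 // subr_ge0 ler1n; lia.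
Qed.

(** Above height 2/5 the nome is at most 1/10 in modulus, and on that disc [lW 2] is injective as a
    function of q; the elliptic point accounts for its only zero there. *)
Lemma zeros_2 t : H t -> lW 2 t = 0 -> exists2 g, Gamma0 2 g & mobius g (ell_pt R 2) = t.
Proof.
move: t; have hp := @ell_pt_upper R 2 isT; have q := qser_lW N1_2 rN_2 (@k00_2 R).
have y0 : 0 < 2 / 5 :> R by lra.
apply: (zeros_in_orbit (k := 2) (N := 2) isT y0 (@hy1_2 R) q) => //.
- exists (- 2); first by rewrite oppr_eq0 pnatr_eq0.
  by move=> t ht; rewrite (lW_fricke N1_2 rN_2 (@k00_2 R)).
- by exists (-1); apply: ell_pt_fricke.
move=> t ht _ hy z; apply: nome_inj.
have e10 : (1 / 10)^-1 <= expR (12 / 5) :> R.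
  apply: (@expR_lower R (12 / 5) (75 / 1000) (1155 / 1000) (1334 / 1000) (1779 / 1000) (3164 / 1000)); lra.
have sm x : H x -> 2 / 5 <= complex.Im x -> nm (nome x) <= 1 / 10.
  by move=> hx hyx; apply: (nome_small hyx y0 _ e10); lra.
(* The coefficient of q is 24. The term n = 2 contributes 48/10; from n = 3 on the bound 36 n^3
   10^(1-n) starts at 9.72 and decreases with ratio at most 1/4, giving 9.72 / (3/4) = 12.96. *)
apply: (@ev_inj R (lWc R 2) (1 / 10) (48 / 10 + 1296 / 100)); [exact: qser_tame q|lra|exact: sm| | | |].
- apply: sm => //; rewrite /ell_pt /=.
  have := @sqrt_ge (4 / 2%:R - 1) (8 / 10); lra.
- have c24 : 24 / (2%:R - 1) = 24 :> R by field.
  have v2 := @nm_lWc_val 2 2 1 isT isT erefl.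
  apply: (@head_tail_sum R _ 3) => // [n||K].
  + by rewrite !mulr_ge0 ?nm_ge0 ?exprn_ge0 //; lra.
  + rewrite big_nat1 v2 /= c24 expr1; lra.
  apply: (@le_trans _ _ (\sum_(3 <= n < K) 36 * n%:R ^+ 3 * (1 / 10) ^+ n.-1)).
    rewrite big_nat_cond [leRHS]big_nat_cond; apply: ler_sum => n /andP[/andP[n3 _] _].
    apply: ler_wpM2r; first by rewrite exprn_ge0 //; lra.
    have := @lWc_bound R 2 n isT (leq_trans (isT : 0 < 3)%N n3).
    have -> : 24 / (2%:R - 1) * (1 + 2%:R^-1) = 36 :> R by field.
    have : 0 <= n%:R :> R by []. move: (nm _) (n%:R : R) => x y; nra.
  apply: le_trans (@geo_sum R (fun n => 36 * n%:R ^+ 3 * (1 / 10) ^+ n.-1) 3 (1 / 4) K _ _) _; [by apply/andP; split; lra| |rewrite /= ler_pdivrMr; lra].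
  move=> n n3; split; first by rewrite !mulr_ge0 ?exprn_ge0 //; lra.
  case: n n3 => // n n3; rewrite /= [_ ^+ n.+1]exprS.
  have p0 : 0 <= (1 / 10) ^+ n :> R by rewrite exprn_ge0 //; lra.
  have n2 : 2 <= n%:R :> R by rewrite ler_nat.
  rewrite -[n.+2%:R](@natr1 R n.+1) -(@natr1 R n).
  move: (_ ^+ n) (n%:R : R) p0 n2 => u x u0 x2.
  have : (x + 1 + 1) ^+ 3 <= 5 / 2 * (x + 1) ^+ 3 by nra.
  move: ((x + 1 + 1) ^+ 3) ((x + 1) ^+ 3) => A B; nra.
- have c24 : 24 / (2%:R - 1) = 24 :> R by field.
  rewrite (@nm_lWc_val 2 1 1) // c24; lra.
have [_ f] := q; rewrite -(f t ht) -(f _ hp) z; apply/esym; exact: (@vanish_at_ell R 2 4 64 isT rN_2 (@k00_2 R)).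
Qed.

(* The zeros of [lW 3] are double, [lW 3] being the square of [cubic_a]: they are
   zeros of its q-derivative, which is injective on a larger disc. *)
Lemma zeros_3 t : H t -> lW 3 t = 0 -> exists2 g, Gamma0 3 g & mobius g (ell_pt R 3) = t.
Proof.
move: t; have hp := @ell_pt_upper R 3 isT; have q := qser_lW N1_3 rN_3 (@k00_3 R).
have y0 : 0 < 57 / 200 :> R by lra.
apply: (zeros_in_orbit (k := 2) (N := 3) isT y0 (@hy1_3 R) q) => //.
- exists (- 3); first by rewrite oppr_eq0 pnatr_eq0.
  by move=> t ht; rewrite (lW_fricke N1_3 rN_3 (@k00_3 R)).
- by exists (-1); apply: ell_pt_fricke.
move=> t ht _ hy z; apply: nome_inj.
(* The exponent 171/100 is 6 times the height 57/200, where 6 bounds 2 pi from below. *)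
have e10 : (19 / 100)^-1 <= expR (171 / 100) :> R.
  apply: (@expR_lower R (171 / 100) (534 / 10000) (11096 / 10000) (12312 / 10000) (15158 / 10000) (22976 / 10000)); lra.
have sm x : H x -> 57 / 200 <= complex.Im x -> nm (nome x) <= 19 / 100.
  by move=> hx hyx; apply: (nome_small hyx y0 _ e10); lra.
pose a n : C := n.+1%:R * lWc R 3 n.+1.
have tW := qser_tame q.
have ta : tame a := tame_deriv tW.
have nma n : nm (a n) = n.+1%:R * nm (lWc R 3 n.+1) by rewrite /a nmM nm_nat.
have a0 x : H x -> lW 3 x = 0 -> ev a (nome x) = 0.
  move=> hx zx; have [b [qb _ _]] := @qjet_a R.
  have ax : cubic_a x = 0 by have /eqP := a_sqr hx; rewrite zx expf_eq0 /= => /eqP.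
  have d := cder_upper hx (@a_sqr R) (cderX 2 (qser_cderD qb hx)).
  have := cderE d; rewrite (cderE (qser_cder q hx)) ax /= expr1 mulr0 mul0r.
  move=> /eqP; rewrite mulf_eq0 (negbTE (@twopii_neq0 R)) /= => /eqP.
  rewrite (ev_shift (tame_muln tW)) ?mul0r ?add0r; last exact: nm_nome_lt1.
  by move=> /eqP; rewrite mulf_eq0 (negbTE (nome_neq0 _)) /= => /eqP.
clearbody a.
(* The linear coefficient is 2 * 36 = 72. Indices 2 to 7 are evaluated exactly and stay below 63;
   from 8 on the quadratic bound for [sig] gives a geometric tail of ratio 3/10, below 6/5. *)
apply: (@ev_inj R a (19 / 100) (63 + 6 / 5)); [exact: ta|lra|exact: sm| | | |].
- apply: sm => //; rewrite /ell_pt /=.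
  have := @sqrt_ge (4 / 3%:R - 1) (57 / 100); lra.
- have c12 : 24 / (3%:R - 1) = 12 :> R by field.
  have v3 := @nm_lWc_val 3 3 1 isT isT erefl. have v4 := @nm_lWc_val 3 4 7 isT isT erefl.
  have v5 := @nm_lWc_val 3 5 6 isT isT erefl. have v6 := @nm_lWc_val 3 6 3 isT isT erefl.
  have v7 := @nm_lWc_val 3 7 8 isT isT erefl. have v8 := @nm_lWc_val 3 8 15 isT isT erefl.
  apply: (@head_tail_sum R _ 8) => // [n||K].
  + by rewrite !mulr_ge0 ?nm_ge0 ?exprn_ge0 //; lra.
  + rewrite 6?big_ltn // big_geq // 6!nma v3 v4 v5 v6 v7 v8 c12.
    clear; rewrite !succnK.
    lra.
  apply: (@le_trans _ _ (\sum_(8 <= n < K) 16 * n%:R * n.+1%:R ^+ 3 * (19 / 100) ^+ n.-1)).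
    rewrite big_nat_cond [leRHS]big_nat_cond; apply: ler_sum => n /andP[/andP[n3 _] _].
    apply: ler_wpM2r; first by rewrite exprn_ge0 //; lra.
    rewrite nma; have := @lWc_bound R 3 n.+1 isT isT.
    have -> : 24 / (3%:R - 1) * (1 + 3%:R^-1) = 16 :> R by field.
    move=> h; have -> : 16 * n%:R * n.+1%:R ^+ 3 = n%:R * (n.+1%:R * (16 * n.+1%:R ^+ 2)) :> R by ring.
    by rewrite ler_wpM2l // ler_wpM2l.
  apply: le_trans (@geo_sum R (fun n => 16 * n%:R * n.+1%:R ^+ 3 * (19 / 100) ^+ n.-1) 8 (3 / 10) K _ _) _; [by apply/andP; split; lra| |rewrite /= ler_pdivrMr; lra].
  move=> n n3; split; first by rewrite !mulr_ge0 ?exprn_ge0 //; lra.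
  case: n n3 => // n n3; rewrite /= [_ ^+ n.+1]exprS.
  have p0 : 0 <= (19 / 100) ^+ n :> R by rewrite exprn_ge0 //; lra.
  have n2 : 7 <= n%:R :> R by rewrite ler_nat.
  rewrite -[n.+3%:R](@natr1 R n.+2) -[n.+2%:R](@natr1 R n.+1) -(@natr1 R n).
  move: (_ ^+ n) (n%:R : R) p0 n2 => u x u0 x2.
  have c : (x + 1 + 1 + 1) ^+ 3 <= 1000 / 729 * (x + 1 + 1) ^+ 3.
    have -> : 1000 / 729 = (10 / 9) ^+ 3 :> R by field.
    rewrite -exprMn lerXn2r ?nnegrE; lra.
  have c2 : x + 1 + 1 <= 9 / 8 * (x + 1) by lra.
  have B0 : 0 <= (x + 1 + 1) ^+ 3 by rewrite exprn_ge0 //; lra.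
  have : (x + 1 + 1) * (x + 1 + 1 + 1) ^+ 3 <= (9 / 8 * (x + 1)) * (1000 / 729 * (x + 1 + 1) ^+ 3).
    by apply: ler_pM => //; [lra|rewrite exprn_ge0 //; lra].
  move: ((x + 1 + 1 + 1) ^+ 3) ((x + 1 + 1) ^+ 3) B0 c => A B B0 c hh.
  have -> : 16 * (x + 1 + 1) * A * (19 / 100 * u) = 304 / 100 * u * ((x + 1 + 1) * A) by field.
  have -> : 3 / 10 * (16 * (x + 1) * B * u) = 480 / 100 * u * ((x + 1) * B) by field.
  have xB : 0 <= (x + 1) * B by rewrite mulr_ge0 //; lra.
  have : (x + 1 + 1) * A <= 125 / 81 * ((x + 1) * B) by apply: le_trans hh _; lra.
  move: ((x + 1 + 1) * A) ((x + 1) * B) xB => D E E0 DE.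
  rewrite -mulrA -[leRHS]mulrA; rewrite [u * D]mulrC [u * E]mulrC !mulrA ler_wpM2r //; lra.
- have c12 : 24 / (3%:R - 1) = 12 :> R by field.
  by rewrite nma (@nm_lWc_val 3 2 3) // c12; lra.
by rewrite (a0 t ht z) (a0 _ hp (@vanish_at_ell R 3 3 27 isT rN_3 (@k00_3 R))).
Qed.

End Zeros.

(** * Stabilizers of the elliptic points *)

Section Stabilizers.
Variable R : realType.
Local Notation C := (cplx R).
Local Notation H := (@upper_half R).
Implicit Types (t : C) (g : 'M[int]_2).

Lemma int_lin_eq0 (x y : int) t : H t -> x%:~R * t + y%:~R = 0 -> x = 0 /\ y = 0.
Proof.
move=> ht e; have [u [eu ru]] := @intC_real R x; have [v [ev_ rv]] := @intC_real R y.
have im : complex.Im (x%:~R * t + y%:~R) = u * complex.Im t by rewrite eu ev_; case: (t) => ? ? /=; ring.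
have re : complex.Re (x%:~R * t + y%:~R) = u * complex.Re t + v by rewrite eu ev_; case: (t) => ? ? /=; ring.
move: im re; rewrite e /= => /esym/eqP; rewrite mulf_eq0 [X in _ || X]gt_eqF // orbF => /eqP u0.
rewrite u0 mul0r add0r => /esym/eqP v0; split; apply/eqP.
  by rewrite -(intr_eq0 R) -ru u0.
by rewrite -(intr_eq0 R) -rv.
Qed.

(** The fixed point equation of [g] must be a multiple of the quadratic equation of the elliptic
    point, which leaves two integer parameters; the determinant condition says that a positive
    definite form in them takes the value 1. *)
Lemma ell_stab N g : (1 < N < 4)%N -> (Gamma0 N g /\ mobius g (ell_pt R N) = ell_pt R N) <->
  exists c d : int, g = mx2 (d + N%:Z * c) (- c) (N%:Z * c) d /\ d ^+ 2 + N%:Z * c * d + N%:Z * c ^+ 2 = 1.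
Proof.
move=> hN; have hp := @ell_pt_upper R N hN; have q := @ell_ptE R N hN.
have intN (x : int) : (N%:Z * x)%:~R = N%:R * x%:~R :> C by rewrite intrM intr_natC.
split.
  move=> [[sg /dvdzP[c hc]] e]; exists c, (g 1 1).
  have j0 := jfactor_neq0 sg hp.
  have e' : mobius g (ell_pt R N) * jfactor g (ell_pt R N) = (g 0 0)%:~R * ell_pt R N + (g 0 1)%:~R.
    by rewrite /mobius divfK.
  rewrite e in e'; have {e'}e := esym e'.
  rewrite /jfactor hc (mulrC c) intN in e.
  have : (g 0 0 - g 1 1 - N%:Z * c)%:~R * ell_pt R N + (g 0 1 + c)%:~R = 0 :> C.
    rewrite !intrD !mulrNz intN; move: e q; move: (ell_pt R N) => p e q.
    transitivity ((g 0 0)%:~R * p + (g 0 1)%:~R - (p * (N%:R * c%:~R * p + (g 1 1)%:~R))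
      + c%:~R * (N%:R * p ^+ 2 - N%:R * p + 1)); first by ring.
    by rewrite q e; ring.
  move=> /(int_lin_eq0 hp)[e1 e2].
  have a1 : g 0 0 = g 1 1 + N%:Z * c by move: e1; lia.
  have b1 : g 0 1 = - c by move: e2; lia.
  split; first by rewrite {1}[g]mx2_eta a1 b1 hc (mulrC c).
  by move/SL2ZE: sg; rewrite a1 b1 hc => <-; ring.
move=> [c [d [-> e]]]; set g' := mx2 _ _ _ _.
have hg : Gamma0 N g'.
  by split; [apply/SL2ZE; rewrite !mx2E -e; ring|rewrite mx2E dvdz_mulr].
split=> //; have j0 := jfactor_neq0 (Gamma0_SL hg) hp.
apply: (mulIf j0); rewrite {1}/mobius divfK // /jfactor !mx2E intrD mulrNz intN.
move: q; move: (ell_pt R N) => p q; apply/eqP; rewrite -subr_eq0; apply/eqP.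
transitivity (- c%:~R * (N%:R * p ^+ 2 - N%:R * p + 1)); first by ring.
by rewrite q mulr0.
Qed.

(** The 4 or 6 representations of 1 by that form; modulo sign they make cyclic groups of order 2 and
    3. *)
Definition stab_list (N : nat) : seq 'M[int]_2 :=
  if N == 2%N then [:: mx2 1 0 0 1; mx2 (-1) 0 0 (-1); mx2 1 (-1) 2 (-1); mx2 (-1) 1 (-2) 1]
  else [:: mx2 1 0 0 1; mx2 (-1) 0 0 (-1); mx2 2 (-1) 3 (-1); mx2 (-2) 1 (-3) 1;
           mx2 1 (-1) 3 (-2); mx2 (-1) 1 (-3) 2].

Lemma stab_listP N g : (1 < N < 4)%N ->
  (Gamma0 N g /\ mobius g (ell_pt R N) = ell_pt R N) <-> g \in stab_list N.
Proof.
move=> hN; apply: (iff_trans (ell_stab g hN)).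
have mk a b c d a' b' c' d' : a = a' -> b = b' -> c = c' -> d = d' -> mx2 a b c d = mx2 a' b' c' d'.
  by move=> -> -> -> ->.
have [->|->] : N = 2%N \/ N = 3%N by lia.
- rewrite /stab_list /= !inE; split.
    move=> [c [d [-> e]]].
    have s : (c + d) ^+ 2 + c ^+ 2 = 1 by rewrite -e; ring.
    have hc : c = 0 \/ c = 1 \/ c = -1 by nia.
    case: hc => [z|[z|z]]; rewrite z in s *.
    + have : d = 1 \/ d = -1 by nia.
      by case=> w; apply/or4P; [constructor 1|constructor 2]; apply/eqP; apply: mk; lia.
    + have : d = -1 by nia.
      by move=> w; apply/or4P; constructor 3; apply/eqP; apply: mk; lia.
    + have : d = 1 by nia.
      by move=> w; apply/or4P; constructor 4; apply/eqP; apply: mk; lia.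
  by case/or4P => /eqP ->; [exists 0, 1|exists 0, (-1)|exists 1, (-1)|exists (-1), 1]; split=> //; apply: mk.
rewrite /stab_list /= !inE; split.
  move=> [c [d [-> e]]].
  have s : (2 * d + 3 * c) ^+ 2 + 3 * c ^+ 2 = 4 by transitivity (4 * (d ^+ 2 + 3%:Z * c * d + 3%:Z * c ^+ 2)); [ring|rewrite e].
  have hc : c = 0 \/ c = 1 \/ c = -1 by nia.
  case: hc => [z|[z|z]]; rewrite z in e *.
  + have : d = 1 \/ d = -1 by nia.
    case=> w; [have /eqP -> : mx2 (d + 3%:Z * 0) (- 0) (3%:Z * 0) d == mx2 1 0 0 1 by apply/eqP; apply: mk; lia
      |have /eqP -> : mx2 (d + 3%:Z * 0) (- 0) (3%:Z * 0) d == mx2 (-1) 0 0 (-1) by apply/eqP; apply: mk; lia];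
      by rewrite eqxx ?orbT.
  + have : d = -1 \/ d = -2.
      have /eqP : (d + 1) * (d + 2) = 0.
        by transitivity (d ^+ 2 + 3%:Z * 1 * d + 3%:Z * 1 ^+ 2 - 1); [ring|rewrite e subrr].
      by rewrite mulf_eq0 => /orP[]/eqP; lia.
    case=> w; [have /eqP -> : mx2 (d + 3%:Z * 1) (- 1) (3%:Z * 1) d == mx2 2 (-1) 3 (-1) by apply/eqP; apply: mk; lia
      |have /eqP -> : mx2 (d + 3%:Z * 1) (- 1) (3%:Z * 1) d == mx2 1 (-1) 3 (-2) by apply/eqP; apply: mk; lia];
      by rewrite eqxx ?orbT.
  + have : d = 1 \/ d = 2.
      have /eqP : (d - 1) * (d - 2) = 0.
        by transitivity (d ^+ 2 + 3%:Z * -1 * d + 3%:Z * (-1) ^+ 2 - 1); [ring|rewrite e subrr].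
      by rewrite mulf_eq0 => /orP[]/eqP; lia.
    case=> w; [have /eqP -> : mx2 (d + 3%:Z * -1) (- -1) (3%:Z * -1) d == mx2 (-2) 1 (-3) 1 by apply/eqP; apply: mk; lia
      |have /eqP -> : mx2 (d + 3%:Z * -1) (- -1) (3%:Z * -1) d == mx2 (-1) 1 (-3) 2 by apply/eqP; apply: mk; lia];
      by rewrite eqxx ?orbT.
case/or4P => [/eqP ->|/eqP ->|/eqP ->|].
- by exists 0, 1; split=> //; apply: mk.
- by exists 0, (-1); split=> //; apply: mk.
- by exists 1, (-1); split=> //; apply: mk.
case/or3P => /eqP ->.
- by exists (-1), 1; split=> //; apply: mk.
- by exists 1, (-2); split=> //; apply: mk.
- by exists (-1), 2; split=> //; apply: mk.
Qed.

Lemma stab_list_uniq N : uniq (stab_list N).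
Proof.
apply: (@map_uniq _ _ (fun g : 'M[int]_2 => (g 0 1, g 1 1))).
by rewrite /stab_list; case: ifP => _; rewrite /= !mx2E.
Qed.

Lemma elliptic_order_orbit N g : (1 < N < 4)%N -> Gamma0 N g ->
  elliptic_order (Gamma0 N) (mobius g (ell_pt R N)) = N.
Proof.
move=> hN hg; have hp := @ell_pt_upper R N hN; have sg := Gamma0_SL hg.
pose s := [seq g *m x *m inv2 g | x <- stab_list N].
have conjK x : inv2 g *m (g *m x *m inv2 g) *m g = x.
  by rewrite !mulmxA inv2Kl // mul1mx -mulmxA inv2Kl // mulmx1.
have us : uniq s.
  rewrite map_inj_uniq ?stab_list_uniq // => x y e.
  by rewrite -(conjK x) e conjK.
have sE : [set h | Gamma0 N h /\ mobius h (mobius g (ell_pt R N)) = mobius g (ell_pt R N)] =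
   [set` [fset x in s]%fset].
  apply/seteqP; split=> h /=.
    move=> [hh e]; rewrite inE /=; apply/mapP; exists (inv2 g *m h *m g); last first.
      by rewrite !mulmxA inv2K // mul1mx -mulmxA inv2K // mulmx1.
    have sh := Gamma0_SL hh; have si := SL2Z_inv sg.
    apply/stab_listP => //; split; first by do 2?apply: Gamma0_mul => //; exact: Gamma0_inv.
    by rewrite mobiusM // ?mobiusM ?e ?mobiusK //; [exact: mobius_upper|exact: SL2Z_mul].
  rewrite inE /= => /mapP[x /(stab_listP x hN)[hx ex] ->].
  have sx := Gamma0_SL hx; have si := SL2Z_inv sg.
  split; first by do 2?apply: Gamma0_mul => //; exact: Gamma0_inv.
  have hm := mobius_upper sg hp.
  by rewrite mobiusM ?mobiusK ?mobiusM ?ex //; exact: SL2Z_mul.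
rewrite /elliptic_order sE set_fsetK card_fseq undup_id // size_map /stab_list.
have [->|->] : N = 2%N \/ N = 3%N by lia.
  by [].
by [].
Qed.

End Stabilizers.

Opaque qD derive1.

(** * Orders of vanishing of squares and cubes *)

Section Orders.
Variable R : realType.
Local Notation C := (cplx R).
Local Notation H := (@upper_half R).
Implicit Types (t : C) (f h : C -> C).

Lemma vanishing_order0 f t : f t != 0 -> vanishing_order f t 0.
Proof. by move=> f0; split. Qed.

Lemma derive1_upper f h t d : H t -> (forall x, H x -> f x = h x) -> cder h t d -> derive1 f t = d.
Proof. by move=> ht e c; apply: cderE; apply: (cder_upper ht _ c) => x hx; rewrite e. Qed.

Lemma vanishing_order_sqr f h a t : qser h a -> H t -> (forall x, H x -> f x = h x ^+ 2) ->
  h t = 0 -> qD h t != 0 -> vanishing_order f t 2.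
Proof.
move=> qh ht e h0 d0; have p0 := @twopii_neq0 R; have qd := qser_qD qh.
have e1 x : H x -> derive1 f x = 2 * twopii R * (h x * qD h x).
  move=> hx; rewrite (derive1_upper hx e (cderX 2 (qser_cderD qh hx))) /= expr1.
  move: (qD h x) (h x) (twopii R) => v w p; ring.
have d2 : derive1 (derive1 f) t = 2 * twopii R ^+ 2 * qD h t ^+ 2.
  rewrite (derive1_upper ht e1 (cderZ _ (cderM (qser_cderD qh ht) (qser_cderD qd ht)))).
  move: (qD (qD h) t) (qD h t) (h t) h0 (twopii R) => u v w -> p; ring.
split; last by rewrite /derive1n /= d2 mulf_eq0 mulf_eq0 !expf_eq0 /= (negbTE p0) (negbTE d0) pnatr_eq0.
case=> [|[|//]] _; rewrite /derive1n /=; first by rewrite e // h0 expr0n.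
by rewrite e1 // h0 mul0r mulr0.
Qed.

Lemma vanishing_order_cube f h a t : qser h a -> H t -> (forall x, H x -> f x = h x ^+ 3) ->
  h t = 0 -> qD h t != 0 -> vanishing_order f t 3.
Proof.
move=> qh ht e h0 d0; have p0 := @twopii_neq0 R; have qd := qser_qD qh.
have qdd := qser_qD qd.
have e1 x : H x -> derive1 f x = 3 * twopii R * (h x ^+ 2 * qD h x).
  move=> hx; rewrite (derive1_upper hx e (cderX 3 (qser_cderD qh hx))) /=.
  move: (qD h x) (h x) (twopii R) => v w p; ring.
have e2 x : H x -> derive1 (derive1 f) x = 3 * twopii R ^+ 2 * (h x * (2 * qD h x ^+ 2 + h x * qD (qD h) x)).
  move=> hx; rewrite (derive1_upper hx e1 (cderZ _ (cderM (cderX 2 (qser_cderD qh hx)) (qser_cderD qd hx)))) /= expr1.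
  move: (qD (qD h) x) (qD h x) (h x) (twopii R) => u v w p; ring.
have d3 : derive1 (derive1 (derive1 f)) t = 6 * twopii R ^+ 3 * qD h t ^+ 3.
  rewrite (derive1_upper ht e2 (cderZ _ (cderM (qser_cderD qh ht)
    (cderD (cderZ 2 (cderX 2 (qser_cderD qd ht))) (cderM (qser_cderD qh ht) (qser_cderD qdd ht)))))) /= expr1.
  generalize (qD (qD (qD h)) t), (qD (qD h) t), (qD h t), (twopii R).
  move=> z u v p; rewrite h0.

 ring.

split; last by rewrite /derive1n /= d3 mulf_eq0 mulf_eq0 !expf_eq0 /= (negbTE p0) (negbTE d0) pnatr_eq0.
case=> [|[|[|//]]] _; rewrite /derive1n /=; first by rewrite e // h0 expr0n.
  by rewrite e1 // h0 expr0n /= mul0r mulr0.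
by rewrite e2 // h0 !mul0r mulr0.
Qed.

End Orders.

(** * Multivalued roots and orders at cusps *)

Section Multivalued.
Variable R : realType.
Local Notation C := (cplx R).
Local Notation H := (@upper_half R).
Implicit Types (t : C) (f F : C -> C).

Definition mv1 f : mvfun R := fun t => [set f t].
(** The two-valued square root: it serves for A at level 2, where [W] has simple zeros, and for all
    three forms at level 4. *)
Definition mv2 F : mvfun R := fun t => [set w | w ^+ 2 = F t].

Lemma mv1_power f m F : (forall t, H t -> f t ^+ m = F t) -> mv_power (mv1 f) m F.
Proof.
move=> h t ht; apply/seteqP; split=> w /=; first by move=> [x -> <-]; exact: h.
by move=> ->; exists (f t) => //; exact: h.
Qed.

Lemma sqrt_exists (z : C) : exists w : C, w ^+ 2 = z.
Proof. by exists (sqrtc z); exact: sqr_sqrtc. Qed.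

Lemma mv2_power f m F : (forall t, H t -> f t ^+ m = F t) -> mv_power (mv2 f) (2 * m) F.
Proof.
move=> h t ht; apply/seteqP; split=> w /=.
  by move=> [x xe <-]; rewrite exprM xe; exact: h.
by move=> ->; have [x xe] := sqrt_exists (f t); exists x => //; rewrite exprM xe; exact: h.
Qed.

Lemma mv1_holo f : holomorphic_on H f -> mv_holomorphic (mv1 f).
Proof.
move=> hf t0 h0 _; exists H; split=> //; first by apply: near_upper.
by move=> t1 w1 h1 /= ->; exists f.
Qed.

Lemma sqrt_right (z : C) : 1 / 2 <= complex.Re z -> exists w : C, w ^+ 2 = z /\ 1 / 2 <= complex.Re w.
Proof.
move=> hz.
have key (w : C) : w ^+ 2 = z -> 1 / 2 <= complex.Re w ^+ 2.
  move=> e; move: hz; rewrite -e expr2; case: w {e} => x y /= h.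
  by have := sqr_ge0 y; rewrite expr2 expr2 => h2; lra.
have [w e] := sqrt_exists z; have k := key w e.
have [w0|w0] := leP 0 (complex.Re w).
  by exists w; split=> //; nra.
exists (- w); rewrite sqrrN; split=> //.
have -> : complex.Re (- w) = - complex.Re w by case: (w).
nra.
Qed.

(** After division by [F t0] the values stay near 1, where a root of real part at least 1/2 is
    chosen. Two such roots have a sum of modulus at least 1, so u(x) - u(t), divided by that sum,
    gives first continuity and then the derivative. *)
Lemma local_sqrt F a t0 : qser F a -> H t0 -> F t0 != 0 -> exists U (s : C -> C),
  [/\ nbhs t0 U, U `<=` H, holomorphic_on U s & forall t, U t -> s t ^+ 2 = F t /\ s t != 0].
Proof.
move=> qF h0 f0; pose u t := F t / F t0.
have cu t : H t -> exists d, cder u t d.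
  by move=> ht; eexists; have := cderM (qser_cderD qF ht) (cder_cst (F t0)^-1 t); exact.
have [d0 c0] := cu t0 h0; have u0 : u t0 = 1 by rewrite /u divff.
have [e0 e0p he0] : exists2 e : R, 0 < e & forall x, nm (x - t0) < e -> nm (u t0 - u x) < 1 / 2.
  by have /cvg_nm_at := cder_continuous c0; apply; lra.
have [e1 e1p he1] := nearP_nm (near_upper h0 (fun x hx => hx)).
pose U : set C := [set x | nm (x - t0) < e0 /\ H x].
have nbU t : U t -> \forall x \near t, U x.
  move=> [h1 h2]; have [e2 e2p he2] := nearP_nm (near_upper h2 (fun x hx => hx)).
  have m0 : 0 < Num.min e2 (e0 - nm (t - t0)) by rewrite lt_min e2p subr_gt0.
  apply: (near_nm m0) => x; rewrite lt_min => /andP[x1 x2]; split; last exact: he2.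
  have -> : x - t0 = (x - t) + (t - t0) by ring.
  by apply: le_lt_trans (nmD _ _) _; rewrite -ltrBrDr.
have Ut0 : U t0 by split=> //; rewrite subrr nm0.
have ReU t : U t -> 1 / 2 <= complex.Re (u t).
  move=> [h1 _]; have := he0 _ h1; rewrite u0 => h; have := le_lt_trans (Re_le_nm _) h.
  by rewrite ReB /= ltr_norml => /andP[_ h']; lra.
have ch (z : C) : exists w : C, 1 / 2 <= complex.Re z -> w ^+ 2 = z /\ 1 / 2 <= complex.Re w.
  have [h|h] := leP (1 / 2) (complex.Re z); last by exists 0.
  by have [w hw] := sqrt_right h; exists w.
have [rt rtP] := boolp.choice ch.
have [s0 s0e] := sqrt_exists (F t0).
have s00 : s0 != 0 by apply: contraNneq f0 => z; rewrite -s0e z expr0n.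
have sum_ge t x : U t -> U x -> 1 <= nm (rt (u x) + rt (u t)).
  move=> ht hx; have [_ r1] := rtP _ (ReU _ ht); have [_ r2] := rtP _ (ReU _ hx).
  apply: le_trans (Re_le_nm _); rewrite ReD ger0_norm; lra.
have diff t x : U t -> U x -> u x - u t = (rt (u x) - rt (u t)) * (rt (u x) + rt (u t)).
  move=> ht hx; have [r1 _] := rtP _ (ReU _ ht); have [r2 _] := rtP _ (ReU _ hx).
  by rewrite -{1}r1 -{1}r2; ring.
have sum0 t x : U t -> U x -> rt (u x) + rt (u t) != 0.
  by move=> ht hx; rewrite -nm_gt0; apply: lt_le_trans (sum_ge t x ht hx).
have crt t : U t -> (fun x => rt (u x)) x @[x --> t] --> rt (u t).
  move=> ht; have [d cd] := cu t ht.2; apply/cvg_nm_at => e ep.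
  have /cvg_nm_at /(_ e ep) [s sp hs] := cder_continuous cd.
  have [s' s'p hs'] := nearP_nm (nbU t ht).
  exists (Num.min s s'); first by rewrite lt_min sp.
  move=> x; rewrite lt_min => /andP[x1 x2]; apply: le_lt_trans (hs x x1).
  have hx := hs' x x2; rewrite nmBC (nmBC (u t)) diff // nmM.
  by rewrite ler_peMr ?nm_ge0 // sum_ge.
have drt t : U t -> exists d, cder (fun x => rt (u x)) t d.
  move=> ht; have [d cd] := cu t ht.2; have [g [gl gt ge]] := cder_slopeP cd.
  exists (d * (rt (u t) + rt (u t))^-1).
  have lim : (fun x => g x * (rt (u x) + rt (u t))^-1) x @[x --> t] --> d * (rt (u t) + rt (u t))^-1.
    exact: (climM gl (climV (climD (crt t ht) (@clim_cst R t (rt (u t)))) (sum0 t t ht ht))).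
  apply: (cder_slope lim); near=> x.
  have hx : U x by near: x; exact: nbU.
  have n0 := sum0 t x ht hx.
  have e : (x - t) * g x = (rt (u x) - rt (u t)) * (rt (u x) + rt (u t)).
    by rewrite -diff // ge addrAC subrr add0r.
  by rewrite /= mulrA e mulfK // addrC subrK.
exists U, (fun x => s0 * rt (u x)); split.
- exact: nbU.
- by move=> t [].
- move=> t ht; have [d cd] := drt t ht; exact: cder_derivable (cderZ s0 cd).
move=> t ht; have [r1 r2] := rtP _ (ReU _ ht); split.
  by rewrite exprMn s0e r1 /u mulrC divfK.
rewrite mulf_neq0 //; apply: contraTneq r2 => ->; rewrite /= -ltNge; lra.
Unshelve. all: by end_near. Qed.

Lemma mv2_holo F a : qser F a -> mv_holomorphic (mv2 F).
Proof.
move=> qF t0 h0 n0; have f0 : F t0 != 0.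
  by apply: contra_notN n0 => /eqP z; rewrite /mv2 /= z expr0n.
have [U [s [nU UH hs es]]] := local_sqrt qF h0 f0.
exists U; split=> // t1 w1 u1 e1; have [se s0] := es t1 u1.
have : (w1 == s t1) || (w1 == - s t1) by rewrite -eqf_sqr se; exact/eqP.
case/orP => /eqP ->.
  by exists s; split; [exact: erefl|exact: hs|move=> t ut; exact: (es t ut).1].
exists (fun t => - s t); split; first exact: erefl.
  by move=> t ut; have d := hs t ut; apply: derivableN.
by move=> t ut; rewrite /mv2 /= sqrrN; exact: (es t ut).1.
Qed.

End Multivalued.

(** * Orders at the cusps and vanishing at one class only *)

Section CuspOrders.
Variable R : realType.
Local Notation C := (cplx R).
Local Notation H := (@upper_half R).
Implicit Types (t : C) (f F : C -> C).

Lemma cusp_ST j : cusp_act (STm j) None = Some 0.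
Proof. by rewrite /= !mx2E /cusp_of oner_eq0 mul0r. Qed.
Lemma cusp_V : cusp_act Vm None = Some (1 / 2).
Proof. by rewrite /= !mx2E. Qed.

Lemma equiv_inf N z : equivalent (Gamma0 N) (Cusp R None) z ->
  exists2 h, Gamma0 N h & z = Cusp R (cusp_act h None).
Proof. by move=> [h hh <-]; exists h. Qed.

Lemma equiv_zero N z : equivalent (Gamma0 N) (Cusp R (Some 0)) z ->
  exists2 h, Gamma0 N h & z = Cusp R (cusp_act (h *m STm 0) None).
Proof. by move=> [h hh <-]; exists h => //; rewrite (cusp_actM _ (SL_ST 0)) cusp_ST. Qed.

Lemma equiv_half N z : equivalent (Gamma0 N) (Cusp R (Some (1 / 2))) z ->
  exists2 h, Gamma0 N h & z = Cusp R (cusp_act (h *m Vm) None).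
Proof. by move=> [h hh <-]; exists h => //; rewrite (cusp_actM _ SL_V) cusp_V. Qed.

Lemma cusp_class N s : (1 < N < 5)%N ->
  [\/ equivalent (Gamma0 N) (Cusp R None) (Cusp R s),
      equivalent (Gamma0 N) (Cusp R (Some 0)) (Cusp R s) |
      N = 4%N /\ equivalent (Gamma0 N) (Cusp R (Some (1 / 2))) (Cusp R s)].
Proof.
move=> hN; have [g sg <-] := cusp_rep s.
case: (coset_rep hN sg) => [hg|[j [h hh ->]]|[N4 [h hh ->]]].
- by constructor 1; exists g.
- by constructor 2; exists h => //; rewrite (cusp_actM _ (SL_ST j)) cusp_ST.
- by constructor 3; split=> //; exists h => //; rewrite (cusp_actM _ SL_V) cusp_V.
Qed.

Definition cusp_orders N k f (m1 m2 m3 : nat) :=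
  [/\ forall z, equivalent (Gamma0 N) (Cusp R None) z -> order_at (Gamma0 N) k f z m1%:R,
      forall z, equivalent (Gamma0 N) (Cusp R (Some 0)) z -> order_at (Gamma0 N) k f z m2%:R &
      forall z, N = 4%N -> equivalent (Gamma0 N) (Cusp R (Some (1 / 2))) z ->
        order_at (Gamma0 N) k f z m3%:R].

Lemma cusp_ordersP N k f f' f3 m1 m2 m3 : (0 < N)%N -> aut N k f -> companion N k f f' ->
  half_cusp N k f f3 -> has_ord f m1 -> has_ord f' m2 -> has_ord f3 m3 ->
  cusp_orders N k f m1 m2 m3.
Proof.
move=> N0 af cf hf o1 o2 o3; split=> z.
- by move=> /equiv_inf[h hh ->]; exact: order_inf.
- by move=> /equiv_zero[h hh ->]; exact: (order_zero 0 N0 af cf).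
move=> N4; move: af hf; rewrite N4 => af hf /equiv_half[h hh ->].
exact: (order_half af hf).
Qed.

Lemma mv_vanish N r A F P0 : (0 < r)%N -> mv_power A r F ->
  (forall z, in_hstar z -> equivalent (Gamma0 N) P0 z -> order_at (Gamma0 N) r F z 1) ->
  (forall z, in_hstar z -> ~ equivalent (Gamma0 N) P0 z -> order_at (Gamma0 N) r F z 0) ->
  mv_vanishes_only_at (Gamma0 N) 1 A P0 (r%:R^-1 : R).
Proof.
move=> r0 pA h1 h0 z hz; have rn : (r%:R : R) != 0 by rewrite pnatr_eq0 -lt0n.
split=> e; exists r, F; rewrite muln1.
  by split; [exact: r0|exact: pA|rewrite divff //; exact: h1].
by split; [exact: r0|exact: pA|rewrite mulr0; exact: h0].
Qed.

Lemma order_pt0 N k F t : F t != 0 -> order_at (Gamma0 N) k F (Pt t) 0.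
Proof. by move=> f0; exists 0%N; [exact: vanishing_order0|rewrite mul0r]. Qed.

Lemma mv_vanish_inf N r A F : (1 < N < 5)%N -> (0 < r)%N -> mv_power A r F -> cusp_orders N r F 1 0 0 ->
  (forall t, H t -> F t != 0) -> mv_vanishes_only_at (Gamma0 N) 1 A (Cusp R None) (r%:R^-1 : R).
Proof.
move=> hN r0 pA [c1 c2 c3] f0; apply: mv_vanish pA _ _ => // [z _ /c1 //|[t|s] hz ne].
  by apply: order_pt0; exact: f0.
by case: (cusp_class s hN) => [//|/c2|[N4 /(c3 _ N4)]].
Qed.

Lemma mv_vanish_zero N r A F : (1 < N < 5)%N -> (0 < r)%N -> mv_power A r F -> cusp_orders N r F 0 1 0 ->
  (forall t, H t -> F t != 0) -> mv_vanishes_only_at (Gamma0 N) 1 A (Cusp R (Some 0)) (r%:R^-1 : R).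
Proof.
move=> hN r0 pA [c1 c2 c3] f0; apply: mv_vanish pA _ _ => // [z _ /c2 //|[t|s] hz ne].
  by apply: order_pt0; exact: f0.
by case: (cusp_class s hN) => [/c1|//|[N4 /(c3 _ N4)]].
Qed.

Lemma mv_vanish_half r A F : (0 < r)%N -> mv_power A r F -> cusp_orders 4 r F 0 0 1 ->
  (forall t, H t -> F t != 0) -> mv_vanishes_only_at (Gamma0 4) 1 A (Cusp R (Some (1 / 2))) (r%:R^-1 : R).
Proof.
move=> r0 pA [c1 c2 c3] f0; apply: mv_vanish pA _ _ => // [z _ h|[t|s] hz ne].
- exact: c3 h.
- by apply: order_pt0; exact: f0.
by case: (@cusp_class 4 s isT) => [/c1|/c2|[]].
Qed.

(** The analytic order at the elliptic point and the order of its stabilizer are both N, so the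
    order of [F] in a local parameter is 1. *)
Lemma mv_vanish_ell N r A F : (1 < N < 4)%N -> (0 < r)%N -> mv_power A r F -> cusp_orders N r F 0 0 0 ->
  (forall t, H t -> F t = 0 -> exists2 g, Gamma0 N g & mobius g (ell_pt R N) = t) ->
  (forall g, Gamma0 N g -> vanishing_order F (mobius g (ell_pt R N)) N) ->
  mv_vanishes_only_at (Gamma0 N) 1 A (Pt (ell_pt R N)) (r%:R^-1 : R).
Proof.
move=> hN r0 pA [c1 c2 c3] f0 vo; apply: mv_vanish pA _ _ => // [z _ [g hg <-]|[t|s] hz ne].
- exists N; first exact: vo.
  rewrite elliptic_order_orbit // divff // pnatr_eq0; lia.
- apply: order_pt0; apply/eqP => z; apply: ne; have [g hg <-] := f0 t hz z; by exists g.
have hN5 : (1 < N < 5)%N by lia.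
by case: (cusp_class s hN5) => [/c1|/c2|[N4 /(c3 _ N4)]].
Qed.

End CuspOrders.

(** * Quasi-modularity at all cusps *)

Section QuasiModular.
Variable R : realType.
Local Notation C := (cplx R).
Local Notation H := (@upper_half R).
Implicit Types (t : C) (f F : C -> C) (g h : 'M[int]_2).

(** The slashed form with its anomaly removed depends only on the coset of the matrix, so expansions
    have to be found for coset representatives only. *)
Lemma quasi_slash N f (s : C) h x t :
  (forall g t, Gamma0 N g -> H t ->
     f (mobius g t) = jfactor g t ^+ 2 * f t + s / twopii R * (g 1 0)%:~R * jfactor g t) ->
  Gamma0 N h -> SL2Z x -> H t ->
  slash 2 f (h *m x) t - s / twopii R * ((h *m x) 1 0)%:~R / jfactor (h *m x) t =
  slash 2 f x t - s / twopii R * (x 1 0)%:~R / jfactor x t.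
Proof.
move=> qf hh hx ht; have sh := Gamma0_SL hh; have hm := mobius_upper hx ht.
have j0 := jfactor_neq0 sh hm; have j1 := jfactor_neq0 hx ht.
rewrite /slash mobiusM // jfactorM // qf // mul2E intrD !intrM.
have me : mobius x t * jfactor x t = (x 0 0)%:~R * t + (x 0 1)%:~R by rewrite /mobius divfK.
have dt : ((x 0 0)%:~R * (x 1 1)%:~R - (x 0 1)%:~R * (x 1 0)%:~R : C) = 1.
  by rewrite -!intrM -intrB; move/SL2ZE: hx => ->.
have key : jfactor h (mobius x t) * jfactor x t * (x 1 0)%:~R + (h 1 0)%:~R =
  ((h 1 0)%:~R * (x 0 0)%:~R + (h 1 1)%:~R * (x 1 0)%:~R) * jfactor x t.
  rewrite [X in X * _ * _]/jfactor mulrDl -(mulrA _ (mobius x t)) me.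
  rewrite /jfactor; transitivity (((h 1 0)%:~R * ((x 0 0)%:~R * t + (x 0 1)%:~R) +
    (h 1 1)%:~R * ((x 1 0)%:~R * t + (x 1 1)%:~R)) * (x 1 0)%:~R + (h 1 0)%:~R *
    ((x 0 0)%:~R * (x 1 1)%:~R - (x 0 1)%:~R * (x 1 0)%:~R) : C); first by rewrite dt mulr1.
  by ring.
move: (s / twopii R) (f (mobius x t)) => k w.
move: (jfactor h _) (jfactor x t) ((x 1 0)%:~R : C) ((h 1 0)%:~R : C)
  ((h 1 0)%:~R * (x 0 0)%:~R + (h 1 1)%:~R * (x 1 0)%:~R : C) j0 j1 key => u v c d z u0 v0 key.
have -> : d = z * v - u * v * c by rewrite -key; ring.
by field; rewrite u0 v0.
Qed.

Lemma quasi_intro N f f0 f3 a b c (s x y : C) : (1 < N < 5)%N ->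
  qser f a -> qser f0 b -> qser f3 c ->
  (forall g t, Gamma0 N g -> H t ->
     f (mobius g t) = jfactor g t ^+ 2 * f t + s / twopii R * (g 1 0)%:~R * jfactor g t) ->
  (forall t, H t -> f (- t^-1) / t ^+ 2 - s / twopii R / t = x * f0 (t / N%:R)) ->
  (N = 4%N -> forall t, H t ->
     f (t / (2 * t + 1)) / (2 * t + 1) ^+ 2 - s / twopii R * 2 / (2 * t + 1) = y * f3 t) ->
  quasi_modular_form (Gamma0 N) f.
Proof.
move=> hN qf q0 q3 tf t0 th; have N0 : (0 < N)%N by lia.
exists s; split; [exact: qser_derivable qf|exact: tf|move=> g hg].
have triv (t : C) : (t + (0 : int)%:~R) / 1%:R = t by rewrite addr0 divr1.
case: (coset_rep hN hg) => [h|[j [h hh ->]]|[N4 [h hh ->]]].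
- apply: (eq_holo_inf _ (qser_holo_inf 1 0 (ltn0Sn 0) qf)) => t ht.
  have := quasi_slash tf h (Gamma0_SL (Gamma0_1 1)) ht; rewrite mulmx1 => ->.
  by rewrite slash_1 triv mx2_1 mx2E mulr0 mul0r subr0 mul1r.
- apply: (eq_holo_inf _ (qser_holo_inf x j N0 q0)) => t ht.
  rewrite (quasi_slash tf hh (SL_ST j) ht) -(t0 _ (upper_addz j ht)).
  by rewrite /slash mobius_ST jfactor_ST mx2E mulr1 [_^-1 * _]mulrC.
apply: (eq_holo_inf _ (qser_holo_inf y 0 (ltn0Sn 0) q3)) => t ht.
rewrite triv (quasi_slash tf hh SL_V ht) -(th N4 t ht).
by rewrite /slash mobius_V jfactor_V mx2E [_^-1 * _]mulrC.
Qed.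

Lemma lE_quasi_form N r k0 : (1 < N < 4)%N -> (r * N.+1 = 12)%N -> k0 != 0 :> C ->
  quasi_modular_form (Gamma0 N) (@lE R N).
Proof.
move=> hN rN k00; have N1 : (1 < N < 5)%N by lia.
have N0 : (0 < N)%N by lia. have n0 := @natC_neq0 R N N0; have p0 := @twopii_neq0 R.
have q := qser_lE N1 rN k00; have qh := qser_lEh N1 rN k00.
apply: (quasi_intro (s := r%:R) (x := N%:R^-1) (y := 1) N1 q qh q) => [g t hg ht|t ht|N4].
- exact: lE_quasi N1 rN k00 _ _ hg ht.
- have hs := upper_divn N0 ht; have t0 := upper_neq0 ht.
  have -> : - t^-1 = fricke N (t / N%:R) by rewrite /fricke mulrC divfK.
  rewrite (lE_fricke N1 rN k00 hs); move: (lEh N _) (twopii R) p0 (r%:R : C) => u p p0 v.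
  by field; rewrite n0 t0 p0.
by lia.
Qed.

End QuasiModular.

(** * Part (2) at levels 2 and 3 *)

Section PartTwo.
Variable R : realType.
Local Notation C := (cplx R).
Local Notation H := (@upper_half R).
Implicit Types (t : C) (f F : C -> C).

Definition part_two (N r : nat) := exists (A B C : mvfun R) (FA FB FC : cplx R -> cplx R) (P : hstar R),
   [/\ [/\ mv_modular_form (Gamma0 N) 1 A, mv_modular_form (Gamma0 N) 1 B &
           mv_modular_form (Gamma0 N) 1 C],
       [/\ mv_power A r FA /\ modular_form (Gamma0 N) r FA,
           mv_power B r FB /\ modular_form (Gamma0 N) r FB,
           mv_power C r FC /\ modular_form (Gamma0 N) r FC &
           forall t, upper_half t -> FA t = FB t + FC t],
       [/\ third_fixed_point N P,
           mv_vanishes_only_at (Gamma0 N) 1 A P r%:R^-1,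
           mv_vanishes_only_at (Gamma0 N) 1 B (Cusp R (Some 0)) r%:R^-1 &
           mv_vanishes_only_at (Gamma0 N) 1 C (Cusp R None) r%:R^-1] &
       forall t a, upper_half t -> A t a ->
         [/\ qD FA t = calEt r t * FA t - a ^+ 2 * FB t,
             qD FB t = calEt r t * FB t - a ^+ 2 * FB t,
             qD FC t = calEt r t * FC t &
             r%:R * qD (calEt r) t = calEt r t ^+ 2 - a ^+ (4 - r) * FB t]].

Lemma mv_modular_intro N r A F : (0 < r)%N -> mv_holomorphic A -> mv_power A r F ->
  modular_form (Gamma0 N) r F -> mv_modular_form (Gamma0 N) 1 A.
Proof. by move=> r0 hA pA mF; split=> //; exists r, F; rewrite muln1. Qed.

Lemma calE4E : calEt 4 = @lE R 2.
Proof.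
apply: funext => t; apply: (etrans (calEtE4 t)); rewrite /lE.
by generalize (P (2 * t)), (P t) => u v; field.
Qed.
Lemma calE3E : calEt 3 = @lE R 3.
Proof.
apply: funext => t; apply: (etrans (calEtE3 t)); rewrite /lE.
by generalize (P (3 * t)), (P t) => u v; field.
Qed.

Section Common.
Variables (N r : nat) (k0 x0 : C).
Hypotheses (hN : (1 < N < 4)%N) (rN : (r * N.+1 = 12)%N) (k00 : k0 != 0) (x0E : x0 ^+ r = k0).
Let N1 : (1 < N < 5)%N. Proof. by clear -hN; lia. Qed.
Let N0 : (0 < N)%N. Proof. by clear -hN; lia. Qed.
Let r0 : (0 < r)%N. Proof. by clear -rN; case: r rN. Qed.
Local Notation FB := (@lFB R N r).
Local Notation FC := (@lFC R N r k0).
Local Notation FA := (@lFA R N r k0).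

Let no_half k f f3 : @half_cusp R N k f f3. Proof. by clear -hN => N4; lia. Qed.

(** The root C is single-valued on [H], since q has the r-th root [nome (t / r)] there. *)
Definition cbranch t := x0 * nome (r%:R^-1 * t) * lc N r t.

Lemma cbranch_pow t : H t -> cbranch t ^+ r = FC t.
Proof.
move=> ht; rewrite /cbranch; have e : nome (r%:R^-1 * t) ^+ r = nome t.
  by apply: (etrans (esym (nome_nat r _))); rewrite mulrA divff ?mul1r //; exact: natC_neq0.
by move: (nome (_^-1 * t)) e => u e; rewrite !exprMn x0E e.
Qed.

Lemma cbranch_holo : holomorphic_on H cbranch.
Proof.
move=> t ht; apply: cder_derivable (cderM (cderZ x0 (cder_comp (cderZ _ (cder_id t)) (cder_nome _)))
  (qser_cderD (qser_lc N1 rN k00) ht)).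
Qed.

Let qB : qser FB _ := projT2 (boolp.cid (let: ex_intro a (And3 q _ _) := qjet_lFB N1 rN k00 in ex_intro _ a q)).
Let qC : qser FC _ := projT2 (boolp.cid (let: ex_intro a (And3 q _ _) := qjet_lFC N1 rN k00 in ex_intro _ a q)).

Let i_ : C := 0 +i* 1.
Let hi : H i_. Proof. by rewrite /upper_half /=. Qed.

Lemma FB_modular : modular_form (Gamma0 N) r FB.
Proof.
exact: (modular_form_intro N1 (lFB_companion N1 rN k00) (no_half _ _ _) qB qC qB hi (lFB_neq0 N1 rN k00 hi)).
Qed.
Lemma FC_modular : modular_form (Gamma0 N) r FC.
Proof.
exact: (modular_form_intro N1 (lFC_companion N1 rN k00) (no_half _ _ _) qC qB qB hi (lFC_neq0 N1 rN k00 hi)).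
Qed.

(** The multiplier is read off at a point where the form does not vanish; [FA] has zeros, so such a
    point is obtained from its constant coefficient 1. *)
Lemma FA_nonzero : exists2 t, H t & FA t != 0.
Proof.
apply: contrapT => ne; have z t : H t -> FA t = 0.
  by move=> ht; apply/eqP/negPn/negP => h; apply: ne; exists t.
have [a [qa a0 _]] := qjetD (qjet_lFB N1 rN k00) (qjet_lFC N1 rN k00).
by have := qser_eq0 qa z 0%N; rewrite a0 addr0 => /eqP; rewrite oner_eq0.
Qed.

Lemma FA_modular : modular_form (Gamma0 N) r FA.
Proof.
have [f cf [b [qb _ _]]] := lFA_companion N1 rN k00; have [t ht t0] := FA_nonzero.
exact: (modular_form_intro N1 cf (no_half _ _ _) (qserD qB qC) qb qB ht t0).
Qed.

Lemma FB_orders : cusp_orders N r FB 0 1 0.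
Proof.
have c := lFB_companion N1 rN k00.
exact: (cusp_ordersP N0 (aut_of_companion N1 qB qC c) c (no_half _ _ _) (ord_lFB N1 rN k00) (ord_lFC N1 rN k00) (ord_lFB N1 rN k00)).
Qed.
Lemma FC_orders : cusp_orders N r FC 1 0 0.
Proof.
have c := lFC_companion N1 rN k00.
exact: (cusp_ordersP N0 (aut_of_companion N1 qC qB c) c (no_half _ _ _) (ord_lFC N1 rN k00) (ord_lFB N1 rN k00) (ord_lFB N1 rN k00)).
Qed.
Lemma FA_orders : cusp_orders N r FA 0 0 0.
Proof.
have [f cf o] := lFA_companion N1 rN k00; have [b [qb _ _]] := o.
exact: (cusp_ordersP N0 (aut_of_companion N1 (qserD qB qC) qb cf) cf (no_half _ _ _) (ord_lFA N1 rN k00) o (ord_lFB N1 rN k00)).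
Qed.

Lemma qD_FA t : H t -> qD FA t = lEh N t * FB t + lE N t * FC t.
Proof.
move=> ht; apply: qDE; apply: cder_eq (cderD (cder_lFB N1 rN k00 ht) (cder_lFC N1 rN k00 ht)) _.
by move: (lEh N t) (lE N t) (FB t) (FC t) (twopii R) => a b c d p; ring.
Qed.

(** Isolates what depends on the level: the root A of [FA], the place and order of its zeros, and
    the relation of its square to [lW] and to the Riccati equation. *)
Lemma part_two_intro A : mv_holomorphic A -> mv_power A r FA ->
  third_fixed_point N (Pt (ell_pt R N)) ->
  (forall t, H t -> FA t = 0 -> exists2 g, Gamma0 N g & mobius g (ell_pt R N) = t) ->
  (forall g, Gamma0 N g -> vanishing_order FA (mobius g (ell_pt R N)) N) ->
  calEt r = @lE R N ->
  (forall t a, H t -> A t a -> a ^+ 2 = lW N t /\ r%:R * qD (lE N) t = lE N t ^+ 2 - a ^+ (4 - r) * FB t) ->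
  part_two N r.
Proof.
move=> hA pA tf zA vA cE sA.
exists A, (mv1 (lb N r)), (mv1 cbranch), FA, FB, FC, (Pt (ell_pt R N)).
have pB : mv_power (mv1 (lb N r)) r FB by apply: mv1_power.
have pC : mv_power (mv1 cbranch) r FC by apply: mv1_power; exact: cbranch_pow.
split.
- split.
  + exact: mv_modular_intro r0 hA pA FA_modular.
  + apply: mv_modular_intro r0 _ pB FB_modular; apply: mv1_holo; exact: qser_derivable (qser_lb N1 rN k00).
  + apply: mv_modular_intro r0 _ pC FC_modular; apply: mv1_holo; exact: cbranch_holo.
- split; [by split; [exact: pA|exact: FA_modular]|by split; [exact: pB|exact: FB_modular]
    |by split; [exact: pC|exact: FC_modular]|by []].
- split; [exact: tf|exact: mv_vanish_ell hN r0 pA FA_orders zA vA| |].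
    exact: mv_vanish_zero N1 r0 pB FB_orders (fun t ht => lFB_neq0 N1 rN k00 ht).
  exact: mv_vanish_inf N1 r0 pC FC_orders (fun t ht => lFC_neq0 N1 rN k00 ht).
move=> t a ht /(sA t a ht)[a2 rE]; rewrite cE a2; split; last exact: rE.
- rewrite qD_FA // (lEhE N1 rN k00) /lFA.
  by move: (lE N t) (lW N t) (FB t) (FC t) => u v w z; ring.
- rewrite (qD_lFB N1 rN k00 ht) (lEhE N1 rN k00); exact: mulrBl.
- exact: qD_lFC N1 rN k00 t ht.
Qed.

End Common.

Lemma part_two_2 : part_two 2 4.
Proof.
(* A fourth root of the constant of [lFC], needed for the branch of C. *)
have x8 : ((Num.sqrt 8)%:C : C) ^+ 4 = 64.
  have -> : ((Num.sqrt 8)%:C : C) ^+ 4 = ((Num.sqrt 8 ^+ 2) ^+ 2)%:C by rewrite -!rmorphXn /= -exprM.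
  rewrite sqr_sqrtr // -natrX; by rewrite rmorph_nat.
have qW := qser_lW N1_2 rN_2 (@k00_2 R).
apply: (@part_two_intro 2 4 64 _ isT rN_2 (@k00_2 R) x8 (mv2 (lW 2))).
- exact: mv2_holo qW.
- by apply: (@mv2_power R (lW 2) 2) => t ht; rewrite W_sqr_2.
- exists (ell_pt R 2); split=> //; first exact: ell_pt_upper.
  have := @elliptic_order_orbit R 2 1%:M isT (Gamma0_1 2); by rewrite mobius_1.
- move=> t ht z; apply: (zeros_2 ht); have := W_sqr_2 ht; rewrite -/(lFA 2 4 64 t) z.
  by move=> /eqP; rewrite expf_eq0 => /andP[_ /eqP].
- move=> g hg; have ht := mobius_upper (Gamma0_SL hg) (@ell_pt_upper R 2 isT).
  have w0 : lW 2 (mobius g (ell_pt R 2)) = 0.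
    have cW : companion 2 2 (@lW R 2) (lW 2).
      exists (- 2); first by rewrite oppr_eq0 pnatr_eq0.
      by move=> t h; rewrite (lW_fricke N1_2 rN_2 (@k00_2 R)).
    have [e _ ->] := aut_of_companion N1_2 qW qW cW hg; last exact: ell_pt_upper.
    by rewrite (@vanish_at_ell R 2 4 64 isT rN_2 (@k00_2 R)) mulr0.
  apply: (vanishing_order_sqr qW ht) => // [x hx|]; first by rewrite W_sqr_2.
  (* At a zero of [W] the differential relation reduces to 2 W' = - FB, which is nonzero: the zero
     is simple. *)
  have := qD_W_2 ht; rewrite w0 mulr0 sub0r => e.
  have := lFB_neq0 N1_2 rN_2 (@k00_2 R) ht; rewrite -oppr_eq0 -e.
  by rewrite mulf_eq0 negb_or => /andP[].
- exact: calE4E.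
move=> t a ht /= aW; split; first exact: aW.
rewrite expr0 mul1r -(riccati_2 ht); move: (lE 2 t) (qD _ t) => u v; ring.
Qed.

Lemma part_two_3 : part_two 3 3.
Proof.
have x3 : (3 : C) ^+ 3 = 27 by rewrite -natrX.
have [b [qa _ _]] := qjet_a R.
apply: (@part_two_intro 3 3 27 _ isT rN_3 (@k00_3 R) x3 (mv1 (@cubic_a R))).
- apply: mv1_holo; exact: qser_derivable qa.
- by apply: mv1_power => t ht; rewrite a_cube.
- exists (ell_pt R 3); split=> //; first exact: ell_pt_upper.
  have := @elliptic_order_orbit R 3 1%:M isT (Gamma0_1 3); by rewrite mobius_1.
- move=> t ht z; apply: (zeros_3 ht); rewrite -a_sqr //.
  have : cubic_a t ^+ 3 == 0 by rewrite a_cube // -/(lFA 3 3 27 t) z.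
  by rewrite expf_eq0 => /andP[_ /eqP ->]; rewrite expr0n.
- move=> g hg; have ht := mobius_upper (Gamma0_SL hg) (@ell_pt_upper R 3 isT).
  have qW := qser_lW N1_3 rN_3 (@k00_3 R).
  have w0 : cubic_a (mobius g (ell_pt R 3)) = 0.
    have cW : companion 3 2 (@lW R 3) (lW 3).
      exists (- 3); first by rewrite oppr_eq0 pnatr_eq0.
      by move=> t h; rewrite (lW_fricke N1_3 rN_3 (@k00_3 R)).
    have w0 : lW 3 (mobius g (ell_pt R 3)) = 0.
      have [e _ ->] := aut_of_companion N1_3 qW qW cW hg; last exact: ell_pt_upper.
      by rewrite (@vanish_at_ell R 3 3 27 isT rN_3 (@k00_3 R)) mulr0.
    by have /eqP := a_sqr ht; rewrite w0 expf_eq0 => /andP[_ /eqP].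
  apply: (vanishing_order_cube qa ht) => // [x hx|]; first by rewrite a_cube.
  have := qD_a ht; rewrite w0 mulr0 sub0r => e.
  have := lFB_neq0 N1_3 rN_3 (@k00_3 R) ht; rewrite -oppr_eq0 -e.
  by rewrite mulf_eq0 negb_or => /andP[].
- exact: calE3E.
move=> t a ht /= ->; split; first exact: a_sqr.
rewrite expr1 -(riccati_3 ht); move: (lE 3 t) (qD _ t) => u v; ring.
Qed.

End PartTwo.

(** * The generalized Chazy equations *)

Section Chazy.
Variable R : realType.
Local Notation C := (cplx R).
Local Notation H := (@upper_half R).
Implicit Types (t : C) (f F : C -> C).

(** The three functions satisfy a closed differential system, and each u_k is a covariant
    derivative, so [E] cancels and the u_k are polynomials in [W] and [F]. It serves r = 4 and, with
    [F] the product of [alpha] and [beta], also r = 2. *)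
Lemma chazy_even (c : C) (E W F : C -> C) :
  (forall t, H t -> cder E t (c * (E t ^+ 2 - F t))) ->
  (forall t, H t -> cder F t (c * (4 * (E t - W t) * F t))) ->
  (forall t, H t -> cder W t (c * (2 * (E t * W t - F t)))) ->
  forall t, H t -> let u := fun t => c * E t in
  chazy_u u 0 t * chazy_u u 2 t - chazy_u u 1 t ^+ 2 + 8 * chazy_u u 0 t ^+ 3 = 0.
Proof.
move=> dE dF dW t0 h0 u.
have u4 t : H t -> chazy_u u 0 t = - c ^+ 2 * F t.
  move=> ht; rewrite /= (cderE (cderZ c (dE t ht))) /u.
  by move: (E t) (F t) => x y; ring.
have u6 t : H t -> chazy_u u 1 t = 4 * c ^+ 3 * (W t * F t).
  move=> ht; have e : chazy_u u 1 t = derive1 (chazy_u u 0) t - (2 * 0 + 4)%N%:R * u t * chazy_u u 0 t by [].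
  rewrite e (derive1_upper ht u4 (cderZ _ (dF t ht))) u4 // /u.
  by move: (E t) (F t) (W t) => x y z; ring.
have u8 t : H t -> chazy_u u 2 t = c ^+ 4 * (- 8 * F t ^+ 2 - 16 * W t ^+ 2 * F t).
  move=> ht; have e : chazy_u u 2 t = derive1 (chazy_u u 1) t - (2 * 1 + 4)%N%:R * u t * chazy_u u 1 t by [].
  rewrite e (derive1_upper ht u6 (cderZ _ (cderM (dW t ht) (dF t ht)))) u6 // /u.
  by move: (E t) (F t) (W t) => x y z; ring.
rewrite u4 // u6 // u8 //; move: (F t0) (W t0) => y z; ring.
Qed.

Lemma chazy_cubic (c : C) (E a F : C -> C) :
  (forall t, H t -> cder E t (c * (E t ^+ 2 - a t * F t))) ->
  (forall t, H t -> cder F t (c * (3 * (E t - a t ^+ 2) * F t))) ->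
  (forall t, H t -> cder a t (c * (E t * a t - F t))) ->
  gen_chazy 3 (fun t => c * E t).
Proof.
move=> dE dF da t0 h0; set u := fun t : C => c * E t.
have u4 t : H t -> chazy_u u 0 t = - c ^+ 2 * (a t * F t).
  move=> ht; rewrite /= (cderE (cderZ c (dE t ht))) /u.
  by move: (E t) (F t) (a t) => x y z; ring.
have u6 t : H t -> chazy_u u 1 t = c ^+ 3 * (F t ^+ 2 + 3 * (a t ^+ 3 * F t)).
  move=> ht; have e : chazy_u u 1 t = derive1 (chazy_u u 0) t - (2 * 0 + 4)%N%:R * u t * chazy_u u 0 t by [].
  rewrite e (derive1_upper ht u4 (cderZ _ (cderM (da t ht) (dF t ht)))) u4 // /u.
  by move: (E t) (F t) (a t) => x y z; ring.
have u8 t : H t -> chazy_u u 2 t = - c ^+ 4 * (15 * a t ^+ 2 * F t ^+ 2 + 9 * a t ^+ 5 * F t).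
  move=> ht; have e : chazy_u u 2 t = derive1 (chazy_u u 1) t - (2 * 1 + 4)%N%:R * u t * chazy_u u 1 t by [].
  rewrite e (derive1_upper ht u6 (cderZ _ (cderD (cderX 2 (dF t ht)) (cderZ 3 (cderM (cderX 3 (da t ht)) (dF t ht)))))) u6 // /u /=.
  by move: (E t) (F t) (a t) => x y z; ring.
rewrite /chazy_p u4 // u6 // u8 //; move: (F t0) (a t0) => y z; ring.
Qed.

Lemma chazy_3 : gen_chazy 3 (fun t : C => twopii R / 3%:R * calEt 3 t).
Proof.
rewrite calE3E; have [b [qa _ _]] := qjet_a R.
apply: (@chazy_cubic (twopii R / 3%:R) (lE 3) (@cubic_a R) (lFB 3 3)) => t ht.
- apply: cder_eq (qser_cderD (qser_lE N1_3 rN_3 (@k00_3 R)) ht) _.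
  by rewrite -(riccati_3 ht); move: (lE 3 t) (qD _ t) (twopii R) => u v p; field.
- have h := @cder_lFB R 3 3 _ N1_3 rN_3 (@k00_3 R) t ht; apply: (cder_eq h).
  by rewrite E_W_3 //; move: (lE 3 t) (cubic_a t) (lFB 3 3 t) (twopii R) => u v w p; field.
- apply: cder_eq (qser_cderD qa ht) _.
  by rewrite -(qD_a ht); move: (qD _ t) (twopii R) => v p; field.
Qed.

Lemma chazy_4 : gen_chazy 4 (fun t : C => twopii R / 4%:R * calEt 4 t).
Proof.
rewrite calE4E => t0 h0.
refine (@chazy_even (twopii R / 4%:R) (lE 2) (lW 2) (lFB 2 4) _ _ _ t0 h0) => t ht.
- apply: cder_eq (qser_cderD (qser_lE N1_2 rN_2 (@k00_2 R)) ht) _.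
  by rewrite -(riccati_2 ht); move: (lE 2 t) (qD _ t) (twopii R) => u v p; field.
- have h := @cder_lFB R 2 4 _ N1_2 rN_2 (@k00_2 R) t ht; apply: (cder_eq h).
  by rewrite E_W_2 //; move: (lE 2 t) (lW 2 t) (lFB 2 4 t) (twopii R) => u v w p; field.
- apply: cder_eq (qser_cderD (qser_lW N1_2 rN_2 (@k00_2 R)) ht) _.
  by rewrite -(qD_W_2 ht); move: (qD _ t) (twopii R) => v p; field.
Qed.

End Chazy.

(** * Level 4 *)

Section LevelFour.
Variable R : realType.
Local Notation C := (cplx R).
Local Notation H := (@upper_half R).
Implicit Types (t : C) (f F : C -> C) (a : nat -> C).

Lemma divisors_odd (m d : nat) : (0 < m)%N -> ~~ (2 %| d)%N -> (d \in divisors (2 * m)) = (d \in divisors m).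
Proof.
move=> m0 od; rewrite -!dvdn_divisors ?muln_gt0 // Gauss_dvdr //.
by rewrite coprime_sym prime_coprime.
Qed.

(** The Hecke relation at the prime 2: odd divisors of 2m are those of m, even ones are the doubles
    of the divisors of m. *)
Lemma sig_double (m : nat) : (0 < m)%N -> sig R (2 * m) = 3 * sig R m - 2 * dil 2 (sig R) m.
Proof.
move=> m0; have m20 : (0 < 2 * m)%N by rewrite muln_gt0.
rewrite !sigE // (bigID (fun d => (2 %| d)%N)) /=.
rewrite (sum_divisors_mul (fun d => d%:R : C) (ltn0Sn 1) m20) dvdn_mulr // mulKn //.
have -> : \sum_(d <- divisors (2 * m) | ~~ (2 %| d)%N) d%:R = \sum_(d <- divisors m | ~~ (2 %| d)%N) d%:R :> C.
  rewrite -big_filter -[RHS]big_filter; apply: perm_big; apply: uniq_perm; rewrite ?filter_uniq ?divisors_uniq //.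
  by move=> d; rewrite !mem_filter; case: (boolP (2 %| d)%N) => //= od; rewrite divisors_odd.
have e : \sum_(d <- divisors m) d%:R = \sum_(d <- divisors m | (2 %| d)%N) d%:R +
    \sum_(d <- divisors m | ~~ (2 %| d)%N) d%:R :> C by rewrite (bigID (fun d => (2 %| d)%N)).
rewrite (sum_divisors_mul (fun d => d%:R : C) (ltn0Sn 1) m0) in e.
have -> : \sum_(d <- divisors m) (2 * d)%:R = 2 * \sum_(d <- divisors m) d%:R :> C.
  by rewrite mulr_sumr; apply: eq_bigr => d _; rewrite natrM.
rewrite e /dil; case: ifP => hm; last by rewrite add0r mulr0 subr0; ring.
have m2 : (0 < m %/ 2)%N by rewrite divn_gt0 // dvdn_leq.
rewrite sigE //.
have -> : \sum_(d <- divisors (m %/ 2)) (2 * d)%:R = 2 * \sum_(d <- divisors (m %/ 2)) d%:R :> C.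
  by rewrite mulr_sumr; apply: eq_bigr => d _; rewrite natrM.
by ring.
Qed.

(** With theta(q) the sum of q^(n^2) over all integers n, [alpha] is theta(q)^4 and [beta] is
    theta(-q)^4; [gamma] = 16 q + ... is the fourth power of the remaining theta constant, and
    Jacobi's quartic identity becomes linear. *)
Definition alpha t : C := (4 * P (4 * t) - P t) / 3.
Definition beta t : C := (8 * P (4 * t) - 6 * P (2 * t) + P t) / 3.
Definition gamma t : C := 2 * (3 * P (2 * t) - 2 * P (4 * t) - P t) / 3.
Definition gammac n : C := 2 / 3 * (3 * dil 2 (@e2c R) n - 2 * dil 4 (@e2c R) n - e2c R n).

Lemma qser_gamma : qser gamma gammac.
Proof.
have q := qserZ (2 / 3) (qserB (qserB (qserZ 3 (qser_dil (ltn0Sn 1) (@qser_P R))) (qserZ 2 (qser_dil (ltn0Sn 3) (@qser_P R)))) (@qser_P R)).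
by apply: eq_qser q => t ht; rewrite /gamma; generalize (P (2 * t)), (P (4 * t)), (P t) => u v w; field.
Qed.

(** The combination defining [gamma] is the Hecke relation at 2, so only odd powers of q remain;
    this parity gives the behaviour under [t + 1 / 2]. *)
Lemma gammac_even m : gammac (2 * m) = 0.
Proof.
rewrite /gammac; case: m => [|m]; first by rewrite muln0 !dil_0 /=; field.
have n0 : (0 < 2 * m.+1)%N by [].
rewrite !dil_e2c // -[e2c R (2 * m.+1)]dil1 dil_e2c // dil1 sig_double //.
have -> : dil 2 (sig R) (2 * m.+1) = sig R m.+1 by rewrite /dil dvdn_mulr // mulKn.
have -> : dil 4 (sig R) (2 * m.+1) = dil 2 (sig R) m.+1.
  by rewrite /dil (_ : 4 = 2 * 2)%N // dvdn_pmul2l // divnMl.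
by move: (sig R m.+1) (dil 2 _ _) => u v; field.
Qed.

Lemma tame_even a : tame a -> tame (fun n => a (2 * n)%N).
Proof.
move=> ta rho r0 r1; have [|M hM] := ta (Num.sqrt rho) (sqrtr_ge0 _).
  by rewrite -[ltRHS]sqrtr1 ltr_sqrt.
by exists M => n; have := hM (2 * n)%N; rewrite exprM sqr_sqrtr.
Qed.

Lemma qser_halve f a : qser f a -> (forall n, odd n -> a n = 0) -> qser (fun t => f (t / 2%:R)) (fun n => a (2 * n)%N).
Proof.
move=> [ta fE] ho; have te := tame_even ta; split=> // t ht.
have h2 := @upper_divn R t 2 isT ht; rewrite (fE _ h2).
have -> : ev a (nome (t / 2%:R)) = ev (dil 2 (fun n => a (2 * n)%N)) (nome (t / 2%:R)).
  apply: eq_ev => n; rewrite /dil; case: ifP => [/dvdnP[m ->]|]; first by rewrite mulnK // mulnC.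
  by rewrite dvdn2 => /negbFE; exact: ho.
rewrite (ev_dil (ltn0Sn 1) te (nm_nome_lt1 h2)); congr ev.
by apply: (etrans (esym (nome_nat 2 _))); congr nome; field.
Qed.

Lemma qser_addhalf f a : qser f a -> qser (fun t => f (t + 1 / 2)) (fun n => (-1) ^+ n * a n).
Proof.
move=> [ta fE]; split.
  by apply: tame_le ta => n; rewrite nmM nmX nmN nm1 expr1n mul1r.
move=> t ht; have h2 : H (t + 1 / 2).
    have -> : 1 / 2 = (1 / 2 : R)%:C :> C by rewrite rmorphM fmorphV rmorph1 rmorph_nat.
    by move: ht; rewrite /upper_half /= ImD /= addr0.
rewrite (fE _ h2); have -> : nome (t + 1 / 2) = - nome t.
  have -> : t + 1 / 2 = (2 * t + 1) / 2 by field.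
  by rewrite nome_half; congr (- nome _); field.
exact: ev_opp.
Qed.

End LevelFour.

(** * Fricke laws and differential relations at level 4 *)

Section LevelFourForms.
Variable R : realType.
Local Notation C := (cplx R).
Local Notation H := (@upper_half R).
Implicit Types (t : C) (f F : C -> C).
Local Notation alpha := (@alpha R).
Local Notation beta := (@beta R).
Local Notation gamma := (@gamma R).
Local Notation E t := (lE 2 (2%:R * t) : C).
Local Notation W t := (lW 2 (2%:R * t) : C).

Let p0 : twopii R != 0 := @twopii_neq0 R.
Let h2 t : H t -> H (2%:R * t). Proof. exact: upper_natM. Qed.

Lemma double_natC t : 4 * t = 2%:R * (2%:R * t). Proof. by rewrite mulrA -natrM. Qed.

Lemma alphaE t : alpha t = W t + gamma t / 2.
Proof.
rewrite /alpha /gamma /lW -double_natC.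
by generalize (P (4 * t)), (P (2 * t)), (P t) => u v w; field.
Qed.
Lemma betaE t : beta t = W t - gamma t / 2.
Proof.
rewrite /beta /gamma /lW -double_natC.
by generalize (P (4 * t)), (P (2 * t)), (P t) => u v w; field.
Qed.
Lemma alpha_split t : alpha t = beta t + gamma t.
Proof. by rewrite alphaE betaE; field. Qed.

Lemma P_fricke4 t : H t -> [/\ P (fricke 4 t) = 16 * t ^+ 2 * P (4 * t) + 48 * t / twopii R,
  P (2 * fricke 4 t) = 4 * t ^+ 2 * P (2 * t) + 24 * t / twopii R &
  P (4 * fricke 4 t) = t ^+ 2 * P t + 12 * t / twopii R].
Proof.
move=> ht; have t0 := upper_neq0 ht.
have e4 := P_inv (@upper_natM R 4 t isT ht); have e2 := P_inv (@upper_natM R 2 t isT ht); have e1 := P_inv ht.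
split.
- rewrite /fricke e4; generalize (P (4%:R * t)), (twopii R) => u p; ring.
- have -> : 2 * fricke 4 t = - (2%:R * t)^-1 by rewrite /fricke; field.
  rewrite e2; generalize (P (2%:R * t)), (twopii R) => u p; ring.
have -> : 4 * fricke 4 t = - t^-1 by rewrite /fricke; field.
exact: e1.
Qed.

Lemma alpha_fricke t : H t -> alpha (fricke 4 t) = - 4 * t ^+ 2 * alpha t.
Proof.
move=> ht; have [e1 e2 e4] := P_fricke4 ht; rewrite /alpha e1 e4.
by move: p0; generalize (P (4 * t)), (P (2 * t)), (P t), (twopii R) => u v w p p0'; field.
Qed.
Lemma gamma_fricke t : H t -> gamma (fricke 4 t) = - 4 * t ^+ 2 * beta t.
Proof.
move=> ht; have [e1 e2 e4] := P_fricke4 ht; rewrite /gamma /beta e1 e2 e4.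
by move: p0; generalize (P (4 * t)), (P (2 * t)), (P t), (twopii R) => u v w p p0'; field.
Qed.
Lemma beta_fricke t : H t -> beta (fricke 4 t) = - 4 * t ^+ 2 * gamma t.
Proof.
move=> ht; have -> : beta (fricke 4 t) = alpha (fricke 4 t) - gamma (fricke 4 t) by rewrite alpha_split addrK.
by rewrite alpha_fricke // gamma_fricke // (alpha_split t); ring.
Qed.

Let qg := @qser_gamma R.

Lemma gamma_odd0 n : ~~ odd n -> @gammac R n = 0.
Proof. by move=> /even_halfK <-; rewrite -mul2n gammac_even. Qed.

Lemma gamma_addhalf t : H t -> gamma (t + 1 / 2) = - gamma t.
Proof.
move=> ht; have [_ e] := qser_addhalf qg; have [tg eg] := qg; rewrite e // eg //.
rewrite -[RHS]mulN1r -(evZ (-1) tg (nm_nome_lt1 ht)); apply: eq_ev => n.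
by rewrite -signr_odd; case: (boolP (odd n)) => [_|/gamma_odd0 ->]; rewrite ?expr1 // !mulr0.
Qed.

Lemma sqr_gamma_odd n : odd n -> cprod (@gammac R) (@gammac R) n = 0.
Proof.
move=> on; rewrite /cprod big_nat big1 // => i /andP[_ hi].
have [oi|/gamma_odd0 ->] := boolP (odd i); last by rewrite mul0r.
by rewrite (@gamma_odd0 (n - i)) ?mulr0 // oddB // on oi.
Qed.

Lemma gammac_01 : @gammac R 0 = 0 /\ @gammac R 1 = 16.
Proof.
split; first exact: (gammac_even R 0).
rewrite /gammac; have -> : dil 2 (@e2c R) 1 = 0 by [].
have -> : dil 4 (@e2c R) 1 = 0 by [].
by rewrite -[e2c R 1]/(-24 * sig R 1) sig1; field.
Qed.

(* [gamma] is odd in q, so its square at t/2 is a q-series, to which the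
   level 2 vanishing lemma applies. *)
Lemma gamma_sqr t : H t -> gamma t ^+ 2 = 4 * lFC 2 4 64 (2%:R * t).
Proof.
have [g0 g1] := gammac_01.
have qh := qser_halve (qserM qg qg) sqr_gamma_odd.
have [k2 k20 c2] := lFC_comp1 N1_2 rN_2 (@k00_2 R).
have [b [qb _ _]] := qjet_lFB N1_2 rN_2 (@k00_2 R).
(* As [gamma] begins with 16 q, its square at t/2 begins with 256 q, which matches 4 * 64. *)
have jh : qjet (fun t => gamma (t / 2%:R) * gamma (t / 2%:R)) 0 256.
  exists (fun n => cprod (@gammac R) (@gammac R) (2 * n)%N); split; first exact: qh.
    by rewrite /cprod muln0 big_nat1 g0 mul0r.
  rewrite /cprod muln1 big_nat_recr //= big_nat_recr //= big_nat1 subn0 subnn.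
  rewrite g0 -[(2 - 1)%N]/1%N g1; ring.
have j := qjetB jh (qjetZ 4 (qjet_lFC N1_2 rN_2 (@k00_2 R))).
have cg : comp1 2 4 (fun t => gamma (t / 2%:R) * gamma (t / 2%:R)) (fun t => 16 * (beta t * beta t)).
  move=> x hx; have x0 := upper_neq0 hx.
  have -> : fricke 2 x / 2%:R = fricke 4 x by rewrite /fricke; field.
  by rewrite gamma_fricke //; ring.
have qbe : exists b, qser beta b.
  have qW := qser_dil (ltn0Sn 1) (qser_lW N1_2 rN_2 (@k00_2 R)).
  by eexists; apply: eq_qser (qserB qW (qserZ (1 / 2) qg)) => x hx; rewrite betaE; ring.
have [be qbe'] := qbe.
have cF : comp1 2 4 (fun t => 4 * lFC 2 4 64 t) (fun t => 4 * (k2 * lFB 2 4 t)).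
  by move=> x hx; rewrite c2 //; exact: mulrCA.
have v := vanish_qjet2 (qjet_eq j _ _) (qserB (qserZ 16 (qserM qbe' qbe')) (qserZ 4 (qserZ k2 qb)))
   (comp1_companion (comp1B cg cF)).
move=> ht; have := v _ _ _ (h2 ht).
have -> : 2%:R * t / 2%:R = t by field.
move=> e; apply/eqP; rewrite -subr_eq0 expr2; apply/eqP; apply: e.
  by rewrite mulr0 subr0.
by ring.
Qed.

(** The product is W^2 - gamma^2/4, that is W^2 - FC at 2t. It makes [alpha] and [beta] zero-free,
    although both are defined by sums. *)
Lemma alpha_beta t : H t -> alpha t * beta t = lFB 2 4 (2%:R * t).
Proof.
move=> ht; have e1 := W_sqr_2 (h2 ht); have e2 := gamma_sqr ht.
rewrite alphaE betaE; transitivity (W t ^+ 2 - gamma t ^+ 2 / 4); first by field.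
by rewrite e1 e2; generalize (lFB 2 4 (2%:R * t)), (lFC 2 4 64 (2%:R * t)) => u v; field.
Qed.

Lemma alpha_neq0 t : H t -> alpha t != 0.
Proof. by move=> ht; have := lFB_neq0 N1_2 rN_2 (@k00_2 R) (h2 ht); rewrite -alpha_beta // mulf_eq0 negb_or => /andP[]. Qed.
Lemma beta_neq0 t : H t -> beta t != 0.
Proof. by move=> ht; have := lFB_neq0 N1_2 rN_2 (@k00_2 R) (h2 ht); rewrite -alpha_beta // mulf_eq0 negb_or => /andP[]. Qed.
Lemma gamma_neq0 t : H t -> gamma t != 0.
Proof.
move=> ht; have := lFC_neq0 N1_2 rN_2 (@k00_2 R) (h2 ht); apply: contraNneq => z.
have := gamma_sqr ht; rewrite z expr0n /= => /esym/eqP; rewrite mulf_eq0 pnatr_eq0 /=; exact.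
Qed.

Lemma qD_double f a t : qser f a -> H t -> cder (fun t => f (2%:R * t)) t (twopii R * (2 * qD f (2%:R * t))).
Proof.
move=> q ht; have h := cder_comp (cderZ 2%:R (cder_id t)) (qser_cderD q (h2 ht)).
by apply: (cder_eq h); generalize (qD f (2%:R * t)), (twopii R) => u p; ring.
Qed.

Let qE := qser_lE N1_2 rN_2 (@k00_2 R).
Let qW := qser_lW N1_2 rN_2 (@k00_2 R).

Lemma cder_E4 t : H t -> cder (fun t => E t) t (twopii R / 2%:R * (E t ^+ 2 - alpha t * beta t)).
Proof.
move=> ht; apply: (cder_eq (qD_double qE ht)).
rewrite alpha_beta // -(riccati_2 (h2 ht)).
by generalize (lE 2 (2%:R * t) : C), (qD (lE 2) (2%:R * t) : C), (twopii R) => u v p; field.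
Qed.

Lemma cder_W4 t : H t -> cder (fun t => W t) t (twopii R * (E t * W t - alpha t * beta t)).
Proof.
move=> ht; apply: (cder_eq (qD_double qW ht)).
by rewrite alpha_beta // -(qD_W_2 (h2 ht)).
Qed.

Lemma cder_gamma t : H t -> cder gamma t (twopii R * (E t * gamma t)).
Proof.
move=> ht; apply: (cder_eq (qser_cderD qg ht)); congr (_ * _).
have [bc [qC _ _]] := qjet_lFC N1_2 rN_2 (@k00_2 R).
have l := cderX 2 (qser_cderD qg ht); have rr := cderZ 4 (qD_double qC ht).
have := cderE (cder_upper ht gamma_sqr l); rewrite (cderE rr) /= expr1.
rewrite (qD_lFC N1_2 rN_2 (@k00_2 R) (h2 ht)).
have -> : 4 * (twopii R * (2 * (E t * lFC 2 4 64 (2%:R * t)))) = 2 * twopii R * E t * gamma t ^+ 2.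
  by rewrite gamma_sqr //; generalize (lFC 2 4 64 (2%:R * t)), (twopii R), (lE 2 (2%:R * t) : C) => u p v; ring.
have g0 := gamma_neq0 ht; move: p0 g0; generalize (qD gamma t), (gamma t), (twopii R), (lE 2 (2%:R * t) : C).
move=> d g p e p0' g0 h.
have c0 : 2 * g * p != 0 by rewrite !mulf_neq0 // pnatr_eq0.
by apply: (mulfI c0); transitivity (2%:R * g * (p * d)); [ring|rewrite -h; ring].
Qed.

Lemma cder_alpha t : H t -> cder alpha t (twopii R * (E t * alpha t - alpha t * beta t)).
Proof.
move=> ht; have h := cderD (cder_W4 ht) (cderZ (1 / 2) (cder_gamma ht)).
have e x : H x -> W x + 1 / 2 * gamma x = alpha x by move=> hx; rewrite alphaE; ring.
apply: (cder_upper ht e); apply: (cder_eq h); rewrite (alphaE t) (betaE t).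
by generalize (lE 2 (2%:R * t) : C), (lW 2 (2%:R * t) : C), (gamma t), (twopii R) => u v w p; field.
Qed.

Lemma cder_beta t : H t -> cder beta t (twopii R * (E t * beta t - alpha t * beta t)).
Proof.
move=> ht; have h := cderB (cder_W4 ht) (cderZ (1 / 2) (cder_gamma ht)).
have e x : H x -> W x - 1 / 2 * gamma x = beta x by move=> hx; rewrite betaE; ring.
apply: (cder_upper ht e); apply: (cder_eq h); rewrite (alphaE t) (betaE t).
by generalize (lE 2 (2%:R * t) : C), (lW 2 (2%:R * t) : C), (gamma t), (twopii R) => u v w p; field.
Qed.

Lemma calE2E : calEt 2 = (fun t => E t).
Proof.
apply: funext => t; apply: (etrans (calEtE2 t)); rewrite /lE (double_natC t).
by generalize (P (2%:R * (2%:R * t)) : C), (P (2%:R * t) : C) => u v; field.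
Qed.

Lemma chazy_2 : gen_chazy 2 (fun t : C => twopii R / 2%:R * calEt 2 t).
Proof.
rewrite calE2E => t0 h0.
refine (@chazy_even R (twopii R / 2%:R) (fun t => E t) (fun t => W t) (fun t => alpha t * beta t) _ _ _ t0 h0) => t ht.
- exact: cder_E4.
- apply: (cder_eq (cderM (cder_alpha ht) (cder_beta ht))).
  have -> : W t = (alpha t + beta t) / 2 by rewrite alphaE betaE; field.
  by generalize (lE 2 (2%:R * t) : C), (alpha t), (beta t), (twopii R) => u v w p; field.
- apply: (cder_eq (cder_W4 ht)).
  by generalize (lE 2 (2%:R * t) : C), (lW 2 (2%:R * t) : C), (alpha t), (beta t), (twopii R) => u v w z p; field.
Qed.

End LevelFourForms.

(** * Modularity and the three cusps at level 4 *)

Section LevelFourModular.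
Variable R : realType.
Local Notation C := (cplx R).
Local Notation H := (@upper_half R).
Implicit Types (t : C) (f F : C -> C).
Local Notation alpha := (@alpha R).
Local Notation beta := (@beta R).
Local Notation gamma := (@gamma R).

Let N4 : (1 < 4 < 5)%N. Proof. by []. Qed.
Let p0 : twopii R != 0 := @twopii_neq0 R.
Let qg := @qser_gamma R.
Let qE := qser_lE N1_2 rN_2 (@k00_2 R).
Let qEh := qser_lEh N1_2 rN_2 (@k00_2 R).
Let qW := qser_lW N1_2 rN_2 (@k00_2 R).
Let qW2 := qser_dil (ltn0Sn 1) qW.

Lemma upper_addhalf t : H t -> H (t + 1 / 2).
Proof.
have -> : 1 / 2 = (1 / 2 : R)%:C :> C by rewrite rmorphM fmorphV rmorph1 rmorph_nat.
by move=> ht; move: ht; rewrite /upper_half /= ImD /= addr0.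
Qed.

Lemma alpha_qser : has_ord alpha 0 /\ exists a, qser alpha a.
Proof.
have q : qser alpha (fun n => dil 2 (lWc R 2) n + 1 / 2 * @gammac R n).
  by apply: eq_qser (qserD qW2 (qserZ (1 / 2) qg)) => t ht; rewrite alphaE; ring.
split; last by eexists; exact: q.
exists (fun n => dil 2 (lWc R 2) n + 1 / 2 * @gammac R n); split=> //.
by rewrite dil_0 (lWc0 N1_2 rN_2 (@k00_2 R)) (gammac_01 R).1 mulr0 addr0 oner_eq0.
Qed.

Lemma beta_qser : has_ord beta 0 /\ exists a, qser beta a.
Proof.
have q : qser beta (fun n => dil 2 (lWc R 2) n - 1 / 2 * @gammac R n).
  by apply: eq_qser (qserB qW2 (qserZ (1 / 2) qg)) => t ht; rewrite betaE; ring.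
split; last by eexists; exact: q.
exists (fun n => dil 2 (lWc R 2) n - 1 / 2 * @gammac R n); split=> //.
by rewrite dil_0 (lWc0 N1_2 rN_2 (@k00_2 R)) (gammac_01 R).1 mulr0 subr0 oner_eq0.
Qed.

Lemma gamma_ord : has_ord gamma 1.
Proof.
have [g0 g1] := gammac_01 R; exists (@gammac R); split; [exact: qg|by case|].
by rewrite g1 pnatr_eq0.
Qed.

Lemma four_neq0 : - 4 != 0 :> C. Proof. by rewrite oppr_eq0 pnatr_eq0. Qed.

Lemma alpha_companion : companion 4 2 alpha alpha.
Proof. by exists (- 4); [exact: four_neq0|exact: alpha_fricke]. Qed.
Lemma beta_companion : companion 4 2 beta gamma.
Proof. by exists (- 4); [exact: four_neq0|exact: beta_fricke]. Qed.
Lemma gamma_companion : companion 4 2 gamma beta.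
Proof. by exists (- 4); [exact: four_neq0|exact: gamma_fricke]. Qed.

Lemma W_addhalf t : H t -> lW 2 (2%:R * (t + 1 / 2)) = lW 2 (2%:R * t) :> C.
Proof.
move=> ht; have -> : 2%:R * (t + 1 / 2) = 2%:R * t + (1 : int)%:~R :> C by rewrite mulrDr mul1r divff ?pnatr_eq0.
exact: qser_addz qW (upper_natM (ltn0Sn 1) ht).
Qed.
Lemma alpha_addhalf t : H t -> alpha (t + 1 / 2) = beta t.
Proof. by move=> ht; rewrite alphaE betaE W_addhalf // gamma_addhalf // mulNr. Qed.
Lemma beta_addhalf t : H t -> beta (t + 1 / 2) = alpha t.
Proof. by move=> ht; rewrite alphaE betaE W_addhalf // gamma_addhalf // mulNr opprK. Qed.

Lemma half_denom t : H t -> 2 * t + 1 != 0.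
Proof. by move=> ht; have := jfactor_neq0 SL_V ht; rewrite jfactor_V. Qed.

(** The matrix reaching the cusp 1/2 is the Fricke involution between two translations by 1/2, so
    expansions there follow from the Fricke laws and from the parity of [gamma] in q. *)
Lemma V_fricke t : H t -> t / (2 * t + 1) = fricke 4 (t + 1 / 2) + 1 / 2.
Proof.
move=> ht; have j0 := half_denom ht; rewrite /fricke.
have -> : 4%:R * (t + 1 / 2) = 2 * (2 * t + 1) by field.
by field; rewrite j0.
Qed.

Lemma slash_V f f' (x f3 : C) t : H t -> (forall s, H s -> f (s + 1 / 2) = f' s) ->
  f' (fricke 4 (t + 1 / 2)) = x * (2 * t + 1) ^+ 2 * f3 -> slash 2 f Vm t = x * f3.
Proof.
move=> ht h1 h2; have j0 := half_denom ht; have hs := upper_addhalf ht.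
rewrite /slash mobius_V jfactor_V V_fricke // h1; last exact: fricke_upper.
by rewrite h2; generalize (2 * t + 1) j0 => u u0; field.
Qed.

Lemma sqr_half t : (2 * t + 1) ^+ 2 = 4 * (t + 1 / 2) ^+ 2. Proof. by field. Qed.

(** At the cusp 1/2 [alpha] looks like [gamma] at i oo, hence its simple zero there. *)
Lemma alpha_half : half_cusp 4 2 alpha gamma.
Proof.
move=> _; exists 1; first exact: oner_neq0.
move=> t ht; apply: (slash_V ht alpha_addhalf).
by rewrite beta_fricke ?gamma_addhalf ?sqr_half //; [ring|exact: upper_addhalf].
Qed.
Lemma beta_half : half_cusp 4 2 beta beta.
Proof.
move=> _; exists (- 1); first by rewrite oppr_eq0 oner_neq0.
move=> t ht; apply: (slash_V ht beta_addhalf).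
by rewrite alpha_fricke ?alpha_addhalf ?sqr_half //; [ring|exact: upper_addhalf].
Qed.
Lemma gamma_half : half_cusp 4 2 gamma alpha.
Proof.
move=> _; exists 1; first exact: oner_neq0.
move=> t ht; apply: (slash_V (f' := fun s => - gamma s) ht (@gamma_addhalf R)).
by rewrite gamma_fricke ?beta_addhalf ?sqr_half //; [ring|exact: upper_addhalf].
Qed.

Lemma calE2_quasi : quasi_modular_form (Gamma0 4) (@calEt R 2).
Proof.
rewrite calE2E.
have q := qser_dil (ltn0Sn 1) qE.
(* Passing from t to 2t halves the anomaly 4 of level 2. The factor 1/8 is 2 (t/4)^2 / t^2, and 1/2
   is 2 (t + 1/2)^2 / (2t + 1)^2, both from the level 2 Fricke law. *)
apply: (quasi_intro (s := 2) (x := 1 / 8) (y := 1 / 2) N4 q qEh (qser_addhalf qEh)) => [g t [sg /dvdzP[c hc]] ht|t ht|_ t ht].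
(* Conjugation by t -> 2t carries Gamma_0(4) into Gamma_0(2). *)
- pose g' := mx2 (g 0 0) (2 * g 0 1) (2 * c) (g 1 1).
  have hg' : Gamma0 2 g'.
    split; last by rewrite mx2E dvdz_mulr.
    by apply/SL2ZE; rewrite !mx2E -[RHS](proj1 (SL2ZE g) sg) hc; ring.
  have h2t := upper_natM (ltn0Sn 1) ht.
  have i2 (x : int) : (2 * x)%:~R = 2 * x%:~R :> C by rewrite intrM.
  have i4 (x : int) : (x * 4%:Z)%:~R = x%:~R * 4 :> C by rewrite intrM.
  have ej : jfactor g' (2%:R * t) = jfactor g t.
    by rewrite /jfactor !mx2E hc ?i2 ?i4; ring.
  have em : mobius g' (2%:R * t) = 2%:R * mobius g t.
    by rewrite /mobius ej !mx2E ?i2 [RHS]mulrA; congr (_ / _); ring.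
  rewrite -em (lE_quasi N1_2 rN_2 (@k00_2 R) hg' h2t) ej mx2E hc ?i2 ?i4.
  by generalize (lE 2 (2%:R * t) : C), (jfactor g t), (c%:~R : C), (twopii R) => u v w p; ring.
- have t0 := upper_neq0 ht; have hs := @upper_divn R t 4 isT ht.
  have -> : 2%:R * - t^-1 = fricke 2 (t / 4%:R) by rewrite /fricke; field.
  rewrite (lE_fricke N1_2 rN_2 (@k00_2 R) hs).
  by move: p0; generalize (lEh 2 (t / 4%:R) : C), (twopii R) => u p p0'; field; rewrite t0 p0'.
have j0 := half_denom ht; have hs := upper_addhalf ht.
have hw := @fricke_upper R 2 _ isT hs.
have -> : 2%:R * (t / (2 * t + 1)) = fricke 2 (t + 1 / 2) + (1 : int)%:~R.
  rewrite /fricke; have -> : 2%:R * (t + 1 / 2) = 2 * t + 1 by field.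
  by field; rewrite j0.
rewrite (qser_addz _ qE hw) (lE_fricke N1_2 rN_2 (@k00_2 R) hs).
have e : t + 1 / 2 = (2 * t + 1) / 2 by field.
move: p0; generalize (lEh 2 (t + 1 / 2) : C), (twopii R) => u p p0'; rewrite e.
by generalize (2 * t + 1) j0 => v v0; field; rewrite v0 p0'.
Qed.

Lemma part_two_4 : part_two R 4 2.
Proof.
have [oa [a qa]] := alpha_qser; have [ob [b qb]] := beta_qser; have oc := gamma_ord.
pose i_ : C := 0 +i* 1; have hi : H i_ by rewrite /upper_half /=.
have ca := alpha_companion; have cb := beta_companion; have cc := gamma_companion.
have mA := modular_form_intro N4 ca alpha_half qa qa qg hi (alpha_neq0 hi).
have mB := modular_form_intro N4 cb beta_half qb qg qb hi (beta_neq0 hi).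
have mC := modular_form_intro N4 cc gamma_half qg qb qa hi (gamma_neq0 hi).
have cA := cusp_ordersP (ltn0Sn 3) (aut_of_companion N4 qa qa ca) ca alpha_half oa oa oc.
have cB := cusp_ordersP (ltn0Sn 3) (aut_of_companion N4 qb qg cb) cb beta_half ob oc ob.
have cC := cusp_ordersP (ltn0Sn 3) (aut_of_companion N4 qg qb cc) cc gamma_half oc ob oa.
have pw f : mv_power (mv2 f) 2 f by apply: (@mv2_power R f 1) => t _.
exists (mv2 alpha), (mv2 beta), (mv2 gamma), alpha, beta, gamma, (Cusp R (Some (1 / 2))).
split.
- split.
  + exact: mv_modular_intro (ltn0Sn 1) (mv2_holo qa) (pw _) mA.
  + exact: mv_modular_intro (ltn0Sn 1) (mv2_holo qb) (pw _) mB.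
  + exact: mv_modular_intro (ltn0Sn 1) (mv2_holo qg) (pw _) mC.
- split; [by split; [exact: pw|exact: mA]|by split; [exact: pw|exact: mB]
    |by split; [exact: pw|exact: mC]|by move=> t _; exact: alpha_split].
- split; [exact: erefl|exact: mv_vanish_half (ltn0Sn 1) (pw _) cA (@alpha_neq0 R)
    |exact: mv_vanish_zero N4 (ltn0Sn 1) (pw _) cB (@beta_neq0 R)
    |exact: mv_vanish_inf N4 (ltn0Sn 1) (pw _) cC (@gamma_neq0 R)].
move=> t w ht wa; have {}wa : w ^+ 2 = alpha t by exact: wa.
rewrite calE2E -[(4 - 2)%N]/2%N wa; split.
- exact: qDE (cder_alpha ht).
- exact: qDE (cder_beta ht).
- exact: qDE (cder_gamma ht).
rewrite (@qDE _ (fun t => lE 2 (2%:R * t)) t (1 / 2 * (lE 2 (2%:R * t) ^+ 2 - alpha t * beta t))).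
  by generalize (lE 2 (2%:R * t) : C), (alpha t), (beta t) => u v z; field.
apply: (cder_eq (cder_E4 ht)).
by generalize (lE 2 (2%:R * t) : C), (alpha t), (beta t), (twopii R) => u v z p; field.
Qed.

End LevelFourModular.

Theorem theorem1 (R : realType) :
  (* (1) *)
  [/\ forall N r : nat, (N, r) \in [:: (2, 4); (3, 3); (4, 2)]%N ->
        [/\ quasi_modular_form (Gamma0 N) (@calEt R r),
            value_at_infty (@calEt R r) 1 &
            gen_chazy r (fun t : cplx R => twopii R / r%:R * calEt r t)],
      has_qseries (@calE R 4) 8 (@sigma R 1 [:: -1; 1]) /\
      has_qseries (@calE R 4) 8 (@sigmac R 1 [:: -3; 1]),
      has_qseries (@calE R 3) 3 (@sigma R 1 [:: -2; 1; 1]) /\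
      has_qseries (@calE R 3) 3 (@sigmac R 1 [:: -8; 1; 1]),
      has_qseries (@calE R 2) 4 (@sigma R 1 [:: -1; 0; 1; 0]) /\
      has_qseries (@calE R 2) 8 (@sigmac R 1 [:: -3; 0; 1; 0]) &
      forall t : cplx R, upper_half t -> calE 2 (nome t) = calE 4 (nome t ^+ 2)]
  /\
  (* (2) *)
  (forall N r : nat, (N, r) \in [:: (2, 4); (3, 3); (4, 2)]%N ->
   exists (A B C : mvfun R) (FA FB FC : cplx R -> cplx R) (P : hstar R),
   [/\ [/\ mv_modular_form (Gamma0 N) 1 A, mv_modular_form (Gamma0 N) 1 B &
           mv_modular_form (Gamma0 N) 1 C],
       (* (a) *)
       [/\ mv_power A r FA /\ modular_form (Gamma0 N) r FA,
           mv_power B r FB /\ modular_form (Gamma0 N) r FB,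
           mv_power C r FC /\ modular_form (Gamma0 N) r FC &
           forall t, upper_half t -> FA t = FB t + FC t],
       (* (b) *)
       [/\ third_fixed_point N P,
           mv_vanishes_only_at (Gamma0 N) 1 A P r%:R^-1,
           mv_vanishes_only_at (Gamma0 N) 1 B (Cusp R (Some 0)) r%:R^-1 &
           mv_vanishes_only_at (Gamma0 N) 1 C (Cusp R None) r%:R^-1] &
       (* (c) *)
       forall t a, upper_half t -> A t a ->
         [/\ qD FA t = calEt r t * FA t - a ^+ 2 * FB t,
             qD FB t = calEt r t * FB t - a ^+ 2 * FB t,
             qD FC t = calEt r t * FC t &
             r%:R * qD (calEt r) t = calEt r t ^+ 2 - a ^+ (4 - r) * FB t]]).
Proof.
have casesNr (T : nat -> nat -> Prop) : T 2%N 4%N -> T 3%N 3%N -> T 4%N 2%N ->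
    forall N r, (N, r) \in [:: (2, 4); (3, 3); (4, 2)]%N -> T N r.
  move=> h2 h3 h4 N r; rewrite !inE => /or3P[] /eqP[-> ->].
  - exact: h2.
  - exact: h3.
  - exact: h4.
split; last exact: (casesNr _ (part_two_2 R) (part_two_3 R) (part_two_4 R)).
split.
- apply: casesNr; split.
  + rewrite calE4E; exact: (@lE_quasi_form R 2 4 64 isT rN_2 (@k00_2 R)).
  + have l := qser_limit (qser_lE N1_2 rN_2 (@k00_2 R)).
    by rewrite (lEc0 N1_2 rN_2 (@k00_2 R)) -calE4E in l.
  + exact: chazy_4.
  + rewrite calE3E; exact: (@lE_quasi_form R 3 3 27 isT rN_3 (@k00_3 R)).
  + have l := qser_limit (qser_lE N1_3 rN_3 (@k00_3 R)).
    by rewrite (lEc0 N1_3 rN_3 (@k00_3 R)) -calE3E in l.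
  + exact: chazy_3.
  + exact: calE2_quasi.
  + have l := qser_limit (qser_dil (ltn0Sn 1) (qser_lE N1_2 rN_2 (@k00_2 R))).
    by rewrite dil_0 (lEc0 N1_2 rN_2 (@k00_2 R)) -calE2E in l.
  + exact: chazy_2.
- exact: calE4_qseries.
- exact: calE3_qseries.
- exact: calE2_qseries.
by move=> t _; rewrite /calE -exprM.
Qed.
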